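(* Let $R>0$, $\varepsilon\in(0,1)$ and $\alpha\in(0,1)$, and suppose that $B(R)\neq\varnothing$. For $\lambda>0$ let $J_{\lambda,\alpha}(r,s)(\varphi)$ be the functional on $\overline{B(R)}$, depending on the parameter $\varphi\in(0,2\pi)$, which is defined in the context. The following holds. 1. For each $\lambda>0$, each $\varphi\in(0,2\pi)$ and each pair $(r,s)\in\overline{B(R)}$ the functional $J_{\lambda,\alpha}(r,s)(\varphi)$ has the Fréchet derivative $$J'_{\lambda,\alpha}(r,s)(\varphi)\in H_0^3(\Omega)\times H_0^3(\Omega),\qquad \forall\varphi\in(0,2\pi).$$ Furthermore, this derivative is Lipschitz continuous on $\overline{B(R)}$: there exists a number $D=D(\lambda,\varphi,R,\Omega)>0$ depending only on the listed parameters such that $$\left\|J'_{\lambda,\alpha}(r_2,s_2)(\varphi)-J'_{\lambda,\alpha}(r_1,s_1)(\varphi)\right\|_{H^3(\Omega)\times H^3(\Omega)}\le D\left\|(r_2,s_2)(\mathbf x,\varphi)-(r_1,s_1)(\mathbf x,\varphi)\right\|_{H^3(\Omega)\times H^3(\Omega)}$$ for all $(r_1,s_1),(r_2,s_2)\in\overline{B(R)}$. 2. Let $\lambda_0=\lambda_0(\Omega)\ge 1$ be the number from the Carleman estimate recalled in the context. There exist a sufficiently large number $\lambda_1=\lambda_1(R,\Omega,\varepsilon)\ge\lambda_0$ and a number $C_1=C_1(R,\Omega,\varepsilon)>0$, both depending only on $R,\Omega,\varepsilon$, such that for each $\lambda\ge\lambda_1$ the functional $J_{\lambda,\alpha}$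 is strongly convex on $\overline{B(R)}$, i.e. $$J_{\lambda,\alpha}(r_2,s_2)(\varphi)-J_{\lambda,\alpha}(r_1,s_1)(\varphi)-J'_{\lambda,\alpha}(r_1,s_1)(\varphi)\,(r_2-r_1,s_2-s_1)(\mathbf x,\varphi)$$ $$\ge C_1\exp\left(\lambda(a-c_1)^2\right)\left\|(r_2-r_1,s_2-s_1)(\mathbf x,\varphi)\right\|^2_{H^2(\Omega)\times H^2(\Omega)}+\alpha\left\|(r_2-r_1,s_2-s_1)(\mathbf x,\varphi)\right\|^2_{H^3(\Omega)\times H^3(\Omega)}$$ for all $\varphi\in(0,2\pi)$, all $(r_1,s_1),(r_2,s_2)\in\overline{B(R)}$ and all $\lambda\ge\lambda_1$. 3. For each $\lambda\ge\lambda_1$ there exists a unique minimizer $(r_{\min,\lambda,\alpha},s_{\min,\lambda,\alpha})(\mathbf x,\varphi)\in\overline{B(R)}$ of the functional $J_{\lambda,\alpha}(r,s)(\varphi)$ on the set $\overline{B(R)}$ (minimization being carried out for each value of the parameter $\varphi\in(0,2\pi)$). Furthermore, $$J'_{\lambda,\alpha}(r_{\min,\lambda,\alpha},s_{\min,\lambda,\alpha})(\varphi)\left((r_{\min,\lambda,\alpha},s_{\min,\lambda,\alpha})(\mathbf x,\varphi)-(r,s)(\mathbf x,\varphi)\right)\le 0$$ for all $\varphi\in(0,2\pi)$ and all $(r,s)\in\overline{B(R)}$.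
   Context: Geometry: $\mathbf x=(x,y)\in\mathbb R^2$; $(a,b)$ is a point, $c_1,c_2>0$, and $\Omega=\{|x-a|<c_1,\ |y-b|<c_2\}$ is a rectangle with $\{x=0\}\cap\overline\Omega=\varnothing$; moreover $a>c_1$, so that $x>0$ on $\overline\Omega$. $\Gamma=\{x=a+c_1,\ y\in(b-c_2,b+c_2)\}\subset\partial\Omega$ is a side of $\Omega$; $\partial_n$ is the normal derivative in $\mathbf x$. The parameter $\varphi\in(0,2\pi)$ is the angle of a source position $\mathbf x_0=(a+A\cos\varphi,b+A\sin\varphi)$ on a circle of radius $A$ centered at $(a,b)$ which encloses $\overline\Omega$. Boundary data: $g_0(\mathbf x,\varphi)>0$ for $\mathbf x\in\partial\Omega$ and $g_1(\mathbf x,\varphi)$ for $\mathbf x\in\Gamma$ are given functions (Dirichlet and Neumann data of the electrical potential for source position $\varphi$). Put $s_0=\ln g_0$, $s_1=g_1/g_0$. The number $\varepsilon\in(0,1)$ (viscosity parameter) is fixed. Operators: for a pair $(r,s)$ of functions of $(\mathbf x,\varphi)$, with $\nabla,\Delta$ taken in $\mathbf x$, $$L_1(r,s)=\Delta r+2\nabla r\cdot\nabla\left(\frac{r-s}{\varepsilon}\right),\qquad L_2(r,s)=\Delta s+2\nabla r\cdot\nabla\left(\frac{r-s}{\varepsilon}\right).$$ Boundary conditions (for all $\varphi\in(0,2\pi)$): (BC1) for $r$: $r|_{\partial\Omega}=\partial_\varphi s_0$, $\ \partial_n r|_\Gamma=\partial_\varphi s_1$; (BC2) for $s$: $s|_{\partial\Omega}=\partial_\varphi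 s_0-\varepsilon s_0$, $\ \partial_n s|_\Gamma=\partial_\varphi s_1-\varepsilon s_1$. Spaces: $H$ is the space of functions $p(\mathbf x,\varphi)$ with $p(\cdot,\varphi)\in H^3(\Omega)$ for all $\varphi\in[0,2\pi]$ and $\|p\|_H=\sup_{\varphi\in(0,2\pi)}\|p(\cdot,\varphi)\|_{H^3(\Omega)}<\infty$. $H_2=H\times H$ with $\|(r,s)\|_{H_2}^2=\|r\|_H^2+\|s\|_H^2$. $B(R)$ is the set of $(r,s)\in H_2$ with $\|(r,s)\|_{H_2}<R$ such that $r$ satisfies (BC1) and $s$ satisfies (BC2); $\overline{B(R)}$ is its closure in $H_2$. $H_0^k(\Omega)=\{u\in H^k(\Omega):u|_{\partial\Omega}=0,\ \partial_nu|_\Gamma=0\}$ for $k=2,3$. Functional: with $\psi_\lambda(\mathbf x)=\exp(2\lambda x^2)$, for $(r,s)\in\overline{B(R)}$ and $\varphi\in(0,2\pi)$, $$J_{\lambda,\alpha}(r,s)(\varphi)=\sqrt\varepsilon\int_\Omega\left[(L_1(r,s)(\mathbf x,\varphi))^2+(L_2(r,s)(\mathbf x,\varphi))^2\right]\psi_\lambda(\mathbf x)\,d\mathbf x+\alpha\|(r,s)(\mathbf x,\varphi)\|^2_{H^3(\Omega)\times H^3(\Omega)}.$$ Here $\varphi$ is a parameter: for fixed $\varphi$ the functional depends only on $(r,s)(\cdot,\varphi)$. The Fréchet derivative at fixed $\varphi$ is taken with respect to increments $(h_1,h_2)\in H_0^3(\Omega)\times H_0^3(\Omega)$ (differences of elements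 of $\overline{B(R)}$ at $\varphi$), and is identified with an element of $H_0^3(\Omega)\times H_0^3(\Omega)$ via the inner product of $H^3(\Omega)\times H^3(\Omega)$; $J'_{\lambda,\alpha}(r,s)(\varphi)(h_1,h_2)$ denotes that inner product. Carleman estimate (known): there are $\lambda_0=\lambda_0(\Omega)\ge1$ and $C=C(\Omega)>0$ such that for all $\lambda\ge\lambda_0$ and $u\in H_0^2(\Omega)$, $$\int_\Omega(\Delta u)^2\psi_\lambda\,d\mathbf x\ge\frac C\lambda\int_\Omega(u_{xx}^2+u_{xy}^2+u_{yy}^2)\psi_\lambda\,d\mathbf x+C\lambda\int_\Omega|\nabla u|^2\psi_\lambda\,d\mathbf x+C\lambda^3\int_\Omega u^2\psi_\lambda\,d\mathbf x.$$
   Formalization: D may also depend on ε (no ε-uniform D exists, since J' grows like ε^(-3/2)). In item 3 the minimizer is obtained for each φ separately, as the slice at φ of an element of the closed ball, not as one pair minimizing at all φ at once, which can fail. *)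

(* Defs.v *)
From mathcomp Require Import all_boot all_order all_algebra.
From mathcomp Require Import all_classical all_reals all_analysis.

Set Implicit Arguments.
Unset Strict Implicit.
Unset Printing Implicit Defensive.

Import Order.TTheory GRing.Theory Num.Theory.
Import numFieldNormedType.Exports.

Local Open Scope classical_set_scope.
Local Open Scope ring_scope.

(* Elements of L^2 and of Sobolev spaces are functions
   R * R -> R considered up to equality a.e. on the domain; values outside the
   domain are irrelevant.  A function p(x, phi) is curried as p phi x. *)

Notation leb2 R := ((@lebesgue_measure R \x @lebesgue_measure R)%E).

Definition square_integrable (R : realType) (d : measure_display)
    (T : measurableType d) (m : set T -> \bar R) (D : set T) (u : T -> R) :=
  measurable_fun D u /\ m.-integrable D (EFin \o (fun x => u x ^+ 2)).

Definition int2 (R : realType) (D : set (R * R)) (f : R * R -> R) : R :=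
  Rintegral (leb2 R) D f.

Definition partial1 (R : realType) (f : R * R -> R) : R * R -> R :=
  fun p => derive1 (fun t => f (t, p.2)) p.1.

Definition partial2 (R : realType) (f : R * R -> R) : R * R -> R :=
  fun p => derive1 (fun t => f (p.1, t)) p.2.

Definition partial (R : realType) (i j : nat) (f : R * R -> R) : R * R -> R :=
  iter i (@partial1 R) (iter j (@partial2 R) f).

(* C^infty on the plane; the word w lists the successive partial derivatives
   (true for the second variable). *)
Definition smooth (R : realType) (f : R * R -> R) :=
  forall w : seq bool,
    let g := foldr (fun e => if e then @partial2 R else @partial1 R) f w in
    continuous g /\
    forall p : R * R, derivable (fun t => g (t, p.2)) p.1 1 /\
                      derivable (fun t => g (p.1, t)) p.2 1.

Definition test_function (R : realType) (D : set (R * R)) (f : R * R -> R) :=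
  smooth f /\
  exists K : set (R * R),
    [/\ compact K, K `<=` D & forall p, ~ K p -> f p = 0].

Definition weak_derivative (R : realType) (D : set (R * R)) (i j : nat)
    (u v : R * R -> R) :=
  forall f, test_function D f ->
    int2 D (fun p => u p * partial i j f p) =
    (-1) ^+ (i + j) * int2 D (fun p => v p * f p).

Definition L2_weak_derivative (R : realType) (D : set (R * R)) (i j : nat)
    (u v : R * R -> R) :=
  square_integrable (leb2 R) D v /\ weak_derivative D i j u v.

(* A version of the weak derivative d^(i+j) u / dx^i dy^j in L^2(D); it is
   the zero function when there is none. *)
Definition Dw (R : realType) (D : set (R * R)) (i j : nat)
    (u : R * R -> R) : R * R -> R :=
  xget (fun=> 0) [set v | L2_weak_derivative D i j u v].

Definition sobolev (R : realType) (D : set (R * R)) (k : nat)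
    (u : R * R -> R) :=
  square_integrable (leb2 R) D u /\
  forall i j, (i + j <= k)%N -> exists v, L2_weak_derivative D i j u v.

Definition sobolev_dot (R : realType) (D : set (R * R)) (k : nat)
    (u v : R * R -> R) : R :=
  \sum_(i < k.+1) \sum_(j < k.+1 | (i + j <= k)%N)
    int2 D (fun p => Dw D i j u p * Dw D i j v p).

Definition sobolev_norm (R : realType) (D : set (R * R)) (k : nat)
    (u : R * R -> R) : R :=
  Num.sqrt (sobolev_dot D k u u).

Definition pair_dot (R : realType) (D : set (R * R)) (k : nat)
    (z w : (R * R -> R) * (R * R -> R)) : R :=
  sobolev_dot D k z.1 w.1 + sobolev_dot D k z.2 w.2.

Definition pair_norm (R : realType) (D : set (R * R)) (k : nat)
    (z : (R * R -> R) * (R * R -> R)) : R :=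
  Num.sqrt (sobolev_norm D k z.1 ^+ 2 + sobolev_norm D k z.2 ^+ 2).

Definition pair_add (R : realType) (z w : (R * R -> R) * (R * R -> R)) :=
  (z.1 \+ w.1, z.2 \+ w.2).

Definition pair_sub (R : realType) (z w : (R * R -> R) * (R * R -> R)) :=
  (z.1 \- w.1, z.2 \- w.2).

(* The rectangle |x - a| < c1, |y - b| < c2. *)
Record rectangle (R : realType) := Rectangle {
  ra : R; rb : R; rc1 : R; rc2 : R }.

Definition Omega (R : realType) (Q : rectangle R) : set (R * R) :=
  [set p | `|p.1 - ra Q| < rc1 Q /\ `|p.2 - rb Q| < rc2 Q].

Definition bdOmega (R : realType) (Q : rectangle R) : set (R * R) :=
  closure (Omega Q) `\` interior (Omega Q).

Definition Gamma (R : realType) (Q : rectangle R) : set (R * R) :=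
  [set p | p.1 = ra Q + rc1 Q /\ rb Q - rc2 Q < p.2 < rb Q + rc2 Q].

(* The four open sides; East is Gamma. *)
Inductive side := West | East | South | North.

Definition side_point (R : realType) (Q : rectangle R) (s : side) (t : R) :
    R * R :=
  match s with
  | West => (ra Q - rc1 Q, t)
  | East => (ra Q + rc1 Q, t)
  | South => (t, rb Q - rc2 Q)
  | North => (t, rb Q + rc2 Q)
  end.

Definition side_range (R : realType) (Q : rectangle R) (s : side) : set R :=
  match s with
  | West | East => `]rb Q - rc2 Q, rb Q + rc2 Q[
  | South | North => `]ra Q - rc1 Q, ra Q + rc1 Q[
  end.

(* The trace in L^2(side) of an element u of H^1(Omega) is g: the trace
   operator is the continuous extension to H^1(Omega) of the restriction to
   the side of functions smooth up to the boundary. *)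
Definition has_trace (R : realType) (Q : rectangle R) (s : side)
    (u g : R * R -> R) :=
  [/\ sobolev (Omega Q) 1 u,
      square_integrable (@lebesgue_measure R) (side_range Q s)
        (g \o side_point Q s) &
      exists w : nat -> R * R -> R,
        [/\ forall n, smooth (w n),
            sobolev_norm (Omega Q) 1 (w n \- u) @[n --> \oo] --> (0 : R) &
            Rintegral (@lebesgue_measure R) (side_range Q s)
              (fun t => (w n (side_point Q s t) - g (side_point Q s t)) ^+ 2)
              @[n --> \oo] --> (0 : R)]].

(* u = f on the boundary and du/dn = h on Gamma; the outward normal on Gamma
   is (1, 0). *)
Definition boundary_conditions (R : realType) (Q : rectangle R)
    (u f h : R * R -> R) :=
  (forall s, has_trace Q s u f) /\ has_trace Q East (Dw (Omega Q) 1 0 u) h.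

Definition H0 (R : realType) (Q : rectangle R) (k : nat) (u : R * R -> R) :=
  sobolev (Omega Q) k u /\
  boundary_conditions Q u (fun=> 0) (fun=> 0).

Definition psi (R : realType) (lambda : R) (p : R * R) : R :=
  expR (2 * lambda * p.1 ^+ 2).

Definition laplacian (R : realType) (D : set (R * R)) (u : R * R -> R)
    (p : R * R) : R :=
  Dw D 2 0 u p + Dw D 0 2 u p.

Definition grad_dot (R : realType) (D : set (R * R)) (u v : R * R -> R)
    (p : R * R) : R :=
  Dw D 1 0 u p * Dw D 1 0 v p + Dw D 0 1 u p * Dw D 0 1 v p.

Definition carleman_estimate (R : realType) (Q : rectangle R)
    (lambda0 C : R) :=
  forall lambda u, lambda0 <= lambda -> H0 Q 2 u ->
    let D := Omega Q in
    C / lambda * int2 D (fun p => (Dw D 2 0 u p ^+ 2 + Dw D 1 1 u p ^+ 2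
                                   + Dw D 0 2 u p ^+ 2) * psi lambda p)
    + C * lambda * int2 D (fun p => grad_dot D u u p * psi lambda p)
    + C * lambda ^+ 3 * int2 D (fun p => u p ^+ 2 * psi lambda p)
    <= int2 D (fun p => laplacian D u p ^+ 2 * psi lambda p).

Definition s0 (R : realType) (g0 : R -> R * R -> R) (phi : R) (p : R * R) : R :=
  ln (g0 phi p).

Definition s1 (R : realType) (g0 g1 : R -> R * R -> R) (phi : R)
    (p : R * R) : R :=
  g1 phi p / g0 phi p.

Definition d_phi (R : realType) (f : R -> R * R -> R) (phi : R)
    (p : R * R) : R :=
  derive1 (fun t => f t p) phi.

Definition angle (R : realType) : set R := `]0, (2 * pi)[.

(* g0 is positive, and the phi-derivatives in the boundary conditions exist. *)
Definition boundary_data (R : realType) (Q : rectangle R)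
    (g0 g1 : R -> R * R -> R) :=
  forall phi, angle phi ->
    (forall p, bdOmega Q p ->
       0 < g0 phi p /\ derivable (fun t => g0 t p) phi 1) /\
    (forall p, Gamma Q p -> derivable (fun t => g1 t p) phi 1).

Definition BC1 (R : realType) (Q : rectangle R) (g0 g1 : R -> R * R -> R)
    (r : R -> R * R -> R) :=
  forall phi, angle phi ->
    boundary_conditions Q (r phi) (d_phi (s0 g0) phi) (d_phi (s1 g0 g1) phi).

Definition BC2 (R : realType) (Q : rectangle R) (eps : R)
    (g0 g1 : R -> R * R -> R) (s : R -> R * R -> R) :=
  forall phi, angle phi ->
    boundary_conditions Q (s phi)
      (fun p => d_phi (s0 g0) phi p - eps * s0 g0 phi p)
      (fun p => d_phi (s1 g0 g1) phi p - eps * s1 g0 g1 phi p).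

Definition H_norms (R : realType) (Q : rectangle R) (p : R -> R * R -> R) :
    set R :=
  [set sobolev_norm (Omega Q) 3 (p phi) | phi in @angle R].

Definition H (R : realType) (Q : rectangle R) (p : R -> R * R -> R) :=
  (forall phi, 0 <= phi <= 2 * pi -> sobolev (Omega Q) 3 (p phi)) /\
  has_ubound (H_norms Q p).

Definition H_norm (R : realType) (Q : rectangle R) (p : R -> R * R -> R) : R :=
  sup (H_norms Q p).

Definition H2 (R : realType) (Q : rectangle R)
    (z : (R -> R * R -> R) * (R -> R * R -> R)) :=
  H Q z.1 /\ H Q z.2.

Definition H2_norm (R : realType) (Q : rectangle R)
    (z : (R -> R * R -> R) * (R -> R * R -> R)) : R :=
  Num.sqrt (H_norm Q z.1 ^+ 2 + H_norm Q z.2 ^+ 2).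

Definition B (R : realType) (Q : rectangle R) (eps : R)
    (g0 g1 : R -> R * R -> R) (rad : R) :
    set ((R -> R * R -> R) * (R -> R * R -> R)) :=
  [set z | [/\ H2 Q z, H2_norm Q z < rad, BC1 Q g0 g1 z.1 &
               BC2 Q eps g0 g1 z.2]].

Definition clB (R : realType) (Q : rectangle R) (eps : R)
    (g0 g1 : R -> R * R -> R) (rad : R) :
    set ((R -> R * R -> R) * (R -> R * R -> R)) :=
  [set z | H2 Q z /\
     forall e, 0 < e -> exists w, B Q eps g0 g1 rad w /\
       H2_norm Q ((fun phi => z.1 phi \- w.1 phi),
                  (fun phi => z.2 phi \- w.2 phi)) < e].

(* (r, s)(., phi) *)
Definition slice (R : realType) (z : (R -> R * R -> R) * (R -> R * R -> R))
    (phi : R) : (R * R -> R) * (R * R -> R) :=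
  (z.1 phi, z.2 phi).

Definition L1 (R : realType) (D : set (R * R)) (eps : R) (r s : R * R -> R)
    (p : R * R) : R :=
  laplacian D r p + 2 * grad_dot D r (fun q => (r q - s q) / eps) p.

Definition L2 (R : realType) (D : set (R * R)) (eps : R) (r s : R * R -> R)
    (p : R * R) : R :=
  laplacian D s p + 2 * grad_dot D r (fun q => (r q - s q) / eps) p.

(* J_{lambda,alpha} as a function of the slice (r, s)(., phi). *)
Definition J (R : realType) (Q : rectangle R) (eps lambda alpha : R)
    (z : (R * R -> R) * (R * R -> R)) : R :=
  let D := Omega Q in
  Num.sqrt eps * int2 D (fun p => (L1 D eps z.1 z.2 p ^+ 2
                                   + L2 D eps z.1 z.2 p ^+ 2) * psi lambda p)
  + alpha * pair_norm D 3 z ^+ 2.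

(* G in H_0^3 x H_0^3 represents the Frechet derivative of F at z, with
   respect to increments in H_0^3 x H_0^3, through the inner product of
   H^3 x H^3. *)
Definition frechet_derivative (R : realType) (Q : rectangle R)
    (F : (R * R -> R) * (R * R -> R) -> R)
    (z G : (R * R -> R) * (R * R -> R)) :=
  [/\ H0 Q 3 G.1, H0 Q 3 G.2 &
    forall e, 0 < e -> exists2 d, 0 < d &
      forall h : (R * R -> R) * (R * R -> R), H0 Q 3 h.1 -> H0 Q 3 h.2 ->
        pair_norm (Omega Q) 3 h < d ->
        `|F (pair_add z h) - F z - pair_dot (Omega Q) 3 G h|
          <= e * pair_norm (Omega Q) 3 h].

(* Main.v *)
(** The functional is quartic in (r, s), so for an increment h it equals its
    tangent plus a remainder plus alpha |h|^2, and everything rests on the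
    remainder.  It contains the squares of the linearized operators, which the
    Carleman estimate bounds below by lambda |grad h|^2 and |D^2 h|^2 / lambda in
    the weighted norm.  The gradients of H^3 functions are bounded, but
    L_j(r, s) D h D h is only a product of an L^2 function f = D^2 r having
    f_y in L^2 with first derivatives u of h: representing functions as
    primitives along almost every line bounds f in L^2_x L^infty_y and u in
    L^infty_x L^2_y on the scale 1 / lambda of the weight, whence
    |f u|^2 <= C (lambda |u|^2 + |u_x|^2 / lambda) in the weighted norm, with an
    arbitrarily small factor in front thanks to Young's inequality.

    The closure of B(R) is the set of families satisfying the boundary
    conditions with H_2 norm at most R.  A minimizing sequence at the angle phi
    is Cauchy by strong convexity; its limit is extended to the other angles by
    the elements of minimal norm subject to the boundary conditions, which keeps
    the supremum over the angles at most R. *)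

Require Import Defs.
From mathcomp Require Import all_boot all_order all_algebra.
From mathcomp Require Import all_classical all_reals all_analysis.
From mathcomp Require Import measurable_realfun ring lra.

Import Order.TTheory GRing.Theory Num.Theory.
Import numFieldNormedType.Exports.

Local Open Scope classical_set_scope.
Local Open Scope ring_scope.

Set Implicit Arguments.
Unset Strict Implicit.
Unset Printing Implicit Defensive.

(** The part of the remainder that is quadratic in h and has no sign is the pairing of L_j(r, s)
    with the gradient product of h. The bound on it has exactly the powers of lambda that the
    Carleman estimate offers: 1 / lambda on second derivatives, lambda on the gradient. Enlarging
    lambda therefore cannot absorb it. A Young parameter tau, depending on R, Omega and epsilon,
    makes its factor a fixed fraction of the Carleman constant; the price 1 / tau falls on the
    gradient alone, and lambda is then taken large. The weight is at least exp(2 lambda (a -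
    c_1)^2): one factor exp(lambda (a - c_1)^2) is spent on 1 / lambda, the other stays in the
    conclusion.

    Weak derivatives are chosen representatives, linear only up to null sets; hence norms are
    treated as semi-norms, and identities between operators hold almost everywhere. The Lipschitz
    constant must not depend on alpha, which is bounded by 1 throughout.

    The H_2 norm takes the supremum over the angles in each component before combining the two, so
    the extension to other angles must minimize both component norms at once. *)

Ltac nneg := rewrite ?lee_fin;
  repeat first [assumption | exact: sqr_ge0 | exact: ltW | exact: ler01 | exact: ler0n
    | apply: mulr_ge0 | apply: addr_ge0].

(** * Almost-everywhere reasoning *)

Section almost_everywhere_rules.
Context d (T : measurableType d) (R : realType) (mu : {measure set T -> \bar R}).
Implicit Types P Q : T -> Prop.

Lemma ae_imp1 P Q : {ae mu, forall x, P x} -> (forall x, P x -> Q x) ->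
  {ae mu, forall x, Q x}.
Proof. by move=> aP PQ; apply: filterS aP. Qed.

Lemma ae_imp2 P1 P2 Q : {ae mu, forall x, P1 x} -> {ae mu, forall x, P2 x} ->
  (forall x, P1 x -> P2 x -> Q x) -> {ae mu, forall x, Q x}.
Proof. by move=> aP1 aP2 PQ; apply: filterS2 aP1 aP2. Qed.

Lemma ae_imp3 P1 P2 P3 Q : {ae mu, forall x, P1 x} -> {ae mu, forall x, P2 x} ->
  {ae mu, forall x, P3 x} ->
  (forall x, P1 x -> P2 x -> P3 x -> Q x) -> {ae mu, forall x, Q x}.
Proof. by move=> a1 a2 a3 PQ; apply: filterS3 a1 a2 a3. Qed.

(** Partial integrals produced by Fubini's theorem take values in the extended reals, possibly
    infinite on a null set. Passing to [fine] never increases the absolute value, so integrability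
    survives. *)
Lemma integrable_fine (D : set T) (F : T -> \bar R) : measurable D ->
  mu.-integrable D F -> mu.-integrable D (EFin \o (fine \o F)).
Proof.
move=> mD iF; have mF := measurable_int _ iF.
have mfF : measurable_fun D (EFin \o (fine \o F)).
  by apply/measurable_EFinP; exact: (measurableT_comp (fine_measurable measurableT)).
apply: (le_integrable mD mfF _ iF) => x Dx /=.
by case: (F x) => [r| |] //=; rewrite ?normr0 ?leey.
Qed.

End almost_everywhere_rules.

(** * Square-integrable functions *)

Section L2_theory.
Context d (T : measurableType d) (R : realType) (mu : {measure set T -> \bar R}).
Variables (D : set T) (mD : measurable D).
Implicit Types (u v w f g : T -> R) (a b c : R).

Notation sqi := (square_integrable mu D).
Notation I := (Rintegral mu D).
Notation itg u := (mu.-integrable D (EFin \o u)).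

Lemma le_itg u v : measurable_fun D u -> (forall x, D x -> `|u x| <= v x) ->
  itg v -> itg u.
Proof.
move=> mu_ uv iv; apply: (le_integrable mD _ _ iv).
  exact/measurable_EFinP.
by move=> x Dx /=; rewrite lee_fin (le_trans (uv _ Dx))// ler_norm.
Qed.

Lemma itg_measurable u : itg u -> measurable_fun D u.
Proof. by move=> /measurable_int /measurable_EFinP. Qed.

Lemma itgD u v : itg u -> itg v -> itg (fun x => u x + v x).
Proof. by move=> iu iv; have := integrableD mD iu iv. Qed.

Lemma itgB u v : itg u -> itg v -> itg (fun x => u x - v x).
Proof. by move=> iu iv; have := integrableB mD iu iv. Qed.

Lemma itgZ k u : itg u -> itg (fun x => k * u x).
Proof. by move=> iu; have := integrableZl mD k iu. Qed.

Lemma eq_itg u v : (forall x, D x -> u x = v x) -> itg u -> itg v.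
Proof.
move=> uv; apply: eq_integrable => // x; rewrite inE => Dx /=.
by rewrite uv.
Qed.

Lemma eq_RI u v : (forall x, D x -> u x = v x) -> I u = I v.
Proof. by move=> uv; apply: eq_Rintegral => x; rewrite inE; exact: uv. Qed.

Lemma le_RI u v : itg u -> itg v ->
  {ae mu, forall x, D x -> u x <= v x} -> I u <= I v.
Proof.
move=> iu iv uv; rewrite -subr_ge0 -RintegralB//.
have mv := itg_measurable iv; have mu_ := itg_measurable iu.
(* The difference agrees almost everywhere with its absolute value, whose integral is
   nonnegative. *)
have -> : I (fun x => v x - u x) = I (fun x => `|v x - u x|).
  rewrite /Rintegral; congr fine; apply: ae_eq_integral => //.
  - by apply/measurable_EFinP; exact: measurable_funB.
  - by apply/measurable_EFinP; apply: measurableT_comp => //; exact: measurable_funB.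
  - by apply: filterS uv => x uv Dx; rewrite ger0_norm ?subr_ge0 ?uv.
by apply: Rintegral_ge0 => x _.
Qed.

Lemma ae_RI u v : measurable_fun D u -> measurable_fun D v ->
  {ae mu, forall x, D x -> u x = v x} -> I u = I v.
Proof.
move=> mu_ mv uv; rewrite /Rintegral; congr fine; apply: ae_eq_integral => //.
- exact/measurable_EFinP.
- exact/measurable_EFinP.
- by apply: filterS uv => x uv Dx; rewrite uv.
Qed.

Lemma ae_itg u v : measurable_fun D v ->
  {ae mu, forall x, D x -> u x = v x} -> itg u -> itg v.
Proof.
move=> mv uv /integrableP[mu_ iu]; apply/integrableP; split.
  exact/measurable_EFinP.
rewrite (@ae_eq_integral _ _ _ _ _ (fun x => `|(u x)%:E|%E))//.
- by apply: measurableT_comp => //; exact/measurable_EFinP.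
- exact: measurableT_comp.
- by apply: filterS uv => x uv Dx /=; rewrite uv.
Qed.

Lemma sqi_itgM u v : sqi u -> sqi v -> itg (fun x => u x * v x).
Proof.
move=> [mu_ iu] [mv iv].
apply: (@le_itg _ (fun x => u x ^+ 2 + v x ^+ 2)).
- exact: measurable_funM.
- move=> x _; rewrite normrM.
  have := sqr_ge0 (`|u x| - `|v x|).
  have := sqr_ge0 (`|u x| + `|v x|).
  rewrite -(real_normK (num_real (u x))) -(real_normK (num_real (v x))).
  nra.
- exact: itgD.
Qed.

Lemma sqiD u v : sqi u -> sqi v -> sqi (fun x => u x + v x).
Proof.
move=> [mu_ iu] [mv iv]; split; first exact: measurable_funD.
apply: (@le_itg _ (fun x => 2 * (u x ^+ 2 + v x ^+ 2))).
- by apply: measurable_funX; exact: measurable_funD.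
- move=> x _; rewrite ger0_norm ?sqr_ge0//.
  have := sqr_ge0 (u x - v x); nra.
- by apply: itgZ; exact: itgD.
Qed.

Lemma sqiZ k u : sqi u -> sqi (fun x => k * u x).
Proof.
move=> [mu_ iu]; split; first exact: measurable_funM.
apply: (@eq_itg (fun x => k ^+ 2 * u x ^+ 2)); first by move=> x _; rewrite exprMn.
exact: itgZ.
Qed.

Lemma sqiN u : sqi u -> sqi (fun x => - u x).
Proof.
move=> /(sqiZ (-1)) [m i]; split.
  by under eq_fun do rewrite -mulN1r.
by apply: eq_itg i => x _; rewrite mulN1r.
Qed.

Lemma sqiB u v : sqi u -> sqi v -> sqi (fun x => u x - v x).
Proof. by move=> su /sqiN; exact: sqiD. Qed.

Lemma ae_sqi u v : measurable_fun D v ->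
  {ae mu, forall x, D x -> u x = v x} -> sqi u -> sqi v.
Proof.
move=> mv uv [mu_ iu]; split => //; apply: ae_itg iu.
- exact: measurable_funX.
- by apply: filterS uv => x uv Dx; rewrite uv.
Qed.

Lemma eq_sqi u v : (forall x, D x -> u x = v x) -> sqi u -> sqi v.
Proof.
move=> uv [mu_ iu]; split.
  by apply: eq_measurable_fun mu_ => x; rewrite inE; exact: uv.
by apply: eq_itg iu => x Dx; rewrite uv.
Qed.

Lemma sqi0 : sqi (fun=> 0).
Proof.
split; first exact: measurable_cst.
by apply: (@eq_itg (fun=> 0)); [move=> x _; rewrite expr0n|exact: integrable0].
Qed.

Definition ess_bounded u k :=
  measurable_fun D u /\ {ae mu, forall x, D x -> `|u x| <= k}.

Lemma ess_bounded_le u a b : a <= b -> ess_bounded u a -> ess_bounded u b.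
Proof.
move=> ab [mu_ ua]; split => //.
by apply: filterS ua => x ua /ua /le_trans; exact.
Qed.

Lemma ess_bounded_itg u v k : ess_bounded u k -> itg v -> itg (fun x => u x * v x).
Proof.
move=> [mu_ uk] iv; have mv := itg_measurable iv.
(* Truncation at the level of the bound gives a function that is bounded everywhere and almost
   everywhere equal to [u], so pointwise domination applies. *)
pose u' x := Num.max (- `|k|) (Num.min `|k| (u x)).
have mu' : measurable_fun D u'.
  by apply: measurable_maxr => //; exact: measurable_minr.
apply: (@ae_itg (fun x => u' x * v x)).
- exact: measurable_funM.
- apply: filterS uk => x uk Dx; congr (_ * _).
  have := le_trans (uk Dx) (ler_norm k); rewrite ler_norml => /andP[h1 h2].
  by rewrite /u' (min_idPr h2) (max_idPr h1).
- apply: (@le_itg _ (fun x => `|k| * `|v x|)).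
  + exact: measurable_funM.
  + move=> x Dx; rewrite normrM ler_wpM2r// ler_norml /u' le_max lexx/=.
    by rewrite ge_max ge_min lexx/= andbT (le_trans _ (normr_ge0 k))// oppr_le0.
  + by apply: itgZ; exact: (integrable_norm iv).
Qed.

Lemma ess_bounded_sqi u v k : ess_bounded u k -> sqi v -> sqi (fun x => u x * v x).
Proof.
move=> bu [mv iv]; split; first by apply: measurable_funM => //; case: bu.
have i1 := ess_bounded_itg bu (ess_bounded_itg bu iv).
by apply: eq_itg i1 => x _; rewrite exprMn expr2 mulrA.
Qed.

Lemma RI_sqr_ge0 u : 0 <= I (fun x => u x ^+ 2).
Proof. by apply: Rintegral_ge0 => x _; exact: sqr_ge0. Qed.

Lemma young_RI u v c : 0 < c -> sqi u -> sqi v ->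
  2 * `|I (fun x => u x * v x)| <=
    c * I (fun x => u x ^+ 2) + c^-1 * I (fun x => v x ^+ 2).
Proof.
move=> c0 su sv; have ii := sqi_itgM su sv.
have [? iu] := su; have [? iv] := sv.
rewrite -RintegralZl// -RintegralZl// -RintegralD//; [|exact: itgZ..].
apply: (@le_trans _ _ (2 * I (fun x => `|u x * v x|))).
  by rewrite ler_wpM2l//; exact: le_normr_Rintegral.
rewrite -RintegralZl//; last exact: (integrable_norm ii).
apply: le_Rintegral => //.
- by apply: itgZ; exact: (integrable_norm ii).
- by apply: itgD; exact: itgZ.
move=> x _; rewrite normrM.
have h : 0 <= c^-1 * (c * `|u x| - `|v x|) ^+ 2.
  by rewrite mulr_ge0 ?sqr_ge0// invr_ge0 ltW.
have e : c^-1 * (c * `|u x| - `|v x|) ^+ 2 =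
   c * `|u x| ^+ 2 + c^-1 * `|v x| ^+ 2 - 2 * (`|u x| * `|v x|).
  by field; rewrite gt_eqF.
by move: h; rewrite e !real_normK ?num_real// subr_ge0.
Qed.

(** A bound on the L^2 norm, packed with integrability and with the sign of the bound so that such
    bounds compose without side conditions. *)
Definition L2le u a := [/\ sqi u, 0 <= a & I (fun x => u x ^+ 2) <= a ^+ 2].

(** Cauchy-Schwarz, from Young's inequality with the optimal parameter b / a. Since [a] or [b] may
    vanish, both are first enlarged by a small positive number. *)
Lemma L2le_dot u v a b : L2le u a -> L2le v b -> `|I (fun x => u x * v x)| <= a * b.
Proof.
move=> [su a0 ua] [sv b0 vb].
have h c : 0 < c -> 2 * `|I (fun x => u x * v x)| <= c * a ^+ 2 + c^-1 * b ^+ 2.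
  move=> c0; apply: (le_trans (young_RI c0 su sv)).
  by rewrite lerD// ler_wpM2l// ?invr_ge0 ltW.
apply/ler_addgt0Pr => e e0.
(* The increment t satisfies t <= 1 and t (a + b + 1 + e) = e, so the product grows by t (a + b) +
   t^2, which is at most [e]. *)
pose a' := a + e / (a + b + 1 + e); pose b' := b + e / (a + b + 1 + e).
have s0 : 0 < a + b + 1 + e by rewrite ltr_wpDl// addr_ge0// addr_ge0.
have t0 : 0 < e / (a + b + 1 + e) by rewrite divr_gt0.
have a'0 : 0 < a' by rewrite /a' ltr_wpDl.
have b'0 : 0 < b' by rewrite /b' ltr_wpDl.
have := h (b' / a') (divr_gt0 b'0 a'0).
have l1 : b' / a' * a ^+ 2 <= b' * a'.
  rewrite mulrAC ler_pdivrMr// -mulrA ler_wpM2l ?(ltW b'0)// -expr2.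
  by rewrite ler_sqr ?nnegrE ?(ltW a'0)// /a' lerDl ltW.
have l2 : (b' / a')^-1 * b ^+ 2 <= b' * a'.
  rewrite invf_div mulrAC ler_pdivrMr// (mulrC b') -mulrA ler_wpM2l ?(ltW a'0)//.
  by rewrite -expr2 ler_sqr ?nnegrE ?(ltW b'0)// /b' lerDl ltW.
move=> l3.
have : `|I (fun x => u x * v x)| <= b' * a' by lra.
move=> /le_trans; apply.
set t := e / (a + b + 1 + e) in t0 a' b' a'0 b'0 l1 l2 l3 *.
have te : t * (a + b + 1 + e) = e by rewrite /t divfK// gt_eqF.
have t1 : t <= 1.
  by rewrite /t ler_pdivrMr// mul1r lerDr addr_ge0// addr_ge0.
rewrite /a' /b'; nra.
Qed.

Lemma L2leD u v a b : L2le u a -> L2le v b -> L2le (fun x => u x + v x) (a + b).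
Proof.
move=> ua vb; have uv := L2le_dot ua vb.
have [su a0 iua] := ua; have [sv b0 ivb] := vb.
split; [exact: sqiD|exact: addr_ge0|].
have [? iu] := su; have [? iv] := sv.
rewrite (@eq_RI _ (fun x => (u x ^+ 2 + v x ^+ 2) + 2 * (u x * v x))); last first.
  by move=> x _; ring.
rewrite RintegralD//; [|exact: itgD|by apply: itgZ; exact: sqi_itgM].
rewrite RintegralD// RintegralZl//; last exact: sqi_itgM.
have := le_trans (ler_norm _) uv; nra.
Qed.

Lemma L2leZ k u a : L2le u a -> L2le (fun x => k * u x) (`|k| * a).
Proof.
move=> [su a0 iua]; split; [exact: sqiZ|exact: mulr_ge0|].
rewrite (@eq_RI _ (fun x => k ^+ 2 * u x ^+ 2)); last by move=> x _; rewrite exprMn.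
rewrite RintegralZl//; last by case: su.
by rewrite exprMn real_normK ?num_real// ler_wpM2l// sqr_ge0.
Qed.

Lemma L2leN u a : L2le u a -> L2le (fun x => - u x) a.
Proof.
move=> [su a0 ua]; split => //; first exact: sqiN.
by rewrite (@eq_RI _ (fun x => u x ^+ 2))// => x _; rewrite sqrrN.
Qed.

Lemma L2leB u v a b : L2le u a -> L2le v b -> L2le (fun x => u x - v x) (a + b).
Proof. by move=> ua /L2leN; exact: L2leD. Qed.

Lemma L2le_le u a b : a <= b -> L2le u a -> L2le u b.
Proof.
move=> ab [su a0 ua]; split => //; first exact: le_trans ab.
by apply: (le_trans ua); rewrite ler_sqr// nnegrE// (le_trans a0).
Qed.

Lemma L2leM u v k a : ess_bounded u k -> 0 <= k -> L2le v a -> L2le (fun x => u x * v x) (k * a).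
Proof.
move=> bu k0 [sv a0 va]; split; [exact: ess_bounded_sqi bu _|exact: mulr_ge0|].
have suv := ess_bounded_sqi bu sv.
apply: (@le_trans _ _ (I (fun x => k ^+ 2 * v x ^+ 2))).
  apply: le_RI; [by case: suv|by apply: itgZ; case: sv|].
  case: bu => _; apply: filterS => x uk Dx.
  rewrite exprMn ler_wpM2r ?sqr_ge0// -(real_normK (num_real (u x))).
  by rewrite ler_sqr ?nnegrE// uk.
by rewrite RintegralZl ?exprMn ?ler_wpM2l ?sqr_ge0//; case: sv.
Qed.

Lemma L2le_norm u : sqi u -> L2le u (Num.sqrt (I (fun x => u x ^+ 2))).
Proof. by move=> su; split => //; rewrite ?sqrtr_ge0// sqr_sqrtr// RI_sqr_ge0. Qed.

Lemma L2le_dotw u v w a b k : ess_bounded w k -> 0 <= k -> L2le u a -> L2le v b ->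
  `|I (fun x => u x * v x * w x)| <= k * a * b.
Proof.
move=> wk k0 ua vb; have := L2le_dot (L2leM wk k0 ua) vb.
by rewrite (@eq_RI _ (fun x => u x * v x * w x))// => x _; ring.
Qed.

Lemma sqr_RI_eq0 u : sqi u -> I (fun x => u x ^+ 2) <= 0 ->
  {ae mu, forall x, D x -> u x = 0}.
Proof.
move=> [mu_ iu] u0.
have h : (\int[mu]_(x in D) `|(u x ^+ 2)%:E| = 0)%E.
  have f := integrable_fin_num mD iu.
  under eq_integral do rewrite gee0_abs ?lee_fin ?sqr_ge0//.
  rewrite -(fineK f); congr EFin; apply/eqP; rewrite eq_le u0.
  exact: RI_sqr_ge0.
have m2 : measurable_fun D (fun x => (u x ^+ 2)%:E).
  by apply/measurable_EFinP; exact: measurable_funX.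
have [+ _] := ae_eq_integral_abs mu mD m2; move=> /(_ h).
by apply: filterS => x /[apply] /= -[] /eqP; rewrite sqrf_eq0 => /eqP.
Qed.

(** The increments are at most (c + 1) / 2^k in absolute value, so the telescoping series converges
    absolutely. *)
Lemma bounded_increments_cvg (w : nat -> R) c :
  (forall k : nat, 4 ^+ k * (w k.+1 - w k) ^+ 2 <= c) -> cvgn w.
Proof.
move=> wc.
have c0 : 0 <= c by apply: le_trans (wc 0); rewrite mulr_ge0 ?sqr_ge0.
have b (k : nat) : `|w k.+1 - w k| <= geometric (c + 1) 2^-1 k.
  rewrite /= -ler_sqr ?nnegrE//; last by rewrite mulr_ge0 ?exprn_ge0 ?invr_ge0 ?addr_ge0.
  rewrite real_normK ?num_real// exprMn exprVn exprVn -exprM mulnC exprM.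
  rewrite [X in _ / (X ^+ _)](_ : _ = 4); last by ring.
  rewrite ler_pdivlMr ?exprn_gt0// mulrC (le_trans (wc k))//; nra.
have /normed_cvg : cvgn [normed series (fun k => w k.+1 - w k)].
  apply: (series_le_cvg _ _ b) => [k|k|] //=.
  - by rewrite mulr_ge0 ?exprn_ge0 ?invr_ge0 ?addr_ge0.
  - by apply: is_cvg_geometric_series; rewrite ger0_norm ?invr_ge0// invf_lt1// ltr1n.
move=> sc; have -> : w = fun n => w 0 + series (fun k => w k.+1 - w k) n.
  by apply/funext => n; rewrite /series/= telescope_sumr// addrC subrK.
by apply: is_cvgD => //; exact: is_cvg_cst.
Qed.

(** Riesz-Fischer: a rapidly converging subsequence converges almost everywhere, and Fatou's lemma
    turns the Cauchy estimate into an estimate on the distance to the pointwise limit. *)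
Lemma L2_complete (u : nat -> T -> R) : (forall n, sqi (u n)) ->
  (forall e, 0 < e -> exists N, forall m n, (N <= m)%N -> (N <= n)%N ->
     I (fun x => (u m x - u n x) ^+ 2) <= e) ->
  exists v, sqi v /\ forall e, 0 < e -> exists N, forall n, (N <= n)%N ->
     I (fun x => (u n x - v x) ^+ 2) <= e.
Proof.
move=> su cu.
have /choice[M hM] : forall k : nat, exists N, forall m n, (N <= m)%N -> (N <= n)%N ->
     I (fun x => (u m x - u n x) ^+ 2) <= 8^-1 ^+ k.
  by move=> k; apply: cu; rewrite exprn_gt0.
pose phi (k : nat) := (\sum_(i < k.+1) M i)%N.
have phiM (k : nat) : (M k <= phi k)%N by rewrite /phi big_ord_recr/= leq_addl.
have phiS (k : nat) : (phi k <= phi k.+1)%N by rewrite /phi [leqRHS]big_ord_recr/= leq_addr.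
have phi_ge j k : (k <= j)%N -> (M k <= phi j)%N.
  elim: j => [|j IH]; first by rewrite leqn0 => /eqP ->.
  by rewrite leq_eqVlt => /predU1P[->//|/IH /leq_trans]; apply.
pose w (k : nat) := u (phi k).
(* Against the rate 8^(-k) of the subsequence, the weight 4^k leaves the summable 2^(-k);
   conversely, a finite sum at a point forces increments of size 2^(-k) there. *)
pose d_ (k : nat) x := 4 ^+ k * (w k.+1 x - w k x) ^+ 2.
have sdw (k : nat) : sqi (fun x => w k.+1 x - w k x) by apply: sqiB; exact: su.
have d0 (k : nat) (x : T) : 0 <= d_ k x by rewrite mulr_ge0 ?sqr_ge0.
have id (k : nat) : itg (d_ k) by apply: itgZ; case: (sdw k).
have md (k : nat) : measurable_fun D (EFin \o d_ k) by apply: measurable_int (id k).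
pose G (x : T) : \bar R := (\sum_(0 <= k <oo) (d_ k x)%:E)%E.
have mG : measurable_fun D G.
  have := @ge0_emeasurable_sum _ _ _ D (fun k x => (d_ k x)%:E) xpredT.
  by apply => [k x Dx _|k _]; [rewrite lee_fin|exact: md].
have G0 x : (0 <= G x)%E by apply: nneseries_ge0 => k _ _; rewrite lee_fin.
have iG : mu.-integrable D G.
  apply/integrableP; split => //.
  under eq_integral do rewrite gee0_abs ?G0//.
  rewrite integral_nneseries//; last by move=> k x _; rewrite lee_fin.
  have le1 : (\sum_(0 <= k <oo) \int[mu]_(x in D) (d_ k x)%:E <=
             \sum_(0 <= k <oo) (1 / (2 ^ k)%:R)%:E)%E.
    apply: lee_nneseries => [k _ _|k _].
      by apply: integral_ge0 => x _; rewrite lee_fin.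
    have f := integrable_fin_num mD (id k).
    rewrite -(fineK f) lee_fin -[fine _]/(I (d_ k)) RintegralZl//; last by case: (sdw k).
    have := hM k (phi k.+1) (phi k) (phi_ge _ _ (leqnSn k)) (phiM k).
    rewrite -(ler_pM2l (_ : 0 < 4 ^+ k)) ?exprn_gt0// => /le_trans; apply.
    rewrite -exprMn natrX div1r -exprVn.
    by rewrite [4 / 8](_ : _ = 2^-1)//; field.
  apply: le_lt_trans le1 _.
  have e1 : (fun n => \sum_(0 <= k < n) (1 / (2 ^ k)%:R)%:E)%E =
            EFin \o series (geometric (1 : R) 2^-1).
    apply/funext => n; rewrite /series/= sumEFin; congr EFin.
    by apply: eq_bigr => k _; rewrite natrX exprVn.
  rewrite e1 EFin_lim ?ltry//.
  by apply: is_cvg_geometric_series; rewrite ger0_norm ?invr_ge0// invf_lt1// ltr1n.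
have aeG := integrable_ae mD iG.
pose A := D `&` [set x | (G x < +oo)%E].
have mA : measurable A by apply: measurable_lte.
have cA x : A x -> cvgn (w ^~ x).
  move=> [Dx /= Gx]; apply: (@bounded_increments_cvg _ (fine (G x))) => k.
  rewrite -lee_fin fineK; last by rewrite ge0_fin_numE.
  rewrite -[X in (X <= _)%E]/((d_ k x)%:E) /G.
  have h (j : nat) : true -> (0 <= (d_ j x)%:E)%E by rewrite lee_fin.
  rewrite (nneseriesD1 h (isT : xpredT k)).
  by rewrite leeDl//; apply: nneseries_ge0 => j _ _; exact: h.
pose v x := if x \in A then limn (w ^~ x) else 0.
have mv : measurable_fun D v.
  apply: (@measurable_fun_cvg _ _ _ _ (fun k x => \1_A x * w k x)).
    by move=> k; apply: measurable_funM; [exact: measurable_indic|case: (su (phi k))].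
  move=> x Dx; rewrite /v indicE; case: (boolP (x \in A)) => xA.
    under eq_fun do rewrite mul1r.
    by apply: cA; rewrite inE in xA.
  by under eq_fun do rewrite mul0r; exact: cvg_cst.
(* Fatou along the subsequence: for large [j] the squared distance of [u n] to [w j] is at most
   8^(-k), and [w j] tends to [v] almost everywhere. *)
have key (k n : nat) : (M k <= n)%N ->
    (\int[mu]_(x in D) ((u n x - v x) ^+ 2)%:E <= (8^-1 ^+ k)%:E)%E.
  move=> kn.
  pose f j x := ((u n x - w j x) ^+ 2)%:E.
  have mun : measurable_fun D (u n) by case: (su n).
  have mf j : measurable_fun D (f j).
    apply/measurable_EFinP; apply: measurable_funX; apply: measurable_funB => //.
    by case: (su (phi j)).
  have f0 j x : D x -> (0 <= f j x)%E by move=> _; rewrite lee_fin sqr_ge0.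
  have mlf : measurable_fun D (fun x => limn_einf (f ^~ x)).
    rewrite (_ : (fun x => _) = (fun x => - limn_esup (fun j => - f j x))%E); last first.
      by apply/funext => x; rewrite -[limn_einf _]oppeK -limn_esupN.
    apply: measurableT_comp => //; apply: measurable_fun_limn_esup => j.
    exact: measurableT_comp.
  rewrite (@ae_eq_integral _ _ _ _ _ (fun x => limn_einf (f ^~ x)))//; last 2 first.
  - by apply/measurable_EFinP; apply: measurable_funX; exact: measurable_funB.
  - apply: filterS aeG => x xG Dx.
    have Ax : A x by split => //=; move: (xG Dx); rewrite ge0_fin_numE.
    have xA : x \in A by rewrite inE.
    have c : f ^~ x @ \oo --> ((u n x - v x) ^+ 2)%:E.
      apply: cvg_EFin; first exact: nearW.
      rewrite /comp/= /v xA; under eq_fun do rewrite /= expr2.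
      by rewrite expr2; apply: cvgM; apply: cvgB; [exact: cvg_cst|exact: cA|exact: cvg_cst|exact: cA].
    by rewrite (cvg_limn_einf_sup c).1.
  apply: (le_trans (fatou mu mD mf f0)).
  rewrite limn_einf_lim; apply: lime_le; first exact: is_cvg_einfs.
  near=> j.
  have h : (\int[mu]_(x in D) f j x <= (8^-1 ^+ k)%:E)%E.
    have kj : (k <= j)%N by near: j; exists k.
    have [_ ii] := sqiB (su n) (su (phi j)).
    rewrite -(fineK (integrable_fin_num mD ii)) lee_fin.
    by apply: hM => //; exact: phi_ge.
  apply: le_trans h; rewrite /einfs; apply: ereal_inf_lbound.
  by exists j => /=.
have kk (k n : nat) : (M k <= n)%N -> sqi (fun x => u n x - v x) /\
     I (fun x => (u n x - v x) ^+ 2) <= 8^-1 ^+ k.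
  move=> kn; have kn' := key k n kn.
  have mm : measurable_fun D (fun x => u n x - v x).
    by apply: measurable_funB => //; case: (su n).
  have ii : itg (fun x => (u n x - v x) ^+ 2).
    apply/integrableP; split; first by apply/measurable_EFinP; exact: measurable_funX.
    apply: le_lt_trans (ltry (8^-1 ^+ k)); apply: le_trans kn'.
    rewrite le_eqVlt (_ : (_ == _)%E)//; apply/eqP; apply: eq_integral => x _ /=.
    by rewrite ger0_norm// sqr_ge0.
  split => //.
  by move: kn'; rewrite -(fineK (integrable_fin_num mD ii)) lee_fin.
exists v; split.
  have [s _] := kk 0 _ (leqnn _).
  by apply: eq_sqi (sqiB (su (M 0)) s) => x _; ring.
move=> e e0; have [k ke] : exists k : nat, 8^-1 ^+ k <= e.
  have c : (fun k : nat => geometric 1 8^-1 k : R^o) @ \oo --> (0 : R^o).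
    by apply: cvg_geometric; rewrite ger0_norm ?invr_ge0// invf_lt1// ltr1n.
  have /cvgrPdist_le /(_ _ e0) [k _ hk] := c.
  exists k; have := hk k (leqnn _); rewrite /= sub0r normrN mul1r.
  by move/(le_trans (ler_norm _)).
by exists (M k) => n kn; exact: le_trans (kk _ _ kn).2 ke.
Unshelve. all: by end_near. Qed.

End L2_theory.

(** * Bump functions *)

Section smooth_1d.
Context (R : realType).
Implicit Types (f g : R -> R) (x y p q : R).

Fixpoint diffn (n : nat) f : Prop :=
  if n is m.+1 then (forall x, derivable f x 1) /\ diffn m (derive1 f) else True.

Definition smooth1 f := forall n, diffn n f.

Lemma is_derive1P f x a : is_derive x 1 f a -> derivable f x 1 /\ derive1 f x = a.
Proof. by move=> h; split; [exact: ex_derive|rewrite derive1E; exact: derive_val]. Qed.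

Lemma derivable_is_derive1 f x : derivable f x 1 -> is_derive x (1 : R) f (derive1 f x).
Proof. by move=> h; apply: DeriveDef => //; rewrite derive1E. Qed.

Lemma smooth1_derivable f x : smooth1 f -> derivable f x 1.
Proof. by move=> /(_ 1) []. Qed.

Lemma smooth1_derive f : smooth1 f -> smooth1 (derive1 f).
Proof. by move=> sf n; have [] := sf n.+1. Qed.

Lemma smooth1_of_derive f g : (forall x, is_derive x (1 : R) f (g x)) -> smooth1 g -> smooth1 f.
Proof.
move=> fg sg [//|n]; split; first by move=> x; have [] := is_derive1P (fg x).
suff -> : derive1 f = g by [].
by apply/funext => x; have [] := is_derive1P (fg x).
Qed.

Lemma smooth1_iter f n : smooth1 f -> smooth1 (iter n (@derive1 R R) f).
Proof. by elim: n => // n IH /IH; exact: smooth1_derive. Qed.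

Lemma derivable1_continuous f : (forall x, derivable f x 1) -> continuous f.
Proof. by move=> df x; apply: differentiable_continuous; apply/derivable1_diffP. Qed.

Lemma smooth1_continuous f : smooth1 f -> continuous f.
Proof. by move=> sf; apply: derivable1_continuous => x; exact: smooth1_derivable. Qed.

Lemma is_derive_mul f g x a b : is_derive x (1 : R) f a -> is_derive x (1 : R) g b ->
  is_derive x (1 : R) (fun t => f t * g t) (f x * b + g x * a).
Proof. by move=> hf hg; exact: (@is_derive_eq _ _ _ _ _ _ _ _ (is_deriveM hf hg)). Qed.

Lemma diffnS n f : diffn n.+1 f -> diffn n f.
Proof. by elim: n f => // n IH f [df h]; split => //; exact: IH. Qed.

Lemma diffn_cst n (c : R) : diffn n (fun=> c).
Proof.
elim: n c => // n IH c; split => //.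
by rewrite (_ : derive1 _ = fun=> 0)//; apply/funext => x; rewrite derive1_cst.
Qed.

Lemma diffnD n f g : diffn n f -> diffn n g -> diffn n (fun x => f x + g x).
Proof.
elim: n f g => // n IH f g [df f'] [dg g'].
have h x : is_derive x (1 : R) (fun x => f x + g x) (derive1 f x + derive1 g x).
  by apply: is_deriveD; exact: derivable_is_derive1.
split; first by move=> x; have [] := is_derive1P (h x).
rewrite (_ : derive1 _ = fun x => derive1 f x + derive1 g x); first exact: IH.
by apply/funext => x; have [] := is_derive1P (h x).
Qed.

Lemma diffnM n f g : diffn n f -> diffn n g -> diffn n (fun x => f x * g x).
Proof.
elim: n f g => // n IH f g hf hg.
have [df f'] := hf; have [dg g'] := hg.
have h x : is_derive x (1 : R) (fun x => f x * g x) (f x * derive1 g x + g x * derive1 f x).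
  by apply: is_deriveM; exact: derivable_is_derive1.
split; first by move=> x; have [] := is_derive1P (h x).
rewrite (_ : derive1 _ = fun x => f x * derive1 g x + g x * derive1 f x).
  by apply: diffnD; apply: IH => //; exact: diffnS.
by apply/funext => x; have [] := is_derive1P (h x).
Qed.

Lemma is_derive_affine (a b x : R) : is_derive x (1 : R) (fun x => a * x + b) a.
Proof.
have h : is_derive x (1 : R) ((a *: (id : R -> R)) + cst b) (a *: 1 + 0).
  by apply: is_deriveD.
by move: h; rewrite addr0 /GRing.scale/= mulr1.
Qed.

Lemma diffn_affine n f a b : diffn n f -> diffn n (fun x => f (a * x + b)).
Proof.
elim: n f => // n IH f [df f'].
have h x : is_derive x (1 : R) (fun x => f (a * x + b)) (derive1 f (a * x + b) * a).
  apply: (@is_derive1_comp _ f (fun x => a * x + b)); first exact: derivable_is_derive1.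
  exact: is_derive_affine.
split; first by move=> x; have [] := is_derive1P (h x).
rewrite (_ : derive1 _ = fun x => derive1 f (a * x + b) * a).
  by apply: diffnM; [exact: IH|exact: diffn_cst].
by apply/funext => x; have [] := is_derive1P (h x).
Qed.

(** The functions x^(-m) exp(-1/x), extended by zero to x <= 0. The derivative of each is a
    combination of two others, so smoothness at 0 follows by induction for the whole family at
    once. *)
Definition flat (m : nat) x := if 0 < x then x^-1 ^+ m * expR (- x^-1) else 0.

Lemma exprn_le_expR (k : nat) x : 0 <= x -> x ^+ k <= k`!%:R * expR x.
Proof.
case: k => [|k] x0; first by rewrite expr0 fact0 mul1r -[leLHS]expR0 ler_expR.
have k0 : (0 : R) < (k.+1)`!%:R by rewrite ltr0n fact_gt0.
have := expR_ge1Dxn k x0.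
have : x ^+ k.+1 / (k.+1)`!%:R <= 1 + x ^+ k.+1 / (k.+1)`!%:R by rewrite lerDr.
by move=> /le_trans /[apply]; rewrite ler_pdivrMr// mulrC.
Qed.

Lemma flat_ge0 m x : 0 <= flat m x.
Proof.
rewrite /flat; case: ifPn => // x0.
by rewrite mulr_ge0 ?expR_ge0// exprn_ge0// invr_ge0 ltW.
Qed.

Lemma flat_le (m k : nat) x : 0 < x -> flat m x <= (m + k)`!%:R * x ^+ k.
Proof.
move=> x0; rewrite /flat x0 expRN.
have i0 : 0 <= x^-1 by rewrite invr_ge0 ltW.
have xk : x^-1 ^+ k * x ^+ k = 1 by rewrite -exprMn mulVf ?expr1n// gt_eqF.
have := exprn_le_expR (m + k) i0; rewrite exprD => h.
have -> : x^-1 ^+ m = x^-1 ^+ m * x^-1 ^+ k * x ^+ k by rewrite -mulrA xk mulr1.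
rewrite ler_pdivrMr ?expR_gt0// [leRHS]mulrAC ler_wpM2r//.
by rewrite exprn_ge0// ltW.
Qed.

Lemma flat_is_derive (m : nat) x :
  is_derive x (1 : R) (flat m) (flat m.+2 x - m%:R * flat m.+1 x).
Proof.
have [x0|x0|->] := ltgtP x 0.
- have -> : flat m.+2 x - m%:R * flat m.+1 x = 0.
    by rewrite /flat !ltNge (ltW x0)/= mulr0 subrr.
  apply: (@near_eq_is_derive _ _ _ (cst 0)) => //.
  near=> t; rewrite /flat ltNge ltW//=.
  by near: t; exact: lt_nbhsl.
- apply: (@near_eq_is_derive R R R (fun t : R => t^-1 ^+ m * expR (- t^-1))).
    near=> t; rewrite /flat ifT//.
    by near: t; exact: lt_nbhsr.
  have hV : is_derive x (1 : R) (fun t : R => t^-1) (- x ^- 2).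
    apply: is_derive_eq; first by apply: is_deriveV; rewrite gt_eqF.
    by rewrite /GRing.scale/= mulr1.
  have hX : is_derive x (1 : R) (fun t : R => t^-1 ^+ m) (- m%:R * x^-1 ^+ m.+1).
    elim: m => [|m IH].
      by rewrite oppr0 mul0r; apply: is_derive_cst.
    under eq_fun do rewrite exprS.
    apply: (@is_derive_eq _ _ _ _ _ _ _ _ (is_derive_mul hV IH)).
    rewrite -[x ^- 2]exprVn !exprS -natr1; ring.
  have hE : is_derive x (1 : R) (fun t : R => expR (- t^-1)) (expR (- x^-1) * x^-1 ^+ 2).
    by apply: is_derive_eq; rewrite opprK exprVn.
  apply: (@is_derive_eq _ _ _ _ _ _ _ _ (is_derive_mul hX hE)).
  rewrite /flat x0 !exprS; ring.
- have -> : flat m.+2 0 - m%:R * flat m.+1 (0 : R) = 0 by rewrite /flat ltxx mulr0 subrr.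
  have c : h^-1 *: (flat m (h *: (1 : R) + 0) - flat m 0) @[h --> (0 : R)^'] --> (0 : R).
    apply/cvgrPdist_le => e e0.
    near=> h; rewrite sub0r normrN [flat m 0]/flat ltxx subr0 addr0 /GRing.scale/= mulr1.
    have [h0|h0] := ltP 0 h; last by rewrite /flat ltNge h0/= mulr0 normr0 ltW.
    rewrite ger0_norm ?mulr_ge0 ?flat_ge0 ?invr_ge0 ?(ltW h0)//.
    rewrite mulrC ler_pdivrMr//.
    (* The exponent 2 leaves one power of [h] after division by [h], so the difference quotient at 0
       tends to zero. *)
    apply: (le_trans (flat_le m 2 h0)).
    rewrite expr2 mulrA ler_wpM2r ?(ltW h0)//.
    have F0 : (0 : R) < (m + 2)`!%:R by rewrite ltr0n fact_gt0.
    rewrite mulrC -ler_pdivlMr// (le_trans (ler_norm _))//.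
    near: h; apply: dnbhs0_le; exact: divr_gt0.
  apply: DeriveDef; first exact: cvgP c.
  exact: cvg_lim c.
Unshelve. all: by end_near. Qed.

Lemma flat_smooth1 m : smooth1 (flat m).
Proof.
move=> n; elim: n m => // n IH m; split.
  by move=> x; have [] := is_derive1P (flat_is_derive m x).
rewrite (_ : derive1 _ = fun x => flat m.+2 x + (- m%:R) * flat m.+1 x).
  by apply: diffnD => //; apply: diffnM => //; exact: diffn_cst.
by apply/funext => x; have [_ ->] := is_derive1P (flat_is_derive m x); rewrite mulNr.
Qed.

(** The shifts by -1 keep the support at distance 1 / (n + 1) from [p] and [q], while the values
    tend to the indicator of the open interval as [n] grows. *)
Definition bump_fun (n : nat) p q x : R :=
  flat 0 (n.+1%:R * (x - p) - 1) * flat 0 (n.+1%:R * (q - x) - 1).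

Lemma bump_smooth1 n p q : smooth1 (bump_fun n p q).
Proof.
move=> k; apply: diffnM.
  rewrite (_ : (fun _ => _) = fun x => flat 0 (n.+1%:R * x + (- n.+1%:R * p - 1))).
    exact: diffn_affine (flat_smooth1 0 k).
  by apply/funext => x; congr flat; ring.
rewrite (_ : (fun _ => _) = fun x => flat 0 (- n.+1%:R * x + (n.+1%:R * q - 1))).
  exact: diffn_affine (flat_smooth1 0 k).
by apply/funext => x; congr flat; ring.
Qed.

Lemma flat0_le1 x : flat 0 x <= 1.
Proof.
rewrite /flat; case: ifPn => // x0; rewrite expr0 mul1r -expR0 ler_expR.
by rewrite oppr_le0 invr_ge0 ltW.
Qed.

Lemma bump_ge0 n p q x : 0 <= bump_fun n p q x.
Proof. by rewrite mulr_ge0 ?flat_ge0. Qed.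

Lemma bump_le1 n p q x : bump_fun n p q x <= 1.
Proof. by rewrite mulr_ile1 ?flat_ge0 ?flat0_le1. Qed.

Lemma bump_neq0 n p q x : bump_fun n p q x != 0 ->
  p + n.+1%:R^-1 <= x <= q - n.+1%:R^-1.
Proof.
have n0 : (0 : R) < n.+1%:R by rewrite ltr0n.
rewrite mulf_eq0 negb_or /flat; case: ltP => [h1|]; last by rewrite eqxx.
case: ltP => [h2 _|]; last by rewrite eqxx andbF.
have i1 : n.+1%:R^-1 * n.+1%:R = 1 :> R by rewrite mulVf// gt_eqF.
move: (n.+1%:R^-1) i1 => i i1; move: (n.+1%:R) n0 i1 h1 h2 => a n0 i1 h1 h2.
by apply/andP; split; rewrite -(ler_pM2l n0); nra.
Qed.

Lemma flat0_cvg p : 0 < p -> flat 0 (n.+1%:R * p - 1) @[n --> \oo] --> (1 : R).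
Proof.
move=> p0; apply/cvgrPdist_le => e e0.
near=> n.
have N : 1 + e^-1 <= n.+1%:R * p.
  rewrite -ler_pdivrMr//; apply: (@le_trans _ _ n%:R); last by rewrite ler_nat.
  by near: n; exact: nbhs_infty_ger.
have y0 : 0 < n.+1%:R * p - 1 by rewrite subr_gt0 (lt_le_trans _ N)// ltrDl invr_gt0.
rewrite ger0_norm ?subr_ge0 ?flat0_le1// /flat y0 expr0 mul1r.
have := expR_ge1Dx (- (n.+1%:R * p - 1)^-1).
have : (n.+1%:R * p - 1)^-1 <= e.
  by rewrite -[leRHS]invrK lef_pV2 ?posrE ?invr_gt0// lerBrDl.
move: (_^-1) (expR _) => a b; lra.
Unshelve. all: by end_near. Qed.

Lemma bump_cvg p q x : bump_fun n p q x @[n --> \oo] --> (\1_(`]p, q[%classic : set R) x : R).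
Proof.
rewrite indicE; case: (boolP (x \in (`]p, q[%classic : set R))).
  rewrite in_setE/= in_itv/= => /andP[px xq].
  have h1 := @flat0_cvg (x - p); have h2 := @flat0_cvg (q - x).
  have := cvgM (h1 _) (h2 _); rewrite !subr_gt0 mulr1; exact.
rewrite notin_setE/= in_itv/= => h; rewrite (_ : (fun n => _) = fun=> 0); first exact: cvg_cst.
apply/funext => n; apply/eqP; apply: contraPT isT => /bump_neq0 /andP[h1 h2] _.
apply: h; have n0 : (0 : R) < n.+1%:R^-1 by rewrite invr_gt0 ltr0n.
by apply/andP; split; move: (_^-1) n0 h1 h2 => a; lra.
Qed.

(** Test functions of one variable. The case p > q is allowed: it covers those members of [bump_fun]
    that vanish identically because [n] is small. *)
Definition bump_on (l r : R) f := smooth1 f /\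
  exists p q, [/\ l < p, q < r & forall x, f x != 0 -> p <= x <= q].

Lemma bump_bump_on n l r p q : l <= p -> q <= r -> bump_on l r (bump_fun n p q).
Proof.
move=> lp qr; split; first exact: bump_smooth1.
exists (p + n.+1%:R^-1), (q - n.+1%:R^-1).
have n0 : (0 : R) < n.+1%:R^-1 by rewrite invr_gt0 ltr0n.
split; [| |by move=> x /bump_neq0]; move: (_^-1) n0 => a; lra.
Qed.

Lemma bump_on0 l r f x : bump_on l r f -> ~ (l < x < r) -> f x = 0.
Proof.
move=> [_ [p [q [lp qr h]]]] n; apply/eqP; apply: contra_notT n => /h /andP[px xq].
by rewrite (lt_le_trans lp px) (le_lt_trans xq qr).
Qed.

Lemma derive1_near0 f x p q : (forall x, f x != 0 -> p <= x <= q) ->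
  ~ (p <= x <= q) -> derive1 f x = 0.
Proof.
move=> h n.
suff : is_derive x (1 : R) f 0 by move=> /is_derive1P [].
apply: (@near_eq_is_derive _ _ _ (cst 0)) => //.
have : \forall t \near x, ~ (p <= t <= q).
  have [px|px] := ltP x p.
    near=> t; apply/negP; rewrite negb_and -ltNge; apply/orP; left.
    by near: t; exact: lt_nbhsl.
  have xq : q < x by rewrite ltNge; apply/negP => xq; apply: n; rewrite px.
  near=> t; apply/negP; rewrite negb_and -!ltNge; apply/orP; right.
  by near: t; exact: lt_nbhsr.
apply: filterS => t nt; apply/esym/eqP; apply: contra_notT nt; exact: h.
Unshelve. all: by end_near. Qed.

Lemma bump_on_derive l r f : bump_on l r f -> bump_on l r (derive1 f).
Proof.
move=> [sf [p [q [lp qr h]]]]; split; first exact: smooth1_derive.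
exists p, q; split => // x; apply: contraNT => /negP.
by move/(derive1_near0 h) => ->.
Qed.

End smooth_1d.

(** * Products of one-variable test functions *)

Section product_tests.
Context (R : realType).
Implicit Types (f g : R -> R) (l r b t : R).

Definition box l r b t : set (R * R) := [set p | l < p.1 < r /\ b < p.2 < t].

Definition tens f g : R * R -> R := fun p => f p.1 * g p.2.

Lemma partial1_tens f g : smooth1 f -> partial1 (tens f g) = tens (derive1 f) g.
Proof.
move=> sf; apply/funext => -[x y]; rewrite /partial1 /tens/=.
have h : is_derive x (1 : R) (fun t => f t * g y) (derive1 f x * g y).
  apply: is_derive_eq.
    apply: (@is_deriveM _ _ f (cst (g y))).
      exact/derivable_is_derive1/smooth1_derivable.
  by rewrite /GRing.scale/= mulr0 add0r mulrC.
by have [] := is_derive1P h.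
Qed.

Lemma partial2_tens f g : smooth1 g -> partial2 (tens f g) = tens f (derive1 g).
Proof.
move=> sf; apply/funext => -[x y]; rewrite /partial2 /tens/=.
have h : is_derive y (1 : R) (fun t => f x * g t) (f x * derive1 g y).
  apply: is_derive_eq.
    apply: (@is_deriveM _ _ (cst (f x)) g).
    exact/derivable_is_derive1/smooth1_derivable.
  by rewrite /GRing.scale/= mulr0 addr0.
by have [] := is_derive1P h.
Qed.

Lemma partial_tens i j f g : smooth1 f -> smooth1 g ->
  partial i j (tens f g) = tens (iter i (@derive1 R R) f) (iter j (@derive1 R R) g).
Proof.
move=> sf sg; rewrite /partial.
have -> : iter j (@partial2 R) (tens f g) = tens f (iter j (@derive1 R R) g).
  by elim: j => //= j ->; rewrite partial2_tens//; exact: smooth1_iter.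
elim: i => //= i ->; rewrite partial1_tens//; exact: smooth1_iter.
Qed.

Lemma tens_continuous f g : continuous f -> continuous g -> continuous (tens f g).
Proof.
move=> cf cg x; apply: cvgM.
  by apply: (@continuous_comp _ _ _ fst f); [exact: cvg_fst|exact: cf].
by apply: (@continuous_comp _ _ _ snd g); [exact: cvg_snd|exact: cg].
Qed.

Lemma tens_smooth f g : smooth1 f -> smooth1 g -> smooth (tens f g).
Proof.
move=> sf sg w /=.
have [i [j ->]] : exists i j, foldr (fun e => if e then @partial2 R else @partial1 R)
    (tens f g) w = tens (iter i (@derive1 R R) f) (iter j (@derive1 R R) g).
  elim: w => [|e w [i [j /= ->]]]; first by exists 0, 0.
  case: e.
    by exists i, j.+1; rewrite partial2_tens//; exact: smooth1_iter.
  by exists i.+1, j; rewrite partial1_tens//; exact: smooth1_iter.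
have si := smooth1_iter i sf; have sj := smooth1_iter j sg.
split; first by apply: tens_continuous; exact: smooth1_continuous.
move=> [x y]; rewrite /tens /=; split.
  apply: (@derivableM _ _ (iter i (@derive1 R R) f) (cst _)) => //.
  exact: smooth1_derivable.
apply: (@derivableM _ _ (cst _)) => //.
exact: smooth1_derivable.
Qed.

Lemma tens_test_function l r b t f g : bump_on l r f -> bump_on b t g ->
  test_function (box l r b t) (tens f g).
Proof.
move=> [sf [p [q [lp qr hf]]]] [sg [p' [q' [bp qt hg]]]].
split; first exact: tens_smooth.
exists (`[p, q]%classic `*` `[p', q']%classic); split.
- by apply: compact_setX; exact: segment_compact.
- move=> [x y] [] /=; rewrite !in_itv/= => /andP[h1 h2] /andP[h3 h4].
  split => /=; [rewrite (lt_le_trans lp h1) (le_lt_trans h2 qr)//|].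
  by rewrite (lt_le_trans bp h3) (le_lt_trans h4 qt).
- move=> [x y] /= n; apply/eqP; apply: contra_notT n; rewrite /tens/= mulf_eq0 negb_or.
  by move=> /andP[/hf h1 /hg h2]; rewrite /= !in_itv.
Qed.

End product_tests.

(** * Vanishing of integrals over a generated sigma-algebra *)

Section dynkin.
Context d d' (T : measurableType d) (S : measurableType d') (R : realType).
Variables (mu : {measure set T -> \bar R}) (pi_ : T -> S).

(** The sets over whose preimage [v] integrates to zero form a Dynkin system. The map [pi_] lets one
    statement serve for both coordinate projections and for the identity of the plane. *)
Lemma integral_preimage_eq0 (G : set (set S)) (D : set T) (v : T -> \bar R) :
  measurable_fun setT pi_ ->
  @measurable _ S = <<s G >> -> setI_closed G ->
  measurable D -> mu.-integrable D v -> (\int[mu]_(x in D) v x = 0)%E ->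
  (forall E, G E -> \int[mu]_(x in D `&` pi_ @^-1` E) v x = 0)%E ->
  forall E, measurable E -> (\int[mu]_(x in D `&` pi_ @^-1` E) v x = 0)%E.
Proof.
move=> mpi gen GI mD iv D0 G0 E mE.
have mpE A : measurable A -> measurable (D `&` pi_ @^-1` A).
  by move=> mA; apply: measurableI => //; rewrite -[X in measurable X]setTI; exact: mpi.
have iS A : measurable A -> mu.-integrable (D `&` pi_ @^-1` A) v.
  by move=> mA; apply: integrableS iv => //; exact: mpE.
have sE : <<s G >> E by rewrite -gen.
apply: (@dynkin_induction _ S G (fun E => \int[mu]_(x in D `&` pi_ @^-1` E) v x = 0)%E)
  => //.
- by rewrite preimage_setT setIT.
- move=> A mA A0.
  have DU : D = (D `&` pi_ @^-1` A) `|` (D `&` pi_ @^-1` (~` A)).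
    by rewrite -setIUr -preimage_setU setUv preimage_setT setIT.
  move: D0; rewrite {1}DU integral_setU ?A0 ?add0e//.
  + exact: mpE.
  + by apply: mpE; exact: measurableC.
  + by rewrite -DU; exact: measurable_int iv.
  + by rewrite disj_set2E; apply/eqP; rewrite setIACA setIid -preimage_setI setICr preimage_set0 setI0.
- move=> F mF tF F0.
  rewrite preimage_bigcup setI_bigcupr integral_bigcup//.
  + by rewrite eseries0.
  + move=> i j _ _ [x [[_ /= xi] [_ /= xj]]]; apply: tF => //.
    by exists (pi_ x).
  + by move=> k; exact: mpE.
  + by rewrite -setI_bigcupr -preimage_bigcup; apply: iS; exact: bigcupT_measurable.
Qed.

End dynkin.

(** * Boxes in the plane and the fundamental lemma of the calculus of variations *)

Section plane.
Context (R : realType).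
Notation leb := (@lebesgue_measure R).
Notation plane := (measurableTypeR R * measurableTypeR R)%type.
Implicit Types (f g : R -> R) (u v w : R * R -> R) (l r b t x y p q : R).

Lemma boxE l r b t : box l r b t = `]l, r[%classic `*` `]b, t[%classic.
Proof. by apply/seteqP; split => -[x y]; rewrite /box /= !in_itv. Qed.

Lemma measurable_box l r b t : measurable (box l r b t : set plane).
Proof. by rewrite boxE; apply: measurableX; exact: measurable_itv. Qed.

Lemma box_finite l r b t : (leb2 R (box l r b t) < +oo)%E.
Proof.
rewrite boxE [X in (X < _)%E](_ : _ = (leb `]l, r[ * leb `]b, t[)%E); last first.
  by rewrite product_measure1E.
rewrite !lebesgue_measure_itv; case: ifP => _; case: ifP => _; rewrite ?mule0 ?mul0e ?ltry//.
Qed.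

(** Continuity refers to the product topology and measurability to the product sigma-algebra; the
    link is that an open set is a countable union of boxes with rational centre and size. *)
Lemma continuous_measurable2 u : continuous u -> measurable_fun (setT : set plane) u.
Proof.
move=> cu; apply: (measurability _ (RGenOpens.measurableE R)) => // _ [_ [a [c ->] <-]].
rewrite setTI.
set U := _ @^-1` _.
have oU : open U by apply: open_comp => //; move=> x _; exact: cu.
pose B (q1 q2 e : R) := box (q1 - e) (q1 + e) (q2 - e) (q2 + e).
have -> : U = \bigcup_(q1 : rat) \bigcup_(q2 : rat) \bigcup_(e : rat)
    (if `[< B (ratr q1) (ratr q2) (ratr e) `<=` U >] then B (ratr q1) (ratr q2) (ratr e)
     else set0).
  apply/seteqP; split; last first.
    by move=> z [q1 _ [q2 _ [e _]]]; case: asboolP => // h /h.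
  move=> [x y] Uxy.
  have /nbhs_ballP[e /= e0 eU] : nbhs (x, y) U by apply: open_nbhs_nbhs.
  have [d] := @rat_in_itvoo R 0 (e / 2) (divr_gt0 e0 (ltr0n _ 2)).
  rewrite in_itv/= => /andP[d0 de].
  have [q1] := @rat_in_itvoo R (x - ratr d) (x + ratr d) ltac:(lra).
  rewrite in_itv/= => /andP[q11 q12].
  have [q2] := @rat_in_itvoo R (y - ratr d) (y + ratr d) ltac:(lra).
  rewrite in_itv/= => /andP[q21 q22].
  exists q1 => //; exists q2 => //; exists d => //.
  rewrite ifT; first by rewrite /B /box/=; split; lra.
  apply/asboolP => -[x' y'] [/= /andP[h1 h2] /andP[h3 h4]]; apply: eU; split => /=.
    by rewrite /ball/= ltr_norml; lra.
  by rewrite /ball/= ltr_norml; lra.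
do 3 (apply: bigcupT_measurable_rat => ?).
by case: ifP => _ //; exact: measurable_box.
Qed.

Lemma measurable_tens f g : measurable_fun (setT : set (measurableTypeR R)) f ->
  measurable_fun (setT : set (measurableTypeR R)) g ->
  measurable_fun (setT : set plane) (tens f g).
Proof.
move=> mf mg; apply: measurable_funM.
  by apply: (measurableT_comp mf); exact: measurable_fst.
by apply: (measurableT_comp mg); exact: measurable_snd.
Qed.

Lemma measurable_continuous f : continuous f -> measurable_fun (setT : set (measurableTypeR R)) f.
Proof. by move=> cf; exact: continuous_measurable_fun. Qed.

Lemma setI_closed_rays : setI_closed (@RGenOInfty.G R).
Proof.
move=> _ _ [x ->] [y ->]; exists (Num.max x y); apply/seteqP; split => z /=;
  rewrite !in_itv/= !andbT gt_max.
- by move=> [-> ->].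
- by move=> /andP[].
Qed.

(** Three passes of [integral_preimage_eq0]: intervals in x are replaced by measurable sets, then
    intervals in y, and then measurable rectangles generate the product sigma-algebra. Open rays are
    convenient generators because cutting a box by a ray gives a box. *)
Lemma ae_eq0_boxes l r b t v : l < r -> b < t ->
  (leb2 R).-integrable (box l r b t) (EFin \o v) ->
  (forall p q p' q', l <= p -> q <= r -> b <= p' -> q' <= t ->
     (\int[leb2 R]_(z in box p q p' q') (v z)%:E = 0)%E) ->
  {ae leb2 R, forall z, box l r b t z -> v z = 0}.
Proof.
move=> lr bt iv h.
set D := box l r b t.
have mD : measurable (D : set plane) by exact: measurable_box.
have sub p q p' q' : l <= p -> q <= r -> b <= p' -> q' <= t -> box p q p' q' `<=` D.
  by move=> lp qr bp qt -[x y] [/= /andP[h1 h2] /andP[h3 h4]]; split => /=; apply/andP; split;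
    [exact: le_lt_trans h1|exact: lt_le_trans qr|exact: le_lt_trans h3|exact: lt_le_trans qt].
have ibox p q p' q' : l <= p -> q <= r -> b <= p' -> q' <= t ->
    (leb2 R).-integrable (box p q p' q') (EFin \o v).
  by move=> *; apply: integrableS iv => //; [exact: measurable_box|exact: sub].
have gR : @measurable _ (measurableTypeR R) = <<s @RGenOInfty.G R >>.
  exact: RGenOInfty.measurableE.
have a1 p' q' (A : set (measurableTypeR R)) : b <= p' -> q' <= t -> measurable A ->
    (\int[leb2 R]_(z in box l r p' q' `&` fst @^-1` A) (v z)%:E = 0)%E.
  move=> bp qt; apply: (@integral_preimage_eq0 _ _ _ _ _ _ _ (@RGenOInfty.G R)) => //.
  - exact: setI_closed_rays.
  - exact: measurable_box.
  - exact: ibox.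
  - exact: h.
  - move=> _ [x ->]; rewrite (_ : _ `&` _ = box (Num.max l x) r p' q').
      by apply: h => //; rewrite le_max lexx.
    apply/seteqP; split => -[z y]; rewrite /box /= in_itv/= andbT gt_max.
      by move=> [[/andP[-> ->] ->] ->].
    by move=> [/andP[/andP[-> ->] ->] ->].
have a2 (A B : set (measurableTypeR R)) : measurable A -> measurable B ->
    (\int[leb2 R]_(z in (D `&` fst @^-1` A) `&` snd @^-1` B) (v z)%:E = 0)%E.
  move=> mA; have mDA : measurable (D `&` fst @^-1` A).
    by apply: measurableI => //; rewrite -[X in measurable X]setTI; exact: measurable_fst.
  apply: (@integral_preimage_eq0 _ _ _ _ _ _ _ (@RGenOInfty.G R)) => //.
  - exact: setI_closed_rays.
  - by apply: integrableS iv.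
  - exact: a1.
  - move=> _ [y ->]; rewrite (_ : (D `&` fst @^-1` A) `&` _ = box l r (Num.max b y) t `&` fst @^-1` A).
      by apply: a1 => //; rewrite le_max lexx.
    apply/seteqP; split => -[x z]; rewrite /D /box /= in_itv/= andbT gt_max.
      by move=> [[[-> /andP[-> ->]] ?] ->].
    by move=> [[-> /andP[/andP[-> ->] ->]] ?].
have a3 (E : set plane) : measurable E -> (\int[leb2 R]_(z in D `&` E) (v z)%:E = 0)%E.
  move=> mE; have -> : D `&` E = D `&` (id @^-1` E) by [].
  move: E mE; apply: (@integral_preimage_eq0 _ _ _ _ _ _ id
     [set A `*` B | A in @measurable _ (measurableTypeR R) & B in @measurable _ (measurableTypeR R)]) => //.
  - exact: measurable_prod_measurableType.
  - move=> _ _ [A mA [B mB <-]] [A' mA' [B' mB' <-]].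
    exists (A `&` A'); first exact: measurableI.
    by exists (B `&` B'); [exact: measurableI|rewrite setXI].
  - exact: h.
  - move=> _ [A mA [B mB <-]]; rewrite -[RHS](a2 A B mA mB); congr integral.
    by rewrite -setIA; congr (_ `&` _).
have := @integral_ae_eq _ _ _ (leb2 R) D mD (cst 0%E) (EFin \o v) iv.
have m0 : measurable_fun D (cst 0%E : R * R -> \bar R) by exact: measurable_cst.
move=> /(_ m0) H.
have {H} : ae_eq (leb2 R) D (EFin \o v) (cst 0%E).
  apply: H => E ED mE; rewrite integral0 -(setIidr ED).
  by rewrite a3.
by apply: filterS => z /[apply] /= -[].
Qed.

(** Products of bumps lie between 0 and 1 and tend to the indicator of a smaller box, so dominated
    convergence reduces the statement to integrals over boxes. *)
Lemma ae_eq0_tests l r b t v : l < r -> b < t ->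
  (leb2 R).-integrable (box l r b t) (EFin \o v) ->
  (forall f g, bump_on l r f -> bump_on b t g ->
     int2 (box l r b t) (fun z => v z * tens f g z) = 0) ->
  {ae leb2 R, forall z, box l r b t z -> v z = 0}.
Proof.
move=> lr bt iv h; apply: ae_eq0_boxes => // p q p' q' lp qr bp qt.
set D := box l r b t.
have mD : measurable (D : set plane) by exact: measurable_box.
have sub : box p q p' q' `<=` D.
  by move=> -[x y] [/= /andP[h1 h2] /andP[h3 h4]]; split => /=; apply/andP; split;
    [exact: le_lt_trans h1|exact: lt_le_trans qr|exact: le_lt_trans h3|exact: lt_le_trans qt].
have mv : measurable_fun D (EFin \o v) by exact: measurable_int iv.
pose F n z := (v z * tens (bump_fun n p q) (bump_fun n p' q') z)%:E.
have tb0 n z : 0 <= tens (bump_fun n p q) (bump_fun n p' q') z.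
  by rewrite mulr_ge0 ?bump_ge0.
have tb1 n z : tens (bump_fun n p q) (bump_fun n p' q') z <= 1.
  by rewrite mulr_ile1 ?bump_ge0 ?bump_le1.
pose F0 z := (v z * (\1_(`]p, q[%classic : set R) z.1 * \1_(`]p', q'[%classic : set R) z.2))%:E.
have mF n : measurable_fun D (F n).
  apply/measurable_EFinP; apply: measurable_funM; first exact/measurable_EFinP.
  apply: measurable_funTS; apply: continuous_measurable2; apply: tens_continuous;
    by apply: smooth1_continuous; exact: bump_smooth1.
have mF0 : measurable_fun D F0.
  apply/measurable_EFinP; apply: measurable_funM; first exact/measurable_EFinP.
  apply: measurable_funTS.
  apply: (@measurable_tens (\1_(`]p, q[%classic : set R)) (\1_(`]p', q'[%classic : set R)));
    exact: measurable_indic.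
have cF : {ae leb2 R, forall z, D z -> F ^~ z @ \oo --> F0 z}.
  apply: aeW => -[x y] _; apply: cvg_EFin; first exact: nearW.
  apply: cvgM; first exact: cvg_cst.
  by apply: cvgM; exact: bump_cvg.
have dF : {ae leb2 R, forall z n, D z -> (`|F n z| <= `|(v z)%:E|)%E}.
  apply: aeW => z n _; rewrite /F /= lee_fin normrM ler_piMr//.
  by rewrite ger0_norm ?tb0 ?tb1.
have iv' : (leb2 R).-integrable D (fun z => `|(v z)%:E|)%E by exact: integrable_abse iv.
have [iF0 _ lim] := @dominated_convergence _ _ _ (leb2 R) D mD F F0 _ mF mF0 cF iv' dF.
have F0n n : (\int[leb2 R]_(z in D) F n z = 0)%E.
  have i : (leb2 R).-integrable D (F n).
    apply: (@le_itg _ _ _ (leb2 R) D mD _ (fun z => `|v z|)).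
    - by apply/measurable_EFinP; exact: mF.
    - move=> z _; rewrite normrM ler_piMr//.
      by rewrite ger0_norm ?tb0 ?tb1.
    - exact: integrable_norm iv.
  rewrite -[LHS](fineK (integrable_fin_num mD i)); congr EFin.
  by apply: h; exact: bump_bump_on.
have : (\int[leb2 R]_(z in D) F0 z = 0)%E.
  move: lim; rewrite (_ : [sequence _]_n = fun=> 0%E); last by apply/funext => n /=.
  by move=> /(cvg_lim (@ereal_hausdorff R)) <-; rewrite lim_cst//; exact: ereal_hausdorff.
move=> <-; rewrite -(setIidr sub) integral_mkcondr; apply: eq_integral => -[x y] _.
rewrite patchE /F0 !indicE /=.
have -> : ((x, y) \in box p q p' q') =
    (x \in (`]p, q[%classic : set R)) && (y \in (`]p', q'[%classic : set R)).
  by rewrite boxE in_setX.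
by do 2 case: (_ \in _); rewrite /= ?mulr1 ?mul0r ?mulr0.
Qed.

End plane.

(** * Absolute continuity on lines *)

Section fubini_tools.
Context (R : realType).
Notation leb := (@lebesgue_measure R).
Notation line := (measurableTypeR R).
Notation plane := (measurableTypeR R * measurableTypeR R)%type.
Implicit Types (f g : R -> R) (u v w : R * R -> R) (l r b t x y p q : R).

Lemma integrable_swap (u : R * R -> \bar R) : (leb2 R).-integrable setT u ->
  (leb2 R).-integrable setT (fun z => u (z.2, z.1)).
Proof.
move=> iu; have mu_ := measurable_int _ iu.
have ms : measurable_fun (setT : set plane) (fun z : plane => u (z.2, z.1)).
  by apply: (measurableT_comp mu_); exact: measurable_swap.
by apply/integrable12ltyP => //; exact/(integrable21ltyP leb leb mu_).
Qed.

Lemma integrable_fubini_G (u : R * R -> \bar R) : (leb2 R).-integrable setT u ->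
  leb.-integrable setT (fun y => \int[leb]_x u (x, y))%E.
Proof. by move=> /integrable_swap /integrable_fubini_F. Qed.

Lemma Rint_fubini21 u : (leb2 R).-integrable setT (EFin \o u) ->
  Rintegral (leb2 R) setT u = Rintegral leb setT (fun y => Rintegral leb setT (fun x => u (x, y))).
Proof.
move=> iu; rewrite /Rintegral -(integral21_prod_meas1 iu); congr fine.
apply: ae_eq_integral => //.
- exact: measurable_int (integrable_fubini_G iu).
- apply/measurable_EFinP; apply: (measurableT_comp (fine_measurable measurableT)).
  exact: measurable_int (integrable_fubini_G iu).
- have := integrable_ae measurableT (integrable_fubini_G iu).
  by apply: filterS => y h _; rewrite fineK ?h.
Qed.

Lemma Rint_fubini12 u : (leb2 R).-integrable setT (EFin \o u) ->
  Rintegral (leb2 R) setT u = Rintegral leb setT (fun x => Rintegral leb setT (fun y => u (x, y))).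
Proof.
move=> iu; rewrite /Rintegral -(integral12_prod_meas1 iu); congr fine.
apply: ae_eq_integral => //.
- exact: measurable_int (integrable_fubini_F iu).
- apply/measurable_EFinP; apply: (measurableT_comp (fine_measurable measurableT)).
  exact: measurable_int (integrable_fubini_F iu).
- have := integrable_ae measurableT (integrable_fubini_F iu).
  by apply: filterS => y h _; rewrite fineK ?h.
Qed.

Lemma integral_swap (u : R * R -> \bar R) : (leb2 R).-integrable setT u ->
  (\int[leb2 R]_z u (z.2, z.1) = \int[leb2 R]_z u z)%E.
Proof.
move=> iu; rewrite -(integral21_prod_meas1 iu).
by rewrite -(integral12_prod_meas1 (integrable_swap iu)).
Qed.

Lemma integrable_tens f g : leb.-integrable setT (EFin \o f) -> leb.-integrable setT (EFin \o g) ->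
  (leb2 R).-integrable setT (EFin \o tens f g).
Proof.
move=> fi gi.
have mf : measurable_fun (setT : set line) f by exact: itg_measurable fi.
have mg : measurable_fun (setT : set line) g by exact: itg_measurable gi.
apply/integrable12ltyP; first by apply/measurable_EFinP; exact: measurable_tens.
have h x : (\int[leb]_y `|(tens f g (x, y))%:E| = `|(f x)%:E| * \int[leb]_y `|(g y)%:E|)%E.
  under eq_integral do rewrite /tens /= normrM EFinM.
  rewrite (@ge0_integralZl _ _ _ leb setT measurableT (fun y => `|g y|%:E))//.
  by apply/measurable_EFinP; exact: measurableT_comp.
under eq_integral do rewrite h.
have gf : (\int[leb]_y `|(g y)%:E|)%E \is a fin_num.
  by have := integrable_fin_num measurableT (integrable_abse gi).
rewrite -(fineK gf) ge0_integralZr//.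
- have ff : (\int[leb]_x `|(f x)%:E|)%E \is a fin_num.
    by have := integrable_fin_num measurableT (integrable_abse fi).
  by rewrite -(fineK ff) -EFinM ltry.
- by apply: measurableT_comp => //; exact/measurable_EFinP.
- by rewrite fineK// integral_ge0.
Qed.

Lemma Rint_tens f g : leb.-integrable setT (EFin \o f) -> leb.-integrable setT (EFin \o g) ->
  Rintegral (leb2 R) setT (tens f g) = Rintegral leb setT f * Rintegral leb setT g.
Proof.
move=> fi gi; rewrite Rint_fubini12; last exact: integrable_tens.
rewrite -RintegralZr//; apply: eq_Rintegral => x _.
by rewrite /tens /= RintegralZl.
Qed.

Lemma ae_snd (P : R -> Prop) : {ae leb, forall y, P y} -> {ae leb2 R, forall z, P z.2}.
Proof.
move=> [N [mN N0 sN]]; exists (setT `*` N); split.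
- exact: measurableX.
- by rewrite [LHS](product_measure1E leb leb measurableT mN) [X in (_ * X)%E]N0 mule0.
- by move=> [x y] /= nP; split => //; exact: sN.
Qed.

Lemma ae_fst (P : R -> Prop) : {ae leb, forall y, P y} -> {ae leb2 R, forall z, P z.1}.
Proof.
move=> [N [mN N0 sN]]; exists (N `*` setT); split.
- exact: measurableX.
- by rewrite [LHS](product_measure1E leb leb mN measurableT) [X in (X * _)%E]N0 mul0e.
- by move=> [x y] /= nP; split => //; exact: sN.
Qed.

(** The measures of the sections of a null set integrate to zero, hence vanish for almost every
    [x]. *)
Lemma ae_section1 (P : R * R -> Prop) : {ae leb2 R, forall z, P z} ->
  {ae leb, forall x, {ae leb, forall y, P (x, y)}}.
Proof.
move=> [N [mN N0 sN]].
have mx := measurable_fun_xsection leb mN.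
have : ae_eq leb setT (leb \o xsection N) (cst 0%E).
  apply/(ae_eq_integral_abs leb measurableT mx).
  by rewrite -[RHS]N0; apply: eq_integral => x _; rewrite gee0_abs.
apply: filterS => x /(_ I) /= h; exists (xsection N x); split => //.
- exact: measurable_xsection.
- by move=> y /= nP; rewrite /xsection /= inE; exact: sN.
Qed.

(** Extension by zero, so that Fubini's theorem on the whole plane applies to functions given on a
    box. *)
Definition cutoff (D : set (R * R)) u : R * R -> R := fun z => if z \in D then u z else 0.

Lemma cutoffE D u z : D z -> cutoff D u z = u z.
Proof. by move=> Dz; rewrite /cutoff mem_set. Qed.

Lemma cutoff0 D u z : ~ D z -> cutoff D u z = 0.
Proof. by move=> Dz; rewrite /cutoff memNset. Qed.

Lemma integral_cutoff (D : set plane) u : 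
  (\int[leb2 R]_(z in D) (u z)%:E = \int[leb2 R]_z (cutoff D u z)%:E)%E.
Proof.
rewrite integral_mkcond; apply: eq_integral => z _; rewrite patchE /cutoff.
by case: (z \in D).
Qed.

Lemma Rint_cutoff (D : set plane) u :
  int2 D u = Rintegral (leb2 R) setT (cutoff D u).
Proof. by rewrite /int2 /Rintegral integral_cutoff. Qed.

Lemma integrable_cutoff (D : set plane) u : measurable D ->
  (leb2 R).-integrable D (EFin \o u) <-> (leb2 R).-integrable setT (EFin \o cutoff D u).
Proof.
move=> mD; rewrite (integrable_mkcond _ mD).
rewrite (_ : (EFin \o u) \_ D = EFin \o cutoff D u)//.
by apply/funext => z; rewrite patchE /cutoff /=; case: (z \in D).
Qed.

(** Exchanging the coordinates transfers statements about x-derivatives to y-derivatives. *)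
Definition flip u : R * R -> R := fun z => u (z.2, z.1).

Lemma cutoff_flip l r b t u : cutoff (box b t l r) (flip u) = flip (cutoff (box l r b t) u).
Proof.
apply/funext => -[x y]; rewrite /flip /cutoff /=.
have -> : ((x, y) \in box b t l r) = ((y, x) \in box l r b t); last by [].
by apply/idP/idP; rewrite !inE /box/= => -[].
Qed.

Lemma integrable_flip l r b t u : (leb2 R).-integrable (box l r b t) (EFin \o u) ->
  (leb2 R).-integrable (box b t l r) (EFin \o flip u).
Proof.
move=> /(integrable_cutoff _ (measurable_box l r b t)) /integrable_swap iu.
apply/(integrable_cutoff _ (measurable_box b t l r)).
by rewrite cutoff_flip.
Qed.

Lemma measurable_flip l r b t u : measurable_fun (box l r b t : set plane) u ->
  measurable_fun (box b t l r : set plane) (flip u).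
Proof.
move=> mu_; apply: (@measurable_comp _ _ _ _ _ _ (box l r b t : set plane) _ _ (fun z : plane => (z.2, z.1))) => //.
- exact: measurable_box.
- by move=> _ [[x y] /= [h1 h2] <-].
- by apply: measurable_funTS; exact: measurable_swap.
Qed.

Lemma sqi_flip l r b t u : square_integrable (leb2 R) (box l r b t) u ->
  square_integrable (leb2 R) (box b t l r) (flip u).
Proof. by move=> [mu_ iu]; split; [exact: measurable_flip|exact: integrable_flip iu]. Qed.

Lemma int2_flip l r b t u : (leb2 R).-integrable (box l r b t) (EFin \o u) ->
  int2 (box b t l r) (flip u) = int2 (box l r b t) u.
Proof.
move=> iu; rewrite !Rint_cutoff cutoff_flip /Rintegral; congr fine.
by apply: (integral_swap (u := EFin \o cutoff (box l r b t) u)); exact/(integrable_cutoff _ (measurable_box l r b t)).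
Qed.

End fubini_tools.

Section acl.
Context (R : realType).
Notation leb := (@lebesgue_measure R).
Notation line := (measurableTypeR R).
Notation plane := (measurableTypeR R * measurableTypeR R)%type.
Notation itg1 f := (leb.-integrable setT (EFin \o f)).
Notation I1 := (Rintegral leb setT).
Implicit Types (f g : R -> R) (u v w : R * R -> R) (l r b t x y p q : R).

Lemma bump_on_itg l r f : bump_on l r f -> itg1 f.
Proof.
move=> [sf [p [q [_ _ h]]]].
have i : leb.-integrable `[p, q] (EFin \o f).
  apply: continuous_compact_integrable; first exact: segment_compact.
  by apply: continuous_subspaceT; exact: smooth1_continuous.
move/(integrable_mkcond _ (measurable_itv `[p, q] : measurable (_ : set line))): i.
apply: eq_integrable => // x _; rewrite patchE /=.
case: ifPn => //; rewrite notin_setE /= in_itv /= => /negP n.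
by apply/esym; congr EFin; apply/eqP; apply: contraNT n => /h.
Qed.

Lemma Rint_derive_ray l r f x : bump_on l r f ->
  I1 (fun s => (x < s)%R%:R * derive1 f s) = - f x.
Proof.
move=> bf; have [sf [p [q [_ _ h]]]] := bf.
(* A point to the right of both [x] and the support, so that the ray may be cut to a compact
   interval. *)
pose M := Num.max q x + 1.
have xM : x < M by rewrite /M ltr_pwDr// le_max lexx orbT.
have fM : f M = 0.
  apply/eqP; apply: contraT => /h /andP[_]; rewrite leNgt /M.
  by rewrite ltr_pwDr// le_max lexx.
have cf : {within `[x, M], continuous (derive1 f)}.
  by apply: continuous_subspaceT; apply: smooth1_continuous; exact: smooth1_derive.
have df : derivable_oo_LRcontinuous f x M.
  have c := smooth1_continuous sf; split.
  - by move=> y _; exact: smooth1_derivable.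
  - by apply: cvg_at_right_filter; exact: c.
  - by apply: cvg_at_left_filter; exact: c.
have E := continuous_FTC2 xM cf df (fun y _ => erefl).
rewrite -[RHS]add0r -fM -[RHS]/(fine ((f M)%:E - (f x)%:E)%E) -E.
rewrite -integral_itv_obnd_cbnd; last first.
  by apply/measurable_EFinP; apply: measurable_funTS; apply: measurable_continuous;
     apply: smooth1_continuous; exact: smooth1_derive.
rewrite integral_mkcond /Rintegral; congr fine; apply: eq_integral => s _.
rewrite patchE; case: ifPn; rewrite ?inE ?notin_setE /= in_itv /=.
  by move=> /andP[-> _]; rewrite mul1r.
move=> n; case: (ltP x s) => xs; last by rewrite mul0r.
rewrite mul1r; congr EFin; apply: (derive1_near0 h) => /andP[_ sq]; apply: n.
by rewrite xs /M (le_trans sq)// (le_trans _ (_ : Num.max q x <= _)) ?le_max ?lexx// lerDl.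
Qed.

Lemma measurable_lt_plane : measurable_fun (setT : set plane)
  (fun z : plane => ((z.2 : R) < z.1)%R%:R : R).
Proof.
rewrite (_ : (fun _ => _) = fun z : plane => if (z.2 : R) < z.1 then 1 else 0); last first.
  by apply/funext => z; case: (_ < _).
apply: measurable_fun_ifT => //.
by apply: measurable_fun_ltr; [exact: measurable_snd|exact: measurable_fst].
Qed.

(** Integration by parts when one factor is the primitive of a merely integrable function: Fubini
    with the kernel s < x moves the inner integral onto [derive1 f], where [Rint_derive_ray]
    evaluates it. *)
Lemma Rint_primitive_parts nu l r f : itg1 nu -> bump_on l r f ->
  I1 (fun x => I1 (fun s => (s < x)%R%:R * nu s) * derive1 f x) = - I1 (fun s => nu s * f s).
Proof.
move=> inu bf.
have if' : itg1 (derive1 f) by apply: bump_on_itg; exact: bump_on_derive bf.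
pose k (z : R * R) := (z.2 < z.1)%R%:R * tens (derive1 f) nu z.
have ik : (leb2 R).-integrable setT (EFin \o k).
  apply: (@le_itg _ _ _ (leb2 R) _ measurableT _ (fun z => `|tens (derive1 f) nu z|)).
  - apply: measurable_funM; first exact: measurable_lt_plane.
    by apply: itg_measurable; exact: integrable_tens.
  - by move=> z _; rewrite /k normrM; case: (_ < _)%R; rewrite /= ?normr1 ?mul1r// normr0 mul0r.
  - exact: integrable_norm (integrable_tens if' inu).
have := Rint_fubini12 ik; rewrite (Rint_fubini21 ik) => E.
transitivity (I1 (fun x => I1 (fun y => k (x, y)))).
  apply: eq_Rintegral => x _.
  rewrite -RintegralZr//; last first.
    apply: (@le_itg _ _ _ leb _ measurableT _ (fun s => `|nu s|)).
    - apply: measurable_funM; last exact: itg_measurable inu.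
      exact: (measurableT_comp measurable_lt_plane (pair1_measurable x)).
    - by move=> s _; rewrite normrM; case: (_ < _)%R; rewrite /= ?normr1 ?mul1r// normr0 mul0r.
    - exact: integrable_norm inu.
  by apply: eq_Rintegral => s _; rewrite /k /tens /=; ring.
rewrite -E -mulN1r -RintegralZl//; last first.
  have [sf [p [q [_ _ h]]]] := bf.
  have mf := measurable_continuous (smooth1_continuous sf).
  have mnu := itg_measurable inu.
  have [M hM] : exists M, forall x, `|f x| <= M.
    have c : compact (f @` `[p, q]).
      apply: continuous_compact; last exact: segment_compact.
      by apply: continuous_subspaceT; exact: smooth1_continuous.
    have [M [_ hM]] := compact_bounded c.
    exists (Num.max (M + 1) 0) => x; rewrite le_max.
    have [->|/h xpq] := eqVneq (f x) 0; first by rewrite normr0 lexx orbT.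
    rewrite (hM (M + 1)) ?ltrDl//; exists x => //=; by rewrite in_itv.
  apply: (@le_itg _ _ _ leb _ measurableT _ (fun s => M * `|nu s|)).
  - exact: measurable_funM.
  - by move=> s _; rewrite normrM mulrC ler_wpM2r.
  - by apply: itgZ => //; exact: integrable_norm inu.
apply: eq_Rintegral => s _.
under eq_Rintegral => x _ do rewrite /k /tens /= mulrA.
rewrite RintegralZr//; first by rewrite (Rint_derive_ray _ bf); ring.
apply: (@le_itg _ _ _ leb _ measurableT _ (fun x => `|derive1 f x|)).
- apply: measurable_funM; last exact: itg_measurable if'.
  exact: (measurableT_comp measurable_lt_plane (pair2_measurable s)).
- by move=> x _; rewrite normrM; case: (_ < _)%R; rewrite /= ?normr1 ?mul1r// normr0 mul0r.
- exact: integrable_norm if'.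
Qed.

(* A version of [v], extended by zero, all of whose horizontal sections are
   integrable, so that its primitive [primx] in x has no exceptional lines. *)
Record sectionwise_rep l r b t v v' : Prop := SectionwiseRep {
  gr_meas : measurable_fun (setT : set plane) v';
  gr_out : forall z, ~ box l r b t z -> v' z = 0;
  gr_ae : {ae leb2 R, forall z, box l r b t z -> v z = v' z};
  gr_itg : forall y, itg1 (fun s => v' (s, y));
  gr_sqr : forall y, itg1 (fun s => v' (s, y) ^+ 2);
  gr_itg2 : (leb2 R).-integrable setT (EFin \o v') }.

Lemma sqi_itg (D : set plane) u : measurable D -> (leb2 R D < +oo)%E ->
  square_integrable (leb2 R) D u -> (leb2 R).-integrable D (EFin \o u).
Proof.
move=> mD fD [mu_ iu].
apply: (@le_itg _ _ _ (leb2 R) D mD u (fun x : R * R => 1 + u x ^+ 2)) => //.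
- by move=> z _; rewrite ler_norml; apply/andP; split; nra.
- apply: itgD => //.
  by apply: (measurable_bounded_integrable (f := cst 1)) => //; exact: bounded_cst.
Qed.

(** The lines on which the section of [v] is not square integrable form a null set, and [v'] is put
    to zero there. On the remaining lines integrability follows from square integrability because
    the box is bounded. *)
Lemma sectionwise_rep_exists l r b t v : square_integrable (leb2 R) (box l r b t) v ->
  exists v', sectionwise_rep l r b t v v'.
Proof.
move=> sv; have [mv iv2] := sv.
have mB := measurable_box l r b t.
have iv := sqi_itg mB (box_finite l r b t) sv.
have /(integrable_cutoff _ mB) ic := iv.
have /(integrable_cutoff _ mB) ic2 := iv2.
set vh := cutoff (box l r b t) v in ic.
have e2 : cutoff (box l r b t) (fun z => v z ^+ 2) = fun z => vh z ^+ 2.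
  by apply/funext => z; rewrite /vh /cutoff; case: ifP => // _; rewrite expr0n.
rewrite e2 in ic2.
pose G y := (\int[leb]_s (vh (s, y) ^+ 2)%:E)%E.
have iG : leb.-integrable setT G := integrable_fubini_G ic2.
pose Y : set line := setT `&` [set y : line | (G y < +oo)%E].
have mY : measurable Y by apply: measurable_lte => //; exact: measurable_int iG.
pose v' (z : R * R) := \1_Y z.2 * vh z.
have mvh : measurable_fun (setT : set plane) vh by exact: itg_measurable ic.
have mv' : measurable_fun (setT : set plane) v'.
  apply: measurable_funM => //.
  by apply: (measurableT_comp (measurable_indic mY)); exact: measurable_snd.
have v'le z : `|v' z| <= `|vh z|.
  by rewrite /v' normrM indicE; case: (_ \in _); rewrite ?normr1 ?mul1r// normr0 mul0r.
have msec (w : plane -> R) y : measurable_fun (setT : set plane) w ->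
    measurable_fun (setT : set line) (fun s => w (s, y)).
  by move=> mw; exact: (measurableT_comp mw (pair2_measurable y)).
have sq y : itg1 (fun s => v' (s, y) ^+ 2).
  have mm : measurable_fun (setT : set line) (fun s => v' (s, y) ^+ 2).
    by apply: measurable_funX; exact: msec.
  apply/integrableP; split; first exact/measurable_EFinP.
  case: (boolP (y \in Y)) => yY; last first.
    rewrite (@eq_integral _ _ _ _ _ (cst 0%E)); first by rewrite integral0 ltry.
    by move=> s _; rewrite /= /v' indicE (negbTE yY) mul0r expr0n normr0.
  have := yY; rewrite inE => -[_ /=]; apply: le_lt_trans; apply: ge0_le_integral => //.
  - by apply/measurable_EFinP; apply: measurableT_comp.
  - by apply/measurable_EFinP; apply: measurable_funX; exact: msec.
  - by move=> s _; rewrite /= lee_fin /v' indicE yY mul1r ger0_norm// sqr_ge0.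
exists v'; split => //.
- by move=> z nz; rewrite /v' /vh cutoff0// mulr0.
- have h := ae_snd (integrable_ae measurableT iG).
  apply: (ae_imp1 h) => z /(_ I) Gz Bz; rewrite /v' /vh cutoffE// indicE mem_set ?mul1r//.
  by split => //=; rewrite -ge0_fin_numE// integral_ge0// => s _; rewrite lee_fin sqr_ge0.
- move=> y; have iI : itg1 (\1_(`]l, r[%classic : set line)).
    apply: integrable_indic_itv.
  apply: (@le_itg _ _ _ leb _ measurableT _ (fun s => \1_(`]l, r[%classic : set line) s + v' (s, y) ^+ 2)).
  - exact: msec.
  - move=> s _; rewrite indicE; case: (boolP (s \in _)) => hs.
      rewrite (_ : true%:R = 1)//; move: (v' _) => c.
      by rewrite ler_norml; apply/andP; split; nra.
    rewrite /v' /vh cutoff0 ?mulr0 ?normr0 ?expr0n ?addr0//.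
    by move=> [/= h _]; move: hs; rewrite notin_setE /= in_itv /= h.
  - exact: itgD.
- apply: (@le_itg _ _ _ (leb2 R) _ measurableT _ (fun z => `|vh z|)) => //.
  exact: integrable_norm ic.
Qed.

Definition primx v z : R := I1 (fun s => (s < z.1)%R%:R * v (s, z.2)).

Lemma primx_section l r b t v v' z : sectionwise_rep l r b t v v' ->
  itg1 (fun s => (s < z.1)%R%:R * v' (s, z.2)).
Proof.
move=> gr; apply: (@le_itg _ _ _ leb _ measurableT _ (fun s => `|v' (s, z.2)|)).
- apply: measurable_funM; last exact: itg_measurable (gr_itg gr _).
  exact: (measurableT_comp measurable_lt_plane (pair1_measurable z.1)).
- by move=> s _; rewrite normrM; case: (_ < _)%R; rewrite /= ?normr1 ?mul1r// normr0 mul0r.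
- exact: integrable_norm (gr_itg gr _).
Qed.

(** Joint measurability of an integral depending on a parameter: the measurability part of Tonelli's
    theorem is applied to the positive and negative parts of the integrand. *)
Lemma primx_measurable l r b t v v' : sectionwise_rep l r b t v v' ->
  measurable_fun (setT : set plane) (primx v').
Proof.
move=> gr.
pose h (p : plane * line) := (p.2 < p.1.1)%R%:R * v' (p.2, p.1.2).
have mh : measurable_fun (setT : set (plane * line)) h.
  apply: measurable_funM.
    have m1 : measurable_fun (setT : set (plane * line)) (fun p : plane * line => (p.1.1, p.2)).
      apply: measurable_fun_pair; last exact: measurable_snd.
      by apply: (measurableT_comp measurable_fst); exact: measurable_fst.
    exact: (measurableT_comp measurable_lt_plane m1).
  have m2 : measurable_fun (setT : set (plane * line)) (fun p : plane * line => (p.2, p.1.2)).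
    apply: measurable_fun_pair; first exact: measurable_snd.
    by apply: (measurableT_comp measurable_snd); exact: measurable_fst.
  exact: (measurableT_comp (gr_meas gr) m2).
have -> : primx v' = fine \o (fun z => \int[leb]_s (h (z, s))%:E)%E by [].
apply: (measurableT_comp (fine_measurable measurableT)).
have -> : (fun z : plane => \int[leb]_s (h (z, s))%:E)%E =
   (fun z => \int[leb]_s ((EFin \o h)^\+ (z, s)) - \int[leb]_s ((EFin \o h)^\- (z, s)))%E.
  apply/funext => z; rewrite [LHS]integralE.
  by congr (_ - _)%E; apply: eq_integral => s _; rewrite ?funeposE ?funenegE.
apply: emeasurable_funB; apply: measurable_fun_fubini_tonelli_F => //.
- by apply: measurable_funepos; exact/measurable_EFinP.
- by apply: measurable_funeneg; exact/measurable_EFinP.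
Qed.

Lemma primx_le l r b t v v' z : sectionwise_rep l r b t v v' ->
  `|primx v' z| <= I1 (fun s => `|v' (s, z.2)|).
Proof.
move=> gr; have i := primx_section z gr.
apply: (le_trans (le_normr_Rintegral measurableT i)).
apply: le_Rintegral => //.
- exact: integrable_norm i.
- exact: integrable_norm (gr_itg gr _).
- by move=> s _; rewrite normrM; case: (_ < _)%R; rewrite /= ?normr1 ?mul1r// normr0 mul0r.
Qed.

Lemma primx_itg l r b t v v' : sectionwise_rep l r b t v v' ->
  (leb2 R).-integrable (box l r b t) (EFin \o primx v').
Proof.
move=> gr; have mB := measurable_box l r b t.
have mp : measurable_fun (box l r b t : set plane) (primx v').
  by apply: measurable_funTS; exact: primx_measurable gr.
pose N y := I1 (fun s => `|v' (s, y)|).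
have iN : itg1 N.
  have ia : (leb2 R).-integrable setT (fun z => (`|v' z|)%:E).
    by have := integrable_norm (gr_itg2 gr).
  have := integrable_fubini_G ia; apply: eq_integrable => // y _.
  rewrite /N /Rintegral /= fineK//.
  by have := integrable_fin_num measurableT (integrable_norm (gr_itg gr y)).
apply: (@le_itg _ _ _ (leb2 R) _ mB _ (tens (\1_(`]l, r[%classic : set line)) N)) => //.
  move=> z [hz _]; rewrite /tens indicE mem_set ?mul1r; first exact: primx_le gr.
  by rewrite /= in_itv.
apply: (integrableS measurableT) => //.
by apply: integrable_tens => //; exact: integrable_indic_itv.
Qed.

(* Products of bumps suffice as test functions: their limits separate boxes. *)
Definition weak_dx l r b t u v := forall f g, bump_on l r f -> bump_on b t g ->
  int2 (box l r b t) (fun z => u z * tens (derive1 f) g z) =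
  - int2 (box l r b t) (fun z => v z * tens f g z).

Definition weak_dy l r b t u v := forall f g, bump_on l r f -> bump_on b t g ->
  int2 (box l r b t) (fun z => u z * tens f (derive1 g) z) =
  - int2 (box l r b t) (fun z => v z * tens f g z).

Lemma bump_on_bounded l r f : bump_on l r f -> exists M, forall x, `|f x| <= M.
Proof.
move=> [sf [p [q [_ _ h]]]].
have c : compact (f @` `[p, q]).
  apply: continuous_compact; last exact: segment_compact.
  by apply: continuous_subspaceT; exact: smooth1_continuous.
have [M [_ hM]] := compact_bounded c.
exists (Num.max (M + 1) 0) => x; rewrite le_max.
have [->|/h xpq] := eqVneq (f x) 0; first by rewrite normr0 lexx orbT.
by rewrite (hM (M + 1)) ?ltrDl//; exists x => //=; rewrite in_itv.
Qed.

Lemma tens_ess_bounded (D : set plane) l r b t f g : measurable D -> bump_on l r f -> bump_on b t g ->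
  exists M, ess_bounded (leb2 R) D (tens f g) M.
Proof.
move=> mD bf bg; have [M hM] := bump_on_bounded bf; have [N hN] := bump_on_bounded bg.
exists (M * N); split.
  apply: measurable_funTS; apply: continuous_measurable2; apply: tens_continuous.
    by case: bf => sf _; exact: smooth1_continuous.
  by case: bg => sg _; exact: smooth1_continuous.
by apply: aeW => z _; rewrite /tens normrM ler_pM.
Qed.

Lemma itg_mul_tens (D : set plane) l r b t f g u : measurable D -> bump_on l r f -> bump_on b t g ->
  (leb2 R).-integrable D (EFin \o u) ->
  (leb2 R).-integrable D (EFin \o (fun z => u z * tens f g z)).
Proof.
move=> mD bf bg iu; have [M hM] := tens_ess_bounded mD bf bg.
by apply: (eq_itg mD _ (ess_bounded_itg mD hM iu)) => z _; rewrite mulrC.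
Qed.

Lemma tens_out l r b t f g z : bump_on l r f -> bump_on b t g -> ~ box l r b t z ->
  tens f g z = 0.
Proof.
move=> bf bg nz; rewrite /tens; have [h1|h1] := pselect (l < z.1 < r); last first.
  by rewrite (bump_on0 bf)// mul0r.
by rewrite (bump_on0 bg) ?mulr0// => h2; apply: nz; split.
Qed.

Lemma cutoff_tens l r b t f g u : bump_on l r f -> bump_on b t g ->
  cutoff (box l r b t) (fun z => u z * tens f g z) = fun z => u z * tens f g z.
Proof.
move=> bf bg; apply/funext => z; rewrite /cutoff; case: ifPn => //.
by rewrite notin_setE => /(tens_out bf bg) ->; rewrite mulr0.
Qed.

Lemma int2_tens l r b t f g u : bump_on l r f -> bump_on b t g ->
  int2 (box l r b t) (fun z => u z * tens f g z) =
  Rintegral (leb2 R) setT (fun z => u z * tens f g z).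
Proof. by move=> bf bg; rewrite Rint_cutoff cutoff_tens. Qed.

Lemma integrable_tensT l r b t f g u : bump_on l r f -> bump_on b t g ->
  (leb2 R).-integrable (box l r b t) (EFin \o u) ->
  (leb2 R).-integrable setT (EFin \o (fun z => u z * tens f g z)).
Proof.
move=> bf bg iu; rewrite -(cutoff_tens u bf bg).
apply/(integrable_cutoff _ (measurable_box l r b t)).
exact: itg_mul_tens (measurable_box l r b t) bf bg iu.
Qed.

(** Fubini in y, then [Rint_primitive_parts] on every horizontal line. *)
Lemma weak_dx_primx l r b t v v' : measurable_fun (box l r b t : set plane) v ->
  sectionwise_rep l r b t v v' -> weak_dx l r b t (primx v') v.
Proof.
move=> mv gr f g bf bg; have mB := measurable_box l r b t.
have bf' := bump_on_derive bf.
have ipt := integrable_tensT bf' bg (primx_itg gr).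
have ivt := itg_mul_tens measurableT bf bg (gr_itg2 gr).
have [_ [mtn _]] := tens_ess_bounded mB bf bg.
have -> : int2 (box l r b t) (fun z => v z * tens f g z) =
   Rintegral (leb2 R) setT (fun z => v' z * tens f g z).
  rewrite -(int2_tens v' bf bg); apply: ae_RI => //.
  - exact: measurable_funM.
  - by apply: measurable_funM => //; apply: measurable_funTS; exact: (gr_meas gr).
  - by apply: (ae_imp1 (gr_ae gr)) => z /[apply] ->.
rewrite (int2_tens _ bf' bg) (Rint_fubini21 ipt) (Rint_fubini21 ivt) -mulN1r -RintegralZl//; last first.
  exact: (integrable_fine measurableT (integrable_fubini_G ivt)).
apply: eq_Rintegral => y _.
have E := Rint_primitive_parts (gr_itg gr y) bf.
transitivity (g y * - I1 (fun s => v' (s, y) * f s)).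
  rewrite -E -RintegralZl//; last first.
    apply: (@le_itg _ _ _ leb _ measurableT _ (fun x => I1 (fun s => `|v' (s, y)|) * `|derive1 f x|)).
    - apply: measurable_funM; last exact: itg_measurable (bump_on_itg bf').
      exact: (measurableT_comp (primx_measurable gr) (pair2_measurable y)).
    - by move=> x _; rewrite normrM ler_wpM2r//; exact: (primx_le (x, y) gr).
    - by apply: itgZ => //; exact: integrable_norm (bump_on_itg bf').
  by apply: eq_Rintegral => x _; rewrite /tens /primx /=; ring.
have -> : I1 (fun x => v' (x, y) * tens f g (x, y)) = g y * I1 (fun s => v' (s, y) * f s).
  rewrite -RintegralZl//; first by apply: eq_Rintegral => x _; rewrite /tens /=; ring.
  have [M hM] := bump_on_bounded bf.
  apply: (@le_itg _ _ _ leb _ measurableT _ (fun s => M * `|v' (s, y)|)).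
  - apply: measurable_funM; first exact: itg_measurable (gr_itg gr y).
    exact: itg_measurable (bump_on_itg bf).
  - by move=> s _; rewrite normrM mulrC ler_wpM2r.
  - by apply: itgZ => //; exact: integrable_norm (gr_itg gr y).
ring.
Qed.

(** If every bump had integral zero, the constant 1 on the square would be orthogonal to all
    products of bumps, hence zero almost everywhere, against the positive area of the square. *)
Lemma bump_mass l r : l < r -> exists f, bump_on l r f /\ I1 f != 0.
Proof.
move=> lr; apply: contrapT => h.
have z0 f : bump_on l r f -> I1 f = 0.
  by move=> bf; apply: contrapT => /eqP n; apply: h; exists f.
have mB := measurable_box l r l r.
have i1 : (leb2 R).-integrable (box l r l r) (EFin \o cst 1).
  apply: (measurable_bounded_integrable (f := cst 1)) => //; first exact: box_finite.
  exact: bounded_cst.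
have z1 f g : bump_on l r f -> bump_on l r g ->
    int2 (box l r l r) (fun z => cst 1 z * tens f g z) = 0.
  move=> bf bg; rewrite (int2_tens (cst 1) bf bg).
  under eq_Rintegral do rewrite /cst mul1r.
  by rewrite Rint_tens ?z0 ?mul0r//; [exact: bump_on_itg bf|exact: bump_on_itg bg].
have [N [mN N0 sN]] := @ae_eq0_tests R l r l r (cst 1) lr lr i1 z1.
have : (leb2 R (box l r l r) <= leb2 R N)%E.
  apply: le_measure => //; rewrite ?inE//.
  by move=> z Bz; apply: sN => /(_ Bz) /eqP; rewrite oner_eq0.
rewrite N0 boxE [X in (X <= _)%E](product_measure1E leb leb (measurable_itv _) (measurable_itv _)).
have e : leb [set` `]l, r[] = (r - l)%:E by rewrite lebesgue_measure_itv /= lte_fin lr -EFinB.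
move=> h1; have : ((r - l)%:E * (r - l)%:E <= 0)%E by rewrite -e; exact: h1.
by rewrite -EFinM lee_fin leNgt mulr_gt0// subr_gt0.
Qed.

(** The vanishing total mass is what makes the primitive vanish to the right of the support. *)
Lemma antiderivative_bump l r h : l < r -> bump_on l r h -> I1 h = 0 ->
  exists f, bump_on l r f /\ derive1 f = h.
Proof.
move=> lr bh h0; have [sh [p [q [lp qr hp]]]] := bh.
have ih := bump_on_itg bh.
have ch := smooth1_continuous sh.
(* The integration starts strictly to the left of the support, so the primitive is zero before
   it. *)
pose a := Num.min l p - 1.
pose F x := (\int[leb]_(s in [set` `[a, x]]) h s)%R.
have F0 x : x < p -> F x = 0.
  move=> xp; rewrite /F /Rintegral (@eq_integral _ _ _ leb _ (cst 0%E)) ?integral0// => s.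
  rewrite inE /= in_itv /=.
  move=> /andP[_ sx]; congr EFin; apply/eqP; apply: contraT => /hp /andP[ps _].
  by move: xp; rewrite ltNge (le_trans ps sx).
have dF x : is_derive x (1 : R) F (h x).
  have [ax|xa] := ltP a x.
    have i : leb.-integrable `[a, x + 1] (EFin \o h) by exact: (integrableS measurableT) ih.
    have [d1 d2] := continuous_FTC1_closed (ltr_pwDr ltr01 (lexx x)) i ax (ch x).
    by apply: (DeriveDef d1); rewrite -derive1E; exact: d2.
  have xp : x < p.
    by rewrite (le_lt_trans xa)// /a ltrBlDr (le_lt_trans (_ : _ <= p)) ?ge_min ?lexx ?orbT// ltrDl.
  have -> : h x = 0.
    by apply/eqP; apply: contraT => /hp /andP[px _]; move: xp; rewrite ltNge px.
  apply: (@near_eq_is_derive _ _ _ (cst 0)) => //.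
  by near=> y; rewrite F0//; near: y; exact: lt_nbhsl.
exists F; split; last by apply/funext => x; have [] := is_derive1P (dF x).
split; first exact: smooth1_of_derive dF sh.
exists p, q; split => // x Fx.
have px : p <= x by rewrite leNgt; apply: contra_neqN Fx => /F0.
rewrite px /= leNgt; apply: contra_neqN Fx => qx.
rewrite -[RHS]h0 /F Rintegral_mkcond; apply: eq_Rintegral => s _.
rewrite patchE; case: ifPn => //; rewrite notin_setE /= in_itv /= => ns.
apply/esym/eqP; apply: contraT => /hp /andP[ps sq]; exfalso; apply: ns.
rewrite (le_trans sq (ltW qx)) andbT (le_trans _ ps)// /a.
by rewrite lerBlDr (le_trans (_ : _ <= p)) ?ge_min ?lexx ?orbT// lerDl.
Unshelve. all: by end_near. Qed.

End acl.

Section acl_representation.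
Context (R : realType).
Notation leb := (@lebesgue_measure R).
Notation line := (measurableTypeR R).
Notation plane := (measurableTypeR R * measurableTypeR R)%type.
Notation itg1 f := (leb.-integrable setT (EFin \o f)).
Notation I1 := (Rintegral leb setT).
Implicit Types (f g : R -> R) (u v w : R * R -> R) (l r b t x y p q : R).

Lemma bump_on_lin l r f g (k : R) : bump_on l r f -> bump_on l r g ->
  bump_on l r (fun x => f x + k * g x).
Proof.
move=> [sf [p [q [lp qr hf]]]] [sg [p' [q' [lp' qr' hg]]]]; split.
  by move=> n; apply: diffnD => //; apply: diffnM => //; exact: diffn_cst.
exists (Num.min p p'), (Num.max q q'); split.
- by rewrite lt_min lp.
- by rewrite gt_max qr.
- move=> x; rewrite ge_min le_max.
  have [fx|/hf /andP[-> ->]//] := eqVneq (f x) 0.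
  have [gx|/hg /andP[-> ->]] := eqVneq (g x) 0; last by rewrite !orbT.
  by rewrite fx gx mulr0 addr0 eqxx.
Qed.

Lemma snd_itg_box l r b t f : itg1 f ->
  (leb2 R).-integrable (box l r b t) (EFin \o (fun z : R * R => f z.2)).
Proof.
move=> fi; have mB := measurable_box l r b t.
apply: (@eq_itg _ _ _ (leb2 R) (box l r b t) mB (tens (\1_(`]l, r[%classic : set line)) f)).
  by move=> z [hz _]; rewrite /tens indicE mem_set ?mul1r//= in_itv.
apply: (integrableS measurableT) => //.
by apply: integrable_tens => //; exact: integrable_indic_itv.
Qed.

Lemma bounded_mul_itg f g (M : R) : measurable_fun (setT : set line) g ->
  (forall x, `|g x| <= M) -> itg1 f -> itg1 (fun x => f x * g x).
Proof.
move=> mg gM fi; apply: (@le_itg _ _ _ leb _ measurableT _ (fun x => M * `|f x|)).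
- by apply: measurable_funM => //; exact: itg_measurable fi.
- by move=> x _; rewrite normrM mulrC ler_wpM2r.
- by apply: itgZ => //; exact: integrable_norm fi.
Qed.

(** The lemma of du Bois-Reymond in the variable x. Modulo derivatives of bumps every bump is a
    multiple of a fixed [f0] of nonzero mass, so [w] acts on it like its average against [f0]
    divided by the mass, a function [W] of y. *)
Lemma x_independent l r b t w : l < r -> b < t ->
  (leb2 R).-integrable (box l r b t) (EFin \o w) ->
  (forall f g, bump_on l r f -> bump_on b t g ->
    int2 (box l r b t) (fun z => w z * tens (derive1 f) g z) = 0) ->
  exists W, itg1 W /\ {ae leb2 R, forall z, box l r b t z -> w z = W z.2}.
Proof.
move=> lr bt iw h; have mB := measurable_box l r b t.
have [f0 [bf0 m0]] := bump_mass lr.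
set m := I1 f0 in m0.
have /(integrable_cutoff _ mB) iwh := iw.
set wh := cutoff (box l r b t) w in iwh.
have [M hM] := bump_on_bounded bf0.
have mf0 := measurable_continuous (smooth1_continuous bf0.1).
have ik : (leb2 R).-integrable setT (EFin \o (fun z => f0 z.1 * wh z)).
  apply: (ess_bounded_itg measurableT (k := M)) iwh; split.
    by apply: (measurableT_comp mf0); exact: measurable_fst.
  by apply: aeW => z _; exact: hM.
pose W0 y := I1 (fun x => f0 x * wh (x, y)).
have iW0 : itg1 W0 by exact: (integrable_fine measurableT (integrable_fubini_G ik)).
pose W y := m^-1 * W0 y.
have iW : itg1 W by apply: itgZ.
exists W; split => //.
have iW2 := @snd_itg_box l r b t W iW.
suff : {ae leb2 R, forall z, box l r b t z -> w z - W z.2 = 0}.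
  by move/ae_imp1; apply => z /[apply] /eqP; rewrite subr_eq0 => /eqP.
apply: ae_eq0_tests => //; first exact: itgB.
move=> f g bf bg.
have mg := measurable_continuous (smooth1_continuous bg.1).
have [N hN] := bump_on_bounded bg.
(* Subtracting this multiple of [f0] removes the mass of [f]; the result is the derivative of a
   bump, on which [w] vanishes. *)
have bh := bump_on_lin (- (I1 f / m)) bf bf0.
have ifi := bump_on_itg bf; have if0 := bump_on_itg bf0.
have h0 : I1 (fun x => f x + - (I1 f / m) * f0 x) = 0.
  rewrite RintegralD//; last by apply: itgZ.
  by rewrite RintegralZl// mulNr divfK// subrr.
have [F [bF dF]] := antiderivative_bump lr bh h0.
have := h F g bF bg; rewrite dF.
have it1 := itg_mul_tens mB bf bg iw.
have it2 := itg_mul_tens mB bf0 bg iw.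
have it3 := itg_mul_tens mB bf bg iW2.
rewrite /int2 (@eq_RI _ _ _ (leb2 R) (box l r b t) _ (fun z : R * R => w z * tens f g z + (- (I1 f / m)) * (w z * tens f0 g z))); last first.
  by move=> z _; rewrite /tens; ring.
rewrite RintegralD//; last by apply: itgZ.
rewrite RintegralZl// => E.
rewrite (@eq_RI _ _ _ (leb2 R) (box l r b t) _ (fun z : R * R => w z * tens f g z - W z.2 * tens f g z)); last first.
  by move=> z _; ring.
rewrite RintegralB//.
have e3 := int2_tens (fun z : R * R => W z.2) bf bg; rewrite /int2 in e3; rewrite e3.
have -> : Rintegral (leb2 R) setT (fun z => W z.2 * tens f g z) =
    Rintegral (leb2 R) setT (tens f (fun y => W y * g y)).
  by apply: eq_Rintegral => z _; rewrite /tens; ring.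
have iWg : itg1 (fun y => W y * g y) by exact: bounded_mul_itg hN iW.
rewrite Rint_tens//.
have -> : I1 (fun y => W y * g y) = m^-1 * int2 (box l r b t) (fun z => w z * tens f0 g z).
  rewrite (int2_tens w bf0 bg).
  have iT := integrable_tensT bf0 bg iw.
  rewrite (Rint_fubini21 iT) -RintegralZl//; last first.
    exact: (integrable_fine measurableT (integrable_fubini_G iT)).
  apply: (@ae_RI _ _ _ leb setT measurableT).
  - exact: itg_measurable iWg.
  - apply: itg_measurable; apply: itgZ => //.
    exact: (integrable_fine measurableT (integrable_fubini_G iT)).
  - have /ae_imp1 := ae_integrable2 ik; apply => y iy _; rewrite /W -mulrA; congr (_ * _).
    rewrite /W0 mulrC -RintegralZl//; apply: eq_Rintegral => x _; rewrite /tens /=.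
    have [hx|nx] := pselect (l < x < r); last by rewrite (bump_on0 bf0 nx); ring.
    have [hy|ny] := pselect (b < y < t); last by rewrite (bump_on0 bg ny); ring.
    by rewrite /wh cutoffE//; ring.
rewrite -/m; move: E; rewrite /int2; set A := Rintegral _ _ _; set B := Rintegral _ _ _.
by move=> /eqP; rewrite addr_eq0 => /eqP ->; field.
Qed.

(* Absolute continuity on lines: [u] is a primitive in x of its weak
   derivative [v], up to a function of y. *)
Definition acl_rep l r b t u v W v' :=
  [/\ sectionwise_rep l r b t v v', itg1 W &
      {ae leb2 R, forall z, box l r b t z -> u z = W z.2 + primx v' z}].

Lemma acl_rep_exists l r b t u v : l < r -> b < t ->
  square_integrable (leb2 R) (box l r b t) u ->
  square_integrable (leb2 R) (box l r b t) v ->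
  weak_dx l r b t u v -> exists W v', acl_rep l r b t u v W v'.
Proof.
move=> lr bt su sv uv; have mB := measurable_box l r b t.
have [v' gr] := sectionwise_rep_exists sv.
have iu := sqi_itg mB (box_finite l r b t) su.
have ip := primx_itg gr.
have [W [iW hW]] : exists W, itg1 W /\
    {ae leb2 R, forall z, box l r b t z -> u z - primx v' z = W z.2}.
  apply: x_independent => //; first exact: itgB.
  move=> f g bf bg; have bf' := bump_on_derive bf.
  have it1 := itg_mul_tens mB bf' bg iu.
  have it2 := itg_mul_tens mB bf' bg ip.
  rewrite /int2 (@eq_RI _ _ _ (leb2 R) (box l r b t) _
    (fun z : R * R => u z * tens (derive1 f) g z - primx v' z * tens (derive1 f) g z)).
    have := uv f g bf bg; have := weak_dx_primx sv.1 gr bf bg; rewrite /int2 => e1 e2.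
    by rewrite RintegralB// e1 e2 subrr.
  by move=> z _; ring.
exists W, v'; split => //.
by apply: (ae_imp1 hW) => z /[apply] <-; rewrite subrK.
Qed.

(* averaging [g x ^+ 2 <= 2 g s ^+ 2 + 2 (g x - g s) ^+ 2] over a one-sided
   interval of length [delta] at [x] loses only the factor [E] on the weight *)
Lemma primitive_sup_bound l r nu (c delta E : R) (omega : R -> R) x :
  itg1 nu -> itg1 (fun s => nu s ^+ 2) ->
  measurable_fun (setT : set line) omega -> (forall s, l < s < r -> 0 <= omega s) ->
  0 < delta -> 2 * delta <= r - l -> 0 <= E ->
  (forall s q, l < s < r -> l < q < r -> `|s - q| <= delta -> omega s <= E * omega q) ->
  let g := fun x => c + I1 (fun s => (s < x)%R%:R * nu s) in
  measurable_fun (setT : set line) g ->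
  l < x < r ->
  ((delta * (g x ^+ 2 * omega x))%:E <=
   (2 * E)%:E * \int[leb]_(s in `]l, r[) (g s ^+ 2 * omega s)%:E +
   (2 * E * delta ^+ 2)%:E * \int[leb]_(s in `]l, r[) (nu s ^+ 2 * omega s)%:E)%E.
Proof.
move=> inu inu2 mw w0 d0 dl E0 wE g mg /andP[lx xr].
have mnu := itg_measurable inu.
(* Since 2 delta <= r - l, an interval of length [delta] with endpoint [x] fits inside on the right
   or on the left. *)
have [p [q [pq lp qr pxq]]] : exists p q, [/\ q - p = delta, l <= p, q <= r & p <= x <= q].
  have [h|h] := leP (x + delta) r.
    by exists x, (x + delta); split; [ring|exact: ltW|exact: h|rewrite lexx lerDl ltW].
  by exists (x - delta), x; split; [ring|lra|exact: ltW|rewrite lexx andbT; lra].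
have {pxq} /andP[px xq] := pxq.
pose I : set line := `]p, q[%classic.
have mI : measurable I by exact: measurable_itv.
have II : I `<=` (`]l, r[%classic : set line).
  by move=> s; rewrite /I /= !in_itv /= => /andP[h1 h2]; rewrite (le_lt_trans lp h1) (lt_le_trans h2 qr).
have lI : leb I = delta%:E.
  by rewrite /I lebesgue_measure_itv /= lte_fin -EFinB pq ifT// -subr_gt0 pq.
pose K := Rintegral leb I (fun s => nu s ^+ 2).
have iI : leb.-integrable I (EFin \o nu) by exact: (integrableS measurableT) inu.
have iI2 : leb.-integrable I (EFin \o (fun s => nu s ^+ 2)) by exact: (integrableS measurableT) inu2.
have K0 : 0 <= K by apply: Rintegral_ge0 => s _; exact: sqr_ge0.
have inI s : s \in I = (p < s < q) by rewrite /I mem_setE /= in_itv.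
have gxs s : I s -> `|g x - g s| <= Rintegral leb I (fun s => `|nu s|).
  move=> Is; have /andP[ps sq] : p < s < q by move: Is; rewrite /I /= in_itv.
  have il y : itg1 (fun s => (s < y)%R%:R * nu s).
    apply: (@le_itg _ _ _ leb _ measurableT _ (fun s => `|nu s|)).
    - apply: measurable_funM => //.
      exact: (measurableT_comp (@measurable_lt_plane R) (pair1_measurable y)).
    - by move=> k _; rewrite normrM; case: (_ < _)%R; rewrite /= ?normr1 ?mul1r// normr0 mul0r.
    - exact: integrable_norm inu.
  have -> : g x - g s = I1 (fun k => (k < x)%R%:R * nu k - (k < s)%R%:R * nu k).
    by rewrite RintegralB// /g; ring.
  apply: (le_trans (le_normr_Rintegral measurableT (itgB measurableT (il x) (il s)))).
  (* pointwise: the difference of rays is supported in [p, q[ *)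
  have -> : Rintegral leb I (fun s => `|nu s|) = Rintegral leb `[p, q[ (fun s => `|nu s|).
    by rewrite /I Rintegral_itv_obnd_cbnd//; exact: (integrableS measurableT) (integrable_norm inu).
  rewrite [leRHS]Rintegral_mkcond; apply: le_Rintegral => //.
  - exact: integrable_norm (itgB measurableT (il x) (il s)).
  - rewrite -restrict_EFin -integrable_mkcond//.
    exact: (integrableS measurableT) (integrable_norm inu).
  - move=> k _; rewrite patchE -mulrBl normrM; case: ifPn.
      rewrite ler_piMl//; case: (_ < _)%R; case: (_ < _)%R; rewrite /= ?subr0 ?subrr ?sub0r ?normrN ?normr1 ?normr0//.
    rewrite notin_setE /= in_itv /= => /negP; rewrite negb_and -ltNge -leNgt => /orP[kp|qk].
      by rewrite (lt_le_trans kp px) (lt_trans kp ps) subrr normr0 mul0r.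
    by rewrite !ltNge (le_trans xq qk) (le_trans (ltW sq) qk) /= subrr normr0 mul0r.
(* Cauchy-Schwarz against the constant 1 on an interval of length [delta]. *)
have cs : (Rintegral leb I (fun s => `|nu s|)) ^+ 2 <= delta * K.
  have s1 : square_integrable leb I (cst 1 : R -> R).
    split => //; apply: (measurable_bounded_integrable (f := fun s : line => cst 1 s ^+ 2)) => //.
    - by have := ltry delta; rewrite -lI; exact.
    - exact: measurable_funX.
    - by exists 1; split => // M M1 s _ /=; rewrite expr1n normr1 ltW.
  have s2 : square_integrable leb I (fun s => `|nu s|).
    split; first by apply: measurableT_comp => //; apply: measurable_funTS.
    by apply: eq_itg iI2 => // s _; rewrite real_normK ?num_real.
  have /L2le_dot := L2le_norm s1; move=> /(_ mI _ _ (L2le_norm s2)) h.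
  have e1 : Rintegral leb I (fun s => cst 1 s * `|nu s|) = Rintegral leb I (fun s => `|nu s|).
    by apply: eq_Rintegral => s _; rewrite /= mul1r.
  have e2 : Rintegral leb I (fun s : line => (cst 1 s : R) ^+ 2) = delta.
    transitivity (Rintegral leb I (cst 1)); first by apply: eq_Rintegral => s _; rewrite /= expr1n.
    by rewrite Rintegral_cst// mul1r -[RHS]/(fine delta%:E) -lI.
  have e3 : Rintegral leb I (fun s => `|nu s| ^+ 2) = K.
    by apply: eq_Rintegral => s _; rewrite real_normK ?num_real.
  rewrite e1 e2 e3 in h.
  have r0 : 0 <= Rintegral leb I (fun s => `|nu s|) by apply: Rintegral_ge0.
  rewrite ger0_norm// in h.
  rewrite -(@sqr_sqrtr _ (delta * K)) ?mulr_ge0 ?(ltW d0)// sqrtrM ?(ltW d0)//.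
  by rewrite ler_sqr ?nnegrE ?mulr_ge0 ?sqrtr_ge0.
have wx0 : 0 <= omega x by apply: w0; rewrite lx.
have near_x s : I s -> l < s < r /\ `|x - s| <= delta /\ `|s - x| <= delta.
  move=> Is; have := II _ Is; rewrite /= in_itv /= => h; split => //.
  move: Is; rewrite /I /= in_itv /= => /andP[ps sq].
  by rewrite distrC; split; rewrite ler_norml; apply/andP; split; lra.
have lxr : l < x < r by rewrite lx.
have key s : I s -> g x ^+ 2 * omega x <= 2 * E * (g s ^+ 2 * omega s) + 2 * delta * K * omega x.
  move=> Is; have [ls [xs sx]] := near_x s Is.
  have h1 : (g x - g s) ^+ 2 <= delta * K.
    apply: le_trans cs; rewrite -[leLHS]real_normK ?num_real// ler_sqr ?nnegrE ?gxs//.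
    by apply: Rintegral_ge0.
  have h2 : g x ^+ 2 <= 2 * g s ^+ 2 + 2 * (delta * K) by have := sqr_ge0 (g x - 2 * g s); nra.
  have h3 := wE x s lxr ls xs.
  have h4 : g s ^+ 2 * omega x <= g s ^+ 2 * (E * omega s) by rewrite ler_wpM2l ?sqr_ge0.
  have h5 : g x ^+ 2 * omega x <= (2 * g s ^+ 2 + 2 * (delta * K)) * omega x by rewrite ler_wpM2r.
  move: h4 h5; move: (g s ^+ 2) (omega x) (omega s) (g x ^+ 2) => a1 a2 a3 a4 h4 h5; lra.
have mgw : measurable_fun (setT : set line) (fun s => (g s ^+ 2 * omega s)%:E).
  by apply/measurable_EFinP; apply: measurable_funM => //; exact: measurable_funX.
have mnw : measurable_fun (setT : set line) (fun s => (nu s ^+ 2 * omega s)%:E).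
  by apply/measurable_EFinP; apply: measurable_funM => //; exact: measurable_funX.
have step1 : ((delta * (g x ^+ 2 * omega x))%:E <=
    (2 * E)%:E * \int[leb]_(s in I) (g s ^+ 2 * omega s)%:E + (delta * (2 * delta * K * omega x))%:E)%E.
  have -> : ((delta * (g x ^+ 2 * omega x))%:E = \int[leb]_(s in I) (g x ^+ 2 * omega x)%:E)%E.
    by rewrite integral_cst//= lI -EFinM mulrC.
  have -> : ((delta * (2 * delta * K * omega x))%:E = \int[leb]_(s in I) (2 * delta * K * omega x)%:E)%E.
    by rewrite integral_cst//= lI -EFinM mulrC.
  have g0 s : I s -> (0 <= (g s ^+ 2 * omega s)%:E)%E.
    by move=> /near_x [ls _]; rewrite lee_fin mulr_ge0 ?sqr_ge0 ?w0.
  have B0 : 0 <= 2 * delta * K * omega x by rewrite !mulr_ge0// ltW.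
  rewrite -ge0_integralZl//; last 2 first.
  - exact: measurable_funTS.
  - by rewrite lee_fin mulr_ge0.
  rewrite -ge0_integralD//; last 2 first.
  - by move=> s Is; rewrite mule_ge0 ?g0// lee_fin mulr_ge0.
  - by apply: measurable_funTS; apply: measurable_funeM.
  apply: ge0_le_integral => //.
  - by move=> s Is; rewrite lee_fin mulr_ge0 ?sqr_ge0.
  - by apply: measurable_funTS; apply: emeasurable_funD => //; apply: measurable_funeM.
(* The weight at the fixed point [x] is moved under the integral, at the cost of the factor [E], by
   the slow variation of [omega]. *)
have step2 : ((K * omega x)%:E <= E%:E * \int[leb]_(s in I) (nu s ^+ 2 * omega s)%:E)%E.
  rewrite mulrC /K -RintegralZl// /Rintegral fineK; last first.
    by apply: integrable_fin_num => //; exact: itgZ.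
  rewrite -ge0_integralZl//; last 2 first.
  - exact: measurable_funTS.
  - by move=> s /near_x [ls _]; rewrite lee_fin mulr_ge0 ?sqr_ge0 ?w0.
  apply: ge0_le_integral => //.
  - by move=> s _; rewrite lee_fin mulr_ge0 ?sqr_ge0.
  - by apply/measurable_EFinP; apply: measurable_funM => //; apply: measurable_funTS; exact: measurable_funX.
  - by apply: measurable_funTS; apply: measurable_funeM.
  - move=> s Is; have [ls [xs sx]] := near_x s Is.
    rewrite -EFinM lee_fin (mulrC (omega x)) [leRHS]mulrCA ler_wpM2l ?sqr_ge0//; exact: wE.
have sub f : measurable_fun (setT : set line) (fun s => (f s)%:E) -> (forall s, l < s < r -> 0 <= f s) ->
    (\int[leb]_(s in I) (f s)%:E <= \int[leb]_(s in `]l, r[) (f s)%:E)%E.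
  move=> mf f0; apply: ge0_subset_integral => //; exact: measurable_funTS.
apply: (le_trans step1); apply: leeD.
  by apply: lee_wpmul2l; [rewrite lee_fin mulr_ge0|apply: sub => // s h; rewrite mulr_ge0 ?sqr_ge0 ?w0].
have -> : delta * (2 * delta * K * omega x) = (2 * delta ^+ 2) * (K * omega x) by ring.
have -> : 2 * E * delta ^+ 2 = (2 * delta ^+ 2) * E by ring.
rewrite [X in (X <= _)%E]EFinM [X in (_ <= X * _)%E]EFinM -muleA.
apply: lee_wpmul2l; first by rewrite lee_fin mulr_ge0 ?sqr_ge0.
apply: (le_trans step2); apply: lee_wpmul2l; first by rewrite lee_fin.
by apply: sub => // s h; rewrite mulr_ge0 ?sqr_ge0 ?w0.
Qed.

End acl_representation.

(** * Anisotropic bounds *)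

Section anisotropic_bounds.
Context (R : realType).
Notation leb := (@lebesgue_measure R).
Notation line := (measurableTypeR R).
Notation plane := (measurableTypeR R * measurableTypeR R)%type.
Notation itg1 f := (leb.-integrable setT (EFin \o f)).
Notation I1 := (Rintegral leb setT).
Implicit Types (u v w f fx fy fxy ux F : R * R -> R) (l r b t x y p q : R).

(* For [exp (2 lambda x^2)] one may take [delta] of order [1 / lambda] with [E]
   independent of [lambda]; see [gauss_slow]. *)
Record slow_weight l r (delta E k : R) (omega : R -> R) : Prop := SlowWeight {
  sw_meas : measurable_fun (setT : set line) omega;
  sw_bnd : forall s, l < s < r -> 0 <= omega s <= k;
  sw_d0 : 0 < delta;
  sw_dl : 2 * delta <= r - l;
  sw_E0 : 0 <= E;
  sw_slow : forall s q, l < s < r -> l < q < r -> `|s - q| <= delta -> omega s <= E * omega q }.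

Lemma slow_weight1 l r : l < r -> slow_weight l r ((r - l) / 2) 1 1 (fun=> 1).
Proof.
move=> lr; split => //.
- by move=> s _; rewrite ler01 lexx.
- by rewrite divr_gt0// subr_gt0.
- by rewrite mulrC divfK.
- by move=> *; rewrite mulr1.
Qed.

Lemma weight_itg l r b t delta E k omega u : slow_weight l r delta E k omega ->
  square_integrable (leb2 R) (box l r b t) u ->
  (leb2 R).-integrable (box l r b t) (EFin \o (fun z : R * R => u z ^+ 2 * omega z.1)).
Proof.
move=> sw su; have mB := measurable_box l r b t.
apply: (@le_itg _ _ _ (leb2 R) (box l r b t) mB _ (fun z => k * u z ^+ 2)).
- apply: measurable_funM; first by apply: measurable_funX; case: su.
  by apply: measurable_funTS; apply: (measurableT_comp (sw_meas sw)); exact: measurable_fst.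
- move=> z [hz _]; have /andP[w0 wk] := sw_bnd sw hz.
  have p0 : 0 <= u z ^+ 2 * omega z.1 by apply: mulr_ge0 => //; exact: sqr_ge0.
  by rewrite ger0_norm// mulrC ler_wpM2r ?sqr_ge0.
- by apply: itgZ => //; case: su.
Qed.

Lemma measurable_cutoff (D : set plane) u : measurable D -> measurable_fun (setT : set plane) u ->
  measurable_fun (setT : set plane) (cutoff D u).
Proof.
move=> mD mu_; rewrite (_ : cutoff D u = fun z => \1_D z * u z).
  by apply: measurable_funM => //; exact: measurable_indic.
by apply/funext => z; rewrite /cutoff indicE; case: (_ \in _); rewrite ?mul1r ?mul0r.
Qed.

(** A nonnegative representative defined on the whole plane, the form in which Tonelli's theorem
    applies to possibly infinite line integrals. *)
Record zero_extension l r b t u F : Prop := ZeroExtension {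
  ne_meas : measurable_fun (setT : set plane) F;
  ne_ge0 : forall z, 0 <= F z;
  ne_out : forall z, ~ box l r b t z -> F z = 0;
  ne_ae : {ae leb2 R, forall z, box l r b t z -> F z = u z} }.

Lemma zero_extension_integral l r b t u F : zero_extension l r b t u F ->
  (leb2 R).-integrable (box l r b t) (EFin \o u) ->
  (\int[leb2 R]_z (F z)%:E = (int2 (box l r b t) u)%:E)%E.
Proof.
move=> ne iu; have mB := measurable_box l r b t.
rewrite /int2 /Rintegral fineK; last exact: integrable_fin_num.
transitivity (\int[leb2 R]_(z in box l r b t) (F z)%:E)%E.
  rewrite [RHS]integral_mkcond; apply: eq_integral => z _; rewrite patchE.
  by case: ifPn => //; rewrite notin_setE => /(ne_out ne) ->.
apply: ae_eq_integral => //.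
- by apply/measurable_EFinP; apply: measurable_funTS; exact: (ne_meas ne).
- exact: measurable_int iu.
- by apply: (ae_imp1 (ne_ae ne)) => z /[apply] ->.
Qed.

(** [primitive_sup_bound] on each horizontal line, applied to the representation as a primitive. The
    right-hand side depends on y only, since x has been integrated out. *)
Lemma x_sup_bound l r b t delta E k omega u v : l < r -> b < t ->
  slow_weight l r delta E k omega ->
  square_integrable (leb2 R) (box l r b t) u ->
  square_integrable (leb2 R) (box l r b t) v ->
  weak_dx l r b t u v -> exists F1 F2,
  [/\ zero_extension l r b t (fun z => u z ^+ 2 * omega z.1) F1,
      zero_extension l r b t (fun z => v z ^+ 2 * omega z.1) F2 &
      {ae leb2 R, forall z, box l r b t z ->
         ((delta * (u z ^+ 2 * omega z.1))%:E <=
          (2 * E)%:E * \int[leb]_x (F1 (x, z.2))%:E +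
          (2 * E * delta ^+ 2)%:E * \int[leb]_x (F2 (x, z.2))%:E)%E}].
Proof.
move=> lr bt sw su sv uv; have mB := measurable_box l r b t.
have [W [v' [gr iW hW]]] := acl_rep_exists lr bt su sv uv.
pose ut z := W z.2 + primx v' z.
have mut : measurable_fun (setT : set plane) ut.
  apply: measurable_funD; last exact: primx_measurable gr.
  by apply: (measurableT_comp (itg_measurable iW)); exact: measurable_snd.
have mw : measurable_fun (setT : set plane) (fun z : plane => omega z.1).
  by apply: (measurableT_comp (sw_meas sw)); exact: measurable_fst.
exists (cutoff (box l r b t) (fun z => ut z ^+ 2 * omega z.1)),
       (cutoff (box l r b t) (fun z => v' z ^+ 2 * omega z.1)).
have ne w w' : measurable_fun (setT : set plane) w' ->
    {ae leb2 R, forall z, box l r b t z -> w z = w' z} ->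
    zero_extension l r b t (fun z => w z ^+ 2 * omega z.1) (cutoff (box l r b t) (fun z => w' z ^+ 2 * omega z.1)).
  move=> mw' aw; split.
  - apply: measurable_cutoff => //; apply: measurable_funM => //; exact: measurable_funX.
  - move=> z; rewrite /cutoff; case: ifPn => //; rewrite in_setE => -[hz _].
    by have /andP[w0 _] := sw_bnd sw hz; rewrite mulr_ge0 ?sqr_ge0.
  - by move=> z nz; rewrite cutoff0.
  - by apply: (ae_imp1 aw) => z h Bz; rewrite cutoffE// h.
split; [exact: ne|by apply: ne (gr_meas gr) (gr_ae gr)|].
apply: (ae_imp1 hW) => -[x y] h Bz; rewrite h//.
have /= [hx hy] := Bz.
have := @primitive_sup_bound R l r (fun s => v' (s, y)) (W y) delta E omega x
  (gr_itg gr y) (gr_sqr gr y) (sw_meas sw) _ (sw_d0 sw) (sw_dl sw) (sw_E0 sw) (sw_slow sw) _ hx.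
have a1 s : l < s < r -> 0 <= omega s by move=> /(sw_bnd sw) /andP[].
have a2 : measurable_fun (setT : set line) (fun x => W y + I1 (fun s => (s < x)%R%:R * v' (s, y))).
  exact: (measurableT_comp mut (pair2_measurable y)).
move=> /(_ a1 a2) /=.
have e (F : R * R -> R) : (\int[leb]_(s in `]l, r[) (F (s, y))%:E =
    \int[leb]_s (cutoff (box l r b t) F (s, y))%:E)%E.
  rewrite integral_mkcond; apply: eq_integral => s _; rewrite patchE /cutoff.
  have -> : ((s, y) \in box l r b t) = (s \in (`]l, r[%classic : set R)); last by case: ifP.
  by apply/idP/idP; rewrite !in_setE /box /= in_itv /=; [case|move=> hs; split].
by rewrite -(e (fun z => ut z ^+ 2 * omega z.1)) -(e (fun z => v' z ^+ 2 * omega z.1)).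
Qed.

Lemma zero_extension_section l r b t u F : zero_extension l r b t u F ->
  measurable_fun (setT : set line) (fun y => \int[leb]_x (F (x, y))%:E)%E.
Proof.
move=> ne; apply: (@measurable_fun_fubini_tonelli_G _ _ _ _ _ leb (EFin \o F)).
- by apply/measurable_EFinP; exact: (ne_meas ne).
- by move=> z; rewrite lee_fin (ne_ge0 ne).
Qed.

Lemma zero_extension_fubini l r b t u F : zero_extension l r b t u F ->
  (\int[leb]_y \int[leb]_x (F (x, y))%:E = \int[leb2 R]_z (F z)%:E)%E.
Proof.
move=> ne; apply/esym.
apply: (@fubini_tonelli2 _ _ _ _ _ leb leb (EFin \o F)).
- by apply/measurable_EFinP; exact: (ne_meas ne).
- by move=> z; rewrite lee_fin (ne_ge0 ne).
Qed.

(** [Th] is a measurable majorant that plays the role of the weighted essential supremum over x, as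
    a function of y; its integral is the square of a mixed norm. *)
Lemma x_sup_majorant l r b t delta E k omega u v : l < r -> b < t ->
  slow_weight l r delta E k omega ->
  square_integrable (leb2 R) (box l r b t) u ->
  square_integrable (leb2 R) (box l r b t) v ->
  weak_dx l r b t u v -> exists Th : R -> \bar R,
  [/\ measurable_fun (setT : set line) Th, forall y, (0 <= Th y)%E,
      {ae leb2 R, forall z, box l r b t z ->
         ((delta * (u z ^+ 2 * omega z.1))%:E <= Th z.2)%E} &
      (\int[leb]_y Th y = (2 * E * int2 (box l r b t) (fun z => u z ^+ 2 * omega z.1) +
        2 * E * delta ^+ 2 * int2 (box l r b t) (fun z => v z ^+ 2 * omega z.1))%:E)%E].
Proof.
move=> lr bt sw su sv uv.
have [F1 [F2 [n1 n2 h]]] := x_sup_bound lr bt sw su sv uv.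
have d0 := sw_d0 sw; have E0 := sw_E0 sw.
have p1 : (0 <= (2 * E)%:E)%E by rewrite lee_fin mulr_ge0.
have p2 : (0 <= (2 * E * delta ^+ 2)%:E)%E by rewrite lee_fin !mulr_ge0 ?sqr_ge0 ?(ltW d0).
have q1 y : (0 <= \int[leb]_x (F1 (x, y))%:E)%E.
  by apply: integral_ge0 => x _; rewrite lee_fin (ne_ge0 n1).
have q2 y : (0 <= \int[leb]_x (F2 (x, y))%:E)%E.
  by apply: integral_ge0 => x _; rewrite lee_fin (ne_ge0 n2).
exists (fun y => (2 * E)%:E * \int[leb]_x (F1 (x, y))%:E +
                 (2 * E * delta ^+ 2)%:E * \int[leb]_x (F2 (x, y))%:E)%E; split => //.
- apply: emeasurable_funD; apply: measurable_funeM; [exact: zero_extension_section n1|exact: zero_extension_section n2].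
- by move=> y; rewrite adde_ge0// mule_ge0.
- rewrite ge0_integralD//.
  + rewrite ge0_integralZl//; last exact: zero_extension_section n1.
    rewrite ge0_integralZl//; last exact: zero_extension_section n2.
    rewrite (zero_extension_fubini n1) (zero_extension_fubini n2).
    rewrite (zero_extension_integral n1 (weight_itg sw su)) (zero_extension_integral n2 (weight_itg sw sv)).
    by rewrite -!EFinM -EFinD.
  + by move=> y _; rewrite mule_ge0.
  + apply: measurable_funeM; exact: zero_extension_section n1.
  + by move=> y _; rewrite mule_ge0.
  + apply: measurable_funeM; exact: zero_extension_section n2.
Qed.

Lemma ae_flip (P : R * R -> Prop) : {ae leb2 R, forall z, P z} ->
  {ae leb2 R, forall z : R * R, P (z.2, z.1)}.
Proof.
move=> [N [mN N0 sN]].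
pose N' : set plane := (fun z : plane => (z.2, z.1)) @^-1` N.
have mN' : measurable N'.
  by rewrite -[N']setTI; exact: measurable_swap.
exists N'; split => //; last by move=> z nP; exact: sN.
have i0 : (leb2 R).-integrable setT (EFin \o \1_N).
  apply/integrableP; split; first by apply/measurable_EFinP; exact: measurable_indic.
  rewrite (@eq_integral _ _ _ (leb2 R) _ (fun z => (\1_N z)%:E)).
    rewrite integral_indic// setIT; apply: le_lt_trans (ltry 0).
    by rewrite le_eqVlt; apply/orP; left; apply/eqP; exact: N0.
  by move=> z _; rewrite /= ger0_norm// indicE; case: (_ \in _).
have e0 : (\int[leb2 R]_z (\1_N z)%:E = 0)%E by rewrite integral_indic// setIT; exact: N0.
have := integral_swap i0; rewrite /= e0 => <-.
transitivity (\int[leb2 R]_z (\1_N' z)%:E)%E; first by rewrite integral_indic// setIT.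
by apply: eq_integral => z _; rewrite !indicE.
Qed.

Lemma weak_dy_flip l r b t u v : (leb2 R).-integrable (box l r b t) (EFin \o u) ->
  (leb2 R).-integrable (box l r b t) (EFin \o v) ->
  weak_dy l r b t u v -> weak_dx b t l r (flip u) (flip v).
Proof.
move=> iu iv uv h g bf bg; have mB := measurable_box l r b t.
have e (w : R * R -> R) (f' g' : R -> R) : (fun z => flip w z * tens f' g' z) =
    flip (fun z => w z * tens g' f' z).
  by apply/funext => z; rewrite /flip /tens /=; ring.
rewrite !e !int2_flip; first exact: uv.
- exact: itg_mul_tens mB bg bf iv.
- exact: itg_mul_tens mB bg (bump_on_derive bf) iu.
Qed.

Lemma y_sup_majorant l r b t u v : l < r -> b < t ->
  square_integrable (leb2 R) (box l r b t) u ->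
  square_integrable (leb2 R) (box l r b t) v ->
  weak_dy l r b t u v -> exists Th : R -> \bar R,
  [/\ measurable_fun (setT : set line) Th, forall y, (0 <= Th y)%E,
      {ae leb2 R, forall z, box l r b t z ->
         (((t - b) / 2 * u z ^+ 2)%:E <= Th z.1)%E} &
      (\int[leb]_y Th y = (2 * int2 (box l r b t) (fun z => u z ^+ 2) +
        2 * ((t - b) / 2) ^+ 2 * int2 (box l r b t) (fun z => v z ^+ 2))%:E)%E].
Proof.
move=> lr bt su sv uv; have mB := measurable_box l r b t.
have fB := box_finite l r b t.
have uv' := weak_dy_flip (sqi_itg mB fB su) (sqi_itg mB fB sv) uv.
have [Th [m0 p0 h hi]] := x_sup_majorant bt lr (slow_weight1 bt) (sqi_flip su) (sqi_flip sv) uv'.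
exists Th; split => //.
- apply: (ae_imp1 (ae_flip h)) => z hz [h1 h2].
  have := hz (conj h2 h1); rewrite mulr1 /flip /=.
  by case: z {hz h1 h2}.
- rewrite hi !mulr1; congr (_ + _)%:E.
    rewrite -(@int2_flip R l r b t); last by case: su.
    by congr (_ * _); apply: eq_Rintegral => z _; rewrite mulr1.
  rewrite -(@int2_flip R l r b t); last by case: sv.
  by congr (_ * _); apply: eq_Rintegral => z _; rewrite mulr1.
Qed.

(* [f ^+ 2] is dominated by a function of x alone and [u ^+ 2 * omega] by a
   function of y alone, so the integral of the product splits.  This replaces
   the L^infty bound that second derivatives of H^3 functions do not have. *)
Lemma product_bound l r b t delta E k omega f fy u ux : l < r -> b < t ->
  slow_weight l r delta E k omega ->
  square_integrable (leb2 R) (box l r b t) f ->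
  square_integrable (leb2 R) (box l r b t) fy ->
  square_integrable (leb2 R) (box l r b t) u ->
  square_integrable (leb2 R) (box l r b t) ux ->
  weak_dy l r b t f fy -> weak_dx l r b t u ux ->
  (leb2 R).-integrable (box l r b t) (EFin \o (fun z : R * R => f z ^+ 2 * (u z ^+ 2 * omega z.1))) /\
  (t - b) / 2 * delta * int2 (box l r b t) (fun z => f z ^+ 2 * (u z ^+ 2 * omega z.1)) <=
  (2 * int2 (box l r b t) (fun z => f z ^+ 2) +
     2 * ((t - b) / 2) ^+ 2 * int2 (box l r b t) (fun z => fy z ^+ 2)) *
  (2 * E * int2 (box l r b t) (fun z => u z ^+ 2 * omega z.1) +
     2 * E * delta ^+ 2 * int2 (box l r b t) (fun z => ux z ^+ 2 * omega z.1)).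
Proof.
move=> lr bt sw sf sfy su sux ffy uux; have mB := measurable_box l r b t.
have [Ph [mPh Ph0 hPh iPh]] := y_sup_majorant lr bt sf sfy ffy.
have [Th [mTh Th0 hTh iTh]] := x_sup_majorant lr bt sw su sux uux.
move: iPh iTh; set A := (X in (_ = X%:E)%E -> _); set B := (X in _ -> (_ = X%:E)%E -> _) => iPh iTh.
set d := (t - b) / 2 in A iPh hPh *; have d0 : 0 < d by rewrite divr_gt0// subr_gt0.
have dl0 := sw_d0 sw.
set G := fun z : R * R => f z ^+ 2 * (u z ^+ 2 * omega z.1).
have mG : measurable_fun (box l r b t : set plane) G.
  apply: measurable_funM; first by apply: measurable_funX; case: sf.
  apply: measurable_funM; first by apply: measurable_funX; case: su.
  by apply: measurable_funTS; apply: (measurableT_comp (sw_meas sw)); exact: measurable_fst.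
have G0 z : box l r b t z -> 0 <= G z.
  by move=> [/(sw_bnd sw) /andP[w0 _] _]; rewrite /G; nneg.
have key : (\int[leb2 R]_(z in box l r b t) (d * delta * G z)%:E <= (A * B)%:E)%E.
  have mP1 : measurable_fun (setT : set plane) (fun z => Ph z.1).
    by apply: (measurableT_comp mPh); exact: measurable_fst.
  have mT2 : measurable_fun (setT : set plane) (fun z => Th z.2).
    by apply: (measurableT_comp mTh); exact: measurable_snd.
  have mPT : measurable_fun (setT : set plane) (fun z => Ph z.1 * Th z.2)%E.
    exact: emeasurable_funM.
  apply: (@le_trans _ _ (\int[leb2 R]_(z in box l r b t) (Ph z.1 * Th z.2))%E).
    apply: ae_ge0_le_integral => //.
    - by move=> z Bz; have := G0 z Bz; move: (G z) => Gz G0z; nneg.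
    - by apply/measurable_EFinP; apply: measurable_funM.
    - by move=> z _; rewrite mule_ge0.
    - exact: measurable_funTS.
    - apply: (ae_imp2 hPh hTh) => z hp ht Bz.
      have := lee_pmul _ _ (hp Bz) (ht Bz); rewrite -EFinM => h.
      apply: le_trans (h _ _).
      + by rewrite lee_fin le_eqVlt; apply/orP; left; apply/eqP; rewrite /G; ring.
      + by nneg.
      + have /andP[w0 _] := sw_bnd sw Bz.1.
        by nneg.
  apply: (@le_trans _ _ (\int[leb2 R]_z (Ph z.1 * Th z.2))%E).
    by apply: ge0_subset_integral => // z _; rewrite mule_ge0.
  rewrite fubini_tonelli1//; last by move=> z; rewrite mule_ge0.
  rewrite /fubini_F /=.
  under eq_integral do rewrite ge0_integralZl// iTh.
  have B0 : (0 <= B%:E)%E by rewrite -iTh integral_ge0.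
  by rewrite ge0_integralZr// iPh -EFinM.
have iG : (leb2 R).-integrable (box l r b t) (EFin \o (fun z => d * delta * G z)).
  apply/integrableP; split; first by apply/measurable_EFinP; exact: measurable_funM.
  apply: le_lt_trans (ltry (A * B)); apply: le_trans key.
  rewrite le_eqVlt; apply/orP; left; apply/eqP; apply: eq_integral => z; rewrite inE => Bz.
  have G0z := G0 _ Bz; rewrite /= ger0_norm//; move: (G z) G0z => Gz G0z; nneg.
have iG' : (leb2 R).-integrable (box l r b t) (EFin \o G).
  apply: (eq_itg mB _ (itgZ mB (d * delta)^-1 iG)) => z _.
  by rewrite mulrA mulVf ?mul1r// gt_eqF// mulr_gt0.
split => //.
rewrite -RintegralZl// -lee_fin /Rintegral fineK//; exact: integrable_fin_num.
Qed.

(** An embedding into bounded functions in which the only second derivative is the mixed one. On a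
    vertical line, f^2 is controlled by the y-integrals of f^2 and f_y^2; both integrals are bounded
    uniformly in x by the horizontal majorants of f and f_y, which involve f_x and f_xy. *)
Lemma ess_bound_of_mixed l r b t f fx fy fxy (c : R) : l < r -> b < t ->
  L2le (leb2 R) (box l r b t) f c -> L2le (leb2 R) (box l r b t) fx c ->
  L2le (leb2 R) (box l r b t) fy c -> L2le (leb2 R) (box l r b t) fxy c ->
  weak_dx l r b t f fx -> weak_dy l r b t f fy -> weak_dx l r b t fy fxy ->
  {ae leb2 R, forall z, box l r b t z -> (r - l) / 2 * ((t - b) / 2) * f z ^+ 2 <=
     4 * (1 + ((r - l) / 2) ^+ 2) * (1 + ((t - b) / 2) ^+ 2) * c ^+ 2}.
Proof.
move=> lr bt [sf c0 lf] [sfx _ lfx] [sfy _ lfy] [sfxy _ lfxy] dfx dfy dfxy.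
have mB := measurable_box l r b t; have fB := box_finite l r b t.
set dx := (r - l) / 2; set dy := (t - b) / 2.
have dx0 : 0 < dx by rewrite divr_gt0// subr_gt0.
have dy0 : 0 < dy by rewrite divr_gt0// subr_gt0.
have dfy' := weak_dy_flip (sqi_itg mB fB sf) (sqi_itg mB fB sfy) dfy.
have [F1 [F2 [n1 n2 h]]] := x_sup_bound bt lr (slow_weight1 bt) (sqi_flip sf) (sqi_flip sfy) dfy'.
have [T1 [mT1 T10 hT1 iT1]] := x_sup_majorant lr bt (slow_weight1 lr) sf sfx dfx.
have [T2 [mT2 T20 hT2 iT2]] := x_sup_majorant lr bt (slow_weight1 lr) sfy sfxy dfxy.
pose M := 2 * (1 + dx ^+ 2) * c ^+ 2.
have M0 : 0 <= M by rewrite !mulr_ge0 ?sqr_ge0// addr_ge0 ?sqr_ge0.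
have bnd w wx (T : R -> \bar R) : int2 (box l r b t) (fun z => w z ^+ 2) <= c ^+ 2 ->
    int2 (box l r b t) (fun z => wx z ^+ 2) <= c ^+ 2 ->
    (\int[leb]_y T y = (2 * 1 * int2 (box l r b t) (fun z => w z ^+ 2 * 1) +
        2 * 1 * dx ^+ 2 * int2 (box l r b t) (fun z => wx z ^+ 2 * 1))%:E)%E ->
    (\int[leb]_y T y <= M%:E)%E.
  move=> h1 h2 ->; rewrite lee_fin /int2.
  under eq_Rintegral do rewrite mulr1.
  under [X in _ + _ * X]eq_Rintegral do rewrite mulr1.
  have := ler_wpM2l (sqr_ge0 dx) h2; rewrite /M /int2 in h1 *; nra.
have b1 := bnd _ _ _ lf lfx iT1; have b2 := bnd _ _ _ lfy lfxy iT2.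
(* on almost every vertical line the y-integral of [F] is at most [M / dx] *)
have line_bound w (T : R -> \bar R) F : (forall y, (0 <= T y)%E) ->
    measurable_fun (setT : set line) T -> (\int[leb]_y T y <= M%:E)%E ->
    {ae leb2 R, forall z, box l r b t z -> ((dx * (w z ^+ 2 * 1))%:E <= T z.2)%E} ->
    zero_extension b t l r (fun z => flip w z ^+ 2 * 1) F ->
    {ae leb, forall x, (dx%:E * \int[leb]_y (F (y, x))%:E <= M%:E)%E}.
  move=> T0 mT iT hT ne.
  have a : {ae leb2 R, forall z : R * R, ((dx * F (z.2, z.1))%:E <= T z.2)%E}.
    apply: (ae_imp2 hT (ae_flip (ne_ae ne))) => -[x y] /= h1 h2.
    have [Bz|nz] := pselect (box l r b t (x, y)).
      by rewrite h2; [exact: h1|case: Bz => ? ?; split].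
    rewrite (ne_out ne) ?mulr0 ?T0// => -[? ?]; apply: nz; split => //.
  apply: (ae_imp1 (ae_section1 a)) => x hx.
  have mF : measurable_fun (setT : set line) (fun y => (F (y, x))%:E).
    apply/measurable_EFinP; exact: (measurableT_comp (ne_meas ne) (pair2_measurable x)).
  rewrite -ge0_integralZl//; last 2 first.
  - by move=> y _; rewrite lee_fin (ne_ge0 ne).
  - by rewrite lee_fin ltW.
  apply: le_trans iT; apply: ae_ge0_le_integral => //.
  - by move=> y _; rewrite mule_ge0// lee_fin ?(ne_ge0 ne)// ltW.
  - exact: measurable_funeM.
  - by apply: (ae_imp1 hx) => y; rewrite EFinM.
have l1 := line_bound _ _ _ T10 mT1 b1 hT1 n1.
have l2 := line_bound _ _ _ T20 mT2 b2 hT2 n2.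
apply: (ae_imp3 (ae_flip h) (ae_fst l1) (ae_fst l2)) => -[x y] /= hz h1 h2 [hx hy].
have := hz (conj hy hx); rewrite /flip /= !mulr1 -/dy => h3.
have h5 : ((dx * (dy * f (x, y) ^+ 2))%:E <=
    2%:E * (dx%:E * \int[leb]_x1 (F1 (x1, x))%:E) +
    (2 * dy ^+ 2)%:E * (dx%:E * \int[leb]_x1 (F2 (x1, x))%:E))%E.
  have p1 : (0 <= \int[leb]_x1 (F1 (x1, x))%:E)%E.
    by apply: integral_ge0 => s _; rewrite lee_fin (ne_ge0 n1).
  have p2 : (0 <= \int[leb]_x1 (F2 (x1, x))%:E)%E.
    by apply: integral_ge0 => s _; rewrite lee_fin (ne_ge0 n2).
  rewrite muleCA [X in (_ <= _ + X)%E]muleCA -ge0_muleDr; last 2 first.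
  - by rewrite mule_ge0.
  - by rewrite mule_ge0// lee_fin mulr_ge0 ?sqr_ge0.
  by rewrite EFinM lee_wpmul2l// lee_fin ltW.
have h4 : (2%:E * (dx%:E * \int[leb]_x1 (F1 (x1, x))%:E) +
    (2 * dy ^+ 2)%:E * (dx%:E * \int[leb]_x1 (F2 (x1, x))%:E) <=
    2%:E * M%:E + (2 * dy ^+ 2)%:E * M%:E)%E.
  by apply: leeD; apply: lee_wpmul2l => //; nneg.
have := le_trans h5 h4; rewrite -!EFinM -EFinD lee_fin mulrA => /le_trans; apply.
by rewrite /M; lra.
Qed.

End anisotropic_bounds.

(** * Test functions and their derivatives *)

Section test_functions.
Context (R : realType).
Implicit Types (u v w f g : R * R -> R) (l r b t x y : R).

Lemma partial_word i j f : partial i j f =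
  foldr (fun e => if e then @partial2 R else @partial1 R) f (nseq i false ++ nseq j true).
Proof.
rewrite /partial foldr_cat; have -> : foldr (fun e => if e then @partial2 R else @partial1 R) f
  (nseq j true) = iter j (@partial2 R) f by elim: j => //= j ->.
by elim: i => //= i ->.
Qed.

Lemma smooth_partial i j f : smooth f -> smooth (partial i j f).
Proof. by move=> sf w /=; rewrite partial_word -foldr_cat; exact: sf. Qed.

Lemma smooth_continuous f : smooth f -> continuous f.
Proof. by move=> sf; have [] := sf [::]. Qed.

Lemma smooth_derivable1 f x y : smooth f -> derivable (fun s => f (s, y)) x 1.
Proof. by move=> sf; exact: ((sf [::]).2 (x, y)).1. Qed.

Lemma smooth_derivable2 f x y : smooth f -> derivable (fun s => f (x, s)) y 1.
Proof. by move=> sf; exact: ((sf [::]).2 (x, y)).2. Qed.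

Lemma partial1_out (K : set (R * R)) f : closed K -> (forall p, ~ K p -> f p = 0) ->
  forall p, ~ K p -> partial1 f p = 0.
Proof.
move=> cK f0 [x y] nK; rewrite /partial1 /=.
suff : is_derive x (1 : R) (fun s => f (s, y)) 0 by move=> /is_derive1P [].
apply: (@near_eq_is_derive _ _ _ (cst 0)) => //.
have oK : open (~` K) by rewrite openC.
have : nbhs (x, y) (~` K) by apply: open_nbhs_nbhs; split.
move=> [[A B] /= [nA nB] AB]; near=> s; rewrite f0//; apply: AB; split => /=.
  by near: s.
exact: nbhs_singleton.
Unshelve. all: by end_near. Qed.

Lemma partial2_out (K : set (R * R)) f : closed K -> (forall p, ~ K p -> f p = 0) ->
  forall p, ~ K p -> partial2 f p = 0.
Proof.
move=> cK f0 [x y] nK; rewrite /partial2 /=.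
suff : is_derive y (1 : R) (fun s => f (x, s)) 0 by move=> /is_derive1P [].
apply: (@near_eq_is_derive _ _ _ (cst 0)) => //.
have oK : open (~` K) by rewrite openC.
have : nbhs (x, y) (~` K) by apply: open_nbhs_nbhs; split.
move=> [[A B] /= [nA nB] AB]; near=> s; rewrite f0//; apply: AB; split => /=.
  exact: nbhs_singleton.
by near: s.
Unshelve. all: by end_near. Qed.

Lemma test_partial (D : set (R * R)) i j f : test_function D f -> test_function D (partial i j f).
Proof.
move=> [sf [K [cK KD f0]]]; split; first exact: smooth_partial.
exists K; split => //.
have clK : closed K by apply: compact_closed => //; exact: Rhausdorff2.
rewrite /partial; elim: i => [|i IH] /=; last exact: partial1_out.
by elim: j => [|j IH] //=; exact: partial2_out.
Qed.

Lemma continuous_bounded_box l r b t u : continuous u ->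
  exists2 M, 0 <= M & forall z, box l r b t z -> `|u z| <= M.
Proof.
move=> cu.
have c : compact (u @` (`[l, r]%classic `*` `[b, t]%classic)).
  apply: continuous_compact; last by apply: compact_setX; exact: segment_compact.
  by apply: continuous_subspaceT.
have [M [_ hM]] := compact_bounded c.
exists (Num.max (M + 1) 0); first by rewrite le_max lexx orbT.
move=> [x y] [/= /andP[h1 h2] /andP[h3 h4]]; rewrite le_max (hM (M + 1)) ?ltrDl//.
by exists (x, y) => //=; rewrite !in_itv /= !ltW.
Qed.

End test_functions.

(** * Integrals over a planar domain *)

Section planar_integral.
Context (R : realType).
Notation plane := (measurableTypeR R * measurableTypeR R)%type.
Variables (D : set (R * R)) (mD : measurable (D : set plane)).
Notation itg u := ((leb2 R).-integrable D (EFin \o u)).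
Implicit Types (u v w f g : R * R -> R) (k : R).

Lemma eq_int2 u v : (forall p, D p -> u p = v p) -> int2 D u = int2 D v.
Proof. by move=> uv; apply: eq_Rintegral => p; rewrite inE; exact: uv. Qed.

Lemma int2D u v : itg u -> itg v -> int2 D (fun p => u p + v p) = int2 D u + int2 D v.
Proof. by move=> iu iv; rewrite /int2 RintegralD. Qed.

Lemma int2B u v : itg u -> itg v -> int2 D (fun p => u p - v p) = int2 D u - int2 D v.
Proof. by move=> iu iv; rewrite /int2 RintegralB. Qed.

Lemma int2Z k u : itg u -> int2 D (fun p => k * u p) = k * int2 D u.
Proof. by move=> iu; rewrite /int2 RintegralZl. Qed.

Lemma int2_ge0 u : (forall p, D p -> 0 <= u p) -> 0 <= int2 D u.
Proof. by move=> u0; apply: Rintegral_ge0. Qed.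

Lemma le_int2 u v : itg u -> itg v -> {ae leb2 R, forall p, D p -> u p <= v p} ->
  int2 D u <= int2 D v.
Proof. exact: le_RI. Qed.

Lemma ae_int2 u v : measurable_fun (D : set plane) u -> measurable_fun (D : set plane) v ->
  {ae leb2 R, forall p, D p -> u p = v p} -> int2 D u = int2 D v.
Proof. exact: ae_RI. Qed.

End planar_integral.

(** * Sobolev spaces *)

Section weak_derivatives.
Context (R : realType) (l r b t : R).
Hypotheses (lr : l < r) (bt : b < t).
Notation plane := (measurableTypeR R * measurableTypeR R)%type.
Notation D := (box l r b t).
Notation sqi := (square_integrable (leb2 R) D).
Notation L2wd := (L2_weak_derivative D).
Implicit Types (u v w f g : R * R -> R) (k : R).

Let mD : measurable (D : set plane) := measurable_box l r b t.

(** This one operation yields sums (k = 1), differences (k = -1) and multiples, since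
    [lin (k - 1) u u] is k u; one linearity lemma per notion then suffices. *)
Definition lin k u v : R * R -> R := fun p => u p + k * v p.

Let sgn_neq0 n : (-1) ^+ n != 0 :> R.
Proof. by rewrite expf_neq0// oppr_eq0 oner_eq0. Qed.

Lemma continuous_ess_bounded u : continuous u -> exists2 M, 0 <= M & ess_bounded (leb2 R) D u M.
Proof.
move=> cu; have [M M0 h] := @continuous_bounded_box R l r b t u cu.
exists M => //; split; last exact: aeW.
exact: measurable_funS (continuous_measurable2 cu).
Qed.

Lemma sqi_cst k : sqi (fun=> k).
Proof.
split; first exact: measurable_cst.
apply/integrableP; split; first exact: measurable_cst.
rewrite (eq_integral (cst (`|k ^+ 2|)%:E)); last by [].
rewrite integral_cst//; apply: lte_mul_pinfty => //; last exact: box_finite.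
Qed.

Lemma continuous_sqi u : continuous u -> sqi u.
Proof.
move=> cu; have [M M0 h] := continuous_ess_bounded cu.
apply: (@eq_sqi _ _ _ (leb2 R) D mD (fun x => u x * 1)); first by move=> x _; rewrite mulr1.
exact: ess_bounded_sqi h (sqi_cst 1).
Qed.

Lemma test_sqi i j f : test_function D f -> sqi (partial i j f).
Proof. by move=> /(@test_partial _ _ i j) [sf _]; exact/continuous_sqi/smooth_continuous. Qed.

Lemma test_itg i j u f : sqi u -> test_function D f ->
  (leb2 R).-integrable D (EFin \o (fun p => u p * partial i j f p)).
Proof. by move=> su tf; apply: sqi_itgM => //; exact: test_sqi. Qed.

Lemma ae_weak_derivative i j u u' v : measurable_fun (D : set plane) u ->
  measurable_fun (D : set plane) u' -> {ae leb2 R, forall z, D z -> u z = u' z} ->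
  weak_derivative D i j u v -> weak_derivative D i j u' v.
Proof.
move=> mu mu' uu' h f tf; rewrite -h//; apply: ae_RI => //.
- by apply: measurable_funM => //; have [] := test_sqi i j tf.
- by apply: measurable_funM => //; have [] := test_sqi i j tf.
- by apply: ae_imp1 uu' _ => z zz Dz; rewrite zz.
Qed.

(** Functions equal almost everywhere have the same set of weak derivatives, and [Dw] chooses from
    that set; hence the two choices are equal, and not merely almost everywhere. *)
Lemma ae_Dw i j u u' : measurable_fun (D : set plane) u ->
  measurable_fun (D : set plane) u' -> {ae leb2 R, forall z, D z -> u z = u' z} ->
  Dw D i j u = Dw D i j u'.
Proof.
move=> mu mu' uu'; rewrite /Dw; congr xget; apply/seteqP; split => v [sv wv]; split => //.
  exact: ae_weak_derivative wv.
by apply: ae_weak_derivative wv => //; apply: ae_imp1 uu' _ => z zz Dz; rewrite zz.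
Qed.

Lemma weak_derivative_unique i j u v v' : L2wd i j u v -> L2wd i j u v' ->
  {ae leb2 R, forall z, D z -> v z = v' z}.
Proof.
move=> [sv wv] [sv' wv'].
have itgB' : (leb2 R).-integrable D (EFin \o (fun z => v z - v' z)).
  apply: itgB => //; apply: sqi_itg => //; exact: box_finite.
have := @ae_eq0_tests R l r b t (fun z => v z - v' z) lr bt itgB'.
move=> H; apply: ae_imp1 (H _) _ => [f g bf bg|z /[apply] /eqP]; last by rewrite subr_eq0 => /eqP.
have tt := tens_test_function bf bg.
have := wv _ tt; rewrite wv'// => e.
rewrite (@eq_int2 _ _ _ (fun z => v z * tens f g z - v' z * tens f g z)); last first.
  by move=> z _; rewrite mulrBl.
rewrite int2B//; [|exact: (@test_itg 0 0)..].
by move/(mulfI (sgn_neq0 _))/eqP : e; rewrite eq_sym -subr_eq0 => /eqP.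
Qed.

Lemma L2wd_lin i j k u v u' v' : sqi u -> sqi u' -> L2wd i j u v -> L2wd i j u' v' ->
  L2wd i j (lin k u u') (lin k v v').
Proof.
move=> su su' [sv wv] [sv' wv']; split; first by apply: sqiD => //; exact: sqiZ.
move=> f tf.
rewrite (@eq_int2 _ _ _ (fun z => u z * partial i j f z + k * (u' z * partial i j f z)));
  last by move=> z _; rewrite /lin; ring.
rewrite int2D//; [|exact: test_itg|by apply: itgZ => //; exact: test_itg].
rewrite int2Z//; last exact: test_itg.
rewrite wv// wv'//.
rewrite (@eq_int2 _ _ (fun z => lin _ _ _ z * _) (fun z => v z * f z + k * (v' z * f z)));
  last by move=> z _; rewrite /lin; ring.
rewrite int2D//; [|exact: (@test_itg 0 0)|by apply: itgZ => //; exact: (@test_itg 0 0)].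
rewrite int2Z//; last exact: (@test_itg 0 0).
ring.
Qed.

Lemma DwP i j u : (exists v, L2wd i j u v) -> L2wd i j u (Dw D i j u).
Proof. by move=> [v hv]; apply: (@xgetPex _ _ [set v | L2wd i j u v]); exists v. Qed.

Lemma DwE i j u v : L2wd i j u v -> {ae leb2 R, forall z, D z -> Dw D i j u z = v z}.
Proof. by move=> h; apply: weak_derivative_unique (h); apply: DwP; exists v. Qed.

Lemma L2wd00 u : sqi u -> L2wd 0 0 u u.
Proof. by move=> su; split => // f tf; rewrite mul1r. Qed.

Lemma sobolev_Dw m u i j : sobolev D m u -> (i + j <= m)%N -> L2wd i j u (Dw D i j u).
Proof. by move=> [_ h] /h; exact: DwP. Qed.

Lemma sobolev_le m n u : (m <= n)%N -> sobolev D n u -> sobolev D m u.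
Proof. by move=> mn [su h]; split => // i j ij; apply: h; exact: leq_trans mn. Qed.

Lemma Dw_sqi m u i j : sobolev D m u -> (i + j <= m)%N -> sqi (Dw D i j u).
Proof. by move=> su ij; have [] := sobolev_Dw su ij. Qed.

Lemma sobolev_lin m k u v : sobolev D m u -> sobolev D m v -> sobolev D m (lin k u v).
Proof.
move=> su sv; split; first by apply: sqiD; [|case: su|apply: sqiZ => //; case: sv].
move=> i j ij; exists (lin k (Dw D i j u) (Dw D i j v)).
by apply: L2wd_lin; [case: su|case: sv|exact: sobolev_Dw ij|exact: sobolev_Dw ij].
Qed.

(** [Dw] of a combination is a separate choice, so it agrees with the combination of the choices
    only off a null set, which may depend on [k], [u] and [v]. *)
Lemma Dw_lin m k u v i j : sobolev D m u -> sobolev D m v -> (i + j <= m)%N ->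
  {ae leb2 R, forall z, D z -> Dw D i j (lin k u v) z = Dw D i j u z + k * Dw D i j v z}.
Proof.
move=> su sv ij; apply: DwE.
by apply: L2wd_lin; [case: su|case: sv|exact: sobolev_Dw ij|exact: sobolev_Dw ij].
Qed.

Lemma ae_sobolev m u u' : measurable_fun (D : set plane) u' ->
  {ae leb2 R, forall z, D z -> u z = u' z} -> sobolev D m u -> sobolev D m u'.
Proof.
move=> mu' uu' [su h]; split; first exact: (ae_sqi mD mu' uu').
move=> i j /h [v [sv wv]]; exists v; split => //; apply: ae_weak_derivative wv => //.
by case: su.
Qed.

(** The test function is replaced by its derivative of order (i, j). Since [partial] applies the
    x-derivatives outermost, one more of them gives [partial i.+1 j f] by definition. *)
Lemma Dw_Dw10 m u i j : sobolev D m u -> (i + j < m)%N ->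
  L2wd i j (Dw D 1 0 u) (Dw D i.+1 j u).
Proof.
move=> su ij; have [_ w1] : L2wd 1 0 u (Dw D 1 0 u).
  by apply: sobolev_Dw su _; exact: leq_trans ij.
have [s2 w2] : L2wd i.+1 j u (Dw D i.+1 j u) by exact: sobolev_Dw su _.
split => // f tf; have := w1 _ (test_partial i j tf).
rewrite -[partial 1 0 _]/(partial i.+1 j f) w2// addSn exprS -mulrA => /mulfI -> //; by rewrite oppr_eq0 oner_eq0.
Qed.

Lemma sobolev_Dw10 m u : sobolev D m.+1 u -> sobolev D m (Dw D 1 0 u).
Proof.
move=> su; split; first exact: Dw_sqi su _.
by move=> i j ij; exists (Dw D i.+1 j u); apply: Dw_Dw10 su _.
Qed.

Lemma weak_dx_Dw m u i j : sobolev D m u -> (i + j < m)%N ->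
  weak_dx l r b t (Dw D i j u) (Dw D i.+1 j u).
Proof.
move=> su ij f g bf bg.
have [_ w1] : L2wd i j u (Dw D i j u) by apply: sobolev_Dw su _; exact: ltnW.
have [_ w2] : L2wd i.+1 j u (Dw D i.+1 j u) by exact: sobolev_Dw su _.
have := w1 _ (tens_test_function (bump_on_derive bf) bg).
have := w2 _ (tens_test_function bf bg).
rewrite !partial_tens; try by [case: bf|case: bg|case: (bump_on_derive bf)].
rewrite iterSr => -> /esym; rewrite addSn exprS -mulrA mulrCA => /(mulfI (sgn_neq0 _)) ->.
by rewrite mulN1r.
Qed.

Lemma weak_dy_Dw m u i j : sobolev D m u -> (i + j < m)%N ->
  weak_dy l r b t (Dw D i j u) (Dw D i j.+1 u).
Proof.
move=> su ij f g bf bg.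
have [_ w1] : L2wd i j u (Dw D i j u) by apply: sobolev_Dw su _; exact: ltnW.
have [_ w2] : L2wd i j.+1 u (Dw D i j.+1 u) by apply: sobolev_Dw su _; rewrite addnS.
have := w1 _ (tens_test_function bf (bump_on_derive bg)).
have := w2 _ (tens_test_function bf bg).
rewrite !partial_tens; try by [case: bf|case: bg|case: (bump_on_derive bg)].
rewrite iterSr => -> /esym; rewrite addnS exprS -mulrA mulrCA => /(mulfI (sgn_neq0 _)) ->.
by rewrite mulN1r.
Qed.

End weak_derivatives.

(** * Classical derivatives are weak derivatives *)

Section classical_weak_derivatives.
Context (R : realType).
Notation leb := (@lebesgue_measure R).
Notation plane := (measurableTypeR R * measurableTypeR R)%type.
Notation I1 := (Rintegral leb setT).
Implicit Types (u v w f g h : R * R -> R) (l r b t x y : R).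

Lemma Rint_derive_supp l r (f : R -> R) : l < r -> (forall x, derivable f x 1) ->
  continuous (derive1 f) -> (forall x, ~ (l < x < r) -> f x = 0) -> I1 (derive1 f) = 0.
Proof.
move=> lr df cf f0; have c := derivable1_continuous df.
have cf' : {within `[l, r], continuous (derive1 f)} by exact: continuous_subspaceT.
have df' : derivable_oo_LRcontinuous f l r.
  split; [by move=> y _; exact: df|by apply: cvg_at_right_filter; exact: c|].
  by apply: cvg_at_left_filter; exact: c.
have E := continuous_FTC2 lr cf' df' (fun y _ => erefl).
have fl : f l = 0 by apply: f0; rewrite ltxx.
have fr : f r = 0 by apply: f0; rewrite ltxx andbF.
have -> : 0 = fine ((f r)%:E - (f l)%:E)%E by rewrite fl fr /= subr0.
rewrite -E integral_mkcond /Rintegral; congr fine; apply: eq_integral => s _.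
rewrite patchE; case: ifPn => //; rewrite notin_setE /= in_itv /= => n; congr EFin.
apply: (@derive1_near0 _ f s l r) => // x; apply: contraNT => /negP nx; rewrite f0//.
by move=> /andP[h1 h2]; apply: nx; rewrite !ltW.
Qed.

Lemma int2_partial1_eq0 l r b t h : l < r -> (forall z, ~ box l r b t z -> h z = 0) ->
  (forall x y, derivable (fun s => h (s, y)) x 1) -> continuous (partial1 h) ->
  (forall z, ~ box l r b t z -> partial1 h z = 0) -> int2 (box l r b t) (partial1 h) = 0.
Proof.
move=> lr h0 dh ch dh0.
have mB := measurable_box l r b t.
have i0 : (leb2 R).-integrable (box l r b t) (EFin \o partial1 h).
  by apply: sqi_itg => //; [exact: box_finite|exact: continuous_sqi].
have e : cutoff (box l r b t) (partial1 h) = partial1 h.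
  apply/funext => z; rewrite /cutoff; case: ifPn => //.
  by rewrite notin_setE => /dh0 ->.
move/(integrable_cutoff _ mB) : i0; rewrite Rint_cutoff e => /Rint_fubini21 ->.
rewrite [LHS](_ : _ = I1 (fun=> 0)); first by rewrite /Rintegral integral0.
apply: eq_Rintegral => y _; apply: (@Rint_derive_supp l r (fun s => h (s, y))) => //.
- move=> x; apply: (@continuous_comp _ _ _ (fun s => (s, y)) (partial1 h)); last exact: ch.
  by move=> W /= [[U V] /= [Ux Vy] UVW]; apply: filterS Ux => s Us; apply: UVW;
    split => //=; exact: nbhs_singleton.
- by move=> x nx; apply: h0 => -[].
Qed.

Lemma continuous_flip h : continuous h -> continuous (flip h).
Proof.
move=> ch [x y] W /= /ch [[U V] /= [Uy Vx] UVW].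
by exists (V, U) => //= -[p q] [Vp Uq]; apply: UVW.
Qed.

Lemma int2_partial2_eq0 l r b t h : b < t -> (forall z, ~ box l r b t z -> h z = 0) ->
  (forall x y, derivable (fun s => h (x, s)) y 1) -> continuous (partial2 h) ->
  (forall z, ~ box l r b t z -> partial2 h z = 0) -> int2 (box l r b t) (partial2 h) = 0.
Proof.
move=> lr h0 dh ch dh0.
have cf : continuous (partial1 (flip h)) by exact: continuous_flip ch.
rewrite -[partial2 h]/(flip (partial1 (flip h))) int2_flip; last first.
  apply: sqi_itg; [exact: measurable_box|exact: box_finite|exact: continuous_sqi].
apply: int2_partial1_eq0 => //.
- by move=> z nz; apply: h0 => -[? ?]; apply: nz.
- by move=> x y; exact: dh.
- by move=> z nz; apply: (dh0 (z.2, z.1)) => -[? ?]; apply: nz.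
Qed.

(** Integration by parts: the derivatives of [w * f] integrate to zero because the test function [f]
    is compactly supported in the box. The lemma places the smooth approximants in the definition of
    a trace in H^1. *)
Lemma smooth_sobolev1 l r b t w : l < r -> b < t -> smooth w -> sobolev (box l r b t) 1 w.
Proof.
move=> lr bt sw; set D := box l r b t.
have mD : measurable (D : set plane) := measurable_box l r b t.
have cw := smooth_continuous sw.
have tt f (K : set (R * R)) : K `<=` D -> (forall p, ~ K p -> f p = 0) -> forall p, ~ D p -> f p = 0.
  by move=> KD f0 p nD; apply: f0 => /KD.
split; first exact: continuous_sqi.
have s1 : smooth (partial1 w) by exact: (@smooth_partial _ 1 0).
have s2 : smooth (partial2 w) by exact: (@smooth_partial _ 0 1).
move=> [|[|i]] [|[|j]]//= _.
- by exists w; split; [exact: continuous_sqi|move=> f _; rewrite mul1r].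
- exists (partial2 w); split; first exact/continuous_sqi/smooth_continuous.
  move=> f tf; have [sf [K [_ KD f0]]] := tf.
  have [sf1 [K1 [_ KD1 f01]]] := @test_partial _ _ 0 1 _ tf.
  have dd x y : is_derive y (1 : R) (fun s => w (x, s) * f (x, s))
      (w (x, y) * partial2 f (x, y) + f (x, y) * partial2 w (x, y)).
    by apply: is_derive_mul; apply: derivable_is_derive1; exact: smooth_derivable2.
  pose h z := w z * f z.
  have e : partial2 h = fun z => w z * partial2 f z + partial2 w z * f z.
    apply/funext => -[x y]; rewrite {1}/partial2 /h /=.
    by have [_ ->] := is_derive1P (dd x y); rewrite (mulrC (f _)).
  have : int2 D (partial2 h) = 0.
    apply: int2_partial2_eq0 => //.
    + by move=> z nz; rewrite /h (tt _ _ KD f0) ?mulr0.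
    + rewrite e => z; apply: cvgD; apply: cvgM; [exact: cw|exact: (smooth_continuous sf1)|
        exact: (smooth_continuous s2)|exact: (smooth_continuous sf)].
    + by move=> z nz; rewrite e (tt _ _ KD f0)// [partial2 f z](tt _ _ KD1 f01)// !mulr0 addr0.
  rewrite e int2D//; last 2 first.
  + by apply: sqi_itgM => //; apply: continuous_sqi => //; exact: smooth_continuous.
  + by apply: sqi_itgM => //; apply: continuous_sqi; exact: smooth_continuous.
  by move/eqP; rewrite addr_eq0 => /eqP ->; rewrite expr1 mulN1r.
- exists (partial1 w); split; first exact/continuous_sqi/smooth_continuous.
  move=> f tf; have [sf [K [_ KD f0]]] := tf.
  have [sf1 [K1 [_ KD1 f01]]] := @test_partial _ _ 1 0 _ tf.
  have dd x y : is_derive x (1 : R) (fun s => w (s, y) * f (s, y))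
      (w (x, y) * partial1 f (x, y) + f (x, y) * partial1 w (x, y)).
    by apply: is_derive_mul; apply: derivable_is_derive1; exact: smooth_derivable1.
  pose h z := w z * f z.
  have e : partial1 h = fun z => w z * partial1 f z + partial1 w z * f z.
    apply/funext => -[x y]; rewrite {1}/partial1 /h /=.
    by have [_ ->] := is_derive1P (dd x y); rewrite (mulrC (f _)).
  have : int2 D (partial1 h) = 0.
    apply: int2_partial1_eq0 => //.
    + by move=> z nz; rewrite /h (tt _ _ KD f0) ?mulr0.
    + rewrite e => z; apply: cvgD; apply: cvgM; [exact: cw|exact: (smooth_continuous sf1)|
        exact: (smooth_continuous s1)|exact: (smooth_continuous sf)].
    + by move=> z nz; rewrite e (tt _ _ KD f0)// [partial1 f z](tt _ _ KD1 f01)// !mulr0 addr0.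
  rewrite e int2D//; last 2 first.
  + by apply: sqi_itgM => //; apply: continuous_sqi => //; exact: smooth_continuous.
  + by apply: sqi_itgM => //; apply: continuous_sqi; exact: smooth_continuous.
  by move/eqP; rewrite addr_eq0 => /eqP ->; rewrite expr1 mulN1r.
Qed.

End classical_weak_derivatives.

(* [comb k u v] stands for [u + k v]; the laws hold on [V] only, and up to
   elements of norm zero. *)
Record semi_hilbert (R : realType) (E : Type) (V : E -> Prop) (comb : R -> E -> E -> E)
    (dot : E -> E -> R) : Prop := SemiHilbert {
  sh_comb : forall k u v, V u -> V v -> V (comb k u v);
  sh_dotC : forall u v, dot u v = dot v u;
  sh_dot : forall k u v w, V u -> V v -> V w -> dot (comb k u v) w = dot u w + k * dot v w;
  sh_ge0 : forall u, V u -> 0 <= dot u u;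
  sh_complete : forall u_ : nat -> E, (forall n, V (u_ n)) ->
    (forall e, 0 < e -> exists N, forall m n, (N <= m)%N -> (N <= n)%N ->
       dot (comb (-1) (u_ m) (u_ n)) (comb (-1) (u_ m) (u_ n)) <= e) ->
    exists u, V u /\ forall e, 0 < e -> exists N, forall n, (N <= n)%N ->
       dot (comb (-1) (u_ n) u) (comb (-1) (u_ n) u) <= e }.

(** * Minimization and representation in a semi-Hilbert space *)

Section semi_hilbert_theory.
Context (R : realType) (E : Type) (V : E -> Prop) (comb : R -> E -> E -> E)
  (dot : E -> E -> R).
Hypothesis hs : semi_hilbert V comb dot.
Implicit Types (u v w g h : E) (k e c : R).

Let cV := sh_comb hs.
Let nq u := dot u u.
Let nrm u := Num.sqrt (nq u).
Let sub u v := comb (-1) u v.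

Lemma dot_combr k u v w : V u -> V v -> V w -> dot w (comb k u v) = dot w u + k * dot w v.
Proof. by move=> Vu Vv Vw; rewrite (sh_dotC hs)// (sh_dot hs)// !(sh_dotC hs w). Qed.

Lemma sqr_norm_comb k u v : V u -> V v ->
  dot (comb k u v) (comb k u v) = dot u u + 2 * k * dot u v + k ^+ 2 * dot v v.
Proof.
move=> Vu Vv; have Vc := cV k Vu Vv.
by rewrite (sh_dot hs)// !dot_combr// (sh_dotC hs v u); ring.
Qed.

Lemma sqr_norm_sub_sym u v : V u -> V v ->
  dot (comb (-1) u v) (comb (-1) u v) = dot (comb (-1) v u) (comb (-1) v u).
Proof. by move=> Vu Vv; rewrite !sqr_norm_comb// (sh_dotC hs v u); ring. Qed.

Lemma cauchy_schwarz u v : V u -> V v -> dot u v ^+ 2 <= dot u u * dot v v.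
Proof.
move=> Vu Vv.
have q k : 0 <= dot u u + 2 * k * dot u v + k ^+ 2 * dot v v.
  by rewrite -sqr_norm_comb//; apply: (sh_ge0 hs); exact: cV.
have a0 := sh_ge0 hs Vu; have c0 := sh_ge0 hs Vv.
move: (dot u u) (dot u v) (dot v v) q a0 c0 => a b c q a0 c0.
have [c1|c1] := ltP 0 c.
  have := q (- b / c); rewrite (_ : _ + _ = (a * c - b ^+ 2) / c); last by field; rewrite gt_eqF.
  by rewrite pmulr_lge0 ?invr_gt0// subr_ge0.
have c2 : c = 0 by apply/eqP; rewrite eq_le c1.
rewrite c2 mulr0; have [->|b0] := eqVneq b 0; first by rewrite expr0n.
(* When [v] has norm zero the quadratic polynomial degenerates to an affine one; this argument makes
   it equal to -1 unless [b] vanishes. *)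
have := q (- (a + 1) / (2 * b)).
by rewrite c2 mulr0 addr0 (_ : _ + _ = - 1) ?ler0N1//; field.
Qed.

Lemma dot_le_norm u v : V u -> V v -> `|dot u v| <= Num.sqrt (dot u u) * Num.sqrt (dot v v).
Proof.
move=> Vu Vv; rewrite -sqrtrM ?(sh_ge0 hs)// -sqrtr_sqr ler_wsqrtr//.
exact: cauchy_schwarz.
Qed.

Lemma norm_comb k u v : V u -> V v ->
  Num.sqrt (dot (comb k u v) (comb k u v)) <=
  Num.sqrt (dot u u) + `|k| * Num.sqrt (dot v v).
Proof.
move=> Vu Vv; rewrite -ler_sqr ?nnegrE ?addr_ge0 ?mulr_ge0 ?sqrtr_ge0//.
have Vc := cV k Vu Vv.
rewrite sqr_sqrtr ?(sh_ge0 hs)// sqr_norm_comb//.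
have h : k * dot u v <= `|k| * (Num.sqrt (dot u u) * Num.sqrt (dot v v)).
  rewrite (le_trans (ler_norm _))// normrM ler_wpM2l//; exact: dot_le_norm.
rewrite -{1}(sqr_sqrtr (sh_ge0 hs Vu)) -{1}(sqr_sqrtr (sh_ge0 hs Vv)).
rewrite sqrrD exprMn real_normK ?num_real// lerD2r lerD2l mulr2n -!mulrA; lra.
Qed.

(** The midpoint inequality bounds the squared distance of two points by the excess of their values
    over the infimum, so a minimizing sequence is Cauchy in norm, and semicontinuity along strong
    limits concludes. *)
Lemma midpoint_minimize (K : E -> Prop) (F : E -> R) (c m : R) : 0 < c ->
  (forall u, K u -> V u) -> (exists u, K u) ->
  (forall (u_ : nat -> E) u, (forall n, K (u_ n)) -> V u ->
     (forall e, 0 < e -> exists N, forall n, (N <= n)%N -> dot (sub (u_ n) u) (sub (u_ n) u) <= e) ->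
     K u) ->
  (forall u, K u -> m <= F u) ->
  (forall u v, K u -> K v -> exists2 w, K w &
     F w <= (F u + F v) / 2 - c * dot (sub u v) (sub u v)) ->
  (forall u, K u -> forall e, 0 < e -> exists2 d, 0 < d & forall v, K v ->
     dot (sub v u) (sub v u) <= d -> F u <= F v + e) ->
  exists2 u, K u & forall v, K v -> F u <= F v.
Proof.
move=> c0 KV [u0 Ku0] Kcl Fm Fmid Flsc.
pose A := F @` [set u | K u].
have A0 : A !=set0 by exists (F u0), u0.
have lA : has_lbound A by exists m => _ [u Ku <-]; exact: Fm.
have hA : has_inf A by [].
have /choice[u_ hu] : forall n : nat, exists u, K u /\ F u < inf A + n.+1%:R^-1.
  move=> n; have [|_ [u Ku <-] h] := @inf_adherent _ A n.+1%:R^-1 _ hA; last by exists u.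
  by rewrite invr_gt0 ltr0n.
have infle u : K u -> inf A <= F u by move=> Ku; apply: ge_inf => //; exists u.
have [u [Vu cu]] : exists u, V u /\ forall e, 0 < e -> exists N, forall n, (N <= n)%N ->
       dot (sub (u_ n) u) (sub (u_ n) u) <= e.
  apply: (sh_complete hs) => [n|e e0]; first by apply: KV; case: (hu n).
  have ec : 0 < e * c by exact: mulr_gt0.
  exists (Num.bound (e * c)^-1) => p q hp hq.
  have b n : (Num.bound (e * c)^-1 <= n)%N -> n.+1%:R^-1 <= e * c.
    move=> hn; rewrite invf_ple ?posrE ?ltr0n// ltW//.
    apply: lt_le_trans (archi_boundP _) _; first by rewrite invr_ge0 ltW.
    by rewrite ler_nat ltnW.
  have [Kp Fp] := hu p; have [Kq Fq] := hu q.
  have [w Kw Fw] := Fmid _ _ Kp Kq.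
  have := infle _ Kw; have := b _ hp; have := b _ hq.
  move: (p.+1%:R^-1) (q.+1%:R^-1) Fp Fq => ip iq Fp Fq h1 h2 h3.
  rewrite -(ler_pM2l c0) (mulrC c e).
  rewrite -/(sub (u_ p) (u_ q)); lra.
have Ku : K u by apply: (Kcl u_) => // n; case: (hu n).
exists u => // v Kv; apply: (@le_trans _ _ (inf A)); last exact: infle.
apply/ler_addgt0Pr => e e0; have e2 : 0 < e / 2 by lra.
have [d d0 hd] := Flsc _ Ku _ e2.
have [N hN] := cu _ d0.
pose n := maxn N (Num.bound (e / 2)^-1).
have [Kn Fn] := hu n.
apply: (le_trans (hd _ Kn _)); first by apply: hN; exact: leq_maxl.
have : n.+1%:R^-1 <= e / 2.
  rewrite invf_ple ?posrE ?ltr0n// ltW//.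
  apply: lt_le_trans (archi_boundP _) _; first by rewrite invr_ge0 ltW.
  by rewrite ler_nat ltnW// ltnS leq_maxr.
move: (n.+1%:R^-1) Fn => i; lra.
Qed.

(** With K the whole space this gives Riesz representation, with L = 0 the element of minimal norm
    of a closed convex set. The constant 1/4 is the one of the parallelogram identity, and the lower
    bound - M^2 comes from completing the square. *)
Lemma quadratic_minimize (K : E -> Prop) (L : E -> R) (M : R) :
  (forall u, K u -> V u) -> (exists u, K u) ->
  (forall (u_ : nat -> E) u, (forall n, K (u_ n)) -> V u ->
     (forall e, 0 < e -> exists N, forall n, (N <= n)%N -> dot (sub (u_ n) u) (sub (u_ n) u) <= e) ->
     K u) ->
  (forall u v, K u -> K v -> K (comb 2^-1 u (sub v u))) ->
  (forall k u v, V u -> V v -> L (comb k u v) = L u + k * L v) ->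
  (forall u, V u -> `|L u| <= M * Num.sqrt (dot u u)) ->
  exists2 g, K g & forall v, K v -> dot g g - 2 * L g <= dot v v - 2 * L v.
Proof.
move=> KV K0 Kcl Kmid Ll Lb.
have N0 u : 0 <= Num.sqrt (dot u u) by exact: sqrtr_ge0.
apply: (@midpoint_minimize K (fun u => dot u u - 2 * L u) (4^-1) (- M ^+ 2)) => //.
- move=> u /KV Vu; have := le_trans (ler_norm _) (Lb _ Vu); have := sqr_ge0 (Num.sqrt (dot u u) - M).
  have := sqr_sqrtr (sh_ge0 hs Vu); nra.
- move=> u v Ku Kv; exists (comb 2^-1 u (sub v u)); first exact: Kmid.
  have [Vu Vv] := (KV _ Ku, KV _ Kv).
  have Vs : V (sub v u) by exact: cV.
  rewrite Ll// /sub Ll// sqr_norm_comb// !sqr_norm_comb// dot_combr// (sh_dotC hs v u); lra.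
- move=> u /KV Vu e e0.
  (* With d = v - u, the functional drops by at most 2 (norm of u + M) times the norm of d; [s]
     bounds the bracket and is positive. *)
  pose s := Num.sqrt (dot u u) + `|M| + 1.
  have s0 : 0 < s by rewrite ltr_wpDl// addr_ge0.
  exists ((e / (2 * s)) ^+ 2); first by rewrite exprn_gt0// divr_gt0// mulr_gt0.
  move=> v /KV Vv; have Vs : V (sub v u) by exact: cV.
  move=> hd; have hn : Num.sqrt (dot (sub v u) (sub v u)) <= e / (2 * s).
    by rewrite -ler_sqr ?nnegrE// ?sqr_sqrtr ?(sh_ge0 hs)// divr_ge0 ?mulr_ge0 ?ltW.
  have E1 : dot (sub v u) (sub v u) = dot v v - 2 * dot v u + dot u u.
    by rewrite sqr_norm_comb//; ring.
  have E2 : dot u (sub v u) = dot v u - dot u u.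
    by rewrite dot_combr// (sh_dotC hs u v) mulN1r.
  have E3 : L (sub v u) = L v - L u by rewrite Ll// mulN1r.
  have l3 := sh_ge0 hs Vs; have l2 := dot_le_norm Vu Vs; have l1 := Lb _ Vs.
  move: hn l2 l1; set t := Num.sqrt _; rewrite E2 E3 => hn l2 l1; rewrite E1 in l3.
  have t0 : 0 <= t by exact: N0.
  have l4 : M * t <= `|M| * t by rewrite ler_wpM2r// ler_norm.
  have l5 : t * (2 * s) <= e by rewrite -ler_pdivlMr// mulr_gt0.
  move: l1 l2; rewrite !ler_norml => /andP[l1 l1'] /andP[l2 l2'].
  rewrite /s in l5; move: t hn l1 l1' l2 l2' t0 l4 l5; clear -l3; move=> t *; nra.
Qed.

Lemma riesz (L : E -> R) (M : R) : (exists u, V u) ->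
  (forall k u v, V u -> V v -> L (comb k u v) = L u + k * L v) ->
  (forall u, V u -> `|L u| <= M * Num.sqrt (dot u u)) ->
  exists2 g, V g & forall h, V h -> dot g h = L h.
Proof.
move=> V0 Ll Lb.
have [||u v Vu Vv|||g Vg hg] := @quadratic_minimize V L M _ V0 => //.
  by apply: cV => //; exact: cV.
exists g => // h Vh.
have q k : 0 <= 2 * k * (dot g h - L h) + k ^+ 2 * dot h h.
  have := hg _ (cV k Vg Vh); rewrite sqr_norm_comb// Ll//; lra.
have h0 := sh_ge0 hs Vh.
move: (dot h h) (dot g h - L h) (subr_eq0 (dot g h) (L h)) q h0 => c a ea q h0.
apply/eqP; rewrite -ea; apply/eqP; apply: contrapT => a0.
have c1 : 0 < c + 1 by rewrite ltr_wpDl.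
(* The first variation at the minimizer. The denominator c + 1 in place of c covers increments of
   norm zero. *)
have := q (- a / (c + 1)).
rewrite (_ : _ + _ = - (a ^+ 2 / (c + 1) ^+ 2 * (c + 2))); last by field; rewrite gt_eqF.
rewrite oppr_ge0 leNgt => /negP; apply; apply: mulr_gt0; last by lra.
apply: divr_gt0; last exact: exprn_gt0.
by rewrite exprn_even_gt0//=; apply/eqP.
Qed.

Lemma semi_hilbert_closed (S : E -> Prop) : (forall u, S u -> V u) ->
  (forall k u v, S u -> S v -> S (comb k u v)) ->
  (forall (u_ : nat -> E) u, (forall n, S (u_ n)) -> V u ->
     (forall e, 0 < e -> exists N, forall n, (N <= n)%N -> dot (sub (u_ n) u) (sub (u_ n) u) <= e) ->
     S u) ->
  semi_hilbert S comb dot.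
Proof.
move=> SV Sc Scl; split => //.
- exact: sh_dotC hs.
- by move=> k u v w Su Sv Sw; apply: (sh_dot hs); exact: SV.
- by move=> u Su; apply: (sh_ge0 hs); exact: SV.
- move=> u_ Su cu; have [u [Vu hu]] := sh_complete hs (fun n => SV _ (Su n)) cu.
  by exists u; split => //; exact: Scl hu.
Qed.

End semi_hilbert_theory.

Section sobolev_space.
Context (R : realType) (l r b t : R).
Hypotheses (lr : l < r) (bt : b < t).
Notation plane := (measurableTypeR R * measurableTypeR R)%type.
Notation D := (box l r b t).
Notation sqi := (square_integrable (leb2 R) D).
Notation L2wd := (L2_weak_derivative D).
Notation L2le := (L2le (leb2 R) D).
Implicit Types (u v w f g : R * R -> R) (k e : R).

Let mD : measurable (D : set plane) := measurable_box l r b t.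

Lemma sobolev_dotC m u v : sobolev_dot D m u v = sobolev_dot D m v u.
Proof.
by apply: eq_bigr => i _; apply: eq_bigr => j _; apply: eq_int2 => p _; rewrite mulrC.
Qed.

Lemma Dw_itgM m u v i j : sobolev D m u -> sobolev D m v -> (i + j <= m)%N ->
  (leb2 R).-integrable D (EFin \o (fun p => Dw D i j u p * Dw D i j v p)).
Proof. by move=> su sv ij; apply: sqi_itgM => //; [exact: Dw_sqi su ij|exact: Dw_sqi sv ij]. Qed.

Lemma sobolev_dot_lin m k u v w : sobolev D m u -> sobolev D m v -> sobolev D m w ->
  sobolev_dot D m (lin k u v) w = sobolev_dot D m u w + k * sobolev_dot D m v w.
Proof.
move=> su sv sw; have sl := sobolev_lin (l := l) (r := r) (b := b) (t := t) k su sv.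
rewrite /sobolev_dot mulr_sumr -big_split; apply: eq_bigr => i _ /=.
rewrite mulr_sumr -big_split; apply: eq_bigr => j ij /=.
have mw : measurable_fun (D : set plane) (Dw D i j w) by have [] := Dw_sqi (l := l) (r := r) (b := b) (t := t) sw ij.
rewrite -int2Z//; last exact: Dw_itgM sv sw ij.
rewrite -int2D//; [|exact: Dw_itgM su sw ij|apply: itgZ => //; exact: Dw_itgM sv sw ij].
apply: ae_int2 => //.
- apply: measurable_funM => //.
  by have [] := Dw_sqi (l := l) (r := r) (b := b) (t := t) sl ij.
- apply: measurable_funD; first exact: itg_measurable (Dw_itgM su sw ij).
  by apply: measurable_funM => //; exact: itg_measurable (Dw_itgM sv sw ij).
- apply: ae_imp1 (Dw_lin lr bt k su sv ij) _ => p h Dp.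
  by rewrite h//; ring.
Qed.

Lemma sobolev_dot_ge0 m u : 0 <= sobolev_dot D m u u.
Proof.
by apply: sumr_ge0 => i _; apply: sumr_ge0 => j _; apply: int2_ge0 => p _; rewrite -expr2 sqr_ge0.
Qed.

Lemma sqr_sobolev_norm m u : sobolev_norm D m u ^+ 2 = sobolev_dot D m u u.
Proof. by rewrite sqr_sqrtr// sobolev_dot_ge0. Qed.

Lemma sobolev_norm_ge0 m u : 0 <= sobolev_norm D m u.
Proof. exact: sqrtr_ge0. Qed.

Lemma int2_Dw_le m u i j : (i + j <= m)%N ->
  int2 D (fun p => Dw D i j u p ^+ 2) <= sobolev_dot D m u u.
Proof.
move=> ij; have im : (i < m.+1)%N by rewrite ltnS (leq_trans _ ij)// leq_addr.
have jm : (j < m.+1)%N by rewrite ltnS (leq_trans _ ij)// leq_addl.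
rewrite /sobolev_dot (bigD1 (Ordinal im))//= (bigD1 (Ordinal jm))//= -addrA.
rewrite (@eq_int2 _ _ (fun p => Dw D i j u p ^+ 2) (fun p => Dw D i j u p * Dw D i j u p)); last by [].
have h q n : 0 <= int2 D (fun p => Dw D q n u p * Dw D q n u p).
  by apply: int2_ge0 => p _; rewrite -expr2 sqr_ge0.
by rewrite lerDl addr_ge0//; apply: sumr_ge0 => q _ //; apply: sumr_ge0.
Qed.

Lemma Dw_L2le m u i j : sobolev D m u -> (i + j <= m)%N ->
  L2le (Dw D i j u) (sobolev_norm D m u).
Proof.
move=> su ij; split; [exact: Dw_sqi su ij|exact: sobolev_norm_ge0|].
by rewrite sqr_sobolev_norm; exact: int2_Dw_le.
Qed.

Lemma sobolev_dot_le m u e : 0 <= e ->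
  (forall i j, (i + j <= m)%N -> int2 D (fun p => Dw D i j u p ^+ 2) <= e) ->
  sobolev_dot D m u u <= m.+1%:R ^+ 2 * e.
Proof.
move=> e0 h; rewrite /sobolev_dot.
have -> : m.+1%:R ^+ 2 * e = \sum_(i < m.+1) \sum_(j < m.+1) e.
  by rewrite !sumr_const !card_ord -mulrnA -[RHS]mulr_natl natrM -expr2.
apply: ler_sum => i _; rewrite big_mkcond; apply: ler_sum => j _.
by case: ifPn => // ij; exact: h.
Qed.

Lemma sobolev_norm_le m n u : (m <= n)%N -> sobolev D n u ->
  sobolev_norm D m u <= m.+1%:R * sobolev_norm D n u.
Proof.
move=> mn su; rewrite -ler_sqr ?nnegrE ?mulr_ge0 ?sobolev_norm_ge0//.
rewrite exprMn !sqr_sobolev_norm sobolev_dot_le ?sobolev_dot_ge0// => i j ij.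
by apply: int2_Dw_le; exact: leq_trans mn.
Qed.

Lemma sobolev_norm_Dw10 m u : sobolev D m.+1 u ->
  sobolev_norm D m (Dw D 1 0 u) <= m.+1%:R * sobolev_norm D m.+1 u.
Proof.
move=> su; rewrite -ler_sqr ?nnegrE ?mulr_ge0 ?sobolev_norm_ge0//.
rewrite exprMn !sqr_sobolev_norm sobolev_dot_le ?sobolev_dot_ge0// => i j ij.
have h := Dw_Dw10 su (ij : (i + j < m.+1)%N).
have s1 := sobolev_Dw10 su.
have -> : int2 D (fun p => Dw D i j (Dw D 1 0 u) p ^+ 2) = int2 D (fun p => Dw D i.+1 j u p ^+ 2).
  apply: ae_int2 => //.
  - by apply: measurable_funX; have [] := Dw_sqi (l := l) (r := r) (b := b) (t := t) s1 ij.
  - by apply: measurable_funX; case: h => -[].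
  - by apply: ae_imp1 (DwE lr bt h) _ => p e Dp; rewrite e.
exact: int2_Dw_le.
Qed.

(** Both sides of the defining identity are continuous in L^2 for a fixed test function, so the
    identity passes to limits. *)
Lemma weak_derivative_closed i j u v : sqi u -> sqi v ->
  (forall e, 0 < e -> exists p q, [/\ L2wd i j p q, L2le (fun x => p x - u x) e &
     L2le (fun x => q x - v x) e]) -> L2wd i j u v.
Proof.
move=> su sv H; split => // f tf.
pose s := (-1) ^+ (i + j) : R.
have s1 : `|s| = 1 by rewrite normrX normrN1 expr1n.
have sf : sqi f by exact: (@test_sqi _ l r b t 0 0).
have spf : sqi (partial i j f) by exact: test_sqi.
have Lf := L2le_norm sf; have Lp := L2le_norm spf.
set a := Num.sqrt _ in Lf; set c := Num.sqrt _ in Lp.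
apply/eqP; rewrite -subr_eq0 -normr_le0; apply/ler_addgt0Pr => e e0; rewrite add0r.
have ac : 0 < a + c + 1 by rewrite ltr_wpDl// addr_ge0 ?sqrtr_ge0.
have [p [q [[sq wpq] hp hq]]] := H (e / (a + c + 1)) (divr_gt0 e0 ac).
have sp : sqi p.
  by apply: (eq_sqi mD _ (sqiD mD (let: And3 h _ _ := hp in h) su)) => x _; rewrite subrK.
have E1 := L2le_dot mD hp Lp; have E2 := L2le_dot mD hq Lf.
have e1 : int2 D (fun x => (p x - u x) * partial i j f x) =
    int2 D (fun x => p x * partial i j f x) - int2 D (fun x => u x * partial i j f x).
  by rewrite -int2B//; [|exact: sqi_itgM..]; apply: eq_int2 => x _; rewrite mulrBl.
have e2 : int2 D (fun x => (q x - v x) * f x) =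
    int2 D (fun x => q x * f x) - int2 D (fun x => v x * f x).
  by rewrite -int2B//; [|exact: sqi_itgM..]; apply: eq_int2 => x _; rewrite mulrBl.
have -> : int2 D (fun x => u x * partial i j f x) - s * int2 D (fun x => v x * f x) =
   s * int2 D (fun x => (q x - v x) * f x) - int2 D (fun x => (p x - u x) * partial i j f x).
  by rewrite e1 e2 wpq// -/s; ring.
rewrite (le_trans (ler_normB _ _))// normrM s1 mul1r.
apply: le_trans (lerD E2 E1) _; rewrite -mulrDr mulrAC ler_pdivrMr// ler_wpM2l ?(ltW e0)//.
by rewrite lerDl.
Qed.

Lemma sobolev_semi_hilbert m : semi_hilbert (sobolev D m) (@lin R) (sobolev_dot D m).
Proof.
split.
- by move=> k u v; exact: sobolev_lin.
- exact: sobolev_dotC.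
- by move=> k u v w; exact: sobolev_dot_lin.
- by move=> u _; exact: sobolev_dot_ge0.
move=> u_ su cu.
have dE p q i j : (i + j <= m)%N ->
    int2 D (fun x => (Dw D i j (u_ p) x - Dw D i j (u_ q) x) ^+ 2) =
    int2 D (fun x => Dw D i j (lin (-1) (u_ p) (u_ q)) x ^+ 2).
  move=> ij; have sl := sobolev_lin (l := l) (r := r) (b := b) (t := t) (-1) (su p) (su q).
  apply: ae_int2 => //.
  - apply: measurable_funX; apply: measurable_funB.
    + by have [] := Dw_sqi (l := l) (r := r) (b := b) (t := t) (su p) ij.
    + by have [] := Dw_sqi (l := l) (r := r) (b := b) (t := t) (su q) ij.
  - by apply: measurable_funX; have [] := Dw_sqi (l := l) (r := r) (b := b) (t := t) sl ij.
  - by apply: ae_imp1 (Dw_lin lr bt (-1) (su p) (su q) ij) _ => x h Dx; rewrite h// mulN1r.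
have lim i j : (i + j <= m)%N -> exists v, sqi v /\ forall e, 0 < e -> exists N, forall n, (N <= n)%N ->
     int2 D (fun x => (Dw D i j (u_ n) x - v x) ^+ 2) <= e.
  move=> ij; apply: (@L2_complete _ _ _ (leb2 R) D mD) => [n|e e0].
    exact: Dw_sqi (su n) ij.
  have [N hN] := cu e e0; exists N => p q hp hq; rewrite -/(int2 _ _) dE//.
  by apply: le_trans (hN p q hp hq); exact: int2_Dw_le.
have /choice[v hv] : forall ij : nat * nat, exists v, (ij.1 + ij.2 <= m)%N ->
    sqi v /\ forall e, 0 < e -> exists N, forall n, (N <= n)%N ->
     int2 D (fun x => (Dw D ij.1 ij.2 (u_ n) x - v x) ^+ 2) <= e.
  move=> [i j] /=; case: (boolP (i + j <= m)%N) => [/lim [v hv]|_]; first by exists v.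
  by exists (fun=> 0).
have [su0 hu0] := hv (0, 0)%N (leq0n m).
(* The candidate limit is that of the derivatives of order zero, which agree almost everywhere with
   the sequence itself. *)
set u := v (0, 0)%N in su0 hu0.
have wd i j : (i + j <= m)%N -> L2wd i j u (v (i, j)).
  move=> ij; have [sv hvv] := hv (i, j) ij.
  apply: weak_derivative_closed => // e e0.
  have e2 : 0 < e ^+ 2 by rewrite exprn_gt0.
  have [N1 h1] := hu0 _ e2; have [N2 h2] := hvv _ e2.
  pose n := maxn N1 N2.
  have s00 := Dw_sqi (l := l) (r := r) (b := b) (t := t) (su n) (leq0n m : (0 + 0 <= m)%N).
  exists (Dw D 0 0 (u_ n)), (Dw D i j (u_ n)); split.
  - have [sw ww] := sobolev_Dw (su n) ij; split => //.
    apply: ae_weak_derivative ww => //; [by case: (su n) => -[]|by case: s00|].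
    have := DwE lr bt (L2wd00 (l := l) (r := r) (b := b) (t := t) (let: conj h _ := su n in h)).
    by move=> h; apply: ae_imp1 h _ => x h Dx; rewrite h.
  - split; [exact: sqiB|exact: ltW|by apply: h1; exact: leq_maxl].
  - split; [|exact: ltW|by apply: h2; exact: leq_maxr].
    by apply: sqiB => //; exact: Dw_sqi (su n) ij.
have sm : sobolev D m u by split => // i j ij; exists (v (i, j)); exact: wd.
exists u; split => // e e0.
have m0 : 0 < m.+1%:R ^+ 2 :> R by rewrite exprn_gt0// ltr0n.
have /choice[N hN] : forall ij : nat * nat, exists N, (ij.1 + ij.2 <= m)%N -> forall n, (N <= n)%N ->
     int2 D (fun x => (Dw D ij.1 ij.2 (u_ n) x - v ij x) ^+ 2) <= e / m.+1%:R ^+ 2.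
  move=> ij; case: (boolP (ij.1 + ij.2 <= m)%N) => [hij|_]; last by exists 0%N.
  by have [_ /(_ _ (divr_gt0 e0 m0)) [N h]] := hv ij hij; exists N.
(* The sum dominates the thresholds of all the finitely many derivatives. *)
exists (\sum_(i < m.+1) \sum_(j < m.+1) N (i : nat, j : nat))%N => n hn.
rewrite -[e](divfK (lt0r_neq0 m0)) mulrC; apply: sobolev_dot_le => [|i j ij].
  by rewrite divr_ge0 ?ltW.
have im : (i < m.+1)%N by rewrite ltnS (leq_trans _ ij)// leq_addr.
have jm : (j < m.+1)%N by rewrite ltnS (leq_trans _ ij)// leq_addl.
have hn' : (N (i, j) <= n)%N.
  apply: leq_trans hn; rewrite (bigD1 (Ordinal im))//= (bigD1 (Ordinal jm))//= -addnA.
  exact: leq_addr.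
have := hN (i, j) ij n hn'; apply: le_trans.
have sl := sobolev_lin (l := l) (r := r) (b := b) (t := t) (-1) (su n) sm.
have sn := Dw_sqi (l := l) (r := r) (b := b) (t := t) (su n) ij.
have [sv _] := hv (i, j) ij.
rewrite le_eqVlt; apply/orP; left; apply/eqP; apply: ae_int2 => //.
- by apply: measurable_funX; have [] := Dw_sqi (l := l) (r := r) (b := b) (t := t) sl ij.
- by apply: measurable_funX; apply: measurable_funB; [case: sn|case: sv].
- apply: ae_imp2 (Dw_lin lr bt (-1) (su n) sm ij) (DwE lr bt (wd i j ij)) _ => x h1 h2 Dx.
  by rewrite h1// h2//= mulN1r.
Qed.

End sobolev_space.

Definition prod_comb (R : realType) E (comb : R -> E -> E -> E) k (z w : E * E) : E * E :=
  (comb k z.1 w.1, comb k z.2 w.2).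

Lemma semi_hilbert_prod (R : realType) (E : Type) (V : E -> Prop) (comb : R -> E -> E -> E)
    (dot : E -> E -> R) : semi_hilbert V comb dot ->
  semi_hilbert (fun z : E * E => V z.1 /\ V z.2) (prod_comb comb)
    (fun z w => dot z.1 w.1 + dot z.2 w.2).
Proof.
move=> hs; split => /=.
- by move=> k u v [u1 u2] [v1 v2]; split; exact: (sh_comb hs).
- by move=> u v; rewrite (sh_dotC hs u.1) (sh_dotC hs u.2).
- by move=> k u v w [u1 u2] [v1 v2] [w1 w2]; rewrite !(sh_dot hs)//; ring.
- by move=> u [u1 u2]; rewrite addr_ge0 ?(sh_ge0 hs).
- move=> u_ hu cu.
  have d0 m n : 0 <= dot (comb (-1) (u_ m).1 (u_ n).1) (comb (-1) (u_ m).1 (u_ n).1).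
    by case: (hu m) (hu n) => ? _ [? _]; apply: (sh_ge0 hs); exact: (sh_comb hs).
  have d0' m n : 0 <= dot (comb (-1) (u_ m).2 (u_ n).2) (comb (-1) (u_ m).2 (u_ n).2).
    by case: (hu m) (hu n) => _ ? [_ ?]; apply: (sh_ge0 hs); exact: (sh_comb hs).
  have [u1 [V1 h1]] : exists u, V u /\ forall e, 0 < e -> exists N, forall n, (N <= n)%N ->
       dot (comb (-1) (u_ n).1 u) (comb (-1) (u_ n).1 u) <= e.
    apply: (sh_complete hs) => [n|e e0]; first by case: (hu n).
    have [N hN] := cu e e0; exists N => m n hm hn; apply: le_trans (hN m n hm hn).
    by rewrite lerDl.
  have [u2 [V2 h2]] : exists u, V u /\ forall e, 0 < e -> exists N, forall n, (N <= n)%N ->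
       dot (comb (-1) (u_ n).2 u) (comb (-1) (u_ n).2 u) <= e.
    apply: (sh_complete hs) => [n|e e0]; first by case: (hu n).
    have [N hN] := cu e e0; exists N => m n hm hn; apply: le_trans (hN m n hm hn).
    by rewrite lerDr.
  exists (u1, u2); split => // e e0; have e2 : 0 < e / 2 by lra.
  have [N1 k1] := h1 _ e2; have [N2 k2] := h2 _ e2.
  exists (maxn N1 N2) => n; rewrite geq_max => /andP[n1 n2] /=.
  by have := k1 n n1; have := k2 n n2; lra.
Qed.

(** * Linearity of classical derivatives *)

Section smooth_linear.
Context (R : realType).
Implicit Types (f g : R * R -> R) (k : R).

Lemma derive1_lin (p q : R -> R) k x : derivable p x 1 -> derivable q x 1 ->
  derivable (fun t => p t + k * q t) x 1 /\
  derive1 (fun t => p t + k * q t) x = derive1 p x + k * derive1 q x.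
Proof.
move=> dp dq; apply: is_derive1P.
have h := is_deriveD (derivable_is_derive1 dp) (is_deriveZ k (derivable_is_derive1 dq)).
exact: h.
Qed.

Lemma sqr_sub_le k (p q x y : R) : (p + k * x - (q + k * y)) ^+ 2 <=
  2 * (p - q) ^+ 2 + 2 * k ^+ 2 * (x - y) ^+ 2.
Proof. by have := sqr_ge0 ((p - q) - k * (x - y)); nra. Qed.

Lemma smooth_lin k f g : smooth f -> smooth g -> smooth (lin k f g).
Proof.
move=> sf sg w /=; pose d := foldr (fun e => if e then @partial2 R else @partial1 R).
have -> : foldr (fun e => if e then @partial2 R else @partial1 R) (lin k f g) w =
    lin k (d f w) (d g w).
  elim: w => // e w /= ->; have [_ df] := sf w; have [_ dg] := sg w.
  apply/funext => p; case: e; rewrite /partial1 /partial2.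
    by have [_] := derive1_lin k (df p).2 (dg p).2.
  by have [_] := derive1_lin k (df p).1 (dg p).1.
have [cf df] := sf w; have [cg dg] := sg w; split.
  move=> p; apply: cvgD; first exact: cf.
  by apply: cvgM; [exact: cvg_cst|exact: cg].
move=> p; split.
  by have [] := derive1_lin k (df p).1 (dg p).1.
by have [] := derive1_lin k (df p).2 (dg p).2.
Qed.

End smooth_linear.

(** * Traces *)

Section traces.
Context (R : realType) (Q : rectangle R).
Hypotheses (hc1 : 0 < rc1 Q) (hc2 : 0 < rc2 Q).
Notation leb := (@lebesgue_measure R).
Notation line := (measurableTypeR R).
Notation plane := (measurableTypeR R * measurableTypeR R)%type.
Notation D := (box (ra Q - rc1 Q) (ra Q + rc1 Q) (rb Q - rc2 Q) (rb Q + rc2 Q)).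
Notation nrm k := (sobolev_norm D k).
Implicit Types (u v w f g h : R * R -> R) (k e : R) (s : side).

Lemma OmegaE : Omega Q = D.
Proof.
by apply/seteqP; split => p; rewrite /Omega /box /= !ltr_distl.
Qed.

Lemma width_gt0 : ra Q - rc1 Q < ra Q + rc1 Q. Proof. by move: hc1; lra. Qed.
Lemma height_gt0 : rb Q - rc2 Q < rb Q + rc2 Q. Proof. by move: hc2; lra. Qed.

Let lr := width_gt0.
Let bt := height_gt0.

Lemma sub_lin u v : u \- v = lin (-1) u v.
Proof. by apply/funext => p; rewrite /lin mulN1r. Qed.

Lemma norm_lin m k u v : sobolev D m u -> sobolev D m v ->
  nrm m (lin k u v) <= nrm m u + `|k| * nrm m v.
Proof. exact: (norm_comb (sobolev_semi_hilbert lr bt m)). Qed.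

Let range s := side_range Q s.

Lemma measurable_side s : measurable (range s : set line).
Proof. by case: s => /=; exact: measurable_itv. Qed.

Lemma side_continuous_sqi s w : smooth w -> square_integrable leb (range s) (w \o side_point Q s).
Proof.
move=> sw; have cw := smooth_continuous sw.
have c : continuous (w \o side_point Q s).
  have cp : continuous (side_point Q s).
    case: s => x W /= [[U V] /= [Ux Vy] UVW].
    - by apply: filterS Vy => y Vy; apply: UVW; split => //=; exact: nbhs_singleton.
    - by apply: filterS Vy => y Vy; apply: UVW; split => //=; exact: nbhs_singleton.
    - by apply: filterS Ux => y Uy; apply: UVW; split => //=; exact: nbhs_singleton.
    - by apply: filterS Ux => y Uy; apply: UVW; split => //=; exact: nbhs_singleton.
  by move=> x; apply: continuous_comp; [exact: cp|exact: cw].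
have mw : measurable_fun (setT : set line) (w \o side_point Q s) by exact: measurable_continuous.
split; first exact: measurable_funTS.
have key p q : p < q -> leb.-integrable `]p, q[ (EFin \o (fun x => (w \o side_point Q s) x ^+ 2)).
  move=> pq; pose F x := (w \o side_point Q s) x ^+ 2.
  have i : leb.-integrable `[p, q] (EFin \o F).
    apply: continuous_compact_integrable; first exact: segment_compact.
    apply: continuous_subspaceT.
    have -> : F = fun x => (w \o side_point Q s) x * (w \o side_point Q s) x.
      by apply/funext => x; rewrite /F expr2.
    by move=> x; apply: cvgM; exact: c.
  have h : `]p, q[ `<=` (`[p, q]%classic : set line).
    by apply: subset_itv; rewrite bnd_simp.
  exact: (integrableS (measurable_itv `[p, q] : measurable (_ : set line))
    (measurable_itv `]p, q[ : measurable (_ : set line)) h i).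
by case: (s) key => key; apply: key.
Qed.

(** The approximating sequence is traded for one smooth approximant per tolerance, the form in which
    traces are combined and passed to limits. *)
Lemma has_traceP s u g : has_trace Q s u g <->
  [/\ sobolev D 1 u, square_integrable leb (range s) (g \o side_point Q s) &
      forall e, 0 < e -> exists w, [/\ smooth w, nrm 1 (lin (-1) w u) <= e &
        Rintegral leb (range s) (fun t => (w (side_point Q s t) - g (side_point Q s t)) ^+ 2) <= e]].
Proof.
rewrite /has_trace OmegaE; split=> -[su sg].
  move=> [w [sw /cvgrPdist_le c1 /cvgrPdist_le c2]]; split => // e e0.
  have [N1 _ h1] := c1 _ e0; have [N2 _ h2] := c2 _ e0.
  exists (w (maxn N1 N2)); split => //.
    have := h1 _ (leq_maxl N1 N2); rewrite /= sub0r normrN -sub_lin.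
    by apply: le_trans; exact: ler_norm.
  have := h2 _ (leq_maxr N1 N2); rewrite /= sub0r normrN.
  by apply: le_trans; exact: ler_norm.
move=> H; split => //.
have /choice[w hw] : forall n : nat, exists w, [/\ smooth w, nrm 1 (lin (-1) w u) <= n.+1%:R^-1 &
        Rintegral leb (range s) (fun t => (w (side_point Q s t) - g (side_point Q s t)) ^+ 2) <= n.+1%:R^-1].
  by move=> n; apply: H; rewrite invr_gt0 ltr0n.
have cv (x : nat -> R) : (forall n, 0 <= x n) -> (forall n, x n <= n.+1%:R^-1) -> x @ \oo --> (0 : R).
  move=> x0 x1; apply: (@squeeze_cvgr _ _ _ _ (fun=> 0) (@harmonic R)).
  - by apply: nearW => n; rewrite x0 x1.
  - exact: cvg_cst.
  - exact: cvg_harmonic.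
exists w; split.
- by move=> n; case: (hw n).
- apply: cv => n; first exact: sobolev_norm_ge0.
  by case: (hw n) => _; rewrite sub_lin.
- apply: cv => n; first by apply: RI_sqr_ge0.
  by case: (hw n).
Qed.

Lemma trace_lin s k u v g h : has_trace Q s u g -> has_trace Q s v h ->
  has_trace Q s (lin k u v) (lin k g h).
Proof.
move=> /has_traceP[su sg hu] /has_traceP[sv sh hv].
have mS := measurable_side s.
have sgh : square_integrable leb (range s) (lin k g h \o side_point Q s).
  by apply: (sqiD mS sg); exact: sqiZ.
apply/has_traceP; split; [exact: sobolev_lin|exact: sgh|].
move=> e e0.
(* The tolerance is e / (2 + |k| + 2 k^2), small enough for the error in the H^1 norm and for the
   squared error on the side. *)
have [m [m0 hm]] : exists m, 0 < m /\ (m * (1 + `|k|) <= e /\ 2 * m + 2 * k ^+ 2 * m <= e).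
  have kk : 0 <= k ^+ 2 by exact: sqr_ge0.
  have k0 := normr_ge0 k.
  have dd : 0 < 2 + `|k| + 2 * k ^+ 2 by lra.
  have me := divfK (lt0r_neq0 dd) e; have m0 := divr_gt0 e0 dd.
  move: (e / _) me m0 => m me m0; exists m; split => //.
  move: (`|k|) (k ^+ 2) kk k0 me => p q *; nra.
have [w1 [sw1 n1 t1]] := hu _ m0; have [w2 [sw2 n2 t2]] := hv _ m0.
have sob1 := smooth_sobolev1 lr bt sw1; have sob2 := smooth_sobolev1 lr bt sw2.
exists (lin k w1 w2); split.
- exact: smooth_lin.
- have -> : lin (-1) (lin k w1 w2) (lin k u v) = lin k (lin (-1) w1 u) (lin (-1) w2 v).
    by apply/funext => p; rewrite /lin; ring.
  apply: le_trans (norm_lin _ _ _) _; [exact: sobolev_lin..|].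
  apply: le_trans hm.1; rewrite mulrDr mulr1; apply: lerD; first exact: n1.
  rewrite mulrC; apply: ler_wpM2r; [exact: normr_ge0|exact: n2].
- have s1 : square_integrable leb (range s) (fun t => w1 (side_point Q s t) - g (side_point Q s t)).
    by apply: sqiB => //; exact: side_continuous_sqi.
  have s2 : square_integrable leb (range s) (fun t => w2 (side_point Q s t) - h (side_point Q s t)).
    by apply: sqiB => //; exact: side_continuous_sqi.
  apply: le_trans hm.2.
  apply: (@le_trans _ _ (Rintegral leb (range s) (fun t =>
     2 * (w1 (side_point Q s t) - g (side_point Q s t)) ^+ 2 +
     2 * k ^+ 2 * (w2 (side_point Q s t) - h (side_point Q s t)) ^+ 2))).
    apply: (@le_RI _ _ _ leb _ mS).
    + have [_] := sqiD mS s1 (sqiZ mS k s2).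
      by apply: eq_itg => // t _; rewrite /lin; ring.
    + by apply: itgD => //; apply: itgZ => //; [case: s1|case: s2].
    + apply: aeW => t _; rewrite /lin.
      move: (w1 _) (g _) (w2 _) (h _) => a b c d.
      exact: sqr_sub_le.
  rewrite RintegralD//; last 2 first.
  + by apply: itgZ => //; case: s1.
  + by apply: itgZ => //; case: s2.
  rewrite RintegralZl//; last by case: s1.
  rewrite RintegralZl//; last by case: s2.
  by apply: lerD; apply: ler_wpM2l => //; rewrite mulr_ge0 ?sqr_ge0.
Qed.

Lemma ae_trace s u u' g : measurable_fun (D : set plane) u' ->
  {ae leb2 R, forall z, D z -> u z = u' z} -> has_trace Q s u g -> has_trace Q s u' g.
Proof.
move=> mu' uu' /has_traceP[su sg hu].
have mu : measurable_fun (D : set plane) u by case: su => -[].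
apply/has_traceP; split; [exact: ae_sobolev uu' su|exact: sg|].
move=> e /hu [w [sw n1 t1]]; exists w; split; [exact: sw| |exact: t1].
suff -> : nrm 1 (lin (-1) w u') = nrm 1 (lin (-1) w u) by exact: n1.
have mw : measurable_fun (D : set plane) w.
  by case: (smooth_sobolev1 lr bt sw) => -[].
rewrite /sobolev_norm /sobolev_dot; apply: (congr1 Num.sqrt).
apply: eq_bigr => i _; apply: eq_bigr => j _.
rewrite (@ae_Dw _ _ _ _ _ i j (lin (-1) w u') (lin (-1) w u))//.
- by apply: measurable_funD => //; exact: measurable_funM.
- by apply: measurable_funD => //; exact: measurable_funM.
- by apply: ae_imp1 uu' _ => p h Dp; rewrite /lin h.
Qed.

(** All the approximants [v] share the trace [g], so a smooth approximant of a [v] close to [u]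
    serves for [u] itself. *)
Lemma trace_closed s u g : sobolev D 1 u ->
  (forall e, 0 < e -> exists2 v, has_trace Q s v g & nrm 1 (lin (-1) v u) <= e) ->
  has_trace Q s u g.
Proof.
move=> su H; apply/has_traceP; split; first exact: su.
  by have [v /has_traceP[]] := H 1 ltr01.
move=> e e0; have e2 : 0 < e / 2 by lra.
have ee : e / 2 <= e by lra.
have [v /has_traceP[sv _ /(_ _ e2) [w [sw n1 t1]]] n2] := H _ e2.
exists w; split; [exact: sw| |exact: le_trans t1 ee].
have -> : lin (-1) w u = lin 1 (lin (-1) w v) (lin (-1) v u).
  by apply/funext => p; rewrite /lin; ring.
have sob := smooth_sobolev1 lr bt sw.
apply: le_trans (norm_lin _ _ _) _; [exact: sobolev_lin..|].
by rewrite normr1 mul1r; have := lerD n1 n2; rewrite -splitr.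
Qed.

Lemma boundary_lin k u v f f' h h' : sobolev D 2 u -> sobolev D 2 v ->
  boundary_conditions Q u f h -> boundary_conditions Q v f' h' ->
  boundary_conditions Q (lin k u v) (lin k f f') (lin k h h').
Proof.
move=> su sv [tu du] [tv dv]; split; first by move=> s; exact: trace_lin.
move: du dv; rewrite OmegaE => du dv; have sl := sobolev_lin k su sv.
apply: ae_trace (trace_lin k du dv).
  by have [] := Dw_sqi sl (isT : (1 + 0 <= 2)%N).
have h1 := Dw_lin lr bt k su sv (isT : (1 + 0 <= 2)%N).
by apply: ae_imp1 h1 _ => p e Dp; rewrite e.
Qed.

Lemma boundary_closed u f h : sobolev D 2 u ->
  (forall e, 0 < e -> exists v, [/\ sobolev D 2 v, boundary_conditions Q v f h &
     nrm 2 (lin (-1) v u) <= e]) ->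
  boundary_conditions Q u f h.
Proof.
move=> su H; have su1 : sobolev D 1 u by exact: sobolev_le su.
(* Halving compensates the factor 2 lost in passing from the H^2 norm to the H^1 norms of the
   function and of its x-derivative. *)
have e4 e : 0 < e -> 0 < e / 2 by move=> e0; lra.
split.
  move=> s; apply: trace_closed => // e /e4 /H [v [sv [tv _] n]]; exists v => //.
  have sl := sobolev_lin (-1) sv su.
  have := le_trans (sobolev_norm_le (isT : (1 <= 2)%N) sl) (ler_wpM2l (ler0n _ 2) n).
  by rewrite (mulrC 2) divfK.
rewrite OmegaE; apply: trace_closed; first exact: sobolev_Dw10.
move=> e /e4 /H [v [sv [_ dv] n]]; rewrite OmegaE in dv; exists (Dw D 1 0 v) => //.
have sl := sobolev_lin (-1) sv su.
have hh : nrm 1 (lin (-1) (Dw D 1 0 v) (Dw D 1 0 u)) = nrm 1 (Dw D 1 0 (lin (-1) v u)).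
  apply: (congr1 Num.sqrt).
  apply: eq_bigr => i _; apply: eq_bigr => j _.
  rewrite (@ae_Dw _ _ _ _ _ i j (lin (-1) (Dw D 1 0 v) (Dw D 1 0 u)) (Dw D 1 0 (lin (-1) v u)))//.
  - have [mv _] := Dw_sqi sv (isT : (1 + 0 <= 2)%N).
    have [mu_ _] := Dw_sqi su (isT : (1 + 0 <= 2)%N).
    by apply: measurable_funD => //; exact: measurable_funM.
  - by have [] := Dw_sqi sl (isT : (1 + 0 <= 2)%N).
  - have h1 := Dw_lin lr bt (-1) sv su (isT : (1 + 0 <= 2)%N).
    by apply: ae_imp1 h1 _ => p e' Dp; rewrite e'.
rewrite hh; have := le_trans (sobolev_norm_Dw10 lr bt sl) (ler_wpM2l (ler0n _ 2) n).
by rewrite (mulrC 2) divfK.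
Qed.

Lemma boundary_affine t u v f h : sobolev D 2 u -> sobolev D 2 v ->
  boundary_conditions Q u f h -> boundary_conditions Q v f h ->
  boundary_conditions Q (lin t u (lin (-1) v u)) f h.
Proof.
move=> su sv bu bv; have := boundary_lin t su (sobolev_lin (-1) sv su) bu (boundary_lin (-1) sv su bv bu).
have e (g : R * R -> R) : lin t g (lin (-1) g g) = g.
  by apply/funext => p; rewrite /lin mulN1r subrr mulr0 addr0.
by rewrite !e.
Qed.

Lemma boundary_sub u v f h : sobolev D 3 u -> sobolev D 3 v ->
  boundary_conditions Q u f h -> boundary_conditions Q v f h -> H0 Q 3 (lin (-1) u v).
Proof.
move=> su sv bu bv; split; first by rewrite OmegaE; exact: sobolev_lin.
have := boundary_lin (-1) (sobolev_le (isT : (2 <= 3)%N) su) (sobolev_le (isT : (2 <= 3)%N) sv) bu bv.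
have e (g : R * R -> R) : lin (-1) g g = fun=> 0.
  by apply/funext => p; rewrite /lin mulN1r subrr.
by rewrite !e.
Qed.

Lemma H0_lin k u v : H0 Q 3 u -> H0 Q 3 v -> H0 Q 3 (lin k u v).
Proof.
rewrite /H0 OmegaE => -[su bu] [sv bv]; split; first exact: sobolev_lin.
have := boundary_lin k (sobolev_le (isT : (2 <= 3)%N) su) (sobolev_le (isT : (2 <= 3)%N) sv) bu bv.
have -> : lin k (fun=> 0) (fun=> 0) = fun=> 0 :> R.
  by apply/funext => p; rewrite /lin mulr0 addr0.
by [].
Qed.

Lemma boundary_lim (u_ : nat -> R * R -> R) u f h :
  (forall n, sobolev D 3 (u_ n) /\ boundary_conditions Q (u_ n) f h) -> sobolev D 3 u ->
  (forall e, 0 < e -> exists N, forall n, (N <= n)%N ->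
     sobolev_dot D 3 (lin (-1) (u_ n) u) (lin (-1) (u_ n) u) <= e) ->
  boundary_conditions Q u f h.
Proof.
move=> hu su cu; apply: boundary_closed; first exact: sobolev_le su.
move=> e e0; have e3 : 0 < (e / 3) ^+ 2 by rewrite exprn_gt0// divr_gt0.
have [N hN] := cu _ e3; have [sn bn] := hu N.
exists (u_ N); split; [exact: sobolev_le sn|exact: bn|].
have sl := sobolev_lin (-1) sn su.
apply: (le_trans (sobolev_norm_le (isT : (2 <= 3)%N) sl)).
rewrite mulrC -ler_pdivlMr// -ler_sqr ?nnegrE ?sobolev_norm_ge0 ?divr_ge0 ?(ltW e0)//.
by rewrite sqr_sobolev_norm; exact: hN.
Qed.

Lemma H0_semi_hilbert : semi_hilbert (H0 Q 3) (@lin R) (sobolev_dot (Omega Q) 3).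
Proof.
have hs := sobolev_semi_hilbert lr bt 3.
rewrite OmegaE; apply: (semi_hilbert_closed hs).
- by move=> u []; rewrite OmegaE.
- by move=> k u v; exact: H0_lin.
- move=> u_ u hu su cu; split; first by rewrite OmegaE.
  by apply: boundary_lim cu => // n; have := hu n; rewrite /H0 OmegaE.
Qed.

End traces.

(** * Euclidean norms of pairs of numbers *)

Section euclidean_norm.
Context (R : realType).
Implicit Types (a b c d t : R).

Lemma hypot_le a b c d : 0 <= a -> 0 <= b -> a <= c -> b <= d ->
  Num.sqrt (a ^+ 2 + b ^+ 2) <= Num.sqrt (c ^+ 2 + d ^+ 2).
Proof.
move=> a0 b0 ac bd; rewrite ler_wsqrtr// lerD// ler_sqr ?nnegrE//.
- exact: le_trans ac.
- exact: le_trans bd.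
Qed.

Lemma hypotD a b c d : 0 <= a -> 0 <= b -> 0 <= c -> 0 <= d ->
  Num.sqrt ((a + c) ^+ 2 + (b + d) ^+ 2) <=
  Num.sqrt (a ^+ 2 + b ^+ 2) + Num.sqrt (c ^+ 2 + d ^+ 2).
Proof.
move=> a0 b0 c0 d0.
have s (x y : R) : 0 <= x ^+ 2 + y ^+ 2 by rewrite addr_ge0 ?sqr_ge0.
apply: (le_trans (ler_norm _)); rewrite -sqrtr_sqr.
have sn : 0 <= Num.sqrt (a ^+ 2 + b ^+ 2) + Num.sqrt (c ^+ 2 + d ^+ 2).
  by rewrite addr_ge0 ?sqrtr_ge0.
rewrite -[leRHS](ger0_norm sn) -sqrtr_sqr ler_wsqrtr//.
suff : a * c + b * d <= Num.sqrt (a ^+ 2 + b ^+ 2) * Num.sqrt (c ^+ 2 + d ^+ 2).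
  rewrite sqr_sqrtr// (sqrrD (Num.sqrt _)) !sqr_sqrtr// mulr2n => h; rewrite !sqrrD !mulr2n; lra.
rewrite -sqrtrM// -[leLHS]ger0_norm ?addr_ge0 ?mulr_ge0// -sqrtr_sqr ler_wsqrtr//.
have := sqr_ge0 (a * d - b * c); nra.
Qed.

Lemma hypotZ a b t : 0 <= t ->
  Num.sqrt ((t * a) ^+ 2 + (t * b) ^+ 2) = t * Num.sqrt (a ^+ 2 + b ^+ 2).
Proof.
by move=> t0; rewrite !exprMn -mulrDr sqrtrM ?sqr_ge0// sqrtr_sqr ger0_norm.
Qed.

(** The value t = a / (a + b) works also for b = 0. It serves wherever a small step along a segment
    has to be chosen. *)
Lemma small_step a b : 0 < a -> 0 <= b -> exists t, [/\ 0 < t, 0 <= t <= 1 & t * b < a].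
Proof.
move=> a0 b0; have ab : 0 < a + b by rewrite ltr_wpDr.
have t0 : 0 < a / (a + b) by rewrite divr_gt0.
have h : a / (a + b) * (a + b) = a by rewrite divfK// gt_eqF.
move: (a / (a + b)) t0 h => t t0 h; exists t.
have ta : 0 < t * a by rewrite mulr_gt0.
split => //; last by lra.
by rewrite ltW//= -(ler_pM2r ab) mul1r h lerDl.
Qed.

End euclidean_norm.

(** * Families depending on the angle *)

Section families.
Context (R : realType) (Q : rectangle R).
Hypotheses (hc1 : 0 < rc1 Q) (hc2 : 0 < rc2 Q).
Notation nrm := (sobolev_norm (Omega Q) 3).
Implicit Types (u v : R * R -> R) (k e t phi : R) (p q : R -> R * R -> R)
  (z w : (R -> R * R -> R) * (R -> R * R -> R)).

Let lr := width_gt0 hc1.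
Let bt := height_gt0 hc2.

Lemma Omega_semi_hilbert m : semi_hilbert (sobolev (Omega Q) m) (@lin R) (sobolev_dot (Omega Q) m).
Proof. by rewrite OmegaE; exact: sobolev_semi_hilbert. Qed.

Lemma Omega_norm_ge0 m u : 0 <= sobolev_norm (Omega Q) m u.
Proof. exact: sqrtr_ge0. Qed.

Lemma norm_convex t u v : 0 <= t <= 1 -> sobolev (Omega Q) 3 u -> sobolev (Omega Q) 3 v ->
  nrm (lin t u (lin (-1) v u)) <= (1 - t) * nrm u + t * nrm v.
Proof.
move=> /andP[t0 t1] su sv; have hs := Omega_semi_hilbert 3.
have -> : lin t u (lin (-1) v u) = lin t (lin (- t) u u) v.
  by apply/funext => x; rewrite /lin; ring.
have s1 := sh_comb hs (- t) su su.
apply: le_trans (norm_comb hs t s1 sv) _; rewrite (ger0_norm t0) lerD2r.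
rewrite (sqr_norm_comb hs (- t) su su).
have t1' : 0 <= 1 - t by rewrite subr_ge0.
rewrite -/(nrm v) (_ : _ + _ + _ = (1 - t) ^+ 2 * sobolev_dot (Omega Q) 3 u u); last by ring.
by rewrite sqrtrM ?sqr_ge0// sqrtr_sqr ger0_norm.
Qed.

Definition famlin k p q : R -> R * R -> R := fun phi => lin k (p phi) (q phi).

(** A witness that the suprema over the angles are taken over a nonempty set. *)
Lemma angle_pi : @angle R pi.
Proof. by rewrite /angle /= in_itv /= pi_gt0 ltr_pMl ?pi_gt0 ?ltr1n. Qed.

Lemma angle_closed phi : angle phi -> 0 <= phi <= 2 * pi.
Proof. by rewrite /angle /= in_itv /= => /andP[h1 h2]; rewrite !ltW. Qed.

Lemma H_norm_ub p phi : H Q p -> angle phi -> nrm (p phi) <= H_norm Q p.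
Proof. by move=> [_ hu] ap; apply: ub_le_sup => //; exists phi. Qed.

Lemma H_norm_lub p k : (forall phi, angle phi -> nrm (p phi) <= k) -> H_norm Q p <= k.
Proof.
move=> h; apply: ge_sup; first by exists (nrm (p pi)), pi => //; exact: angle_pi.
by move=> _ [phi aphi <-]; exact: h.
Qed.

Lemma H_norm_ge0 p : H Q p -> 0 <= H_norm Q p.
Proof. by move=> hp; apply: le_trans (H_norm_ub hp angle_pi); exact: Omega_norm_ge0. Qed.

Lemma H_bounded p k : (forall phi, 0 <= phi <= 2 * pi -> sobolev (Omega Q) 3 (p phi)) ->
  (forall phi, angle phi -> nrm (p phi) <= k) -> H Q p.
Proof. by move=> h1 h2; split => //; exists k => _ [phi aphi <-]; exact: h2. Qed.

Lemma H_lin k p q : H Q p -> H Q q -> H Q (famlin k p q) /\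
  H_norm Q (famlin k p q) <= H_norm Q p + `|k| * H_norm Q q.
Proof.
move=> hp hq; have hs := Omega_semi_hilbert 3.
have b phi : angle phi -> nrm (famlin k p q phi) <= H_norm Q p + `|k| * H_norm Q q.
  move=> aphi; have ac := angle_closed aphi.
  have := norm_comb hs k (hp.1 _ ac) (hq.1 _ ac); move=> /le_trans; apply.
  by rewrite lerD ?H_norm_ub// ler_wpM2l// H_norm_ub.
split; last exact: H_norm_lub.
by apply: H_bounded b => phi ac; apply: (sh_comb hs); [exact: hp.1|exact: hq.1].
Qed.

Lemma H_norm_triangle p q : H Q p -> H Q q ->
  H_norm Q p <= H_norm Q q + H_norm Q (famlin (-1) p q).
Proof.
move=> hp hq; have [h1 _] := H_lin (-1) hp hq; have [_] := H_lin 1 hq h1.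
rewrite normr1 mul1r.
have -> // : famlin 1 q (famlin (-1) p q) = p.
by apply/funext => phi; apply/funext => x; rewrite /famlin /lin; ring.
Qed.

Definition famconv t p q := famlin t p (famlin (-1) q p).

Lemma H_conv t p q : 0 <= t <= 1 -> H Q p -> H Q q -> H Q (famconv t p q) /\
  H_norm Q (famconv t p q) <= (1 - t) * H_norm Q p + t * H_norm Q q.
Proof.
move=> t01 hp hq; have [h1 _] := H_lin (-1) hq hp; have [h2 _] := H_lin t hp h1.
split => //; apply: H_norm_lub => phi aphi; have ac := angle_closed aphi.
apply: le_trans (norm_convex t01 (hp.1 _ ac) (hq.1 _ ac)) _.
case/andP: t01 => t0 t1.
by rewrite lerD ?ler_wpM2l ?subr_ge0 ?H_norm_ub.
Qed.

Lemma famlin_sub p q : (fun phi => p phi \- q phi) = famlin (-1) p q.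
Proof. by apply/funext => phi; rewrite sub_lin. Qed.

Section fixed_boundary_data.
Variables (f h : R -> R * R -> R).
Let bc p := forall phi, angle phi -> boundary_conditions Q (p phi) (f phi) (h phi).

Lemma bc_conv t p q : H Q p -> H Q q -> bc p -> bc q -> bc (famconv t p q).
Proof.
move=> hp hq bp bq phi aphi; have ac := angle_closed aphi.
have s2 : (2 <= 3)%N by [].
apply: (boundary_affine hc1 hc2) (bp _ aphi) (bq _ aphi).
- by have := hp.1 _ ac; rewrite OmegaE; exact: sobolev_le.
- by have := hq.1 _ ac; rewrite OmegaE; exact: sobolev_le.
Qed.

Lemma bc_closed p : H Q p ->
  (forall e, 0 < e -> exists q, [/\ H Q q, bc q & H_norm Q (famlin (-1) p q) < e]) -> bc p.
Proof.
move=> hp hq phi aphi; have ac := angle_closed aphi.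
have s2 : (2 <= 3)%N by [].
have sp : sobolev (Omega Q) 3 (p phi) by exact: hp.1.
apply: (boundary_closed hc1 hc2); first by move: sp; rewrite OmegaE; exact: sobolev_le.
move=> e e0; have e3 : 0 < e / 3 by rewrite divr_gt0.
have [q [hq1 bq n]] := hq _ e3; exists (q phi).
have sq : sobolev (Omega Q) 3 (q phi) by exact: hq1.1.
split; [by move: sq; rewrite OmegaE; exact: sobolev_le|exact: bq|].
have hs := Omega_semi_hilbert 3.
have sl : sobolev (Omega Q) 3 (lin (-1) (q phi) (p phi)) by exact: (sh_comb hs).
have n1 : nrm (lin (-1) (q phi) (p phi)) <= e / 3.
  have -> : nrm (lin (-1) (q phi) (p phi)) = nrm (lin (-1) (p phi) (q phi)).
    exact: (congr1 Num.sqrt (sqr_norm_sub_sym hs sq sp)).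
  have [hl _] := H_lin (-1) hp hq1.
  exact: le_trans (H_norm_ub hl aphi) (ltW n).
rewrite OmegaE in sl n1.
have := le_trans (sobolev_norm_le s2 sl) (ler_wpM2l (ler0n _ 3) n1).
by rewrite (mulrC 3) divfK.
Qed.

End fixed_boundary_data.

Definition fam2conv t z w := (famconv t z.1 w.1, famconv t z.2 w.2).

Lemma H2_conv t z w : 0 <= t <= 1 -> H2 Q z -> H2 Q w -> H2 Q (fam2conv t z w) /\
  H2_norm Q (fam2conv t z w) <= (1 - t) * H2_norm Q z + t * H2_norm Q w.
Proof.
move=> t01 [hz1 hz2] [hw1 hw2].
have [h1 n1] := H_conv t01 hz1 hw1; have [h2 n2] := H_conv t01 hz2 hw2.
have [z10 z20] := (H_norm_ge0 hz1, H_norm_ge0 hz2).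
have [w10 w20] := (H_norm_ge0 hw1, H_norm_ge0 hw2).
case/andP: t01 => t0 t1; have t1' : 0 <= 1 - t by rewrite subr_ge0.
split; first exact: conj h1 h2.
have e (x y s : R) : 0 <= s -> s * Num.sqrt (x ^+ 2 + y ^+ 2) = Num.sqrt ((s * x) ^+ 2 + (s * y) ^+ 2).
  by move=> s0; rewrite hypotZ.
rewrite /H2_norm (e _ _ _ t0) (e _ _ _ t1').
apply: le_trans (hypotD (mulr_ge0 t1' z10) (mulr_ge0 t1' z20) (mulr_ge0 t0 w10) (mulr_ge0 t0 w20)).
exact: hypot_le (H_norm_ge0 h1) (H_norm_ge0 h2) n1 n2.
Qed.

Variables (eps rad : R) (g0 g1 : R -> R * R -> R).
Hypothesis rad0 : 0 < rad.
Notation B := (B Q eps g0 g1 rad).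
Notation clB := (clB Q eps g0 g1 rad).

(** A family of norm at most [rad] is approached along the segment towards [z0]: convexity of the
    norm makes the points (1 - t) z + t z0 lie strictly inside the ball, and the boundary data are
    unchanged. This is where nonemptiness of the open ball enters. *)
Lemma clBP z0 z : B z0 ->
  clB z <-> [/\ H2 Q z, BC1 Q g0 g1 z.1, BC2 Q eps g0 g1 z.2 & H2_norm Q z <= rad].
Proof.
move=> [hz0 nz0 b10 b20]; split=> [[hz hw]|[hz b1 b2 nz]].
  have hz' := hz; case: hz' => hz1 hz2.
  split; first exact: hz.
  - apply: bc_closed => // e /hw [w [[[hw1 hw2] nw bw1 bw2] n]].
    exists w.1; split => //; apply: le_lt_trans n.
    have [h1 _] := H_lin (-1) hz1 hw1.
    by rewrite !famlin_sub -[leLHS](ger0_norm (H_norm_ge0 h1)) -sqrtr_sqr ler_wsqrtr// lerDl sqr_ge0.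
  - apply: bc_closed => // e /hw [w [[[hw1 hw2] nw bw1 bw2] n]].
    exists w.2; split => //; apply: le_lt_trans n.
    have [h2 _] := H_lin (-1) hz2 hw2.
    by rewrite !famlin_sub -[leLHS](ger0_norm (H_norm_ge0 h2)) -sqrtr_sqr ler_wsqrtr// lerDr sqr_ge0.
  - apply/ler_addgt0Pr => e /hw [w [[[hw1 hw2] nw bw1 bw2] n]].
    rewrite !famlin_sub in n.
    have [h1 _] := H_lin (-1) hz1 hw1; have [h2 _] := H_lin (-1) hz2 hw2.
    have n1 := H_norm_triangle hz1 hw1; have n2 := H_norm_triangle hz2 hw2.
    apply: (@le_trans _ _ (H2_norm Q w + H2_norm Q (famlin (-1) z.1 w.1, famlin (-1) z.2 w.2))); last first.
      by apply: lerD; exact: ltW.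
    apply: le_trans (hypotD (H_norm_ge0 hw1) (H_norm_ge0 hw2) (H_norm_ge0 h1) (H_norm_ge0 h2)).
    exact: hypot_le (H_norm_ge0 hz1) (H_norm_ge0 hz2) n1 n2.
split => // e e0.
have [hz1 hz2] := hz; have [hz01 hz02] := hz0.
have [h1 n1] := H_lin (-1) hz01 hz1; have [h2 n2] := H_lin (-1) hz02 hz2.
pose m := H2_norm Q (famlin (-1) z0.1 z.1, famlin (-1) z0.2 z.2).
have m0 : 0 <= m by exact: sqrtr_ge0.
have [t [t0 t01 tme]] := small_step e0 m0.
have /andP[_ t1] := t01; have t1' : 0 <= 1 - t by rewrite subr_ge0.
have [hw nw] := H2_conv t01 hz hz0.
exists (fam2conv t z z0); split.
  split; first exact: hw.
  - apply: le_lt_trans nw _.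
    apply: (@lt_le_trans _ _ ((1 - t) * rad + t * rad)); last by rewrite -mulrDl subrK mul1r.
    apply: ler_ltD; first exact: ler_wpM2l t1' _ _ nz.
    rewrite (ltr_pM2l t0); exact: nz0.
  - exact: (bc_conv t hz1 hz01 b1 b10).
  - exact: (bc_conv t hz2 hz02 b2 b20).
rewrite /= !famlin_sub.
apply: (@le_lt_trans _ _ (t * m)); last exact: tme.
rewrite /m /H2_norm -hypotZ ?(ltW t0)//=.
have e2 p q : H Q p -> H Q q -> 0 <= H_norm Q (famlin (-1) p (famconv t p q)) <= t * H_norm Q (famlin (-1) q p).
  move=> hp hq; have [hc _] := H_conv t01 hp hq; have [hl _] := H_lin (-1) hp hc.
  have [hqp _] := H_lin (-1) hq hp.
  rewrite (H_norm_ge0 hl)/=; apply: H_norm_lub => phi aphi.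
  have hs := Omega_semi_hilbert 3; have ac := angle_closed aphi.
  have s1 := hqp.1 _ ac.
  (* The difference is - t times the difference of [q] and [p], written with the only operation
     available. *)
  have -> : famlin (-1) p (famconv t p q) phi = lin (- (1 + t)) (famlin (-1) q p phi) (famlin (-1) q p phi).
    by apply/funext => x; rewrite /famconv /famlin /lin; ring.
  rewrite /sobolev_norm (sqr_norm_comb hs _ s1 s1).
  rewrite (_ : _ + _ + _ = t ^+ 2 * sobolev_dot (Omega Q) 3 (famlin (-1) q p phi) (famlin (-1) q p phi)); last by ring.
  rewrite sqrtrM ?sqr_ge0// sqrtr_sqr (ger0_norm (ltW t0)) ler_wpM2l ?(ltW t0)//.
  exact: H_norm_ub.
have /andP[a1 a2] := e2 _ _ hz1 hz01; have /andP[a3 a4] := e2 _ _ hz2 hz02.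
exact: hypot_le a1 a3 a2 a4.
Qed.

Lemma clB_conv z0 t z w : B z0 -> 0 <= t <= 1 -> clB z -> clB w -> clB (fam2conv t z w).
Proof.
move=> Bz0 t01 /(clBP _ Bz0)[hz b1 b2 nz] /(clBP _ Bz0)[hw b1' b2' nw].
have [hc nc] := H2_conv t01 hz hw.
case: (hz) (hw) => hz1 hz2 [hw1 hw2].
apply/(clBP _ Bz0); split; first exact: hc.
- exact: (bc_conv t hz1 hw1 b1 b1').
- exact: (bc_conv t hz2 hw2 b2 b2').
- apply: le_trans nc _; case/andP: t01 => t0 t1.
  have -> : rad = (1 - t) * rad + t * rad by ring.
  have t1' : 0 <= 1 - t by rewrite subr_ge0.
  exact: lerD (ler_wpM2l t1' nz) (ler_wpM2l t0 nw).
Qed.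

Lemma slice_conv t z w phi : slice (fam2conv t z w) phi =
  prod_comb (@lin R) t (slice z phi) (prod_comb (@lin R) (-1) (slice w phi) (slice z phi)).
Proof. by []. Qed.

Lemma clB_slice z0 z phi : B z0 -> clB z -> angle phi ->
  [/\ sobolev (Omega Q) 3 (slice z phi).1, sobolev (Omega Q) 3 (slice z phi).2 &
     pair_norm (Omega Q) 3 (slice z phi) <= rad].
Proof.
move=> Bz0 /(clBP _ Bz0)[[h1 h2] _ _ nz] aphi; have ac := angle_closed aphi.
split; [exact: h1.1|exact: h2.1|].
by apply: le_trans nz; apply: hypot_le; rewrite ?Omega_norm_ge0 ?H_norm_ub.
Qed.

Lemma clB_sub z0 z w phi : B z0 -> clB z -> clB w -> angle phi ->
  H0 Q 3 (lin (-1) (z.1 phi) (w.1 phi)) /\ H0 Q 3 (lin (-1) (z.2 phi) (w.2 phi)).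
Proof.
move=> Bz0 /(clBP _ Bz0)[[h1 h2] b1 b2 _] /(clBP _ Bz0)[[h1' h2'] b1' b2' _] aphi.
have ac := angle_closed aphi.
have := (h1.1 _ ac, h2.1 _ ac, h1'.1 _ ac, h2'.1 _ ac); rewrite OmegaE => -[[[s1 s2] s1'] s2'].
by split; apply: boundary_sub => //; [exact: b1|exact: b1'|exact: b2|exact: b2'].
Qed.

End families.

(** * Pairs of functions *)

Section pair_norms.
Context (R : realType) (l r b t : R).
Hypotheses (lr : l < r) (bt : b < t).
Notation D := (box l r b t).
Notation fn := (R * R -> R).
Notation pr := (fn * fn)%type.
Implicit Types (z h d : pr) (i : bool).

Lemma pair_semi_hilbert : semi_hilbert (fun z : pr => sobolev D 3 z.1 /\ sobolev D 3 z.2)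
  (prod_comb (@lin R)) (pair_dot D 3).
Proof. exact: (semi_hilbert_prod (sobolev_semi_hilbert lr bt 3)). Qed.

Lemma pair_normE z : pair_norm D 3 z = Num.sqrt (pair_dot D 3 z z).
Proof.
have e u : sobolev_norm D 3 u ^+ 2 = sobolev_dot D 3 u u by exact: sqr_sobolev_norm.
exact: (congr1 Num.sqrt (congr2 _ (e z.1) (e z.2))).
Qed.

Lemma sqr_pair_norm z : pair_norm D 3 z ^+ 2 = pair_dot D 3 z z.
Proof. by rewrite pair_normE sqr_sqrtr// addr_ge0// sobolev_dot_ge0. Qed.

(** A boolean index lets a single argument treat both components, and both operators. *)
Definition cpt i z := if i then z.1 else z.2.

Lemma cpt_norm i z : sobolev_norm D 3 (cpt i z) <= pair_norm D 3 z.
Proof.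
rewrite -[leLHS](ger0_norm (sobolev_norm_ge0 _ _ _ _ _ _)) -sqrtr_sqr ler_wsqrtr//.
by case: i; [rewrite lerDl|rewrite lerDr]; exact: sqr_ge0.
Qed.

Lemma cpt_sobolev i z : sobolev D 3 z.1 /\ sobolev D 3 z.2 -> sobolev D 3 (cpt i z).
Proof. by move=> [h1 h2]; case: i; [exact: h1|exact: h2]. Qed.

End pair_norms.

(** * Uniform bounds on gradients *)

Section gradient.
Context (R : realType) (l r b t : R).
Hypotheses (lr : l < r) (bt : b < t).
Notation plane := (measurableTypeR R * measurableTypeR R)%type.
Notation D := (box l r b t).
Notation L2le := (L2le (leb2 R) D).
Notation ess := (ess_bounded (leb2 R) D).

(** Three derivatives are what [ess_bound_of_mixed] asks for: the mixed second derivatives of the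
    two gradient components are [Dw D 2 1 u] and [Dw D 1 2 u]. *)
Lemma gradient_bound : exists2 K, 0 <= K & forall u, sobolev D 3 u ->
  ess (Dw D 1 0 u) (K * sobolev_norm D 3 u) /\ ess (Dw D 0 1 u) (K * sobolev_norm D 3 u).
Proof.
pose m := (r - l) / 2 * ((t - b) / 2).
have m0 : 0 < m by rewrite mulr_gt0// divr_gt0// subr_gt0.
pose B := 4 * (1 + ((r - l) / 2) ^+ 2) * (1 + ((t - b) / 2) ^+ 2).
have B0 : 0 <= B.
  by rewrite /B !mulr_ge0// addr_ge0 ?sqr_ge0.
exists (Num.sqrt (B / m)) => [|u su]; first exact: sqrtr_ge0.
have key (f : R * R -> R) : measurable_fun (D : set plane) f ->
    {ae leb2 R, forall p, D p -> m * f p ^+ 2 <= B * sobolev_norm D 3 u ^+ 2} ->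
    ess f (Num.sqrt (B / m) * sobolev_norm D 3 u).
  move=> mf af; split => //; apply: ae_imp1 af _ => p hp Dp.
  rewrite -sqrtr_sqr -[X in _ <= _ * X](ger0_norm (sobolev_norm_ge0 _ _ _ _ _ _)) -sqrtr_sqr.
  rewrite -sqrtrM ?divr_ge0// ?(ltW m0)// ler_wsqrtr// mulrAC ler_pdivlMr// mulrC.
  exact: hp.
have L (i j : nat) : (i + j <= 3)%N -> L2le (Dw D i j u) (sobolev_norm D 3 u) by exact: Dw_L2le.
have M (i j : nat) : (i + j <= 3)%N -> measurable_fun (D : set plane) (Dw D i j u).
  by move=> ij; have [] := Dw_sqi su ij.
split; [apply: (key _ (M 1%N 0%N isT))|apply: (key _ (M 0%N 1%N isT))].
- apply: (@ess_bound_of_mixed R l r b t _ (Dw D 2 0 u) (Dw D 1 1 u) (Dw D 2 1 u)).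
  + exact: lr. + exact: bt.
  + exact: (L 1%N 0%N isT). + exact: (L 2%N 0%N isT). + exact: (L 1%N 1%N isT). + exact: (L 2%N 1%N isT).
  + exact: weak_dx_Dw su _. + exact: weak_dy_Dw su _. + exact: weak_dx_Dw su _.
- apply: (@ess_bound_of_mixed R l r b t _ (Dw D 1 1 u) (Dw D 0 2 u) (Dw D 1 2 u)).
  + exact: lr. + exact: bt.
  + exact: (L 0%N 1%N isT). + exact: (L 1%N 1%N isT). + exact: (L 0%N 2%N isT). + exact: (L 1%N 2%N isT).
  + exact: weak_dx_Dw su _. + exact: weak_dy_Dw su _. + exact: weak_dx_Dw su _.
Qed.

End gradient.

(** * The functional *)

Section weighted_functional.
Context (R : realType).
Notation plane := (measurableTypeR R * measurableTypeR R)%type.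
Notation fn := (R * R -> R).
Notation pr := (fn * fn)%type.
Implicit Types (u v w f g : fn) (k e a c : R) (z h d : pr) (i : bool).
Variables (D : set (R * R)) (mD : measurable (D : set plane)).
Notation sqi := (square_integrable (leb2 R) D).
Notation L2le := (L2le (leb2 R) D).
Notation ess := (ess_bounded (leb2 R) D).

(* [dw i j] is the derivative of order [(i, j)] and [S] the Sobolev space of
   order three; only linearity and a priori bounds matter here. *)
Variables (S : fn -> Prop) (dw : nat -> nat -> fn -> fn) (dot : pr -> pr -> R) (omega : fn).
Variables (eps K M alpha : R).
Hypotheses (eps0 : 0 < eps) (K0 : 0 <= K) (M0 : 0 <= M) (alpha01 : 0 < alpha < 1).
Hypothesis hM : ess omega M.

Let V z := S z.1 /\ S z.2.
Let comb := prod_comb (@lin R).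
Hypothesis hs : semi_hilbert V comb dot.
Let N z := Num.sqrt (dot z z).

Hypothesis hlin : forall p q k u v, (p + q <= 2)%N -> S u -> S v ->
  {ae leb2 R, forall x, D x -> dw p q (lin k u v) x = dw p q u x + k * dw p q v x}.
Hypothesis hL2 : forall p q i z, (p + q <= 2)%N -> V z -> L2le (dw p q (cpt i z)) (N z).
Hypothesis hK : forall i z, V z ->
  ess (dw 1 0 (cpt i z)) (K * N z) /\ ess (dw 0 1 (cpt i z)) (K * N z).

Definition wdot u v := int2 D (fun p => u p * v p * omega p).

Lemma wdot_itg u v : sqi u -> sqi v ->
  (leb2 R).-integrable D (EFin \o (fun p => u p * v p * omega p)).
Proof.
move=> su sv; have := ess_bounded_itg mD hM (sqi_itgM mD su sv).
by apply: eq_itg => // p _; rewrite mulrC.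
Qed.

Lemma wdotC u v : wdot u v = wdot v u.
Proof. by apply: eq_int2 => p _; rewrite (mulrC (u p)). Qed.

Lemma wdot_lin k u v w : sqi u -> sqi v -> sqi w ->
  wdot (lin k u v) w = wdot u w + k * wdot v w.
Proof.
move=> su sv sw; rewrite /wdot -int2Z//; last exact: wdot_itg.
rewrite -int2D//; [|exact: wdot_itg|by apply: itgZ => //; exact: wdot_itg].
by apply: eq_int2 => p _; rewrite /lin; ring.
Qed.

Lemma wdot_sqr_lin k u v : sqi u -> sqi v ->
  wdot (lin k u v) (lin k u v) = wdot u u + 2 * k * wdot u v + k ^+ 2 * wdot v v.
Proof.
move=> su sv; have sl : sqi (lin k u v) by apply: sqiD => //; exact: sqiZ.
rewrite wdot_lin// !(wdotC _ (lin k u v)) !wdot_lin// (wdotC v u); ring.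
Qed.

Lemma wdot_le u v a c : L2le u a -> L2le v c -> `|wdot u v| <= M * a * c.
Proof. by move=> ua vc; exact: (L2le_dotw mD hM M0 ua vc). Qed.

Lemma ae_wdot u v u' v' : sqi u -> sqi v ->
  measurable_fun (D : set plane) u' -> measurable_fun (D : set plane) v' ->
  {ae leb2 R, forall p, D p -> u' p = u p} -> {ae leb2 R, forall p, D p -> v' p = v p} ->
  wdot u' v' = wdot u v.
Proof.
move=> [mu_ _] [mv _] mu' mv' uu vv.
have mpsi : measurable_fun (D : set plane) (omega) by case: hM.
apply: ae_int2 => //.
- by apply: measurable_funM mpsi; exact: measurable_funM.
- by apply: measurable_funM mpsi; exact: measurable_funM.
- by apply: ae_imp2 uu vv _ => p h1 h2 Dp; rewrite h1// h2.
Qed.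

(* [Lop true] and [Lop false] are the operators L_1 and L_2 of the pair [z];
   [bil] is their common bilinear part and [dLop] their linearization. *)
Definition bil z h p : R := 2 / eps *
  (dw 1 0 z.1 p * (dw 1 0 h.1 p - dw 1 0 h.2 p) +
   dw 0 1 z.1 p * (dw 0 1 h.1 p - dw 0 1 h.2 p)).

Definition lap u p : R := dw 2 0 u p + dw 0 2 u p.

Definition Lop i z p := lap (cpt i z) p + bil z z p.

Definition dLop i z h p := lap (cpt i h) p + (bil z h p + bil h z p).

(** The prefactor 2 / eps times two products; in each, a gradient component is at most [K * N z] in
    absolute value and a difference of two components has L^2 norm at most [2 * N h]. *)
Definition bil_const : R := 8 * K / eps.

Lemma bil_const_ge0 : 0 <= bil_const.
Proof. by rewrite divr_ge0 ?mulr_ge0// ltW. Qed.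

Lemma eq_L2le_bound u a c : a = c -> L2le u a -> L2le u c.
Proof. by move=> ->. Qed.

Lemma N_ge0 z : 0 <= N z. Proof. exact: sqrtr_ge0. Qed.

Lemma cpt_S i z : V z -> S (cpt i z).
Proof. by move=> [h1 h2]; case: i. Qed.

Lemma bil_L2 z h : V z -> V h -> L2le (bil z h) (bil_const * N z * N h).
Proof.
move=> Vz Vh; have [c1 c2] := hK true Vz.
have KN0 : 0 <= K * N z by rewrite mulr_ge0// N_ge0.
have h1 := L2leM mD c1 KN0 (L2leB mD (hL2 true (isT : (1 + 0 <= 2)%N) Vh) (hL2 false (isT : (1 + 0 <= 2)%N) Vh)).
have h2 := L2leM mD c2 KN0 (L2leB mD (hL2 true (isT : (0 + 1 <= 2)%N) Vh) (hL2 false (isT : (0 + 1 <= 2)%N) Vh)).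
apply: (eq_L2le_bound _ (L2leZ mD (2 / eps) (L2leD mD h1 h2))).
have e0 : 0 <= 2 / eps by rewrite divr_ge0// ltW.
by rewrite (ger0_norm e0) /bil_const; field; rewrite gt_eqF.
Qed.

Lemma lap_L2 i h : V h -> L2le (lap (cpt i h)) (2 * N h).
Proof.
move=> Vh.
have := L2leD mD (hL2 i (isT : (2 + 0 <= 2)%N) Vh) (hL2 i (isT : (0 + 2 <= 2)%N) Vh).
by apply: eq_L2le_bound; ring.
Qed.

Lemma Lop_L2 i z : V z -> L2le (Lop i z) (2 * N z + bil_const * N z * N z).
Proof. by move=> Vz; exact: (L2leD mD (lap_L2 i Vz) (bil_L2 Vz Vz)). Qed.

Lemma dLop_L2 i z h : V z -> V h -> L2le (dLop i z h) (2 * N h + 2 * bil_const * N z * N h).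
Proof.
move=> Vz Vh.
have := L2leD mD (lap_L2 i Vh) (L2leD mD (bil_L2 Vz Vh) (bil_L2 Vh Vz)).
by apply: eq_L2le_bound; ring.
Qed.

Lemma lap_comb i k z h : V z -> V h -> {ae leb2 R, forall p, D p ->
  lap (cpt i (comb k z h)) p = lap (cpt i z) p + k * lap (cpt i h) p}.
Proof.
move=> Vz Vh; have sz := cpt_S i Vz; have sh := cpt_S i Vh.
have -> : cpt i (comb k z h) = lin k (cpt i z) (cpt i h) by case: (i).
apply: ae_imp2 (hlin k (isT : (2 + 0 <= 2)%N) sz sh)
  (hlin k (isT : (0 + 2 <= 2)%N) sz sh) _ => p h1 h2 Dp.
by rewrite /lap h1// h2//; ring.
Qed.

Lemma grad_comb k z h : V z -> V h -> {ae leb2 R, forall p, D p ->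
  forall i, dw 1 0 (cpt i (comb k z h)) p = dw 1 0 (cpt i z) p + k * dw 1 0 (cpt i h) p /\
    dw 0 1 (cpt i (comb k z h)) p = dw 0 1 (cpt i z) p + k * dw 0 1 (cpt i h) p}.
Proof.
move=> [z1 z2] [h1 h2].
have a1 := ae_imp2 (hlin k (isT : (1 + 0 <= 2)%N) z1 h1)
  (hlin k (isT : (0 + 1 <= 2)%N) z1 h1) (fun p x y => conj x y).
have a2 := ae_imp2 (hlin k (isT : (1 + 0 <= 2)%N) z2 h2)
  (hlin k (isT : (0 + 1 <= 2)%N) z2 h2) (fun p x y => conj x y).
apply: ae_imp2 a1 a2 _ => p [e1 e2] [e3 e4] Dp [] /=.
  by split; [exact: e1|exact: e2].
by split; [exact: e3|exact: e4].
Qed.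

Lemma comb_V k z h : V z -> V h -> V (comb k z h).
Proof. exact: (sh_comb hs). Qed.

(** The operators are quadratic, so their second-order expansion is exact: the nested [lin] reads L
    z + k dL z h + k^2 bil h h. *)
Lemma Lop_comb i k z h : V z -> V h -> {ae leb2 R, forall p, D p ->
  Lop i (comb k z h) p = lin k (Lop i z) (lin k (dLop i z h) (bil h h)) p}.
Proof.
move=> Vz Vh; apply: ae_imp2 (lap_comb i k Vz Vh) (grad_comb k Vz Vh) _ => p el eg Dp.
have [e1 e2] := eg Dp true; have [e3 e4] := eg Dp false.
by rewrite /Lop el// /bil e1 e2 e3 e4 /lin /dLop /bil /cpt; ring.
Qed.

Lemma dLop_combr i k z h d : V h -> V d -> {ae leb2 R, forall p, D p ->
  dLop i z (comb k h d) p = lin k (dLop i z h) (dLop i z d) p}.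
Proof.
move=> Vh Vd; apply: ae_imp2 (lap_comb i k Vh Vd) (grad_comb k Vh Vd) _ => p el eg Dp.
have [e1 e2] := eg Dp true; have [e3 e4] := eg Dp false.
by rewrite /dLop el// /bil e1 e2 e3 e4 /lin /dLop /bil /cpt; ring.
Qed.

Lemma dLop_combl i k z h d : V h -> V d -> {ae leb2 R, forall p, D p ->
  dLop i (comb k h d) z p = lin k (dLop i h z) (fun p => bil d z p + bil z d p) p}.
Proof.
move=> Vh Vd; apply: ae_imp1 (grad_comb k Vh Vd) _ => p eg Dp.
have [e1 e2] := eg Dp true; have [e3 e4] := eg Dp false.
by rewrite /dLop /bil e1 e2 e3 e4 /lin /dLop /bil /cpt; ring.
Qed.

Definition DJ z h := 2 * Num.sqrt eps * (wdot (Lop true z) (dLop true z h) +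
  wdot (Lop false z) (dLop false z h)) + 2 * alpha * dot z h.

(** The coefficient of k^2 in the weighted integral along z + k h. It still depends on [k] through
    the cubic and quartic terms; the value k = 1 is the remainder for the increment [h]. *)
Definition JR k z h := Num.sqrt eps * (
  (wdot (lin k (dLop true z h) (bil h h)) (lin k (dLop true z h) (bil h h)) +
   2 * wdot (Lop true z) (bil h h)) +
  (wdot (lin k (dLop false z h) (bil h h)) (lin k (dLop false z h) (bil h h)) +
   2 * wdot (Lop false z) (bil h h))).

Definition JJ z := Num.sqrt eps * (wdot (Lop true z) (Lop true z) +
  wdot (Lop false z) (Lop false z)) + alpha * N z ^+ 2.

Lemma sqr_N z : V z -> N z ^+ 2 = dot z z.
Proof. by move=> Vz; rewrite sqr_sqrtr// (sh_ge0 hs). Qed.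

Lemma Lop_sqi i z : V z -> sqi (Lop i z). Proof. by move=> /(Lop_L2 i) []. Qed.
Lemma dLop_sqi i z h : V z -> V h -> sqi (dLop i z h).
Proof. by move=> Vz /(dLop_L2 i Vz) []. Qed.
Lemma bil_sqi z h : V z -> V h -> sqi (bil z h).
Proof. by move=> Vz /(bil_L2 Vz) []. Qed.

Lemma sqi_lin k u v : sqi u -> sqi v -> sqi (lin k u v).
Proof. by move=> su sv; apply: sqiD => //; exact: sqiZ. Qed.

Lemma JJ_expand k z h : V z -> V h ->
  JJ (comb k z h) = JJ z + k * DJ z h + k ^+ 2 * (JR k z h + alpha * N h ^+ 2).
Proof.
move=> Vz Vh; have Vk := comb_V k Vz Vh.
have q := bil_sqi Vh Vh.
have e i : wdot (Lop i (comb k z h)) (Lop i (comb k z h)) =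
    wdot (Lop i z) (Lop i z) + 2 * k * (wdot (Lop i z) (dLop i z h) + k * wdot (Lop i z) (bil h h)) +
    k ^+ 2 * wdot (lin k (dLop i z h) (bil h h)) (lin k (dLop i z h) (bil h h)).
  have s1 := Lop_sqi i Vz; have s2 := dLop_sqi i Vz Vh.
  have s3 := sqi_lin k s2 q; have s4 := sqi_lin k s1 s3.
  have a := Lop_comb i k Vz Vh.
  have [m _] := Lop_sqi i Vk.
  rewrite (ae_wdot s4 s4 m m a a) wdot_sqr_lin// (wdotC _ (lin k (dLop i z h) _)) wdot_lin//.
  by rewrite (wdotC _ (Lop i z)) (wdotC (bil h h)).
rewrite /JJ !e !sqr_N// (sqr_norm_comb hs)// /JR /DJ; ring.
Qed.

Lemma DJ_comb k z h d : V z -> V h -> V d -> DJ z (comb k h d) = DJ z h + k * DJ z d.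
Proof.
move=> Vz Vh Vd; have Vk := comb_V k Vh Vd.
have e i : wdot (Lop i z) (dLop i z (comb k h d)) =
    wdot (Lop i z) (dLop i z h) + k * wdot (Lop i z) (dLop i z d).
  have s1 := dLop_sqi i Vz Vh; have s2 := dLop_sqi i Vz Vd; have s0 := Lop_sqi i Vz.
  have [m0 _] := s0; have [m _] := dLop_sqi i Vz Vk.
  rewrite (ae_wdot s0 (sqi_lin k s1 s2) m0 m (aeW _ (fun p _ => erefl)) (dLop_combr i k z Vh Vd)).
  by rewrite wdotC wdot_lin// !(wdotC _ (Lop i z)).
by rewrite /DJ !e (dot_combr hs)//; ring.
Qed.

(** Bounds valid on the ball of radius [rho]: this one for the L^2 norm of [Lop], the next ones for
    [JR] relative to the squared norm of [h], for [DJ] relative to the norm of [h], and for the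
    Lipschitz constant of [DJ]. The parameter [alpha] is replaced by 1, so none of them depends on
    it. *)
Definition Lop_const rho : R := 2 * rho + bil_const * rho * rho.
Definition remainder_const rho : R := 2 * Num.sqrt eps * M *
  ((2 + 3 * bil_const * rho) ^+ 2 + 2 * Lop_const rho * bil_const).
Definition derivative_const rho : R := 4 * Num.sqrt eps * M * Lop_const rho * (2 + 2 * bil_const * rho) + 2 * rho.
Definition lipschitz_const rho : R := 4 * Num.sqrt eps * M *
  ((2 + 4 * bil_const * rho) * (2 + 2 * bil_const * rho) + Lop_const rho * (2 * bil_const)) + 2.

Section bounded_arguments.
Variables (rho : R).

Let k0 : 0 <= bil_const := bil_const_ge0.

Lemma rho_ge0 z : N z <= rho -> 0 <= rho.
Proof. exact: le_trans (N_ge0 z). Qed.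

Lemma Lop_le i z : V z -> N z <= rho -> L2le (Lop i z) (Lop_const rho).
Proof.
move=> Vz nz; apply: L2le_le (Lop_L2 i Vz); have n0 := N_ge0 z.
have : bil_const * N z * N z <= bil_const * rho * rho.
  rewrite -(mulrA _ (N z)) -(mulrA _ rho); apply: (ler_wpM2l k0).
  exact: (ler_pM n0 n0 nz nz).
rewrite /Lop_const; lra.
Qed.

Lemma dLop_le i z h : V z -> V h -> N z <= rho -> L2le (dLop i z h) ((2 + 2 * bil_const * rho) * N h).
Proof.
move=> Vz Vh nz; apply: L2le_le (dLop_L2 i Vz Vh); have n0 := N_ge0 z.
have : 2 * bil_const * N z * N h <= 2 * bil_const * rho * N h.
  by rewrite ler_wpM2r ?N_ge0// ler_wpM2l// mulr_ge0.
lra.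
Qed.

Lemma JR_bound k z h : V z -> V h -> `|k| <= 1 -> N z <= rho -> N h <= rho ->
  `|JR k z h| <= remainder_const rho * N h ^+ 2.
Proof.
move=> Vz Vh k1 nz nh; have h0 := N_ge0 h; have r0 := rho_ge0 nz.
have q := bil_L2 Vh Vh.
(* Of the 3 copies of [bil_const], two come from the linearization and one from [bil h h], where one
   factor [N h] is bounded by [rho]. *)
have X i : L2le (lin k (dLop i z h) (bil h h)) ((2 + 3 * bil_const * rho) * N h).
  apply: L2le_le (L2leD mD (dLop_le i Vz Vh nz) (L2leZ mD k q)).
  have a1 : bil_const * N h * N h <= bil_const * rho * N h by rewrite ler_wpM2r// ler_wpM2l.
  have a2 : 0 <= bil_const * N h * N h by nneg.
  have := ler_piMl a2 k1; lra.
have b1 i := wdot_le (X i) (X i); have b2 i := wdot_le (Lop_le i Vz nz) q.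
have b3 i : `|wdot (lin k (dLop i z h) (bil h h)) (lin k (dLop i z h) (bil h h)) +
   2 * wdot (Lop i z) (bil h h)| <= M * ((2 + 3 * bil_const * rho) ^+ 2 + 2 * Lop_const rho * bil_const) * N h ^+ 2.
  apply: (le_trans (ler_normD _ _)); rewrite normrM (ger0_norm (ler0n _ 2)).
  have := b1 i; have := b2 i; lra.
rewrite /JR normrM (ger0_norm (sqrtr_ge0 _)).
have : `|_ + _| <= _ := le_trans (ler_normD _ _) (lerD (b3 true) (b3 false)).
move/(ler_wpM2l (sqrtr_ge0 eps)); rewrite /remainder_const; lra.
Qed.

Lemma DJ_bound z h : V z -> V h -> N z <= rho -> `|DJ z h| <= derivative_const rho * N h.
Proof.
move=> Vz Vh nz; have h0 := N_ge0 h; have r0 := rho_ge0 nz.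
have b i := wdot_le (Lop_le i Vz nz) (dLop_le i Vz Vh nz).
have s0 := sqrtr_ge0 eps.
have [a0 a1] := andP alpha01.
apply: (le_trans (ler_normD _ _)); rewrite !normrM !(ger0_norm (ler0n _ 2)) (ger0_norm s0) (ger0_norm (ltW a0)).
have b3 := ler_wpM2l (mulr_ge0 (ler0n _ 2) s0) (le_trans (ler_normD _ _) (lerD (b true) (b false))).
have b4 : `|dot z h| <= rho * N h.
  by apply: le_trans (dot_le_norm hs Vz Vh) _; rewrite ler_wpM2r.
have b5 : 2 * alpha * `|dot z h| <= 2 * (rho * N h).
  by rewrite ler_pM ?mulr_ge0 ?(ltW a0)//; lra.
rewrite /derivative_const; lra.
Qed.

Lemma DJ_lip z d h : V z -> V d -> V h -> N z <= rho -> N d <= 2 * rho -> N (comb 1 z d) <= rho ->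
  `|DJ (comb 1 z d) h - DJ z h| <= lipschitz_const rho * N d * N h.
Proof.
move=> Vz Vd Vh nz nd nzd; have h0 := N_ge0 h; have r0 := rho_ge0 nz; have d0 := N_ge0 d.
have Vc := comb_V 1 Vz Vd.
pose E i := lin 1 (dLop i z d) (bil d d).
pose c p := bil d h p + bil h d p.
have LE i : L2le (E i) ((2 + 4 * bil_const * rho) * N d).
  apply: L2le_le (L2leD mD (dLop_le i Vz Vd nz) (L2leZ mD 1 (bil_L2 Vd Vd))).
  rewrite normr1 mul1r.
  have : bil_const * N d * N d <= bil_const * (2 * rho) * N d by rewrite ler_wpM2r// ler_wpM2l.
  lra.
have Lc : L2le c (2 * bil_const * N d * N h).
  by apply: eq_L2le_bound (L2leD mD (bil_L2 Vd Vh) (bil_L2 Vh Vd)); ring.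
have LB i := dLop_le i Vc Vh nzd.
have LA i := Lop_le i Vz nz.
have sA i : sqi (Lop i z) by exact: Lop_sqi.
have sB i : sqi (dLop i z h) by exact: dLop_sqi.
have sB' i : sqi (dLop i (comb 1 z d) h) by exact: dLop_sqi.
have sE i : sqi (E i) by case: (LE i).
have sc : sqi c by case: Lc.
(* A product rule for differences: [E i] is the increment of the operator and [c] the increment of
   its linearization. *)
have e i : wdot (Lop i (comb 1 z d)) (dLop i (comb 1 z d) h) - wdot (Lop i z) (dLop i z h) =
    wdot (E i) (dLop i (comb 1 z d) h) + wdot (Lop i z) c.
  have [m1 _] := Lop_sqi i Vc; have [m2 _] := sB' i; have [m3 _] := sA i.
  rewrite (ae_wdot (sqi_lin 1 (sA i) (sE i)) (sB' i) m1 m2 (Lop_comb i 1 Vz Vd) (aeW _ (fun p _ => erefl))).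
  rewrite wdot_lin// mul1r.
  rewrite (ae_wdot (sA i) (sqi_lin 1 (sB i) sc) m3 m2 (aeW _ (fun p _ => erefl)) (dLop_combl i 1 h Vz Vd)).
  rewrite (wdotC _ (lin 1 _ _)) wdot_lin// mul1r (wdotC (dLop i z h)) (wdotC c); ring.
have b i : `|wdot (Lop i (comb 1 z d)) (dLop i (comb 1 z d) h) - wdot (Lop i z) (dLop i z h)| <=
    M * ((2 + 4 * bil_const * rho) * (2 + 2 * bil_const * rho) + Lop_const rho * (2 * bil_const)) * (N d * N h).
  rewrite e; apply: (le_trans (ler_normD _ _)).
  have := wdot_le (LE i) (LB i); have := wdot_le (LA i) Lc; lra.
have s0 := sqrtr_ge0 eps; have [a0 a1] := andP alpha01.
have -> : DJ (comb 1 z d) h - DJ z h =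
   2 * Num.sqrt eps * ((wdot (Lop true (comb 1 z d)) (dLop true (comb 1 z d) h) - wdot (Lop true z) (dLop true z h)) +
    (wdot (Lop false (comb 1 z d)) (dLop false (comb 1 z d) h) - wdot (Lop false z) (dLop false z h))) +
   2 * alpha * dot d h.
  by rewrite /DJ (sh_dot hs)//; ring.
apply: (le_trans (ler_normD _ _)); rewrite !normrM !(ger0_norm (ler0n _ 2)) (ger0_norm s0) (ger0_norm (ltW a0)).
have b3 := ler_wpM2l (mulr_ge0 (ler0n _ 2) s0) (le_trans (ler_normD _ _) (lerD (b true) (b false))).
have b4 := dot_le_norm hs Vd Vh.
have b5 : 2 * alpha * `|dot d h| <= 2 * (N d * N h).
  by rewrite ler_pM ?mulr_ge0 ?(ltW a0)//; lra.
rewrite /lipschitz_const; lra.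
Qed.

End bounded_arguments.

Lemma remainder_const_ge0 rho : 0 <= rho -> 0 <= remainder_const rho.
Proof.
have k0 := bil_const_ge0; have s0 := sqrtr_ge0 eps; move=> r0; rewrite /remainder_const /Lop_const.
by move: bil_const (Num.sqrt eps) k0 s0 => x y x0 y0; nneg.
Qed.

(** [comb (t - 1) h h] is the multiple t h; this and the next lemmas rewrite steps along a segment
    in terms of [comb]. *)
Lemma comb_scale t z h : comb 1 z (comb (t - 1) h h) = comb t z h.
Proof. by congr pair; apply/funext => p; rewrite /comb /prod_comb /lin /=; ring. Qed.

Lemma comb_sub z h : comb 1 z (comb (-1) h z) = h.
Proof.
case: h => h1 h2; congr pair; apply/funext => p; rewrite /comb /prod_comb /lin /=; ring.
Qed.

Lemma dot_scale t d h : V d -> V h -> dot d (comb (t - 1) h h) = t * dot d h.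
Proof. by move=> Vd Vh; rewrite (dot_combr hs)//; ring. Qed.

Lemma N_scale t h : V h -> 0 <= t -> N (comb (t - 1) h h) = t * N h.
Proof.
move=> Vh t0; rewrite /N (sqr_norm_comb hs)//.
rewrite (_ : _ + _ + _ = t ^+ 2 * dot h h); last by ring.
by rewrite sqrtrM ?sqr_ge0// sqrtr_sqr ger0_norm.
Qed.

Definition frechet (W : pr -> Prop) z G := forall e, 0 < e -> exists2 d, 0 < d &
  forall h, W h -> N h < d -> `|JJ (comb 1 z h) - JJ z - dot G h| <= e * N h.

Lemma second_order t z h : V z -> V h -> 0 <= t <= 1 ->
  `|JJ (comb t z h) - JJ z - t * DJ z h| <= t ^+ 2 * ((remainder_const (N z + N h) + 1) * N h ^+ 2).
Proof.
move=> Vz Vh /andP[t0 t1]; have z0 := N_ge0 z; have h0 := N_ge0 h.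
have [a0 a1] := andP alpha01.
rewrite JJ_expand// (_ : _ - _ - _ = t ^+ 2 * (JR t z h + alpha * N h ^+ 2)); last by ring.
rewrite normrM (ger0_norm (sqr_ge0 _)) ler_wpM2l ?sqr_ge0//.
apply: (le_trans (ler_normD _ _)); rewrite mulrDl; apply: lerD.
  by apply: JR_bound => //; rewrite ?ger0_norm// ?lerDl// lerDr.
by rewrite ger0_norm ?mulr_ge0 ?sqr_ge0 ?(ltW a0)// ler_wpM2r ?sqr_ge0// ltW.
Qed.

(** The theorem speaks of every Frechet derivative [G], so each one has to be identified with the
    explicit first variation: the two first-order expansions are compared along t h and divided by
    t. *)
Lemma frechet_repr (W : pr -> Prop) z G : (forall h, W h -> V h) ->
  (forall k h d, W h -> W d -> W (comb k h d)) -> V z -> V G -> frechet W z G ->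
  forall h, W h -> dot G h = DJ z h.
Proof.
move=> WV Wc Vz VG fG h Wh; have Vh := WV _ Wh; have h0 := N_ge0 h.
apply/eqP; rewrite -subr_eq0 -normr_le0; apply/ler_addgt0Pr => e e0; rewrite add0r.
have e1 : 0 < e / 2 / (N h + 1) by rewrite divr_gt0 ?divr_gt0// ltr_wpDl.
have e2 : 0 < e / 2 by rewrite divr_gt0.
have [d d0 hd] := fG _ e1.
pose X := (remainder_const (N z + N h) + 1) * N h ^+ 2.
have X0 : 0 <= X by rewrite mulr_ge0 ?sqr_ge0// addr_ge0// remainder_const_ge0// addr_ge0// N_ge0.
(* One step size keeps the increment inside the neighbourhood where [G] approximates, the other
   makes the quadratic error smaller than e / 2 after division; their product satisfies both. *)
have [t1 [t10 /andP[_ t11] t1d]] := small_step d0 h0.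
have [t2 [t20 /andP[_ t21] t2e]] := small_step e2 X0.
pose t := t1 * t2; have t0 : 0 < t by rewrite mulr_gt0.
have tt1 : t <= t1 by rewrite ger_pMr.
have tt2 : t <= t2 by rewrite ger_pMl.
have t01 : 0 <= t <= 1 by rewrite (ltW t0) (le_trans tt1).
have Wt : W (comb (t - 1) h h) by exact: Wc.
have nt : N (comb (t - 1) h h) < d.
  by rewrite N_scale ?(ltW t0)//; apply: le_lt_trans t1d; rewrite ler_wpM2r.
have := hd _ Wt nt; rewrite comb_scale dot_scale// N_scale ?(ltW t0)//.
have := second_order Vz Vh t01; rewrite -/X.
set A := JJ _ - JJ z => u1 u2.
have u3 : `|t * (dot G h - DJ z h)| <= t ^+ 2 * X + e / 2 / (N h + 1) * (t * N h).
  rewrite (_ : t * _ = (A - t * DJ z h) - (A - t * dot G h)); last by ring.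
  by apply: (le_trans (ler_normB _ _)); exact: lerD.
rewrite normrM (ger0_norm (ltW t0)) in u3.
rewrite -(ler_pM2l t0); apply: (le_trans u3).
rewrite (_ : t * e = t * (e / 2) + t * (e / 2)); last by field.
apply: lerD.
  rewrite expr2 -mulrA ler_wpM2l ?(ltW t0)//; apply: le_trans (ltW t2e).
  by rewrite ler_wpM2r.
rewrite mulrCA ler_wpM2l ?(ltW t0)// mulrAC ler_pdivrMr ?ltr_wpDl//.
by rewrite ler_wpM2l ?(ltW e2)// lerDl.
Qed.

(** Riesz representation of [DJ z] in the space [W] of increments, where it is bounded; the
    remainder is quadratic in the increment. *)
Lemma frechet_exists (W : pr -> Prop) z : (forall h, W h -> V h) -> (exists h, W h) ->
  semi_hilbert W comb dot -> V z -> exists2 G, W G & frechet W z G.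
Proof.
move=> WV W0 hW Vz.
have [|k u v Wu Wv|u Wu|G WG hG] := @riesz R _ W comb dot hW (DJ z) (derivative_const (N z)).
- exact: W0.
- by apply: DJ_comb => //; exact: WV.
- by apply: DJ_bound => //; exact: WV.
exists G => // e e0; have z0 := N_ge0 z.
pose X := remainder_const (N z + 1) + 1.
have X0 : 0 < X by rewrite ltr_wpDl// remainder_const_ge0// addr_ge0.
(* The bound 1 keeps [h] in the ball of radius N z + 1 for which [X] was computed. *)
exists (Num.min 1 (e / X)); first by rewrite lt_min ltr01 divr_gt0.
move=> h Wh; rewrite lt_min => /andP[h1 hX]; have Vh := WV _ Wh; have h0 := N_ge0 h.
have [a0 a1] := andP alpha01.
rewrite JJ_expand// hG// expr1n !mul1r (_ : _ - _ - _ = JR 1 z h + alpha * N h ^+ 2); last by ring.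
have b1 : `|JR 1 z h| <= remainder_const (N z + 1) * N h ^+ 2.
  by apply: JR_bound; rewrite ?normr1// ?lerDl// (le_trans (ltW h1))// lerDr.
apply: (@le_trans _ _ (X * N h ^+ 2)).
  rewrite mulrDl; apply: (le_trans (ler_normD _ _)); apply: lerD => //.
  by rewrite ger0_norm ?mulr_ge0 ?sqr_ge0 ?(ltW a0)// ler_wpM2r ?sqr_ge0// ltW.
rewrite expr2 mulrA ler_wpM2r// mulrC -ler_pdivlMr//; exact: ltW.
Qed.

(** Pairing with g = G2 - G1 itself gives its squared norm as an increment of [DJ], and [DJ_lip]
    bounds this by a multiple of the norm of g, which is then cancelled. *)
Lemma representer_lip (W : pr -> Prop) rho z d G1 G2 : (forall h, W h -> V h) ->
  (forall k h d, W h -> W d -> W (comb k h d)) ->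
  V z -> V d -> N z <= rho -> N d <= 2 * rho -> N (comb 1 z d) <= rho -> W G1 -> W G2 ->
  (forall h, W h -> dot G1 h = DJ z h) -> (forall h, W h -> dot G2 h = DJ (comb 1 z d) h) ->
  N (comb (-1) G2 G1) <= lipschitz_const rho * N d.
Proof.
move=> WV Wc Vz Vd nz nd nzd W1 W2 r1 r2.
have Wg := Wc (-1) _ _ W2 W1; set g := comb (-1) G2 G1 in Wg *.
have V1 := WV _ W1; have V2 := WV _ W2; have Vg := WV _ Wg.
have e : N g ^+ 2 = DJ (comb 1 z d) g - DJ z g.
  by rewrite sqr_N// {1}/g (sh_dot hs)// r1// r2// mulN1r.
have := DJ_lip Vz Vd Vg nz nd nzd; rewrite -e ger0_norm ?sqr_ge0// expr2.
have := N_ge0 g; rewrite le_eqVlt => /predU1P[<- _|g0].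
  rewrite mulr_ge0 ?N_ge0// /lipschitz_const addr_ge0// mulr_ge0 ?mulr_ge0 ?sqrtr_ge0//.
  have k0 := bil_const_ge0; have r0 := rho_ge0 nz.
  by rewrite /Lop_const; move: bil_const k0 => x x0; nneg.
by rewrite ler_pM2r.
Qed.

Lemma first_order z d : V z -> V d -> (forall t, 0 < t <= 1 -> JJ z <= JJ (comb t z d)) ->
  0 <= DJ z d.
Proof.
move=> Vz Vd mn; rewrite leNgt; apply/negP => neg.
have z0 := N_ge0 z; have h0 := N_ge0 d.
pose X := (remainder_const (N z + N d) + 1) * N d ^+ 2.
have X0 : 0 <= X by rewrite mulr_ge0 ?sqr_ge0// addr_ge0// remainder_const_ge0// addr_ge0.
have neg' : 0 < - DJ z d by rewrite oppr_gt0.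
(* The step is so short that a negative first-order term outweighs the quadratic remainder,
   contradicting minimality. *)
have [t [t0 t01 tX]] := small_step neg' X0.
have /andP[_ t1] := t01.
have := mn t; rewrite t0 t1 => /(_ isT) m1.
have := le_trans (ler_norm _) (second_order Vz Vd t01); rewrite -/X => m2.
have : 0 <= t * (DJ z d + t * X) by rewrite mulrDr mulrA -expr2; lra.
by rewrite pmulr_rge0// leNgt => /negP; apply; lra.
Qed.

End weighted_functional.

(** * The pointwise inequality behind strong convexity *)

Section pointwise.
Context (R : realType).
Implicit Types (a b c e k q s x y z tau sigma : R).

Lemma sqr_bounded_mul a c x : `|a| <= c -> (a * x) ^+ 2 <= c ^+ 2 * x ^+ 2.
Proof.
move=> ac; rewrite exprMn ler_wpM2r ?sqr_ge0// -(real_normK (num_real a)).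
by rewrite ler_sqr ?nnegrE// (le_trans (normr_ge0 a)).
Qed.

(** Young's inequality 2 |s| <= tau s^2 + 1 / tau, multiplied by the bound on q; thus q enters only
    through its bound. *)
Lemma young_mul tau sigma s q g e : 0 < tau -> tau * sigma = 1 -> `|q| <= e * g -> 0 <= e * g ->
  - ((tau * s ^+ 2 + sigma) * (e * g)) <= 2 * s * q.
Proof.
move=> t0 ts qg g0.
have s0 : 0 < sigma by rewrite -(pmulr_rgt0 _ t0) ts.
have h : `|2 * s * q| <= 2 * `|s| * (e * g).
  by rewrite !normrM (ger0_norm (ler0n _ 2)) ler_wpM2l.
have h2 : 2 * `|s| <= tau * s ^+ 2 + sigma.
  rewrite -(real_normK (num_real s)); move: `|s| => w.
  have : 0 <= sigma * (tau * w - 1) ^+ 2 by rewrite mulr_ge0 ?sqr_ge0 ?(ltW s0).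
  have -> : sigma * (tau * w - 1) ^+ 2 = tau * (tau * sigma) * w ^+ 2 - 2 * (tau * sigma) * w + sigma.
    by ring.
  by rewrite ts; lra.
have := le_trans h (ler_wpM2r g0 h2); rewrite ler_norml => /andP[h3 _]; exact: h3.
Qed.

(** Here (zx, zy) and (wx, wy) are the gradients of the two components at the base point, (hx, hy)
    and (gx, gy) those of the increment, A1 and A2 its Laplacians, f1 to f4 the pure second
    derivatives at the base point, e = 2 / eps and k = K rho. Then q is the quadratic part, b the
    first-order part of the linearization and s the sum of both operators. The term F G survives
    because second derivatives have no uniform bound. *)
Lemma convexity_integrand e k tau sigma A1 A2 zx zy wx wy hx hy gx gy f1 f2 f3 f4
    q b s G F :
  0 < e -> 0 <= k -> 0 < tau -> tau * sigma = 1 ->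
  `|zx| <= k -> `|zy| <= k -> `|wx| <= k -> `|wy| <= k -> `|hx| <= 2 * k -> `|hy| <= 2 * k ->
  q = e * (hx * (hx - gx) + hy * (hy - gy)) ->
  b = e * (zx * (hx - gx) + zy * (hy - gy)) + e * (hx * (zx - wx) + hy * (zy - wy)) ->
  s = f1 + f2 + f3 + f4 + 2 * (e * (zx * (zx - wx) + zy * (zy - wy))) ->
  G = hx ^+ 2 + hy ^+ 2 + (gx ^+ 2 + gy ^+ 2) ->
  F = f1 ^+ 2 + f2 ^+ 2 + (f3 ^+ 2 + f4 ^+ 2) ->
  2^-1 * (A1 ^+ 2 + A2 ^+ 2) -
    (176 * (e * k) ^+ 2 + 2 * e * (128 * tau * (e * k ^+ 2) ^+ 2 + sigma)) * G - 16 * e * tau * (F * G) <=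
  (A1 + (b + 1 * q)) ^+ 2 + (A2 + (b + 1 * q)) ^+ 2 + 2 * s * q.
Proof.
move=> e0 k0 t0 ts hzx hzy hwx hwy hhx hhy qE bE sE GE FE.
have tri x y c d : `|x| <= c -> `|y| <= d -> `|x + y| <= c + d.
  by move=> h1 h2; rewrite (le_trans (ler_normD _ _))// lerD.
have trin x y c d : `|x| <= c -> `|y| <= d -> `|x - y| <= c + d.
  by move=> h1 h2; rewrite (le_trans (ler_normB _ _))// lerD.
have G0 : 0 <= G by rewrite GE; nneg.
(* After regrouping there are four products with factors bounded by 3 k or 2 k. Each direction costs
   2 * 9 + 4 = 22, and squaring a sum of four terms costs another factor 4. *)
have bq : (b + 1 * q) ^+ 2 <= 88 * (e * k) ^+ 2 * G.
  have -> : b + 1 * q = e * ((zx + hx) * (hx - gx) + (zy + hy) * (hy - gy) + (zx - wx) * hx + (zy - wy) * hy).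
    by rewrite bE qE; ring.
  have q1 := sqr_bounded_mul (hx - gx) (tri _ _ _ _ hzx hhx).
  have q2 := sqr_bounded_mul (hy - gy) (tri _ _ _ _ hzy hhy).
  have q3 := sqr_bounded_mul hx (trin _ _ _ _ hzx hwx).
  have q4 := sqr_bounded_mul hy (trin _ _ _ _ hzy hwy).
  have d1 : (hx - gx) ^+ 2 <= 2 * (hx ^+ 2 + gx ^+ 2) by have := sqr_ge0 (hx + gx); nra.
  have d2 : (hy - gy) ^+ 2 <= 2 * (hy ^+ 2 + gy ^+ 2) by have := sqr_ge0 (hy + gy); nra.
  have kk : 0 <= k ^+ 2 by exact: sqr_ge0.
  move: ((zx + hx) * (hx - gx)) ((zy + hy) * (hy - gy)) ((zx - wx) * hx) ((zy - wy) * hy) q1 q2 q3 q4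
    => t1 t2 t3 t4 q1 q2 q3 q4.
  have s4 : (t1 + t2 + t3 + t4) ^+ 2 <= 4 * (t1 ^+ 2 + t2 ^+ 2 + t3 ^+ 2 + t4 ^+ 2).
    have := sqr_ge0 (t1 - t2); have := sqr_ge0 (t1 - t3); have := sqr_ge0 (t1 - t4).
    have := sqr_ge0 (t2 - t3); have := sqr_ge0 (t2 - t4); have := sqr_ge0 (t3 - t4); nra.
  have q1' := le_trans q1 (ler_wpM2l (sqr_ge0 (k + 2 * k)) d1).
  have q2' := le_trans q2 (ler_wpM2l (sqr_ge0 (k + 2 * k)) d2).
  have ss : (t1 + t2 + t3 + t4) ^+ 2 <= 88 * k ^+ 2 * G.
    apply: (le_trans s4); rewrite GE.
    have := mulr_ge0 kk (sqr_ge0 gx); have := mulr_ge0 kk (sqr_ge0 gy).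
    have := mulr_ge0 kk (sqr_ge0 hx); have := mulr_ge0 kk (sqr_ge0 hy); lra.
  rewrite exprMn; apply: le_trans (ler_wpM2l (sqr_ge0 e) ss) _.
  by rewrite le_eqVlt; apply/orP; left; apply/eqP; ring.
have qG : `|q| <= 2 * e * G.
  rewrite qE normrM (gtr0_norm e0) mulrAC (mulrC _ e) ler_wpM2l ?(ltW e0)// ler_norml GE.
  apply/andP; split.
    by have := sqr_ge0 (hx - gx); have := sqr_ge0 (hy - gy); have := sqr_ge0 hx; have := sqr_ge0 hy;
      have := sqr_ge0 gx; have := sqr_ge0 gy; nra.
  by have := sqr_ge0 (hx + gx); have := sqr_ge0 (hy + gy); have := sqr_ge0 hx; have := sqr_ge0 hy;
      have := sqr_ge0 gx; have := sqr_ge0 gy; nra.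
(* The gradient part B is at most 4 e k^2, so s^2 <= 2 (f1 + f2 + f3 + f4)^2 + 8 B^2 gives 2 * 4 and
   8 * 16. *)
have sF : s ^+ 2 <= 8 * F + 128 * (e * k ^+ 2) ^+ 2.
  rewrite sE; set B := e * _.
  have hB : B ^+ 2 <= (4 * (e * k ^+ 2)) ^+ 2.
    rewrite -(real_normK (num_real B)) ler_sqr ?nnegrE ?mulr_ge0 ?sqr_ge0 ?(ltW e0)//.
    rewrite /B normrM (gtr0_norm e0) mulrCA ler_wpM2l ?(ltW e0)//.
    have m1 : `|zx * (zx - wx)| <= k * (k + k) by rewrite normrM ler_pM// trin.
    have m2 : `|zy * (zy - wy)| <= k * (k + k) by rewrite normrM ler_pM// trin.
    by apply: le_trans (tri _ _ _ _ m1 m2) _; lra.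
  have s4 : (f1 + f2 + f3 + f4) ^+ 2 <= 4 * F.
    rewrite FE; have := sqr_ge0 (f1 - f2); have := sqr_ge0 (f1 - f3); have := sqr_ge0 (f1 - f4).
    have := sqr_ge0 (f2 - f3); have := sqr_ge0 (f2 - f4); have := sqr_ge0 (f3 - f4); nra.
  move: (f1 + f2 + f3 + f4) s4 => y s4; have := sqr_ge0 (y - 2 * B); lra.
have yg := young_mul s t0 ts qG (le_trans (normr_ge0 _) qG).
have r1 : 2^-1 * A1 ^+ 2 - (b + 1 * q) ^+ 2 <= (A1 + (b + 1 * q)) ^+ 2.
  by have := sqr_ge0 (A1 + 2 * (b + 1 * q)); lra.
have r2 : 2^-1 * A2 ^+ 2 - (b + 1 * q) ^+ 2 <= (A2 + (b + 1 * q)) ^+ 2.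
  by have := sqr_ge0 (A2 + 2 * (b + 1 * q)); lra.
have tF := ler_wpM2r (mulr_ge0 (mulr_ge0 (ler0n _ 2) (ltW e0)) G0) (lerD (ler_wpM2l (ltW t0) sF) (lexx sigma)).
move: (b + 1 * q) bq r1 r2 => B bq r1 r2; lra.
Qed.

End pointwise.

(** * Absorption of the remainder into the Carleman estimate *)

Section strong_convexity.
Context (R : realType).
Notation plane := (measurableTypeR R * measurableTypeR R)%type.
Notation fn := (R * R -> R).
Notation pr := (fn * fn)%type.
Implicit Types (u v w f g : fn) (k e a c : R) (i j : bool) (x y : bool * bool).
Variables (D : set (R * R)) (mD : measurable (D : set plane)).
Notation sqi := (square_integrable (leb2 R) D).
Notation L2le := (L2le (leb2 R) D).
Notation ess := (ess_bounded (leb2 R) D).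
Variables (S : fn -> Prop) (dw : nat -> nat -> fn -> fn) (dot : pr -> pr -> R) (omega : fn).
Variables (eps K M rho lambda C product_const tau sigma : R) (z h : pr).
Hypotheses (eps0 : 0 < eps) (K0 : 0 <= K) (l0 : 0 < lambda) (c0 : 0 < C) (product_const_ge0 : 0 <= product_const).
Hypotheses (tau0 : 0 < tau) (ts : tau * sigma = 1).
Hypothesis hM : ess omega M.
Hypothesis omega0 : forall p, D p -> 0 <= omega p.

Let V (z : pr) := S z.1 /\ S z.2.
Let N (z : pr) := Num.sqrt (dot z z).

Hypothesis hL2 : forall p q i z, (p + q <= 2)%N -> V z -> L2le (dw p q (cpt i z)) (N z).
Hypothesis hK : forall i z, V z ->
  ess (dw 1 0 (cpt i z)) (K * N z) /\ ess (dw 0 1 (cpt i z)) (K * N z).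
Hypotheses (Vz : V z) (Vh : V h) (nz : N z <= rho) (nh : N h <= 2 * rho).

Let wi f := int2 D (fun p => f p * omega p).
Let wok f := (leb2 R).-integrable D (EFin \o (fun p => f p * omega p)).

Lemma wok_sqr u v : sqi u -> sqi v -> wok (fun p => u p * v p).
Proof. exact: wdot_itg hM _ _. Qed.

Lemma wokX u : sqi u -> wok (fun p => u p ^+ 2).
Proof. by move=> su; have := wok_sqr su su. Qed.

Lemma wokD f g : wok f -> wok g -> wok (fun p => f p + g p).
Proof. by move=> wf wg; apply: eq_itg (itgD mD wf wg) => // p _; rewrite mulrDl. Qed.

Lemma wokZ k f : wok f -> wok (fun p => k * f p).
Proof. by move=> wf; apply: eq_itg (itgZ mD k wf) => // p _; rewrite mulrA. Qed.

Lemma wiD f g : wok f -> wok g -> wi (fun p => f p + g p) = wi f + wi g.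
Proof. by move=> wf wg; rewrite -int2D//; apply: eq_int2 => p _; rewrite mulrDl. Qed.

Lemma wiZ k f : wok f -> wi (fun p => k * f p) = k * wi f.
Proof. by move=> wf; rewrite -int2Z//; apply: eq_int2 => p _; rewrite mulrA. Qed.

Lemma wi_le f g : wok f -> wok g -> {ae leb2 R, forall p, D p -> f p <= g p} -> wi f <= wi g.
Proof.
move=> wf wg fg; apply: le_int2 => //; apply: ae_imp1 fg _ => p h' Dp.
by rewrite ler_wpM2r ?omega0// h'.
Qed.

Lemma eq_wi f g : (forall p, f p = g p) -> wi f = wi g.
Proof. by move=> fg; apply: eq_int2 => p _; rewrite fg. Qed.

Lemma eq_wok f g : (forall p, f p = g p) -> wok f -> wok g.
Proof. by move=> fg; apply: eq_itg => // p _; rewrite fg. Qed.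

Lemma wi_ge0 f : (forall p, 0 <= f p) -> 0 <= wi f.
Proof. by move=> f0; apply: int2_ge0 => p Dp; rewrite mulr_ge0// omega0. Qed.

Lemma wi_sum (T : Type) (s : seq T) (f_ : T -> fn) : (forall t, wok (f_ t)) ->
  wok (fun p => \sum_(t <- s) f_ t p) /\
  wi (fun p => \sum_(t <- s) f_ t p) = \sum_(t <- s) wi (f_ t).
Proof.
move=> wf; elim: s => [|t s [w1 w2]].
  have e : (fun p => \sum_(t <- [::]) f_ t p) = fun=> 0 by apply/funext => p; rewrite big_nil.
  rewrite e big_nil; split.
    by apply: eq_itg (sqi_itgM mD (sqi0 _ mD) (sqi0 _ mD)) => // p _; rewrite !mul0r.
  by rewrite /wi (@eq_int2 _ _ _ (fun=> 0)) ?/int2 ?Rintegral_cst//= => [|p _]; rewrite mul0r.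
have e : (fun p => \sum_(t <- t :: s) f_ t p) = fun p => f_ t p + \sum_(t <- s) f_ t p.
  by apply/funext => p; rewrite big_cons.
by rewrite e big_cons; split; [exact: wokD|rewrite wiD// w2].
Qed.

(** A pair of booleans encodes a component and a direction: [fz] runs over the pure second
    derivatives of [z], [uh] over the gradients of [h], and [uxh] is the x-derivative of [uh]. *)
Let fz x := dw (if x.2 then 2 else 0) (if x.2 then 0 else 2) (cpt x.1 z).
Let uh y := dw (if y.2 then 1 else 0) (if y.2 then 0 else 1) (cpt y.1 h).
Let uxh y := dw (if y.2 then 2 else 1) (if y.2 then 0 else 1) (cpt y.1 h).

Let hess i p := dw 2 0 (cpt i h) p ^+ 2 + dw 1 1 (cpt i h) p ^+ 2 + dw 0 2 (cpt i h) p ^+ 2.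
Let grad i p := dw 1 0 (cpt i h) p ^+ 2 + dw 0 1 (cpt i h) p ^+ 2.

Hypothesis carleman : forall i,
  C / lambda * wi (hess i) + C * lambda * wi (grad i) +
  C * lambda ^+ 3 * wi (fun p => cpt i h p ^+ 2) <= wi (fun p => lap dw (cpt i h) p ^+ 2).

Hypothesis product : forall x y,
  wok (fun p => fz x p ^+ 2 * uh y p ^+ 2) /\
  wi (fun p => fz x p ^+ 2 * uh y p ^+ 2) <=
    product_const * (lambda * wi (fun p => uh y p ^+ 2) + lambda^-1 * wi (fun p => uxh y p ^+ 2)).

(** The product term has the same powers of lambda as the Carleman estimate and must be small
    through [tau]; the cost sigma = 1 / tau then multiplies only the gradient, which a large lambda
    absorbs. The number 64 is 16 from the pointwise inequality times the 4 choices of [fz]. *)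
Hypothesis small_tau : 64 * (2 / eps) * tau * product_const <= C / 8.
Hypothesis large_lambda :
  176 * (2 / eps * (K * rho)) ^+ 2 +
  2 * (2 / eps) * (128 * tau * (2 / eps * (K * rho) ^+ 2) ^+ 2 + sigma) <= C * lambda / 8.

Let idx : seq (bool * bool) := [:: (true, true); (true, false); (false, true); (false, false)].

Lemma sqi_dw p q i (d : pr) : (p + q <= 2)%N -> V d -> sqi (dw p q (cpt i d)).
Proof. by move=> pq Vd; case: (hL2 i pq Vd). Qed.

(** The pointwise inequality keeps one half of the squared Laplacians. The gradient error and the
    product error each consume at most one eighth, by the two absorption conditions, so one quarter
    remains. *)
Lemma JR_lower : Num.sqrt eps / 4 *
  (wi (fun p => lap dw (cpt true h) p ^+ 2) + wi (fun p => lap dw (cpt false h) p ^+ 2)) <=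
  JR D dw omega eps 1 z h.
Proof.
have s2 i (d : pr) : V d -> sqi (dw 2 0 (cpt i d)) by exact: sqi_dw.
have s02 i (d : pr) : V d -> sqi (dw 0 2 (cpt i d)) by exact: sqi_dw.
have s11 i (d : pr) : V d -> sqi (dw 1 1 (cpt i d)) by exact: sqi_dw.
have s10 i (d : pr) : V d -> sqi (dw 1 0 (cpt i d)) by exact: sqi_dw.
have s01 i (d : pr) : V d -> sqi (dw 0 1 (cpt i d)) by exact: sqi_dw.
have su y : sqi (uh y) by rewrite /uh; case: y => [? []]; exact: sqi_dw.
have sux y : sqi (uxh y) by rewrite /uxh; case: y => [? []]; exact: sqi_dw.
have sl i : sqi (lap dw (cpt i h)) by apply: sqiD => //; [exact: s2|exact: s02].
pose G p := \sum_(y <- idx) uh y p ^+ 2.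
pose F p := \sum_(x <- idx) fz x p ^+ 2.
have [wG eG] := wi_sum idx (fun y => wokX (su y)).
have [wX eX] := wi_sum idx (fun y => wokX (sux y)).
have FG p : F p * G p = \sum_(x <- idx) \sum_(y <- idx) fz x p ^+ 2 * uh y p ^+ 2.
  by rewrite /F /G mulr_suml; apply: eq_bigr => x _; rewrite mulr_sumr.
have hx x := wi_sum idx (fun y => (product x y).1).
have [wFG' eFG] := wi_sum idx (fun x => (hx x).1).
have wFG : wok (fun p => F p * G p) by apply: eq_wok wFG' => p; rewrite FG.
have lFG : wi (fun p => F p * G p) <= 4 * product_const * (lambda * wi G + lambda^-1 * wi (fun p => \sum_(y <- idx) uxh y p ^+ 2)).
  rewrite (eq_wi FG) eFG eG eX.
  apply: (@le_trans _ _ (\sum_(x <- idx) \sum_(y <- idx)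
      product_const * (lambda * wi (fun p => uh y p ^+ 2) + lambda^-1 * wi (fun p => uxh y p ^+ 2)))).
    apply: ler_sum => x _; rewrite (hx x).2; apply: ler_sum => y _; exact: (product x y).2.
  rewrite big_const_seq count_predT /= addr0 -mulr_sumr big_split /= -!mulr_sumr.
  by rewrite le_eqVlt; apply/orP; left; apply/eqP; ring.
have GE : wi G = wi (grad true) + wi (grad false).
  rewrite -wiD; [|by apply: wokD; apply: wokX; [exact: s10|exact: s01]..].
  by apply: eq_wi => p; rewrite /G /idx !big_cons big_nil /uh /grad /=; ring.
have wH i : wok (hess i).
  by apply: wokD; [apply: wokD|]; apply: wokX; [exact: s2|exact: s11|exact: s02].
(* The x-derivatives of the gradient are the derivatives xx and xy, so the Hessian dominates
   them. *)
have XE : wi (fun p => \sum_(y <- idx) uxh y p ^+ 2) <= wi (hess true) + wi (hess false).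
  rewrite -wiD//; apply: wi_le => //; first exact: wokD.
  apply: aeW => p _; rewrite /idx !big_cons big_nil /uxh /hess /=.
  by have := sqr_ge0 (dw 0 2 (cpt true h) p); have := sqr_ge0 (dw 0 2 (cpt false h) p); lra.
set A := _ + _.
pose M3 := 176 * (2 / eps * (K * rho)) ^+ 2 +
  2 * (2 / eps) * (128 * tau * (2 / eps * (K * rho) ^+ 2) ^+ 2 + sigma).
pose Lo p := 2^-1 * (lap dw (cpt true h) p ^+ 2 + lap dw (cpt false h) p ^+ 2) +
  (- M3) * G p + (- (16 * (2 / eps) * tau)) * (F p * G p).
have wA : wok (fun p => lap dw (cpt true h) p ^+ 2 + lap dw (cpt false h) p ^+ 2).
  by apply: wokD; exact: wokX.
have wLo : wok Lo by apply: wokD; [apply: wokD; exact: wokZ|exact: wokZ].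
have LoE : wi Lo = 2^-1 * A - M3 * wi G - 16 * (2 / eps) * tau * wi (fun p => F p * G p).
  rewrite /Lo wiD; [|by apply: wokD; exact: wokZ|exact: wokZ].
  rewrite wiD; [|exact: wokZ|exact: wokZ].
  rewrite !wiZ// wiD; [|exact: wokX|exact: wokX].
  by rewrite -/A !mulNr.
have sL i : sqi (Lop dw eps i z) by apply: (Lop_sqi mD eps0 K0 hL2 hK) => //.
have sq : sqi (bil dw eps h h) by apply: (bil_sqi mD eps0 K0 hL2 hK).
have sX i : sqi (lin 1 (dLop dw eps i z h) (bil dw eps h h)).
  by apply: sqi_lin => //; apply: (dLop_sqi mD eps0 K0 hL2 hK).
pose Hi p := (lin 1 (dLop dw eps true z h) (bil dw eps h h) p) ^+ 2 +
   (lin 1 (dLop dw eps false z h) (bil dw eps h h) p) ^+ 2 +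
   2 * ((Lop dw eps true z p + Lop dw eps false z p) * bil dw eps h h p).
have wsq : wok (fun p => (Lop dw eps true z p + Lop dw eps false z p) * bil dw eps h h p).
  by apply: wok_sqr => //; exact: sqiD.
have wHi : wok Hi.
  by apply: wokD; [apply: wokD; exact: wokX|exact: wokZ].
have JE : JR D dw omega eps 1 z h = Num.sqrt eps * wi Hi.
  rewrite /JR; congr (_ * _); rewrite /Hi wiD; [|by apply: wokD; exact: wokX|exact: wokZ].
  rewrite wiD; [|exact: wokX|exact: wokX].
  have e3 : wi (fun p => (Lop dw eps true z p + Lop dw eps false z p) * bil dw eps h h p) =
      wdot D omega (Lop dw eps true z) (bil dw eps h h) + wdot D omega (Lop dw eps false z) (bil dw eps h h).
    have w1 := wok_sqr (sL true) sq; have w2 := wok_sqr (sL false) sq.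
    by rewrite -[RHS](wiD w1 w2); apply: eq_wi => p; rewrite mulrDl.
  have e4 u : wi (fun p => u p ^+ 2) = wdot D omega u u.
    by apply: eq_int2 => p _; rewrite expr2.
  by rewrite wiZ// e3 !e4; ring.
have hle : wi Lo <= wi Hi.
  apply: wi_le => //.
  have [[_ zx] [_ zy]] := hK true Vz; have [[_ wx] [_ wy]] := hK false Vz.
  have [[_ hhx] [_ hhy]] := hK true Vh.
  have Kz := ler_wpM2l K0 nz; have Kh := ler_wpM2l K0 nh.
  have a1 := ae_imp3 zx zy wx (fun p m1 m2 m3 => conj m1 (conj m2 m3)).
  have a2 := ae_imp3 wy hhx hhy (fun p m1 m2 m3 => conj m1 (conj m2 m3)).
  apply: ae_imp2 a1 a2 _ => p [b1 [b2 b3]] [b4 [b5 b6]] Dp.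
  have e0 : 0 < 2 / eps by rewrite divr_gt0.
  have k0 : 0 <= K * rho by apply: le_trans Kz; rewrite mulr_ge0// sqrtr_ge0.
  have Kh' : K * N h <= 2 * (K * rho) by rewrite mulrCA.
  have := @convexity_integrand R (2 / eps) (K * rho) tau sigma (lap dw (cpt true h) p)
    (lap dw (cpt false h) p) (dw 1 0 (cpt true z) p) (dw 0 1 (cpt true z) p)
    (dw 1 0 (cpt false z) p) (dw 0 1 (cpt false z) p)
    (dw 1 0 (cpt true h) p) (dw 0 1 (cpt true h) p)
    (dw 1 0 (cpt false h) p) (dw 0 1 (cpt false h) p)
    (dw 2 0 (cpt true z) p) (dw 0 2 (cpt true z) p) (dw 2 0 (cpt false z) p) (dw 0 2 (cpt false z) p)
    _ _ _ (G p) (F p) e0 k0 tau0 ts (le_trans (b1 Dp) Kz) (le_trans (b2 Dp) Kz)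
    (le_trans (b3 Dp) Kz) (le_trans (b4 Dp) Kz) (le_trans (b5 Dp) Kh') (le_trans (b6 Dp) Kh')
    erefl erefl erefl.
  have GpE : G p = dw 1 0 (cpt true h) p ^+ 2 + dw 0 1 (cpt true h) p ^+ 2 +
     (dw 1 0 (cpt false h) p ^+ 2 + dw 0 1 (cpt false h) p ^+ 2).
    by rewrite /G /idx !big_cons big_nil /uh /=; ring.
  have FpE : F p = dw 2 0 (cpt true z) p ^+ 2 + dw 0 2 (cpt true z) p ^+ 2 +
     (dw 2 0 (cpt false z) p ^+ 2 + dw 0 2 (cpt false z) p ^+ 2).
    by rewrite /F /idx !big_cons big_nil /fz /=; ring.
  move=> /(_ GpE FpE) hh.
  rewrite [leLHS](_ : _ = 2^-1 * (lap dw (cpt true h) p ^+ 2 + lap dw (cpt false h) p ^+ 2) -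
    M3 * G p - 16 * (2 / eps) * tau * (F p * G p)); last by rewrite /Lo; ring.
  apply: (le_trans hh); rewrite le_eqVlt; apply/orP; left; apply/eqP.
  by rewrite /Hi /lin /dLop /Lop /bil /lap /cpt; ring.
have c1 := carleman true; have c2 := carleman false.
have u0 i : 0 <= C * lambda ^+ 3 * wi (fun p => cpt i h p ^+ 2).
  by rewrite !mulr_ge0 ?exprn_ge0 ?(ltW l0) ?(ltW c0)// wi_ge0// => p; exact: sqr_ge0.
have G0 : 0 <= wi G by rewrite eG; apply: sumr_ge0 => y _; apply: wi_ge0 => p; exact: sqr_ge0.
have H0 i : 0 <= wi (hess i) by apply: wi_ge0 => p; rewrite !addr_ge0 ?sqr_ge0.
set HH := wi (hess true) + wi (hess false) in XE.
have HH0 : 0 <= HH by rewrite addr_ge0.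
(* The sum of the two Carleman estimates, with the nonnegative zero-order terms dropped. *)
have AC : C * (lambda^-1 * HH + lambda * wi G) <= A.
  rewrite GE /HH /A; have := u0 true; have := u0 false; move: c1 c2; lra.
have li : 0 <= lambda^-1 by rewrite invr_ge0 ltW.
have t1 : M3 * wi G <= C * lambda / 8 * wi G by rewrite ler_wpM2r.
have t2 : 16 * (2 / eps) * tau * wi (fun p => F p * G p) <= C / 8 * (lambda * wi G + lambda^-1 * HH).
  have e0 : 0 <= 16 * (2 / eps) * tau by rewrite !mulr_ge0 ?invr_ge0 ?(ltW eps0) ?(ltW tau0).
  apply: (le_trans (ler_wpM2l e0 lFG)).
  have x1 : lambda * wi G + lambda^-1 * wi (fun p => \sum_(y <- idx) uxh y p ^+ 2) <= lambda * wi G + lambda^-1 * HH.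
    by rewrite lerD2l ler_wpM2l.
  have x2 : 0 <= lambda * wi G + lambda^-1 * HH by rewrite addr_ge0 ?mulr_ge0 ?(ltW l0).
  apply: le_trans (ler_wpM2r x2 small_tau).
  rewrite (_ : 64 * (2 / eps) * tau * product_const * _ = 16 * (2 / eps) * tau * (4 * product_const * (lambda * wi G + lambda^-1 * HH))); last by ring.
  by rewrite ler_wpM2l// ler_wpM2l// mulr_ge0.
rewrite JE -mulrA ler_wpM2l ?sqrtr_ge0//; apply: le_trans hle; rewrite LoE.
have CH : 0 <= C * (lambda^-1 * HH) by rewrite !mulr_ge0// ltW.
move: (M3 * wi G) (16 * (2 / eps) * tau * wi _) t1 t2 => a1 a2 t1 t2; lra.
Qed.

End strong_convexity.

(** * Scalar inequalities in lambda *)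

Section arithmetic.
Context (R : realType).
Implicit Types (c m e rho lambda x y a b : R).

(** [product_bound] divided by its left factor, with delta = m / lambda: the factor 1 / delta puts
    lambda in front of [a], and delta^2 / delta puts 1 / lambda in front of [b]. *)
Lemma product_arith c m e rho lambda x y a b w : 0 < c -> 0 < m -> m <= 1 -> 0 <= e ->
  0 < lambda -> 0 <= x -> x <= rho ^+ 2 -> y <= rho ^+ 2 -> 0 <= a -> 0 <= b ->
  c * (m / lambda) * w <= (2 * x + 2 * c ^+ 2 * y) * (2 * e * a + 2 * e * (m / lambda) ^+ 2 * b) ->
  w <= (2 + 2 * c ^+ 2) * rho ^+ 2 * (2 * e) / (c * m) * (lambda * a + lambda^-1 * b).
Proof.
move=> c0 m0 m1 e0 l0 x0 xr yr a0 b0 h.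
have k0 : 0 < lambda / (c * m) by rewrite divr_gt0// mulr_gt0.
have -> : w = lambda / (c * m) * (c * (m / lambda) * w) by field; rewrite !gt_eqF.
have s0 : 0 <= 2 * e * a + 2 * e * (m / lambda) ^+ 2 * b.
  by nneg.
have s1 : 2 * x + 2 * c ^+ 2 * y <= (2 + 2 * c ^+ 2) * rho ^+ 2.
  by have := ler_wpM2l (sqr_ge0 c) yr; lra.
apply: (le_trans (ler_wpM2l (ltW k0) (le_trans h (ler_wpM2r s0 s1)))).
rewrite -subr_ge0 (_ : _ - _ = (2 + 2 * c ^+ 2) * rho ^+ 2 * (2 * e) / (c * m) * ((1 - m ^+ 2) / lambda * b)); last first.
  by field; rewrite !gt_eqF.
have mm : 0 <= 1 - m ^+ 2 by rewrite subr_ge0 -(expr1n _ 2) ler_sqr ?nnegrE ?(ltW m0).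
have cm : 0 < c * m by exact: mulr_gt0.
have i1 : 0 <= (c * m)^-1 by rewrite invr_ge0 ltW.
have i2 : 0 <= lambda^-1 by rewrite invr_ge0 ltW.
by nneg.
Qed.

Lemma carleman_arith lambda c e1 e2 n0 n1 n2 w0 w1 w2 : 1 <= lambda -> 0 < c ->
  e1 <= lambda^-1 * e2 -> 0 <= e2 -> 0 <= n0 -> 0 <= n1 -> 0 <= n2 ->
  e2 * n0 <= w0 -> e2 * n1 <= w1 -> e2 * n2 <= w2 ->
  c * e1 * (n2 + n1 + n0) <= c / lambda * w2 + c * lambda * w1 + c * lambda ^+ 3 * w0.
Proof.
move=> l1 c0 e12 e0 h0 h1 h2 k0 k1 k2.
have lp : 0 < lambda by rewrite (lt_le_trans ltr01).
have li : lambda^-1 <= 1 by rewrite invf_le1.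
have li0 : 0 <= lambda^-1 by rewrite invr_ge0 ltW.
have l3 : 1 <= lambda ^+ 3 by rewrite exprn_ege1.
have p0 : 0 <= w0 by apply: le_trans k0; exact: mulr_ge0.
have p1 : 0 <= w1 by apply: le_trans k1; exact: mulr_ge0.
have a1 : lambda^-1 * w1 <= lambda * w1 by rewrite ler_wpM2r// (le_trans li).
have a0 : lambda^-1 * w0 <= lambda ^+ 3 * w0 by rewrite ler_wpM2r// (le_trans li).
have a2 : e1 * (n2 + n1 + n0) <= lambda^-1 * (w2 + w1 + w0).
  apply: (le_trans (ler_wpM2r (addr_ge0 (addr_ge0 h2 h1) h0) e12)).
  by rewrite -mulrA ler_wpM2l// !mulrDr !lerD.
have a3 : e1 * (n2 + n1 + n0) <= lambda^-1 * w2 + lambda * w1 + lambda ^+ 3 * w0 by lra.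
by have := ler_wpM2l (ltW c0) a3; rewrite !mulrDr !mulrA.
Qed.

Lemma sum_triangle (f : nat -> nat -> R) :
  \sum_(i < 3) \sum_(j < 3) (if (i + j <= 2)%N then f i j else 0) =
  f 2 0 + f 1 1 + f 0 2 + (f 1 0 + f 0 1) + f 0 0.
Proof. by rewrite !big_ord_recl !big_ord0 /= /bump /=; ring. Qed.

Lemma sqr_sumE x y a : (x * x + y * y) * a = (x ^+ 2 + y ^+ 2) * a.
Proof. by rewrite !expr2. Qed.

(** Of the two exponential factors in the weight one is spent on 1 / lambda, by t <= exp t; this is
    why the convexity constant carries exp(lambda b) and not its square. *)
Lemma exp_arith lambda b : 0 < lambda ->
  b * expR (lambda * b) <= lambda^-1 * expR (2 * (lambda * b)).
Proof.
move=> l0; have -> : 2 * (lambda * b) = lambda * b + lambda * b by ring.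
have : lambda * b <= expR (lambda * b) by apply: le_trans (expR_ge1Dx _); rewrite lerDr.
rewrite expRD; move: (expR _) (expR_ge0 (lambda * b)) => e e0 h.
by rewrite -(ler_pM2l l0) mulrA mulVKf ?gt_eqF// ler_wpM2r.
Qed.

Lemma ratio_arith c m lambda : 0 < c -> 8 * m / c <= lambda -> m <= c * lambda / 8.
Proof. by move=> c0; rewrite ler_pdivrMr// ler_pdivlMr// => h; lra. Qed.

End arithmetic.

(** * The Carleman estimate and the remainder *)

Section rectangle_functional.
Context (R : realType) (Q : rectangle R).
Hypotheses (hc1 : 0 < rc1 Q) (hc2 : 0 < rc2 Q) (ha : rc1 Q < ra Q).
Notation line := (measurableTypeR R).
Notation plane := (measurableTypeR R * measurableTypeR R)%type.
Notation l := (ra Q - rc1 Q).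
Notation r := (ra Q + rc1 Q).
Notation D := (box l r (rb Q - rc2 Q) (rb Q + rc2 Q)).
Notation fn := (R * R -> R).
Notation pr := (fn * fn)%type.
Notation L2le := (L2le (leb2 R) D).
Notation ess := (ess_bounded (leb2 R) D).
Notation sqi := (square_integrable (leb2 R) D).
Implicit Types (u v f g : fn) (z h : pr) (lambda alpha eps K M : R).

Let lr := width_gt0 hc1.
Let bt := height_gt0 hc2.
Let mD : measurable (D : set plane) := measurable_box _ _ _ _.
Notation V := (fun z : pr => sobolev D 3 z.1 /\ sobolev D 3 z.2).
Notation N := (fun z : pr => Num.sqrt (pair_dot D 3 z z)).

Let l0 : 0 < l. Proof. by rewrite subr_gt0. Qed.

Definition gauss lambda (s : R) := expR (2 * lambda * s ^+ 2).

Lemma gauss_continuous lambda : continuous (gauss lambda).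
Proof.
move=> x; apply: (@continuous_comp _ _ _ (fun s : R => 2 * lambda * s ^+ 2) expR); last exact: continuous_expR.
by apply: cvgM; [exact: cvg_cst|rewrite expr2; under eq_fun do rewrite expr2; apply: cvgM; exact: cvg_id].
Qed.

Lemma psi_continuous lambda : continuous (psi lambda : fn).
Proof.
move=> p; apply: (@continuous_comp _ _ _ fst (gauss lambda)); last exact: gauss_continuous.
exact: cvg_fst.
Qed.

Lemma psi_bound lambda : exists2 M, 0 <= M & ess (psi lambda) M.
Proof. exact: continuous_ess_bounded (@psi_continuous lambda). Qed.

Lemma psi_ge0 lambda (p : R * R) : D p -> 0 <= psi lambda p.
Proof. by move=> _; exact: expR_ge0. Qed.

Lemma cpt_L2le p q i z : (p + q <= 3)%N -> V z -> L2le (Dw D p q (cpt i z)) (N z).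
Proof.
move=> pq Vz; have h := Dw_L2le (cpt_sobolev i Vz) pq.
by have := L2le_le (cpt_norm _ _ _ _ i z) h; rewrite pair_normE.
Qed.

Lemma cpt_L2le2 p q i z : (p + q <= 2)%N -> V z -> L2le (Dw D p q (cpt i z)) (N z).
Proof. by move=> pq; apply: cpt_L2le; exact: leq_trans pq _. Qed.

Lemma Dw_lin2 p q k u v : (p + q <= 2)%N -> sobolev D 3 u -> sobolev D 3 v ->
  {ae leb2 R, forall x, D x -> Dw D p q (lin k u v) x = Dw D p q u x + k * Dw D p q v x}.
Proof. by move=> pq su sv; apply: (Dw_lin lr bt k su sv); exact: leq_trans pq _. Qed.

Lemma jet_bound : exists2 K, 0 <= K & forall i z, V z ->
  ess (Dw D 1 0 (cpt i z)) (K * N z) /\ ess (Dw D 0 1 (cpt i z)) (K * N z).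
Proof.
have [K K0 hK] := gradient_bound lr bt; exists K => // i z Vz.
have [h1 h2] := hK _ (cpt_sobolev i Vz).
have c : K * sobolev_norm D 3 (cpt i z) <= K * Num.sqrt (pair_dot D 3 z z).
  by rewrite -pair_normE; exact: (ler_wpM2l K0 (cpt_norm _ _ _ _ i z)).
by split; [exact: ess_bounded_le c h1|exact: ess_bounded_le c h2].
Qed.

(** [L1] and [L2] differentiate (r - s) / eps as one function, [Lop] combines derivatives of the
    components; with chosen representatives these agree only almost everywhere. *)
Lemma L1_Lop eps z : V z -> {ae leb2 R, forall p, D p ->
  L1 D eps z.1 z.2 p = Lop (Dw D) eps true z p /\ L2 D eps z.1 z.2 p = Lop (Dw D) eps false z p}.
Proof.
move=> [z1 z2].
have e : (fun q => (z.1 q - z.2 q) / eps) = lin (eps^-1 - 1) (lin (-1) z.1 z.2) (lin (-1) z.1 z.2).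
  by apply/funext => p; rewrite /lin; ring.
have sd := sobolev_lin (-1) z1 z2.
have a1 := ae_imp2 (Dw_lin lr bt (-1) z1 z2 (isT : (1 + 0 <= 3)%N))
  (Dw_lin lr bt (-1) z1 z2 (isT : (0 + 1 <= 3)%N)) (fun p m1 m2 => conj m1 m2).
have a2 := ae_imp2 (Dw_lin lr bt (eps^-1 - 1) sd sd (isT : (1 + 0 <= 3)%N))
  (Dw_lin lr bt (eps^-1 - 1) sd sd (isT : (0 + 1 <= 3)%N)) (fun p m1 m2 => conj m1 m2).
apply: ae_imp2 a1 a2 _ => p [e1 e2] [e3 e4] Dp.
have alg (A e' x x' y y' : R) : A + 2 * (x * (x + -1 * x' + (e' - 1) * (x + -1 * x')) +
    y * (y + -1 * y' + (e' - 1) * (y + -1 * y'))) = A + 2 * e' * (x * (x - x') + y * (y - y')).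
  by ring.
have gE : grad_dot D z.1 (fun q => (z.1 q - z.2 q) / eps) p =
    Dw D 1 0 z.1 p * (Dw D 1 0 z.1 p + -1 * Dw D 1 0 z.2 p + (eps^-1 - 1) * (Dw D 1 0 z.1 p + -1 * Dw D 1 0 z.2 p)) +
    Dw D 0 1 z.1 p * (Dw D 0 1 z.1 p + -1 * Dw D 0 1 z.2 p + (eps^-1 - 1) * (Dw D 0 1 z.1 p + -1 * Dw D 0 1 z.2 p)).
  by rewrite /grad_dot e (e3 Dp) (e4 Dp) (e1 Dp) (e2 Dp).
by rewrite /L1 /L2 gE; split; exact: alg.
Qed.

Lemma J_JJ eps lambda alpha z : 0 < eps -> V z ->
  J Q eps lambda alpha z = JJ D (Dw D) (pair_dot D 3) (psi lambda) eps alpha z.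
Proof.
move=> eps0 Vz; have [K K0 hK] := jet_bound; have [M M0 hM] := psi_bound lambda.
rewrite /J (OmegaE Q) pair_normE /JJ; congr (_ * _ + _).
have sL i : sqi (Lop (Dw D) eps i z) by apply: (Lop_sqi mD eps0 K0 cpt_L2le2 hK i Vz).
rewrite -int2D//; [|exact: (wdot_itg mD hM (sL _) (sL _))..].
have [m1 _] := sL true; have [m2 _] := sL false.
have mpsi : measurable_fun (D : set plane) (psi lambda) by case: hM.
have [z1 z2] := Vz.
have mg f p q : sobolev D 3 f -> (p + q <= 3)%N -> measurable_fun (D : set plane) (Dw D p q f).
  by move=> sf pq; have [] := Dw_sqi sf pq.
have ml f : sobolev D 3 f -> measurable_fun (D : set plane) (laplacian D f).
  move=> sf; have a := mg f 2%N 0%N sf isT; have b := mg f 0%N 2%N sf isT.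
  exact: (measurable_funD a b).
have sq : sobolev D 3 (fun q => (z.1 q - z.2 q) / eps).
  have -> : (fun q => (z.1 q - z.2 q) / eps) = lin (eps^-1 - 1) (lin (-1) z.1 z.2) (lin (-1) z.1 z.2).
    by apply/funext => p; rewrite /lin; ring.
  by apply: sobolev_lin; exact: sobolev_lin.
have mb : measurable_fun (D : set plane) (grad_dot D z.1 (fun q => (z.1 q - z.2 q) / eps)).
  have a := mg _ 1%N 0%N z1 isT; have a' := mg _ 1%N 0%N sq isT.
  have b := mg _ 0%N 1%N z1 isT; have b' := mg _ 0%N 1%N sq isT.
  exact: (measurable_funD (measurable_funM a a') (measurable_funM b b')).
have m2b := measurable_funM (measurable_cst (2 : R) : measurable_fun (D : set plane) _) mb.
have mL1 : measurable_fun (D : set plane) (L1 D eps z.1 z.2) by exact: (measurable_funD (ml _ z1) m2b).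
have mL2 : measurable_fun (D : set plane) (L2 D eps z.1 z.2) by exact: (measurable_funD (ml _ z2) m2b).
apply: (ae_int2 mD).
- apply: (measurable_funM _ mpsi); apply: measurable_funD; apply: measurable_funX; [exact: mL1|exact: mL2].
- apply: measurable_funD; (apply: (measurable_funM _ mpsi)); [exact: (measurable_funM m1 m1)|exact: (measurable_funM m2 m2)].
- apply: ae_imp1 (L1_Lop eps Vz) _ => p e Dp; have [-> ->] := e Dp.
  by move: (Lop _ _ _ _ _) (Lop _ _ _ _ _) (psi _ _) => x y w; ring.
Qed.

(** For |s - q| <= delta the exponents differ by 2 lambda |s - q| (s + q), at most 4 r, which does
    not involve lambda. The minimum with [rc1 Q] makes two such intervals fit side by side for every
    lambda >= 1. *)
Lemma gauss_slow lambda : 1 <= lambda ->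
  slow_weight l r (Num.min 1 (rc1 Q) / lambda) (expR (4 * r)) (expR (2 * lambda * r ^+ 2)) (gauss lambda).
Proof.
move=> l1; have lp : 0 < lambda by rewrite (lt_le_trans ltr01).
have m0 : 0 < Num.min 1 (rc1 Q) by rewrite lt_min ltr01 hc1.
have mm1 : Num.min 1 (rc1 Q) <= 1 by rewrite ge_min lexx.
have mc1 : Num.min 1 (rc1 Q) <= rc1 Q by rewrite ge_min lexx orbT.
move: (Num.min 1 (rc1 Q)) m0 mm1 mc1 => m m0 mm1 mc1.
have r0 : 0 < r by have := l0; have := hc1; lra.
split.
- exact: measurable_continuous (@gauss_continuous lambda).
- move=> s /andP[s1 s2]; rewrite expR_ge0 ler_expR ler_wpM2l ?mulr_ge0 ?(ltW lp)//.
  by rewrite ler_sqr ?nnegrE ?(ltW s2) ?(ltW r0)// ltW// (lt_trans l0).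
- exact: divr_gt0.
- apply: (@le_trans _ _ (2 * m)); last by move: mc1; lra.
  by rewrite ler_wpM2l// ler_pdivrMr// ler_peMr// ltW.
- exact: expR_ge0.
- move=> s q /andP[s1 s2] /andP[q1 q2]; rewrite ler_pdivlMr// => sq.
  rewrite /gauss -expRD ler_expR.
  have h : lambda * (s ^+ 2 - q ^+ 2) <= 2 * r.
    apply: (le_trans (ler_norm _)); rewrite normrM (gtr0_norm lp) subr_sqr normrM mulrA (mulrC lambda).
    have sp : `|s + q| <= 2 * r.
      rewrite ger0_norm; last by have := l0; lra.
      lra.
    apply: (@le_trans _ _ (1 * (2 * r))); last by rewrite mul1r.
    by apply: ler_pM => //; [rewrite mulr_ge0 ?(ltW lp)|exact: le_trans sq mm1].
  lra.
Qed.

(** The constant of [product_arith] for c = rc2 Q, half the height of the rectangle, m = min(1, rc1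
    Q) and the factor exp(4 r) of [gauss_slow]. *)
Definition product_const rho : R := (2 + 2 * rc2 Q ^+ 2) * rho ^+ 2 * (2 * expR (4 * r)) /
  (rc2 Q * Num.min 1 (rc1 Q)).

Lemma product_const_gt0 rho : 0 < rho -> 0 < product_const rho.
Proof.
move=> rho0; have m0 : 0 < Num.min 1 (rc1 Q) by rewrite lt_min ltr01 hc1.
rewrite divr_gt0 ?mulr_gt0 ?expR_gt0 ?exprn_gt0//.
by rewrite ltr_wpDr// mulr_ge0 ?sqr_ge0.
Qed.

Lemma weighted_product rho lambda f fy u ux : 1 <= lambda -> 0 <= rho ->
  L2le f rho -> L2le fy rho -> sqi u -> sqi ux ->
  weak_dy l r (rb Q - rc2 Q) (rb Q + rc2 Q) f fy -> weak_dx l r (rb Q - rc2 Q) (rb Q + rc2 Q) u ux ->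
  (leb2 R).-integrable D (EFin \o (fun p => f p ^+ 2 * u p ^+ 2 * psi lambda p)) /\
  int2 D (fun p => f p ^+ 2 * u p ^+ 2 * psi lambda p) <=
    product_const rho * (lambda * int2 D (fun p => u p ^+ 2 * psi lambda p) +
              lambda^-1 * int2 D (fun p => ux p ^+ 2 * psi lambda p)).
Proof.
move=> l1 rho0 [sf _ nf] [sfy _ nfy] su sux wf wu.
have lp : 0 < lambda by rewrite (lt_le_trans ltr01).
have [ii le] := product_bound lr bt (gauss_slow l1) sf sfy su sux wf wu.
have e : forall p, D p -> f p ^+ 2 * (u p ^+ 2 * gauss lambda p.1) = f p ^+ 2 * u p ^+ 2 * psi lambda p.
  by move=> p _; rewrite mulrA.
split; first exact: (eq_itg mD e ii).
move: le; rewrite (eq_int2 e).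
rewrite -/(int2 D (fun p => f p ^+ 2)) -/(int2 D (fun p => fy p ^+ 2)) in nf nfy *.
have a0 : 0 <= int2 D (fun p => u p ^+ 2 * psi lambda p).
  by apply: int2_ge0 => p _; rewrite mulr_ge0 ?sqr_ge0 ?expR_ge0.
have b0 : 0 <= int2 D (fun p => ux p ^+ 2 * psi lambda p).
  by apply: int2_ge0 => p _; rewrite mulr_ge0 ?sqr_ge0 ?expR_ge0.
rewrite -/(int2 D (fun p => u p ^+ 2 * psi lambda p)) -/(int2 D (fun p => ux p ^+ 2 * psi lambda p)).
have -> : (rb Q + rc2 Q - (rb Q - rc2 Q)) / 2 = rc2 Q by field.
have m0 : 0 < Num.min 1 (rc1 Q) by rewrite lt_min ltr01 hc1.
have mm1 : Num.min 1 (rc1 Q) <= 1 by rewrite ge_min lexx.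
have f0 : 0 <= int2 D (fun p => f p ^+ 2) by apply: int2_ge0 => p _; exact: sqr_ge0.
have fy0 : 0 <= int2 D (fun p => fy p ^+ 2) by apply: int2_ge0 => p _; exact: sqr_ge0.
have E0 : 0 < expR (4 * r) by exact: expR_gt0.
exact: (product_arith hc2 m0 mm1 (ltW E0) lp f0 nf nfy a0 b0).
Qed.

Lemma sobolev_dot2 u : sobolev D 3 u -> sobolev_dot D 2 u u =
  int2 D (fun p => Dw D 2 0 u p ^+ 2 + Dw D 1 1 u p ^+ 2 + Dw D 0 2 u p ^+ 2) +
  int2 D (fun p => Dw D 1 0 u p ^+ 2 + Dw D 0 1 u p ^+ 2) + int2 D (fun p => u p ^+ 2).
Proof.
move=> su; have i p q : (p + q <= 3)%N -> (leb2 R).-integrable D (EFin \o (fun x => Dw D p q u x ^+ 2)).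
  by move=> pq; case: (Dw_sqi su pq).
rewrite !int2D//; [|exact: i..|by apply: itgD => //; exact: i|exact: i].
have e00 : int2 D (fun p => u p ^+ 2) = int2 D (fun p => Dw D 0 0 u p ^+ 2).
  have su0 : sqi u by case: su.
  have [m0 _] := Dw_sqi su (isT : (0 + 0 <= 3)%N).
  apply: (ae_int2 mD); [by apply: measurable_funX; case: su0|exact: measurable_funX|].
  by apply: ae_imp1 (DwE lr bt (L2wd00 su0)) _ => p e Dp; rewrite e.
have sq p q : int2 D (fun x => Dw D p q u x * Dw D p q u x) = int2 D (fun x => Dw D p q u x ^+ 2).
  by apply: eq_int2 => x _; rewrite expr2.
rewrite e00 -(sum_triangle (fun p q => int2 D (fun x => Dw D p q u x ^+ 2))).
apply: eq_bigr => i0 _; rewrite big_mkcond; apply: eq_bigr => j0 _.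
by case: (_ <= _)%N => //; exact: sq.
Qed.

Variables (lambda0 C : R).
Hypotheses (hlambda0 : 1 <= lambda0) (hC : 0 < C).
Hypothesis carleman : carleman_estimate Q lambda0 C.

Lemma carleman_D lambda u : lambda0 <= lambda -> H0 Q 3 u ->
  C / lambda * int2 D (fun p => (Dw D 2 0 u p ^+ 2 + Dw D 1 1 u p ^+ 2 + Dw D 0 2 u p ^+ 2) * psi lambda p) +
  C * lambda * int2 D (fun p => (Dw D 1 0 u p ^+ 2 + Dw D 0 1 u p ^+ 2) * psi lambda p) +
  C * lambda ^+ 3 * int2 D (fun p => u p ^+ 2 * psi lambda p)
  <= int2 D (fun p => lap (Dw D) u p ^+ 2 * psi lambda p).
Proof.
move=> ll [su bu]; have su2 : sobolev D 2 u by move: su; rewrite OmegaE; exact: sobolev_le.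
have := @carleman lambda u ll; rewrite /H0 (OmegaE Q) => /(_ (conj su2 bu)) /=.
have -> : int2 D (fun p => grad_dot D u u p * psi lambda p) =
    int2 D (fun p => (Dw D 1 0 u p ^+ 2 + Dw D 0 1 u p ^+ 2) * psi lambda p).
  by apply: eq_int2 => p _; exact: sqr_sumE.
by [].
Qed.

(** The infimum of x^2 over the rectangle, because the rectangle lies in x > 0. *)
Let beta := (ra Q - rc1 Q) ^+ 2.

Lemma psi_lower lambda (p : R * R) : 0 < lambda -> D p -> expR (2 * (lambda * beta)) <= psi lambda p.
Proof.
move=> lp [/andP[p1 _] _]; rewrite ler_expR mulrA ler_wpM2l ?mulr_ge0 ?(ltW lp)//.
by rewrite /beta ler_sqr ?nnegrE ?(ltW l0) ?(ltW p1)// ltW// (lt_trans l0).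
Qed.

Lemma int2_psi_lower lambda f : 0 < lambda -> (forall p, 0 <= f p) ->
  (leb2 R).-integrable D (EFin \o f) ->
  expR (2 * (lambda * beta)) * int2 D f <= int2 D (fun p => f p * psi lambda p).
Proof.
move=> lp f0 fi; have [M M0 hM] := psi_bound lambda.
rewrite -int2Z//; apply: (le_int2 mD).
- exact: itgZ.
- by apply: (eq_itg mD _ (ess_bounded_itg mD hM fi)) => p _; rewrite mulrC.
- by apply: aeW => p Dp; rewrite mulrC ler_wpM2l// psi_lower.
Qed.

Lemma carleman_H2 lambda u : lambda0 <= lambda -> H0 Q 3 u ->
  C * beta * expR (lambda * beta) * sobolev_norm D 2 u ^+ 2 <=
  int2 D (fun p => lap (Dw D) u p ^+ 2 * psi lambda p).
Proof.
move=> ll hu; have l1 : 1 <= lambda by exact: le_trans ll.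
have lp : 0 < lambda by rewrite (lt_le_trans ltr01).
apply: le_trans (carleman_D ll hu).
have su : sobolev D 3 u by case: hu; rewrite OmegaE.
rewrite sqr_sobolev_norm (sobolev_dot2 su).
have i p q : (p + q <= 3)%N -> (leb2 R).-integrable D (EFin \o (fun x => Dw D p q u x ^+ 2)).
  by move=> pq; case: (Dw_sqi su pq).
have i0 : (leb2 R).-integrable D (EFin \o (fun x => u x ^+ 2)) by case: su => -[].
have i1 : (leb2 R).-integrable D (EFin \o (fun x => Dw D 1 0 u x ^+ 2 + Dw D 0 1 u x ^+ 2)).
  by apply: itgD => //; exact: i.
have i2 : (leb2 R).-integrable D (EFin \o (fun x => Dw D 2 0 u x ^+ 2 + Dw D 1 1 u x ^+ 2 + Dw D 0 2 u x ^+ 2)).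
  by apply: itgD => //; [apply: itgD => //; exact: i|exact: i].
have h0 := int2_psi_lower lp (fun p => sqr_ge0 (u p)) i0.
have h1 := int2_psi_lower lp (fun p => addr_ge0 (sqr_ge0 (Dw D 1 0 u p)) (sqr_ge0 (Dw D 0 1 u p))) i1.
have h2 := int2_psi_lower lp (fun p => addr_ge0 (addr_ge0 (sqr_ge0 (Dw D 2 0 u p)) (sqr_ge0 (Dw D 1 1 u p))) (sqr_ge0 (Dw D 0 2 u p))) i2.
have n0 : 0 <= int2 D (fun x => u x ^+ 2) by apply: int2_ge0 => p _; exact: sqr_ge0.
have n1 : 0 <= int2 D (fun x => Dw D 1 0 u x ^+ 2 + Dw D 0 1 u x ^+ 2).
  by apply: int2_ge0 => p _; rewrite addr_ge0 ?sqr_ge0.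
have n2 : 0 <= int2 D (fun x => Dw D 2 0 u x ^+ 2 + Dw D 1 1 u x ^+ 2 + Dw D 0 2 u x ^+ 2).
  by apply: int2_ge0 => p _; rewrite !addr_ge0 ?sqr_ge0.
have E : beta * expR (lambda * beta) <= lambda^-1 * expR (2 * (lambda * beta)).
  by apply: exp_arith lp.
rewrite -(mulrA C beta); exact: (carleman_arith l1 hC E (expR_ge0 _) n0 n1 n2 h0 h1 h2).
Qed.

Lemma remainder_lower rad eps : 0 < rad -> 0 < eps -> exists lambda1 C1,
  [/\ lambda0 <= lambda1, 0 < C1 & forall lambda z h, lambda1 <= lambda -> V z ->
     N z <= rad -> N h <= 2 * rad -> H0 Q 3 h.1 -> H0 Q 3 h.2 ->
     C1 * expR (lambda * beta) * pair_norm D 2 h ^+ 2 <= JR D (Dw D) (psi lambda) eps 1 z h].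
Proof.
move=> rad0 eps0; have [K K0 hK] := jet_bound.
have product_const_ge0 := product_const_gt0 rad0.
(* This value turns the smallness condition on the product term into an equality. *)
pose tau := C / 8 / (64 * (2 / eps) * product_const rad).
have tau0 : 0 < tau.
  apply: divr_gt0; first exact: divr_gt0.
  by apply: mulr_gt0 product_const_ge0; apply: mulr_gt0 => //; exact: divr_gt0.
pose M3 := 176 * (2 / eps * (K * rad)) ^+ 2 +
  2 * (2 / eps) * (128 * tau * (2 / eps * (K * rad) ^+ 2) ^+ 2 + tau^-1).
have b0 : 0 < beta by rewrite exprn_gt0.
(* The second entry of the maximum is the condition M3 <= C lambda / 8. The constant is the factor
   of [JR_lower] times that of [carleman_H2]. *)
exists (Num.max lambda0 (8 * M3 / C)), (Num.sqrt eps / 4 * (C * beta)); split.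
- by rewrite le_max lexx.
- by rewrite !mulr_gt0 ?invr_gt0 ?sqrtr_gt0.
move=> lambda z h; rewrite ge_max => /andP[ll lM] Vz nz nh hh1 hh2.
have l1 : 1 <= lambda by exact: le_trans ll.
have lp : 0 < lambda by rewrite (lt_le_trans ltr01).
have Vh : V h by move: (hh1.1) (hh2.1); rewrite OmegaE => s1 s2; exact: conj s1 s2.
have hh i : H0 Q 3 (cpt i h) by case: i; [exact: hh1|exact: hh2].
have [M M0 hM] := psi_bound lambda.
have prod (x y : bool * bool) := @weighted_product rad lambda
  (Dw D (if x.2 then 2 else 0) (if x.2 then 0 else 2) (cpt x.1 z))
  (Dw D (if x.2 then 2 else 0) (if x.2 then 1 else 3) (cpt x.1 z))
  (Dw D (if y.2 then 1 else 0) (if y.2 then 0 else 1) (cpt y.1 h))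
  (Dw D (if y.2 then 2 else 1) (if y.2 then 0 else 1) (cpt y.1 h)) l1 (ltW rad0).
have small : 64 * (2 / eps) * tau * product_const rad <= C / 8.
  rewrite le_eqVlt; apply/orP; left; apply/eqP; rewrite /tau; field.
  by rewrite !gt_eqF.
have large : M3 <= C * lambda / 8 by exact: ratio_arith.
have := @JR_lower R D mD (sobolev D 3) (Dw D) (pair_dot D 3) (psi lambda) eps K M rad lambda C (product_const rad)
  tau tau^-1 z h eps0 K0 lp hC (ltW product_const_ge0) tau0 (mulfV (lt0r_neq0 tau0)) hM (@psi_ge0 lambda)
  cpt_L2le2 hK Vz Vh nz nh (fun i => carleman_D ll (hh i)) _ small large.
move=> H; apply: le_trans (H _).
  have c1 := carleman_H2 ll hh1; have c2 := carleman_H2 ll hh2.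
  have -> : pair_norm D 2 h ^+ 2 = sobolev_norm D 2 h.1 ^+ 2 + sobolev_norm D 2 h.2 ^+ 2.
    by rewrite sqr_sqrtr// addr_ge0 ?sqr_ge0.
  have -> (x y e : R) : Num.sqrt eps / 4 * (C * beta) * e * (x + y) =
     Num.sqrt eps / 4 * (C * beta * e * x + C * beta * e * y) by ring.
  rewrite ler_wpM2l ?divr_ge0 ?sqrtr_ge0//; exact: lerD c1 c2.
move=> x y; apply: prod.
- by case: x => i [] /=; apply: L2le_le nz _; exact: cpt_L2le.
- by case: x => i [] /=; apply: L2le_le nz _; exact: cpt_L2le.
- by case: y => i [] /=; exact: (Dw_sqi (cpt_sobolev i Vh)).
- by case: y => i [] /=; exact: (Dw_sqi (cpt_sobolev i Vh)).
- by case: x => i [] /=; exact: (weak_dy_Dw (cpt_sobolev i Vz)).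
- by case: y => i [] /=; exact: (weak_dx_Dw (cpt_sobolev i Vh)).
Qed.

End rectangle_functional.

(** * Scalar inequalities for the minimization *)

Section arithmetic.
Context (R : realType).
Implicit Types (a b c x y rho alpha t : R).

Lemma twice_bound a b rho : a <= rho -> b <= rho -> a + `|-1| * b <= 2 * rho.
Proof. by rewrite normrN1 mul1r => h1 h2; lra. Qed.

Lemma drop_remainder a b c x y : 0 <= b -> b <= a -> x + y + c <= x + y + (a + c).
Proof. by move=> h1 h2; lra. Qed.

Lemma remainder_convexity a b c x y : b <= a -> b + c <= x + y + (a + c) - x - y.
Proof. by move=> h; lra. Qed.

(** The average of two tangent inequalities with opposite increments, so that the first-order terms
    cancel. *)
Lemma midpoint_arith a b c x y alpha :
  a + - 2^-1 * x + alpha * ((- 2^-1) ^+ 2 * y) <= b ->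
  a + 2^-1 * x + alpha * (2^-1 ^+ 2 * y) <= c ->
  a <= (b + c) / 2 - alpha / 4 * y.
Proof.
have -> : (- 2^-1) ^+ 2 = 4^-1 :> R by field.
have -> : (2^-1) ^+ 2 = 4^-1 :> R by field.
by move=> h1 h2; lra.
Qed.

Lemma half_sqr : (- 2^-1) ^+ 2 <= 1 :> R /\ 2^-1 ^+ 2 <= 1 :> R.
Proof. by rewrite sqrrN; split; lra. Qed.

Lemma hypot_half (e : R) : 0 < e -> Num.sqrt ((e / 2) ^+ 2 + (e / 2) ^+ 2) <= e.
Proof.
move=> e0; rewrite -[leRHS](ger0_norm (ltW e0)) -sqrtr_sqr ler_wsqrtr//.
have := sqr_ge0 e; rewrite exprMn; lra.
Qed.

Lemma uniqueness_arith a b c y alpha : 0 < alpha -> b <= a -> c <= a ->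
  a <= (b + c) / 2 - alpha / 4 * y -> y <= 0.
Proof.
by move=> a0 h1 h2 h3; rewrite leNgt; apply/negP => y0; have := mulr_gt0 a0 y0; lra.
Qed.

Lemma strip_linear x y : x - 2 * 0 <= y - 2 * 0 -> x <= y.
Proof. by rewrite mulr0 !subr0. Qed.

Lemma sqr_le_cancel a b c : 0 <= b -> a ^+ 2 + c <= b ^+ 2 + c -> a <= b.
Proof. by move=> b0 h; nra. Qed.

Lemma sqr_le_cancel_l a b c : 0 <= b -> c + a ^+ 2 <= c + b ^+ 2 -> a <= b.
Proof. by move=> b0 h; nra. Qed.

Lemma eq_le a b x y : a = x -> b = y -> a <= b -> x <= y.
Proof. by move=> -> ->. Qed.

Lemma lerDl_le x y : 0 <= y -> x <= x + y. Proof. by move=> y0; rewrite lerDl. Qed.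

Lemma lerDr_le x y : 0 <= x -> y <= x + y. Proof. by move=> x0; rewrite lerDr. Qed.

Lemma negate_arith x y : x + -1 * y = y + -1 * x + (-1 - 1) * (y + -1 * x).
Proof. by ring. Qed.

Lemma negate_le x : 0 <= x -> x + (-1 - 1) * x <= 0.
Proof. by move=> x0; lra. Qed.

Lemma midpoint_left x y : x + 2^-1 * y + 1 * (y + (- 2^-1 - 1) * y) = x.
Proof. by field. Qed.

Lemma midpoint_right x y :
  x + 2^-1 * (y + -1 * x) + 1 * (y + -1 * x + (2^-1 - 1) * (y + -1 * x)) = y.
Proof. by field. Qed.

Lemma lsc_arith a b c x y z u v e : 0 <= x -> x <= 1 -> x * (a + b) <= e ->
  `|y| <= a * x -> 0 <= b -> `|z| <= b * x ^+ 2 -> 0 <= c -> v = u + y + (z + c) -> u <= v + e.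
Proof.
move=> x0 x1 h; rewrite !ler_norml => /andP[hy _] b0 /andP[hz _] c0 ->.
have x2 : x ^+ 2 <= x by rewrite expr2 ler_piMl.
have := ler_wpM2l b0 x2; lra.
Qed.

End arithmetic.

(** * Minimization *)

Section minimization.
Context (R : realType) (Q : rectangle R).
Hypotheses (hc1 : 0 < rc1 Q) (hc2 : 0 < rc2 Q) (ha : rc1 Q < ra Q).
Notation plane := (measurableTypeR R * measurableTypeR R)%type.
Notation D := (box (ra Q - rc1 Q) (ra Q + rc1 Q) (rb Q - rc2 Q) (rb Q + rc2 Q)).
Notation fn := (R * R -> R).
Notation pr := (fn * fn)%type.
Notation fam := ((R -> fn) * (R -> fn))%type.
Implicit Types (u v : fn) (y h d G : pr) (z w : fam) (lambda alpha eps K M phi t e : R).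

Let lr := width_gt0 hc1.
Let bt := height_gt0 hc2.
Let mD : measurable (D : set plane) := measurable_box _ _ _ _.
Notation V := (fun y : pr => sobolev D 3 y.1 /\ sobolev D 3 y.2).
Notation N := (fun y : pr => Num.sqrt (pair_dot D 3 y y)).
Notation comb := (prod_comb (@lin R)).
Notation W := (fun y : pr => H0 Q 3 y.1 /\ H0 Q 3 y.2).
Notation dot := (pair_dot D 3).

Lemma W_semi_hilbert : semi_hilbert W comb dot.
Proof. by have := semi_hilbert_prod (H0_semi_hilbert hc1 hc2); rewrite OmegaE. Qed.

Lemma W_V y : W y -> V y.
Proof. by rewrite /H0 OmegaE => -[[h1 _] [h2 _]]; exact: conj h1 h2. Qed.

Lemma W_comb t y h : W y -> W h -> W (comb t y h).
Proof. exact: (sh_comb W_semi_hilbert). Qed.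

Lemma pair_subE y h : pair_sub y h = comb (-1) y h.
Proof. by rewrite /pair_sub !sub_lin. Qed.

Lemma pair_addE y h : pair_add y h = comb 1 y h.
Proof. by congr pair; apply/funext => p; rewrite /lin mul1r. Qed.

Lemma frechetE eps lambda alpha y G : 0 < eps -> V y ->
  frechet_derivative Q (J Q eps lambda alpha) y G ->
  W G /\ frechet D (Dw D) dot (psi lambda) eps alpha W y G.
Proof.
move=> eps0 Vy [G1 G2 hG]; split; first exact: conj G1 G2.
move=> e /hG [d d0 hd]; exists d => // h Wh nh.
have Vh := W_V Wh.
have Vc := sh_comb (pair_semi_hilbert lr bt) 1 Vy Vh.
have := hd h Wh.1 Wh.2; rewrite (OmegaE Q) (pair_normE _ _ _ _ h) => /(_ nh).
rewrite pair_addE (J_JJ hc1 hc2 lambda alpha eps0 Vy) (J_JJ hc1 hc2 lambda alpha eps0 Vc).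
by [].
Qed.

Lemma frechet_derivativeE eps lambda alpha y G : 0 < eps -> V y -> W G ->
  frechet D (Dw D) dot (psi lambda) eps alpha W y G ->
  frechet_derivative Q (J Q eps lambda alpha) y G.
Proof.
move=> eps0 Vy WG hG; split; [exact: WG.1|exact: WG.2|].
move=> e /hG [d d0 hd]; exists d => // h W1 W2; rewrite (OmegaE Q) (pair_normE _ _ _ _ h) => nh.
have Wh : W h by exact: conj W1 W2.
have Vh := W_V Wh.
have Vc := sh_comb (pair_semi_hilbert lr bt) 1 Vy Vh.
rewrite pair_addE (J_JJ hc1 hc2 lambda alpha eps0 Vy) (J_JJ hc1 hc2 lambda alpha eps0 Vc).
exact: hd Wh nh.
Qed.

Variables (rad eps : R).
Hypotheses (rad0 : 0 < rad) (eps0 : 0 < eps).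
Notation B g0 g1 := (B Q eps g0 g1 rad).
Notation clB g0 g1 := (clB Q eps g0 g1 rad).

Lemma clB_V g0 g1 z0 z phi : B g0 g1 z0 -> clB g0 g1 z -> angle phi ->
  V (slice z phi) /\ N (slice z phi) <= rad.
Proof.
move=> Bz0 cz aphi; have [s1 s2 n] := clB_slice hc1 hc2 Bz0 cz aphi.
rewrite (OmegaE Q) in s1 s2 n; rewrite pair_normE in n.
by split; [exact: conj s1 s2|exact: n].
Qed.

Lemma clB_W g0 g1 z0 z w phi : B g0 g1 z0 -> clB g0 g1 z -> clB g0 g1 w -> angle phi ->
  W (comb (-1) (slice z phi) (slice w phi)).
Proof. by move=> Bz0 cz cw aphi; exact: (clB_sub hc1 hc2 Bz0 cz cw aphi). Qed.

Lemma B_clB g0 g1 z0 : B g0 g1 z0 -> clB g0 g1 z0.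
Proof.
move=> Bz0; apply/(clBP hc1 hc2 _ Bz0); case: Bz0 => h n b1 b2.
by split; [exact: h|exact: b1|exact: b2|exact: ltW].
Qed.

Lemma norm_sub rho y h : V y -> V h -> N y <= rho -> N h <= rho -> N (comb (-1) y h) <= 2 * rho.
Proof.
move=> Vy Vh ny nh; apply: le_trans (norm_comb (pair_semi_hilbert lr bt) (-1) Vy Vh) _.
exact: (twice_bound ny nh).
Qed.

Lemma derivative_part lambda phi : angle phi -> exists C : R, 0 < C /\
  forall alpha g0 g1, 0 < alpha < 1 -> B g0 g1 !=set0 ->
  (forall z, clB g0 g1 z ->
     exists G, frechet_derivative Q (J Q eps lambda alpha) (slice z phi) G) /\
  (forall z1 z2 G1 G2, clB g0 g1 z1 -> clB g0 g1 z2 ->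
     frechet_derivative Q (J Q eps lambda alpha) (slice z1 phi) G1 ->
     frechet_derivative Q (J Q eps lambda alpha) (slice z2 phi) G2 ->
     pair_norm (Omega Q) 3 (pair_sub G2 G1) <=
     C * pair_norm (Omega Q) 3 (pair_sub (slice z2 phi) (slice z1 phi))).
Proof.
move=> aphi; have [K K0 hK] := jet_bound hc1 hc2; have [M M0 hM] := psi_bound Q lambda.
have hs := pair_semi_hilbert lr bt.
(* The absolute value and the 1 only secure positivity; the constant is fixed before [alpha] and the
   boundary data. *)
exists (`|lipschitz_const eps K M rad| + 1); split; first by rewrite ltr_wpDl.
move=> alpha g0 g1 a01 [z0 Bz0]; split.
  move=> z cz; have [Vz nz] := clB_V Bz0 cz aphi.
  (* The zero increment, obtained as the difference of a slice with itself. *)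
  have W0 : exists h, W h by exists (comb (-1) (slice z phi) (slice z phi)); exact: (clB_W Bz0 cz cz aphi).
  have [G WG hG] := frechet_exists mD eps0 K0 M0 a01 hM hs (Dw_lin2 hc1 hc2) (@cpt_L2le2 _ Q) hK
    W_V W0 W_semi_hilbert Vz.
  by exists G; exact: frechet_derivativeE eps0 Vz WG hG.
move=> z1 z2 G1 G2 cz1 cz2 fG1 fG2.
have [V1 n1] := clB_V Bz0 cz1 aphi; have [V2 n2] := clB_V Bz0 cz2 aphi.
have [WG1 F1] := frechetE eps0 V1 fG1; have [WG2 F2] := frechetE eps0 V2 fG2.
have r1 := frechet_repr mD eps0 K0 M0 a01 hM hs (Dw_lin2 hc1 hc2) (@cpt_L2le2 _ Q) hK
  W_V W_comb V1 (W_V WG1) F1.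
have r2 := frechet_repr mD eps0 K0 M0 a01 hM hs (Dw_lin2 hc1 hc2) (@cpt_L2le2 _ Q) hK
  W_V W_comb V2 (W_V WG2) F2.
set d := comb (-1) (slice z2 phi) (slice z1 phi).
have e : comb 1 (slice z1 phi) d = slice z2 phi by exact: comb_sub.
have Vd : V d by exact: (sh_comb hs).
have nd : N d <= 2 * rad by exact: norm_sub V2 V1 n2 n1.
rewrite -e in n2 r2.
have := representer_lip mD eps0 K0 M0 a01 hM hs (Dw_lin2 hc1 hc2) (@cpt_L2le2 _ Q) hK
  W_V W_comb V1 Vd n1 nd n2 WG1 WG2 r1 r2.
rewrite (OmegaE Q) !pair_subE !pair_normE -/d => /le_trans; apply.
by rewrite ler_wpM2r ?sqrtr_ge0// (le_trans (ler_norm _))// lerDl.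
Qed.

Section fixed_parameters.
Variables (lambda alpha phi : R) (g0 g1 : R -> fn) (z0 : fam).
Hypotheses (aphi : angle phi) (a01 : 0 < alpha < 1) (Bz0 : B g0 g1 z0).
Notation clB := (clB g0 g1).
Variable C1 : R.
Hypothesis C10 : 0 <= C1.
Hypothesis lower : forall y h, V y -> N y <= rad -> N h <= 2 * rad -> W h ->
  C1 * pair_norm D 2 h ^+ 2 <= JR D (Dw D) (psi lambda) eps 1 y h.

Notation Jf := (JJ D (Dw D) dot (psi lambda) eps alpha).
Notation DJ := (DJ D (Dw D) dot (psi lambda) eps alpha).
Notation JR := (JR D (Dw D) (psi lambda) eps).

Let hs := pair_semi_hilbert lr bt.
Let slV z : clB z -> V (slice z phi). Proof. by move=> cz; case: (clB_V Bz0 cz aphi). Qed.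
Let slN z : clB z -> N (slice z phi) <= rad. Proof. by move=> cz; case: (clB_V Bz0 cz aphi). Qed.

Lemma JJ_increment y h : V y -> V h -> Jf (comb 1 y h) = Jf y + DJ y h + (JR 1 y h + alpha * dot h h).
Proof.
move=> Vy Vh; have [K K0 hK] := jet_bound hc1 hc2; have [M M0 hM] := psi_bound Q lambda.
rewrite (JJ_expand mD alpha eps0 K0 hM hs (Dw_lin2 hc1 hc2) (@cpt_L2le2 _ Q) hK 1 Vy Vh).
by rewrite expr1n !mul1r sqr_sqrtr// (sh_ge0 hs).
Qed.

Lemma JJ_tangent y h : V y -> N y <= rad -> N h <= 2 * rad -> W h ->
  Jf y + DJ y h + alpha * dot h h <= Jf (comb 1 y h).
Proof.
move=> Vy ny nh Wh; rewrite (JJ_increment Vy (W_V Wh)).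
exact: drop_remainder (mulr_ge0 C10 (sqr_ge0 _)) (lower Vy ny nh Wh).
Qed.

Lemma strong_convexity z1 z2 G1 : clB z1 -> clB z2 ->
  frechet_derivative Q (J Q eps lambda alpha) (slice z1 phi) G1 ->
  C1 * pair_norm (Omega Q) 2 (pair_sub (slice z2 phi) (slice z1 phi)) ^+ 2 +
  alpha * pair_norm (Omega Q) 3 (pair_sub (slice z2 phi) (slice z1 phi)) ^+ 2 <=
  J Q eps lambda alpha (slice z2 phi) - J Q eps lambda alpha (slice z1 phi) -
  pair_dot (Omega Q) 3 G1 (pair_sub (slice z2 phi) (slice z1 phi)).
Proof.
move=> cz1 cz2 fG1; set h := pair_sub _ _; have [K K0 hK] := jet_bound hc1 hc2; have [M M0 hM] := psi_bound Q lambda.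
have V1 := slV cz1; have V2 := slV cz2.
have [WG1 F1] := frechetE eps0 V1 fG1.
have r1 := frechet_repr mD eps0 K0 M0 a01 hM hs (Dw_lin2 hc1 hc2) (@cpt_L2le2 _ Q) hK
  W_V W_comb V1 (W_V WG1) F1.
have hE : h = comb (-1) (slice z2 phi) (slice z1 phi) by exact: pair_subE.
have Wh : W h by rewrite hE; exact: clB_W Bz0 cz2 cz1 aphi.
have nh : N h <= 2 * rad by rewrite hE; exact: norm_sub V2 V1 (slN cz2) (slN cz1).
have e : comb 1 (slice z1 phi) h = slice z2 phi by rewrite hE; exact: comb_sub.
rewrite (OmegaE Q) (r1 _ Wh) (J_JJ hc1 hc2 lambda alpha eps0 V1) (J_JJ hc1 hc2 lambda alpha eps0 V2).
rewrite -{1}e (JJ_increment V1 (W_V Wh)) (sqr_pair_norm _ _ _ _ h).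
exact: remainder_convexity (lower V1 (slN cz1) nh Wh).
Qed.

(** The tangent inequality at the midpoint, which belongs to the closed ball, for the increments - d
    / 2 and d / 2. The term in [alpha] alone gives the quadratic gain. *)
Lemma JJ_midpoint z w : clB z -> clB w ->
  Jf (comb 2^-1 (slice z phi) (comb (-1) (slice w phi) (slice z phi))) <=
  (Jf (slice z phi) + Jf (slice w phi)) / 2 -
  alpha / 4 * dot (comb (-1) (slice z phi) (slice w phi)) (comb (-1) (slice z phi) (slice w phi)).
Proof.
move=> cz cw; have [K K0 hK] := jet_bound hc1 hc2; have [M M0 hM] := psi_bound Q lambda.
have Vz := slV cz; have Vw := slV cw.
have t01 : 0 <= (2^-1 : R) <= 1 by rewrite invr_ge0 ler0n invf_le1 ?ler1n.
have cm : clB (fam2conv 2^-1 z w) by exact: clB_conv Bz0 t01 cz cw.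
have Vm := slV cm; have nm := slN cm; rewrite slice_conv in Vm nm.
set m := comb 2^-1 _ _ in Vm nm *.
set d := comb (-1) (slice w phi) (slice z phi) in m Vm nm *.
have Wd : W d by exact: clB_W Bz0 cw cz aphi.
have Vd := W_V Wd.
have nd : N d <= 2 * rad by exact: norm_sub Vw Vz (slN cw) (slN cz).
have ez : comb 1 m (comb (- 2^-1 - 1) d d) = slice z phi.
  rewrite /m; case: (slice z phi) => x1 x2; congr pair; apply/funext => p; exact: midpoint_left.
have ew : comb 1 m (comb (2^-1 - 1) d d) = slice w phi.
  rewrite /m /d; case: (slice w phi) => x1 x2; congr pair; apply/funext => p; exact: midpoint_right.
have Wt t : W (comb (t - 1) d d) by exact: W_comb.
have dt t : dot (comb (t - 1) d d) (comb (t - 1) d d) = t ^+ 2 * dot d d.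
  by rewrite (sqr_norm_comb hs (t - 1) Vd Vd); ring.
have d0 := sh_ge0 hs Vd.
have nt t : t ^+ 2 <= 1 -> N (comb (t - 1) d d) <= 2 * rad.
  by move=> t1; apply: le_trans nd; rewrite dt ler_wsqrtr// ler_piMl.
have [q1 q2] := half_sqr R.
have i1 := JJ_tangent Vm nm (nt _ q1) (Wt _).
have i2 := JJ_tangent Vm nm (nt _ q2) (Wt _).
have Dt t : DJ m (comb (t - 1) d d) = t * DJ m d.
  rewrite (DJ_comb mD alpha eps0 K0 hM hs (Dw_lin2 hc1 hc2) (@cpt_L2le2 _ Q) hK (t - 1) Vm Vd Vd).
  by rewrite mulrBl mul1r addrC subrK.
rewrite ez dt Dt in i1; rewrite ew dt Dt in i2.
rewrite (sqr_norm_sub_sym hs Vz Vw) -/d.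
exact: midpoint_arith i1 i2.
Qed.

Lemma JJ_ge0 y : V y -> 0 <= Jf y.
Proof.
move=> Vy; have [a0 _] := andP a01; rewrite /JJ.
have q u : 0 <= wdot D (psi lambda) u u.
  by apply: int2_ge0 => p _; rewrite -expr2 mulr_ge0 ?sqr_ge0 ?expR_ge0.
by rewrite addr_ge0 ?mulr_ge0 ?sqrtr_ge0 ?addr_ge0 ?sqr_ge0 ?(ltW a0).
Qed.

Lemma JJ_lsc y e : V y -> N y <= rad -> 0 < e -> exists2 c, 0 < c & forall h, V h -> N h <= rad ->
  dot (comb (-1) h y) (comb (-1) h y) <= c -> Jf y <= Jf h + e.
Proof.
move=> Vy ny e0; have [K K0 hK] := jet_bound hc1 hc2; have [M M0 hM] := psi_bound Q lambda.
have [a0 _] := andP a01.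
(* The remainder is bounded with radius 2 rad because [JR_bound] uses one radius for the base point
   and for the increment, a difference of two points of the ball. *)
pose A := `|derivative_const eps K M rad|; pose X := remainder_const eps K M (2 * rad).
have X0 : 0 <= X by apply: remainder_const_ge0 => //; rewrite mulr_ge0// ltW.
have AX : 0 < A + X + 1 by apply: ltr_wpDl (ltr01); exact: addr_ge0 (normr_ge0 _) X0.
pose s := Num.min 1 (e / (A + X + 1)).
have s0 : 0 < s by rewrite lt_min ltr01 divr_gt0.
exists (s ^+ 2) => [|h Vh nh hd]; first exact: exprn_gt0.
set d := comb (-1) h y in hd *.
have Vd : V d by exact: (sh_comb hs).
have nd : N d <= 2 * rad by exact: norm_sub Vh Vy nh ny.
have ns : N d <= s by rewrite -[leRHS](ger0_norm (ltW s0)) -sqrtr_sqr ler_wsqrtr.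
have e1 : comb 1 y d = h by exact: comb_sub.
have b1 : `|DJ y d| <= A * N d.
  apply: le_trans (DJ_bound mD eps0 K0 M0 a01 hM hs (@cpt_L2le2 _ Q) hK Vy Vd ny) _.
  by rewrite ler_wpM2r ?sqrtr_ge0// ler_norm.
have ny2 : N y <= 2 * rad by apply: le_trans ny _; rewrite ler_peMl ?ler1n// ltW.
have b2 : `|JR 1 y d| <= X * N d ^+ 2.
  by apply: (JR_bound mD eps0 K0 M0 hM (@cpt_L2le2 _ Q) hK Vy Vd _ ny2 nd); rewrite normr1.
have s1 : s <= 1 by rewrite ge_min lexx.
have sA : s <= e / (A + X + 1) by rewrite ge_min lexx orbT.
have h1 : N d * (A + X) <= e.
  apply: (@le_trans _ _ (N d * (A + X + 1))); first by rewrite ler_wpM2l ?sqrtr_ge0// lerDl.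
  by rewrite -ler_pdivlMr//; exact: le_trans ns sA.
apply: (lsc_arith (sqrtr_ge0 _) (le_trans ns s1) h1 b1 X0 b2 (mulr_ge0 (ltW a0) (sh_ge0 hs Vd))).
by rewrite -{1}e1; exact: JJ_increment.
Qed.

Let f1 := d_phi (s0 g0).
Let h1 := d_phi (s1 g0 g1).
Let f2 t p := d_phi (s0 g0) t p - eps * s0 g0 t p.
Let h2 t p := d_phi (s1 g0 g1) t p - eps * s1 g0 g1 t p.

Definition admissible t y := V y /\
  (boundary_conditions Q y.1 (f1 t) (h1 t) /\ boundary_conditions Q y.2 (f2 t) (h2 t)).

Lemma admissible_slice z t : clB z -> angle t -> admissible t (slice z t).
Proof.
move=> cz at_; have [Vz _] := clB_V Bz0 cz at_.
have /(clBP hc1 hc2 _ Bz0)[_ b1 b2 _] := cz.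
by split; [exact: Vz|split; [exact: (b1 t at_)|exact: (b2 t at_)]].
Qed.

Lemma admissible_closed t (u_ : nat -> pr) y : (forall n, admissible t (u_ n)) -> V y ->
  (forall e, 0 < e -> exists m, forall n, (m <= n)%N ->
     dot (comb (-1) (u_ n) y) (comb (-1) (u_ n) y) <= e) -> admissible t y.
Proof.
move=> hu Vy cu; split; first exact: Vy.
split.
  apply: (boundary_lim hc1 hc2 (u_ := fun n => (u_ n).1)) Vy.1 _ => [n|e /cu [m hm]].
    by have [[? _] [? _]] := hu n; split.
  exists m => n /hm; apply: le_trans; rewrite lerDl; exact: sobolev_dot_ge0.
apply: (boundary_lim hc1 hc2 (u_ := fun n => (u_ n).2)) Vy.2 _ => [n|e /cu [m hm]].
  by have [[_ ?] [_ ?]] := hu n; split.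
exists m => n /hm; apply: le_trans; rewrite lerDr; exact: sobolev_dot_ge0.
Qed.

Lemma admissible_midpoint t y h : admissible t y -> admissible t h -> admissible t (comb 2^-1 y (comb (-1) h y)).
Proof.
move=> [Vy [b1 b2]] [Vh [b1' b2']]; have s (u : fn) : sobolev D 3 u -> sobolev D 2 u by exact: sobolev_le.
split; first by do 2 apply: (sh_comb hs) => //.
split.
  exact: (boundary_affine hc1 hc2 2^-1 (s _ Vy.1) (s _ Vh.1) b1 b1').
exact: (boundary_affine hc1 hc2 2^-1 (s _ Vy.2) (s _ Vh.2) b2 b2').
Qed.

(** The boundary conditions do not couple the components, so one component of a competitor may be
    exchanged alone; minimizing the joint norm therefore minimizes each component norm. *)
Lemma min_norm_admissible t : angle t -> exists m, admissible t m /\ forall y, admissible t y ->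
  sobolev_norm D 3 m.1 <= sobolev_norm D 3 y.1 /\ sobolev_norm D 3 m.2 <= sobolev_norm D 3 y.2.
Proof.
move=> at_.
have [||||||m bm hm] := @quadratic_minimize _ _ V comb dot hs (admissible t) (fun=> 0) 0.
- by move=> y [].
- by exists (slice z0 t); apply: admissible_slice => //; exact: B_clB.
- exact: admissible_closed.
- exact: admissible_midpoint.
- by move=> k u v _ _; rewrite mulr0 addr0.
- by move=> u _; rewrite normr0 mul0r.
exists m; split; first exact: bm.
have [Vm [m1 m2]] := bm.
have q y : admissible t y -> dot m m <= dot y y by move=> /hm /strip_linear.
move=> y [Vy [y1 y2]]; split.
  have := q (y.1, m.2) (conj (conj Vy.1 Vm.2) (conj y1 m2)); rewrite /pair_dot /= -!sqr_sobolev_norm.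
  apply: sqr_le_cancel; exact: sqrtr_ge0.
have := q (m.1, y.2) (conj (conj Vm.1 Vy.2) (conj m1 y2)); rewrite /pair_dot /= -!sqr_sobolev_norm.
apply: sqr_le_cancel_l; exact: sqrtr_ge0.
Qed.

(* Any admissible slice at [phi] extends to a member of the closed ball: at the
   other angles take the boundary-value extensions of minimal norm. *)
Lemma admissible_extends y : admissible phi y ->
  (forall e, 0 < e -> exists2 w, clB w & sobolev_norm D 3 y.1 <= sobolev_norm D 3 (w.1 phi) + e /\
     sobolev_norm D 3 y.2 <= sobolev_norm D 3 (w.2 phi) + e) ->
  exists2 z, clB z & slice z phi = y.
Proof.
move=> by_ near.
have /choice[m hm] : forall t, exists m, angle t -> admissible t m /\ forall y, admissible t y ->
    sobolev_norm D 3 m.1 <= sobolev_norm D 3 y.1 /\ sobolev_norm D 3 m.2 <= sobolev_norm D 3 y.2.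
  move=> t; have [/min_norm_admissible [m hm]|n] := pselect (angle t); first by exists m.
  by exists y => /n.
(* Outside the open interval of angles the slices of [z0] are kept: membership in [H] also requires
   Sobolev slices at the end points 0 and 2 pi. *)
pose g t : pr := if t == phi then y else if `[< angle t >] then m t else slice z0 t.
have gphi : g phi = y by rewrite /g eqxx.
have gE t : angle t -> t != phi -> g t = m t.
  by move=> at_ /negPf tp; rewrite /g tp; case: asboolP.
have gn t : ~ angle t -> g t = slice z0 t.
  move=> nt; rewrite /g; case: eqP => [e|_]; first by case: nt; rewrite e.
  by case: asboolP.
have gb t : angle t -> admissible t (g t).
  by move=> at_; have [->|tp] := eqVneq t phi; [rewrite gphi|rewrite gE//; case: (hm t at_)].
pose z : fam := (fun t => (g t).1, fun t => (g t).2).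
(* Each component norm of the glued family is compared with that of a member [w] of the closed ball:
   at [phi] by assumption up to [e], at other angles by minimality. *)
have gle w e : clB w -> 0 <= e -> sobolev_norm D 3 y.1 <= sobolev_norm D 3 (w.1 phi) + e ->
   sobolev_norm D 3 y.2 <= sobolev_norm D 3 (w.2 phi) + e ->
   (forall t, angle t -> sobolev_norm (Omega Q) 3 (z.1 t) <= H_norm Q w.1 + e) /\
   (forall t, angle t -> sobolev_norm (Omega Q) 3 (z.2 t) <= H_norm Q w.2 + e).
  move=> cw e0 n1 n2; have /(clBP hc1 hc2 _ Bz0)[[hw1 hw2] _ _ _] := cw.
  have U1 t (at_ : angle t) := H_norm_ub hw1 at_; have U2 t (at_ : angle t) := H_norm_ub hw2 at_.
  have mE t : sobolev_norm (Omega Q) 3 = sobolev_norm D 3 by rewrite OmegaE.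
  split=> t at_; have [tp|tp] := eqVneq t phi.
  - rewrite /z /= tp gphi (mE t); apply: (le_trans n1).
    by rewrite lerD2r; have := U1 phi aphi; rewrite (mE t).
  - rewrite /z /= gE// (mE t); have [_ mm] := hm t at_.
    have [l1 _] := mm _ (admissible_slice cw at_).
    apply: (le_trans l1); have := U1 t at_; rewrite (mE t) => /le_trans; apply; by rewrite lerDl.
  - rewrite /z /= tp gphi (mE t); apply: (le_trans n2).
    by rewrite lerD2r; have := U2 phi aphi; rewrite (mE t).
  - rewrite /z /= gE// (mE t); have [_ mm] := hm t at_.
    have [_ l2] := mm _ (admissible_slice cw at_).
    apply: (le_trans l2); have := U2 t at_; rewrite (mE t) => /le_trans; apply; by rewrite lerDl.
have sz t : 0 <= t <= 2 * pi -> sobolev (Omega Q) 3 (g t).1 /\ sobolev (Omega Q) 3 (g t).2.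
  move=> ht; have [at_|nt] := pselect (angle t).
    by rewrite (OmegaE Q); case: (gb t at_).
  rewrite (gn t nt); case: Bz0 => -[[h01 _] [h02 _]] _ _ _.
  by split; [exact: h01|exact: h02].
have Hz : H2 Q z.
  have [w cw [n1 n2]] := near 1 ltr01; have [u1 u2] := gle w 1 cw ler01 n1 n2.
  split; [apply: H_bounded u1|apply: H_bounded u2] => t ht; [exact: (sz t ht).1|exact: (sz t ht).2].
exists z; last by rewrite /slice /z /= gphi; case: (y).
apply/(clBP hc1 hc2 _ Bz0); split; first exact: Hz.
- by move=> t at_; have [_ [b1 _]] := gb t at_.
- by move=> t at_; have [_ [_ b2]] := gb t at_.
- apply/ler_addgt0Pr => e e0; have e2 : 0 < e / 2 by rewrite divr_gt0.
  have [w cw [n1 n2]] := near _ e2; have [u1 u2] := gle w _ cw (ltW e2) n1 n2.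
  have /(clBP hc1 hc2 _ Bz0)[[hw1 hw2] _ _ nw] := cw.
  have hz1 := H_norm_ge0 Hz.1; have hz2 := H_norm_ge0 Hz.2.
  apply: (le_trans (hypot_le hz1 hz2 (H_norm_lub u1) (H_norm_lub u2))).
  apply: (le_trans (hypotD (H_norm_ge0 hw1) (H_norm_ge0 hw2) (ltW e2) (ltW e2))).
  apply: (lerD nw); exact: hypot_half e0.
Qed.

Lemma minimizer_exists : exists2 z, clB z & forall w, clB w -> Jf (slice z phi) <= Jf (slice w phi).
Proof.
have [a0 _] := andP a01; have cz0 := B_clB Bz0.
have c40 : 0 < alpha / 4 by rewrite divr_gt0.
(* The minimization is carried out over slices at [phi], where the distance is a single H^3 norm;
   [admissible_extends] makes this set closed. *)
pose S y := exists2 z, clB z & slice z phi = y.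
have [||||||y [z cz zy] hy] := @midpoint_minimize _ _ V comb dot hs S Jf (alpha / 4) 0 c40.
- by move=> y [z cz <-]; exact: slV.
- by exists (slice z0 phi), z0.
- move=> u_ y Su Vy cu; apply: admissible_extends.
    apply: admissible_closed Vy cu => n; have [z cz <-] := Su n; exact: admissible_slice.
  move=> e e0; have e2 : 0 < e ^+ 2 by exact: exprn_gt0.
  have [m /(_ m (leqnn m)) hm] := cu _ e2; have [w cw ew] := Su m.
  exists w => //; have Vw := slV cw; rewrite -ew in hm.
  have n (i : bool) : sobolev_norm D 3 (cpt i y) <= sobolev_norm D 3 (cpt i (slice w phi)) + e.
    have s1 := cpt_sobolev i Vy; have s2 := cpt_sobolev i Vw.
    have hs1 := sobolev_semi_hilbert lr bt 3.
    have sl := sh_comb hs1 (-1) s1 s2.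
    have -> : cpt i y = lin 1 (cpt i (slice w phi)) (lin (-1) (cpt i y) (cpt i (slice w phi))).
      by apply/funext => p; rewrite /lin; ring.
    apply: le_trans (norm_comb hs1 1 s2 sl) _; rewrite normr1 mul1r; apply: lerD; first by [].
    rewrite -[leRHS](ger0_norm (ltW e0)) -sqrtr_sqr ler_wsqrtr//; apply: le_trans hm.
    rewrite (sqr_norm_sub_sym hs1 s1 s2) /pair_dot.
    by case: (i); [rewrite lerDl|rewrite lerDr]; exact: sobolev_dot_ge0.
  by split; [exact: (n true)|exact: (n false)].
- by move=> y [z cz <-]; apply: JJ_ge0; exact: slV.
- move=> _ _ [z cz <-] [w cw <-].
  exists (slice (fam2conv 2^-1 z w) phi); last exact: JJ_midpoint.
  exists (fam2conv 2^-1 z w); last reflexivity.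
  apply: (clB_conv hc1 hc2 Bz0 _ cz cw); by rewrite invr_ge0 ler0n invf_le1 ?ler1n.
- move=> _ [z cz <-] e e0; have [c c0 hc] := JJ_lsc (slV cz) (slN cz) e0.
  by exists c => // _ [w cw <-]; apply: hc; [exact: slV|exact: slN].
exists z; first exact: cz.
by move=> w cw; rewrite zy; exact: (hy _ (ex_intro2 _ _ w cw erefl)).
Qed.

(** By [JJ_midpoint] two minimizers are at distance zero in the semi-norm; the derivative of order
    zero of their difference then vanishes almost everywhere. *)
Lemma minimizer_unique z w : clB z -> clB w ->
  (forall x, clB x -> Jf (slice z phi) <= Jf (slice x phi)) ->
  (forall x, clB x -> Jf (slice w phi) <= Jf (slice x phi)) ->
  {ae leb2 R, forall p, D p -> (slice z phi).1 p = (slice w phi).1 p /\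
     (slice z phi).2 p = (slice w phi).2 p}.
Proof.
move=> cz cw mz mw; have [a0 _] := andP a01.
have h := JJ_midpoint cz cw.
have cm : clB (fam2conv 2^-1 z w).
  by apply: (clB_conv hc1 hc2 Bz0 _ cz cw); rewrite invr_ge0 ler0n invf_le1 ?ler1n.
have [Vz Vw] := (slV cz, slV cw).
have q : dot (comb (-1) (slice z phi) (slice w phi)) (comb (-1) (slice z phi) (slice w phi)) <= 0.
  by apply: uniqueness_arith a0 (mz _ cm) (mw _ cm) h.
have key (u v : fn) : sobolev D 3 u -> sobolev D 3 v -> sobolev_dot D 3 (lin (-1) u v) (lin (-1) u v) <= 0 ->
    {ae leb2 R, forall p, D p -> u p = v p}.
  move=> su sv n; have sl := sobolev_lin (-1) su sv.
  have s0 := Dw_sqi sl (isT : (0 + 0 <= 3)%N).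
  have z1 := sqr_RI_eq0 mD s0 (le_trans (int2_Dw_le _ _ _ _ _ (isT : (0 + 0 <= 3)%N)) n).
  have ss : square_integrable (leb2 R) D (lin (-1) u v) by case: sl.
  apply: ae_imp2 z1 (DwE lr bt (L2wd00 ss)) _ => p e1 e2 Dp.
  by have := e2 Dp; rewrite e1// /lin mulN1r => /esym/eqP; rewrite subr_eq0 => /eqP.
have n1 := sobolev_dot_ge0 (ra Q - rc1 Q) (ra Q + rc1 Q) (rb Q - rc2 Q) (rb Q + rc2 Q) 3 (lin (-1) (z.1 phi) (w.1 phi)).
have n2 := sobolev_dot_ge0 (ra Q - rc1 Q) (ra Q + rc1 Q) (rb Q - rc2 Q) (rb Q + rc2 Q) 3 (lin (-1) (z.2 phi) (w.2 phi)).
have k1 := key _ _ Vz.1 Vw.1 (le_trans (@lerDl_le _ (sobolev_dot D 3 _ _) _ n2) q).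
have k2 := key _ _ Vz.2 Vw.2 (le_trans (@lerDr_le _ _ (sobolev_dot D 3 _ _) n1) q).
by apply: ae_imp2 k1 k2 _ => p e1 e2 Dp; split; [exact: e1|exact: e2].
Qed.

Lemma minimizer_variational z w G : clB z -> clB w ->
  (forall x, clB x -> Jf (slice z phi) <= Jf (slice x phi)) ->
  frechet_derivative Q (J Q eps lambda alpha) (slice z phi) G ->
  pair_dot (Omega Q) 3 G (pair_sub (slice z phi) (slice w phi)) <= 0.
Proof.
move=> cz cw mz fG; have [K K0 hK] := jet_bound hc1 hc2; have [M M0 hM] := psi_bound Q lambda.
have [Vz Vw] := (slV cz, slV cw).
have [WG FG] := frechetE eps0 Vz fG.
have r1 := frechet_repr mD eps0 K0 M0 a01 hM hs (Dw_lin2 hc1 hc2) (@cpt_L2le2 _ Q) hK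
  W_V W_comb Vz (W_V WG) FG.
set d := comb (-1) (slice w phi) (slice z phi).
have Wd : W d by exact: (clB_W Bz0 cw cz aphi).
have Vd := W_V Wd.
have nn : 0 <= DJ (slice z phi) d.
  apply: (first_order mD eps0 K0 M0 a01 hM hs (Dw_lin2 hc1 hc2) (@cpt_L2le2 _ Q) hK Vz Vd) => t /andP[t0 t1].
  have t01 : 0 <= t <= 1 by rewrite (ltW t0) t1.
  by have := mz _ (clB_conv hc1 hc2 Bz0 t01 cz cw); rewrite slice_conv.
(* The increment z - w is - d, whereas convexity allows only steps from [z] in the direction [d] of
   [w]. *)
have e : pair_sub (slice z phi) (slice w phi) = comb (- 1 - 1) d d.
  by rewrite pair_subE /d; congr pair; apply/funext => p; exact: negate_arith.
rewrite (OmegaE Q) e (dot_combr hs _ Vd Vd (W_V WG)) (r1 _ Wd).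
exact: negate_le.
Qed.

End fixed_parameters.
End minimization.

Unset Implicit Arguments.

Theorem theorem5p2 (R : realType) (Q : rectangle R)
    (hc1 : 0 < rc1 Q) (hc2 : 0 < rc2 Q) (ha : rc1 Q < ra Q)
    (lambda0 C : R) (hlambda0 : 1 <= lambda0) (hC : 0 < C)
    (carleman : carleman_estimate Q lambda0 C)
    (rad eps : R) (hrad : 0 < rad) (heps : 0 < eps < 1) :
  (forall lambda phi : R, 0 < lambda -> angle phi ->
   exists D : R, 0 < D /\
   forall (alpha : R) (g0 g1 : R -> R * R -> R),
     0 < alpha < 1 -> boundary_data Q g0 g1 -> B Q eps g0 g1 rad !=set0 ->
     (forall z, clB Q eps g0 g1 rad z ->
        exists G, frechet_derivative Q (J Q eps lambda alpha) (slice z phi) G)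
     /\
     (forall z1 z2 G1 G2,
        clB Q eps g0 g1 rad z1 -> clB Q eps g0 g1 rad z2 ->
        frechet_derivative Q (J Q eps lambda alpha) (slice z1 phi) G1 ->
        frechet_derivative Q (J Q eps lambda alpha) (slice z2 phi) G2 ->
        pair_norm (Omega Q) 3 (pair_sub G2 G1) <=
        D * pair_norm (Omega Q) 3 (pair_sub (slice z2 phi) (slice z1 phi))))
  /\
  (exists lambda1 C1 : R, lambda0 <= lambda1 /\ 0 < C1 /\
   forall (alpha : R) (g0 g1 : R -> R * R -> R),
     0 < alpha < 1 -> boundary_data Q g0 g1 -> B Q eps g0 g1 rad !=set0 ->
   forall lambda phi : R, lambda1 <= lambda -> angle phi ->
     (forall z1 z2 G1,
        clB Q eps g0 g1 rad z1 -> clB Q eps g0 g1 rad z2 ->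
        frechet_derivative Q (J Q eps lambda alpha) (slice z1 phi) G1 ->
        let h := pair_sub (slice z2 phi) (slice z1 phi) in
        C1 * expR (lambda * (ra Q - rc1 Q) ^+ 2)
          * pair_norm (Omega Q) 2 h ^+ 2
        + alpha * pair_norm (Omega Q) 3 h ^+ 2
        <= J Q eps lambda alpha (slice z2 phi)
           - J Q eps lambda alpha (slice z1 phi)
           - pair_dot (Omega Q) 3 G1 h)
     /\
     (exists zmin,
        [/\ clB Q eps g0 g1 rad zmin,
            forall z, clB Q eps g0 g1 rad z ->
              J Q eps lambda alpha (slice zmin phi)
                <= J Q eps lambda alpha (slice z phi),
            forall z', clB Q eps g0 g1 rad z' ->
              (forall z, clB Q eps g0 g1 rad z ->
                 J Q eps lambda alpha (slice z' phi)
                   <= J Q eps lambda alpha (slice z phi)) ->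
              {ae (leb2 R), forall p, Omega Q p ->
                 (slice z' phi).1 p = (slice zmin phi).1 p /\
                 (slice z' phi).2 p = (slice zmin phi).2 p} &
            forall G, frechet_derivative Q (J Q eps lambda alpha)
                        (slice zmin phi) G ->
              forall z, clB Q eps g0 g1 rad z ->
                pair_dot (Omega Q) 3 G
                  (pair_sub (slice zmin phi) (slice z phi)) <= 0])).

Proof.
have [eps0 _] := andP heps; split.
  move=> lambda phi _ aphi.
  have [K [K0 hK]] := derivative_part hc1 hc2 rad eps0 lambda aphi.
  (* The Lipschitz constant is fixed before [alpha] and the boundary data are introduced. *)
  exists K; split; first exact: K0.
  by move=> alpha g0 g1 a01 _ nB; exact: (hK alpha g0 g1 a01 nB).
have [lambda1 [C1 [l01 C10 lower]]] := remainder_lower hc1 hc2 ha hlambda0 hC carleman hrad eps0.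
exists lambda1, C1; split; first exact: l01.
split; first exact: C10.
move=> alpha g0 g1 a01 _ [z0 Bz0] lambda phi l1 aphi.
have K0 : 0 <= C1 * expR (lambda * (ra Q - rc1 Q) ^+ 2) := mulr_ge0 (ltW C10) (expR_ge0 _).
have low y h := fun Vy ny nh (Wh : H0 Q 3 h.1 /\ H0 Q 3 h.2) => lower lambda y h l1 Vy ny nh Wh.1 Wh.2.
have JE z (cz : clB Q eps g0 g1 rad z) := J_JJ hc1 hc2 lambda alpha eps0 (clB_V hc1 hc2 Bz0 cz aphi).1.
split.
  by move=> z1 z2 G1 cz1 cz2 fG1; exact: (strong_convexity hc1 hc2 eps0 aphi a01 Bz0 low cz1 cz2 fG1).
have [zmin cmin mmin] := minimizer_exists hc1 hc2 hrad eps0 aphi a01 Bz0 K0 low.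
exists zmin; split.
- exact: cmin.
- by move=> z cz; rewrite (JE _ cz) (JE _ cmin); exact: mmin.
- move=> z cz mz; rewrite (OmegaE Q).
  have {}mz x (cx : clB Q eps g0 g1 rad x) := eq_le (JE _ cz) (JE _ cx) (mz x cx).
  have := minimizer_unique hc1 hc2 eps0 aphi a01 Bz0 K0 low cz cmin mz mmin.
  by [].
- by move=> G fG z cz; exact: (minimizer_variational hc1 hc2 eps0 aphi a01 Bz0 cmin cz mmin fG).
Qed.
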